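(* Let $\mu>0$, $a,b\in\mathbb{R}$, $\alpha\in(2,\tfrac52]$ and let $B_0\in H^{\frac52-\alpha}(\mathbb{S}^1)$ be real-valued with zero mean. There exists a time $T>0$, depending on $\|B_0\|_{H^{\frac52-\alpha}(\mathbb S^1)}$, such that there exists a unique solution $B(t,x)$ on $[0,T)$ to $$B_t+aBJ_x+bJB_x+\mu\Lambda^\alpha B=0,\qquad B_x=\mathcal{H}J,\qquad x\in\mathbb{S}^1,$$ with initial data $B(0,x)=B_0(x)$, satisfying $$B\in C\left([0,T);H^{\frac52-\alpha}(\mathbb{S}^1)\right)\cap L^2\left([0,T);H^{\frac52-\frac{\alpha}{2}}(\mathbb{S}^1)\right)$$ together with $$\sup_{0<t<T}t^{\frac{\beta}{\alpha}}\|B(t)\|_{H^{\frac52-\alpha+\beta}(\mathbb{S}^1)}<\infty\quad\text{for all }\beta\ge 0,$$ $$\lim_{t\to0}t^{\frac{\beta}{\alpha}}\|B(t)\|_{H^{\frac52-\alpha+\beta}(\mathbb{S}^1)}=0\quad\text{for all }\beta>0.$$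
   Context: $\mathbb{S}^1=[-\pi,\pi]$ is the periodic interval. $\mathcal{H}$ is the periodic Hilbert transform $\mathcal{H}f(x)=\frac{1}{2\pi}\,\mathrm{P.V.}\int_{-\pi}^{\pi}f(y)\cot\left(\frac{x-y}{2}\right)dy$, and $\Lambda=(-\partial_{xx})^{1/2}=\mathcal{H}\partial_x$, i.e. $\Lambda^\alpha$ is the Fourier multiplier with symbol $|k|^\alpha$. The unknown is the real-valued function $B$. The relation $B_x=\mathcal{H}J$ is understood with $J=-\Lambda B$ (so $J$ has zero mean), and $B$ is normalized by $\int_{\mathbb{S}^1}B(t,x)\,dx=0$, a condition formally preserved by the equation. $H^s(\mathbb{S}^1)$ denotes the (inhomogeneous) $L^2$-based Sobolev space.
   Formalization: The time T is allowed to depend on B_0 itself (and on mu, a, b, alpha), not only on the norm of B_0 in H^{5/2-alpha}; a T depending on the norm alone fails, e.g. for a=0, b nonzero and large data concentrated at frequencies N to 2N. *)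

(* Defs.v *)
From HB Require Import structures.
From mathcomp Require Import all_boot all_order all_algebra.
From mathcomp Require Import all_classical all_reals all_analysis.
From mathcomp Require Import complex.

Set Implicit Arguments.
Unset Strict Implicit.
Unset Printing Implicit Defensive.

Import Order.TTheory GRing.Theory Num.Theory.
Import numFieldNormedType.Exports.

Local Open Scope classical_set_scope.
Local Open Scope ring_scope.

(* A function on the periodic interval S^1 = [-pi, pi] is represented by a map
   R -> R of which only the values on [-pi, pi] are used, and those only up to
   a Lebesgue-null set.  A function of (t, x) is a map B : R -> R -> R, with
   B t the function of x at time t. *)
Section Circle.
Context {R : realType}.
Implicit Types (f g phi : R -> R) (s r T : R) (B : R -> R -> R).

Local Notation leb := (@lebesgue_measure R).

Definition circle : set R := `[(- pi : R), pi].

Definition circle_eq f g : Prop := ae_eq leb circle f g.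

Definition L2 f : Prop :=
  measurable_fun circle f /\
  leb.-integrable circle (fun x => (f x ^+ 2)%:E).

Definition zero_mean f : Prop := \int[leb]_(x in circle) f x = 0.

(* (2 pi)^-1 * int_{-pi}^{pi} f(x) exp(- i k x) dx *)
Definition fourier f (k : int) : R[i] :=
  Complex ((2 * pi)^-1 * \int[leb]_(x in circle) (f x * cos (k%:~R * x)))
          (- ((2 * pi)^-1 * \int[leb]_(x in circle) (f x * sin (k%:~R * x)))).

Definition sobolev_norm s f : \bar R :=
  ((\esum_(k in [set: int])
      ((1 + k%:~R ^+ 2) `^ s * ComplexField.Normc.normc (fourier f k) ^+ 2)%:E)
   `^ 2^-1)%E.

(* Only orders s >= 0 occur, for which H^s(S^1) is a subspace of L^2(S^1). *)
Definition Sobolev s f : Prop := L2 f /\ (sobolev_norm s f < +oo)%E.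

(* B \in C([0, T); H^s) *)
Definition continuous_Sobolev T s B : Prop :=
  (forall t : R, 0 <= t < T -> Sobolev s (B t)) /\
  (forall t0 : R, 0 <= t0 < T ->
     sobolev_norm s (fun x => B t x - B t0 x) @[t --> within `[0, T[ (nbhs t0)]
       --> 0%E).

(* B \in L^2([0, T); H^r).  As H^r is a separable Hilbert space, strong
   measurability of t |-> B t is measurability of its Fourier coefficients. *)
Definition L2_Sobolev T r B : Prop :=
  [/\ forall k : int,
        measurable_fun `[0, T[ (fun t => complex.Re (fourier (B t) k)) /\
        measurable_fun `[0, T[ (fun t => complex.Im (fourier (B t) k)),
      {ae leb, forall t : R, 0 <= t < T -> Sobolev r (B t)} &
      (\int[leb]_(t in `[0%R, T[) (sobolev_norm r (B t) ^+ 2) < +oo)%E].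

(* g = Lambda^s f, the Fourier multiplier with symbol |k|^s *)
Definition Lambda s f g : Prop :=
  L2 g /\
  forall k : int, fourier g k = (`|k%:~R| `^ s)%:C%C * fourier f k.

(* (Hilbert transform of f) = g, where
   H f (x) = (2 pi)^-1 * P.V. int_{-pi}^{pi} f(y) cot((x - y) / 2) dy.
   For x in the open interval (-pi, pi) the only singularity of the kernel
   with y in [-pi, pi] is y = x. *)
Definition Hilbert f g : Prop :=
  {ae leb, forall x, - pi < x < pi ->
    (2 * pi)^-1 *
      \int[leb]_(y in circle `&` [set y | e < `|x - y|])
         (f y * (cos ((x - y) / 2) / sin ((x - y) / 2)))
    @[e --> 0^'+] --> g x}.

Definition test_function phi : Prop :=
  (forall (n : nat) (x : R), derivable (derive1n n phi) x 1) /\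
  (forall x, phi (x + 2 * pi) = phi x).

(* g = f_x in the sense of distributions on S^1 *)
Definition weak_derivative f g : Prop :=
  L2 g /\
  forall phi, test_function phi ->
    \int[leb]_(x in circle) (f x * derive1 phi x) =
    - \int[leb]_(x in circle) (g x * phi x).

(* B is a solution on [0, T) of
     B_t + a B J_x + b J B_x + mu Lambda^alpha B = 0,   B_x = H J,
   with J = - Lambda B, zero mean, and initial data B0.  The evolution equation
   is tested against smooth functions of x and integrated in time over
   [t1, t2] for arbitrary 0 < t1 <= t2 < T. *)
Definition is_solution (a b mu alpha T : R) (B0 : R -> R) B : Prop :=
  [/\ circle_eq (B 0) B0,
      forall t : R, 0 <= t < T -> zero_mean (B t) &
      exists J Jx Bx LB : R -> R -> R,
        (forall t : R, 0 < t < T ->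
           [/\ Lambda 1 (B t) (fun x => - J t x),
               weak_derivative (B t) (Bx t),
               weak_derivative (J t) (Jx t),
               Hilbert (J t) (Bx t) &
               Lambda alpha (B t) (LB t)]) /\
        (forall phi, test_function phi ->
         let F t := \int[leb]_(x in circle)
           ((a * B t x * Jx t x + b * J t x * Bx t x + mu * LB t x) * phi x) in
         forall t1 t2 : R, 0 < t1 -> t1 <= t2 -> t2 < T ->
           leb.-integrable `[t1, t2] (EFin \o F) /\
           \int[leb]_(x in circle) (B t2 x * phi x) -
             \int[leb]_(x in circle) (B t1 x * phi x) =
           - \int[leb]_(t in `[t1, t2]) F t)].

(* Membership of B in the class of the statement on [0, T). *)
Definition solution_class (alpha T : R) B : Prop :=
  [/\ continuous_Sobolev T (5 / 2 - alpha) B,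
      L2_Sobolev T (5 / 2 - alpha / 2) B,
      forall beta : R, 0 <= beta ->
        (ereal_sup [set (t `^ (beta / alpha))%:E *
                        sobolev_norm (5 / 2 - alpha + beta) (B t)
                   | t in `]0%R, T[ ] < +oo)%E &
      forall beta : R, 0 < beta ->
        ((t `^ (beta / alpha))%:E * sobolev_norm (5 / 2 - alpha + beta) (B t))%E
          @[t --> 0^'+] --> 0%E].

End Circle.

(* Main.v *)
(* In the Hartley basis cos kx + sin kx the equation becomes the system
   h_k' = - mu |k|^alpha h_k + N_k(h, h), where N_k(u, v) is dominated by
   sum_j (|j| + |k|) |l| U_j V_l over l = k - j for even majorants U, V of u, v.

   Existence.  The Picard iterates of Duhamel's formula are bounded by
     b_k |k|^-(5/2 - alpha + beta) t^-(beta / alpha) exp (- mu |k| t^(1/alpha) / 2)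
   for two values of beta, with b square summable and independent of t.  The
   exponential is submultiplicative in k, hence it passes through the
   convolution, and a discrete Hardy-Littlewood-Sobolev inequality shows that the
   majorants of the iterates obey b <- b_0 + Q(b, b) with Q bounded on l^2.  The
   majorant b_0 of the free evolution tends to 0 with T, so that the iteration
   converges for small T.  The exponential factor makes the limit smooth for
   t > 0 and yields all the weighted estimates.

   Uniqueness.  For two solutions u, v put y = sum_k (u_k - v_k)^2 and
   s = 5/2 - alpha/2.  The same inequality and interpolation give
   y' <= C (1 + |u|_{H^s}^2 + |v|_{H^s}^2) y, with a coefficient integrable in
   time, and y tends to 0 at 0. *)
Require Import Defs.
From HB Require Import structures.
From mathcomp Require Import all_boot all_order all_algebra.
From mathcomp Require Import all_classical all_reals all_analysis.
From mathcomp Require Import measurable_realfun complex ring lra zify.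

Set Implicit Arguments.
Unset Strict Implicit.
Unset Printing Implicit Defensive.

Import Order.TTheory GRing.Theory Num.Theory.
Import numFieldNormedType.Exports.

Local Open Scope classical_set_scope.
Local Open Scope ring_scope.

(** The regularity 5/2 - alpha is critical for the scaling of the equation: [scaling_identity]
    leaves no power of t over, so that smallness cannot be bought with a power of T. It comes from
    the free evolution alone, frequency by frequency: a bound that vanishes with T at each fixed
    frequency and another one that is uniform in T are combined by dominated convergence. No
    contraction constant enters the convergence of the iterates. Their majorants increase, the
    quadratic map is monotone on nonnegative sequences, and the difference of two iterates is
    bounded by the difference of their majorants; smallness only keeps the majorants bounded in l^2.
    Since b does not depend on t, the supremum in time sits inside the sum over frequencies. The
    same b then serves as a dominating sequence for the continuity at t = 0 and for the limits of
    the weighted norms. In the uniqueness part only one trilinear term resists: the one in which the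
    known solution carries no derivative. It is the reason for [kap_one_interp]. *)

HB.instance Definition _ := isPointed.Build int 0.
HB.instance Definition _ := @isMeasurable.Build default_measure_display
  int discrete_measurable discrete_measurable0
  discrete_measurableC discrete_measurableU.

(** Even indices enumerate the nonnegative integers, odd ones the negative integers; sums over the
    integers become series through this bijection. *)
Definition int_enum (n : nat) : int :=
  if odd n then Negz n./2 else Posz n./2.

Definition int_rank (k : int) : nat :=
  match k with Posz n => n.*2 | Negz n => n.*2.+1 end.

Lemma int_enumK : cancel int_enum int_rank.
Proof.
move=> n; rewrite /int_enum -[RHS]odd_double_half; case: (odd n) => /=;
by rewrite ?add0n ?add1n.
Qed.

Lemma int_rankK : cancel int_rank int_enum.
Proof.
case=> n; rewrite /int_enum /= odd_double /=; first by rewrite doubleK.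
by rewrite uphalf_double.
Qed.

Lemma int_enum_bij : set_bij [set: nat] [set: int] int_enum.
Proof.
split=> //; first by move=> x y _ _; exact: (can_inj int_enumK).
by move=> k _; exists (int_rank k) => //; exact: int_rankK.
Qed.

(** * Sums over the integers *)

Section IntSums.
Context {R : realType}.
Implicit Types (f g : int -> R) (k j : int).

Local Notation cnt := (@counting int R).

Lemma counting_int_sigma_finite : sigma_finite [set: int] cnt.
Proof.
exists (fun n => int_enum @` `I_n).
  apply/seteqP; split=> // k _; exists (int_rank k).+1 => //=.
  by exists (int_rank k) => //=; exact: int_rankK.
move=> n; split => //; rewrite /counting/= asboolT ?ltry//.
exact: finite_image.
Qed.

HB.instance Definition _ := @isSigmaFinite.Build _ _ _ cnt counting_int_sigma_finite.

(** Bridge between the counting measure, which brings linearity and dominated convergence, and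
    [\esum], in which the Sobolev norms are written. *)
Lemma ge0_integral_counting_int (f : int -> \bar R) : (forall k, 0 <= f k)%E ->
  (\int[cnt]_k f k = \esum_(k in [set: int]) f k)%E.
Proof.
move=> f0.
have UE : [set: int] = \bigcup_n [set int_enum n].
  by apply/seteqP; split=> // k _; exists (int_rank k) => //=; rewrite int_rankK.
rewrite {1}UE ge0_integral_bigcup//; last first.
  apply/trivIsetP => i j _ _ /eqP ij; apply/seteqP; split=> // x [/= ->].
  by move=> /(can_inj int_enumK).
rewrite (reindex_esum _ _ _ _ int_enum_bij) -nneseries_esumT//.
apply: eq_eseriesr => i _.
rewrite (eq_integral (cst (f (int_enum i)))); last by move=> x; rewrite inE/= => ->.
rewrite integral_cst//.
rewrite [X in (_ * X)%E](_ : _ = 1%E) ?mule1//.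
rewrite -[LHS]/(cnt _) /counting asboolT; last exact: finite_set1.
by rewrite fset_set1 finmap.cardfs1.
Qed.

(** Absolute summability and sums are integrability and integrals for the counting measure, so that
    the theorems of integration apply to them directly. *)
Definition summ f : Prop := cnt.-integrable setT (EFin \o f).
Definition zsum f : R := (\int[cnt]_k f k)%R.

Lemma summP f : summ f <-> (\esum_(k in [set: int]) `|f k|%:E < +oo)%E.
Proof.
rewrite -ge0_integral_counting_int//; split; first by case/integrableP.
by move=> h; apply/integrableP; split.
Qed.

Lemma le_summ f g : (forall k, `|f k| <= `|g k|) -> summ g -> summ f.
Proof.
by move=> fg; apply: le_integrable => // k _ /=; rewrite lee_fin.
Qed.

Lemma le_summ_ge0 f g : (forall k, `|f k| <= g k) -> summ g -> summ f.
Proof. by move=> fg; apply: le_summ => k; rewrite (le_trans (fg k))// ler_norm. Qed.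

Lemma eq_summ f g : f =1 g -> summ f -> summ g.
Proof. by move=> /funext ->. Qed.

Lemma eq_zsum f g : f =1 g -> zsum f = zsum g.
Proof. by move=> /funext ->. Qed.

Lemma summ_norm f : summ f -> summ (fun k => `|f k|).
Proof. by apply: le_summ => k; rewrite normr_id. Qed.

Lemma summD f g : summ f -> summ g -> summ (fun k => f k + g k).
Proof. by move=> sf sg; apply: eq_integrable (integrableD measurableT sf sg). Qed.

Lemma summN f : summ f -> summ (fun k => - f k).
Proof. by apply: le_summ => k; rewrite normrN. Qed.

Lemma summB f g : summ f -> summ g -> summ (fun k => f k - g k).
Proof. by move=> sf sg; apply: summD => //; exact: summN. Qed.

Lemma summZ c f : summ f -> summ (fun k => c * f k).
Proof.
move=> sf; have := integrableZl measurableT c sf.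
by apply: eq_integrable.
Qed.

Lemma zsumD f g : summ f -> summ g ->
  zsum (fun k => f k + g k) = zsum f + zsum g.
Proof. exact: RintegralD. Qed.

Lemma zsumB f g : summ f -> summ g ->
  zsum (fun k => f k - g k) = zsum f - zsum g.
Proof. exact: RintegralB. Qed.

Lemma zsumZ c f : summ f -> zsum (fun k => c * f k) = c * zsum f.
Proof. exact: RintegralZl. Qed.

Lemma zsumN f : summ f -> zsum (fun k => - f k) = - zsum f.
Proof.
move=> sf; rewrite -[RHS]mulN1r -zsumZ//; apply: eq_zsum => k.
by rewrite mulN1r.
Qed.

Lemma summ0 : summ (fun=> 0 : R).
Proof. by apply: eq_integrable (integrable0 cnt [set: int]). Qed.

Lemma zsum0 : zsum (fun=> 0) = 0.
Proof. by rewrite /zsum /Rintegral integral0. Qed.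

Lemma le_zsum f g : summ f -> summ g -> (forall k, f k <= g k) -> zsum f <= zsum g.
Proof. by move=> sf sg fg; apply: le_Rintegral. Qed.

Lemma zsum_ge0 f : (forall k, 0 <= f k) -> 0 <= zsum f.
Proof. by move=> f0; apply: Rintegral_ge0. Qed.

Lemma ler_norm_zsum f : summ f -> `|zsum f| <= zsum (fun k => `|f k|).
Proof. by move=> sf; apply: le_normr_Rintegral. Qed.

Lemma ge0_EFin_zsum f : summ f -> (forall k, 0 <= f k) ->
  ((zsum f)%:E = \esum_(k in [set: int]) (f k)%:E)%E.
Proof.
move=> sf f0; rewrite -ge0_integral_counting_int//.
by rewrite /zsum /Rintegral fineK//; exact: integrable_fin_num.
Qed.

Lemma EFin_zsum f : summ f -> (zsum f)%:E = (\int[cnt]_k (f k)%:E)%E.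
Proof. by move=> sf; rewrite /zsum /Rintegral fineK//; exact: integrable_fin_num. Qed.

Lemma summ_esum_le f (M : R) : (forall k, 0 <= f k) ->
  (\esum_(k in [set: int]) (f k)%:E <= M%:E)%E -> summ f /\ zsum f <= M.
Proof.
move=> f0 fM; have sf : summ f.
  apply/summP; apply: le_lt_trans (ltry M); apply: le_trans fM.
  by apply: le_esum => k _; rewrite ger0_norm.
by split=> //; rewrite -lee_fin ge0_EFin_zsum.
Qed.

Lemma le_zsum_term f j : summ f -> (forall k, 0 <= f k) -> f j <= zsum f.
Proof.
move=> sf f0; rewrite -lee_fin ge0_EFin_zsum//; apply: esum_ge.
by exists [set j]; [split|rewrite fsbig_set1].
Qed.

Lemma zsum_reindex (e : int -> int) f : bijective e -> summ f ->
  summ (fun k => f (e k)) /\ zsum (fun k => f (e k)) = zsum f.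
Proof.
move=> be sf.
have eb : set_bij [set: int] [set: int] e.
  case: be => e' ee' e'e; split=> //; first by move=> x y _ _; exact: (can_inj ee').
  by move=> k _; exists (e' k).
have sfe g : summ g -> summ (g \o e).
  by move=> /summP; rewrite (reindex_esum _ _ _ _ eb) => sg; apply/summP.
have zge g : summ g -> (forall k, 0 <= g k) -> zsum (g \o e) = zsum g.
  move=> sg g0; apply: EFin_inj; rewrite (ge0_EFin_zsum (sfe _ sg))//= ge0_EFin_zsum//.
  by rewrite (reindex_esum _ _ _ _ eb).
split; first exact: sfe.
(* Reindexing is available for nonnegative families only; [f] is written as a difference of two of
   them. *)
have fE : f = (fun k => (`|f k| + f k) - `|f k|) by apply/funext => k; ring.
have s1 := summ_norm sf.
have s2 := summD s1 sf.
rewrite [in LHS]fE [in RHS]fE zsumB ?zsumB//; last 2 first.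
  exact: (sfe _ s2).
  exact: (sfe _ s1).
congr (_ - _); first by apply: (zge _ s2) => k; have := ler_norm (- f k); rewrite normrN; lra.
exact: (zge _ s1).
Qed.

Lemma bij_oppz : bijective (fun k : int => - k).
Proof. by exists (fun k : int => - k) => k; rewrite opprK. Qed.
Lemma bij_subz j : bijective (fun k : int => j - k).
Proof. by exists (fun k : int => j - k) => k; ring. Qed.
Lemma bij_addz j : bijective (fun k : int => k + j).
Proof. by exists (fun k : int => k - j) => k; ring. Qed.

Lemma zsum_opp f : summ f -> zsum (fun k => f (- k)) = zsum f.
Proof. by move=> /(zsum_reindex bij_oppz)[]. Qed.
Lemma summ_opp f : summ f -> summ (fun k => f (- k)).
Proof. by move=> /(zsum_reindex bij_oppz)[]. Qed.

(** Summability is not assumed: k -> - k exchanges the positive and negative parts, and if both have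
    infinite sum then the real value of the integral is the default 0 of [fine]. *)
Lemma zsum_odd f : (forall k, f (- k) = - f k) -> zsum f = 0.
Proof.
move=> fN; have [sf|nsf] := pselect (summ f).
  have := zsum_opp sf; rewrite (eq_zsum fN) zsumN// => /eqP.
  by rewrite -subr_eq0 -opprD oppr_eq0 -mulr2n mulrn_eq0/= => /eqP.
rewrite /zsum /Rintegral integralE.
have -> : (\int[cnt]_k (fun k => (f k)%:E)^\- k = \int[cnt]_k (fun k => (f k)%:E)^\+ k)%E.
  rewrite !ge0_integral_counting_int//.
  have eb : set_bij [set: int] [set: int] (fun k : int => - k).
    split=> [//|x y _ _|]; first exact: oppr_inj.
    by move=> k _; exists (- k) => //=; rewrite opprK.
  rewrite [RHS](reindex_esum _ _ _ _ eb); apply: eq_esum => k _.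
  by rewrite funeposE funenegE fN EFinN.
by case: (integral _ _ _) => [r| |] /=; rewrite ?subrr.
Qed.

Lemma zsum_delta f j : (forall k, k != j -> f k = 0) -> summ f /\ zsum f = f j.
Proof.
move=> fj.
have zge g : (forall k, 0 <= g k) -> (forall k, k != j -> g k = 0) ->
    (\esum_(k in [set: int]) (g k)%:E = (g j)%:E)%E.
  move=> g0 gj; rewrite (esumID [set j]); last by move=> k _; rewrite lee_fin.
  rewrite setTI esum_set1 ?lee_fin// [X in (_ + X)%E]esum1 ?adde0// => k [_ /=].
  by move/eqP => kj; rewrite gj.
have sf : summ f.
  apply/summP; rewrite (zge (fun k => `|f k|)) ?ltry// => k kj.
  by rewrite fj ?normr0.
split=> //.
have fE : f = (fun k => (`|f k| + f k) - `|f k|) by apply/funext => k; ring.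
have s1 := summ_norm sf; have s2 := summD s1 sf.
have H g : summ g -> (forall k, 0 <= g k) -> (forall k, k != j -> g k = 0) -> zsum g = g j.
  by move=> sg g0 gj; apply: EFin_inj; rewrite ge0_EFin_zsum// zge.
rewrite [in LHS]fE zsumB// (H _ s1)//.
  rewrite (H _ s2)//; first ring.
    by move=> k; have := ler_norm (- f k); rewrite normrN; lra.
  by move=> k kj; rewrite fj// normr0 addr0.
by move=> k kj; rewrite fj// normr0.
Qed.

Lemma zsum_cvg (F : nat -> int -> R) f g : summ g ->
  (forall n k, `|F n k| <= g k) -> (forall k, F ^~ k @ \oo --> f k) ->
  zsum (F n) @[n --> \oo] --> zsum f.
Proof.
move=> sg Fg Ff.
have := @dominated_convergence _ _ R cnt setT measurableT
  (fun n k => (F n k)%:E) (fun k => (f k)%:E) (EFin \o g) _ _ _ sg _.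
case=> //.
- by apply/aeW => k _; apply/fine_cvgP; split; [apply: nearW|exact: Ff].
- by apply/aeW => k n _; rewrite lee_fin.
move=> sf _ cf.
by apply: fine_cvg; rewrite (EFin_zsum sf).
Qed.

End IntSums.

#[global] Opaque summ zsum.

(** * Square-summable sequences, power weights and the Hardy kernel *)

Section SquareSummable.
Context {R : realType}.
Implicit Types (f g a b : int -> R) (k j : int).

Lemma esum_swap (F : int -> int -> \bar R) : (forall k j, 0 <= F k j)%E ->
  (\esum_(k in [set: int]) \esum_(j in [set: int]) F k j =
   \esum_(j in [set: int]) \esum_(k in [set: int]) F k j)%E.
Proof.
move=> F0; rewrite !esum_esum//.
pose sw (z : int * int) := (z.2, z.1).
have swb : set_bij ([set: int] `*`` (fun=> [set: int])) ([set: int] `*`` (fun=> [set: int])) sw.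
  split=> [//|[x1 x2] [y1 y2] _ _ [-> ->]//|[x1 x2] _]; by exists (x2, x1).
by rewrite [LHS](reindex_esum _ _ _ _ swb).
Qed.

Lemma zsum_tonelli (F : int -> int -> R) : (forall k j, 0 <= F k j) ->
  (forall j, summ (F ^~ j)) -> summ (fun j => zsum (F ^~ j)) ->
  [/\ forall k, summ (F k), summ (fun k => zsum (F k)) &
    zsum (fun k => zsum (F k)) = zsum (fun j => zsum (F ^~ j))].
Proof.
move=> F0 s1 s2.
have E : (\esum_(k in [set: int]) \esum_(j in [set: int]) (F k j)%:E =
   (zsum (fun j => zsum (F ^~ j)))%:E)%E.
  rewrite esum_swap; last by move=> k j; rewrite lee_fin.
  rewrite ge0_EFin_zsum//; last by move=> j; exact: zsum_ge0.
  by apply: eq_esum => j _; rewrite ge0_EFin_zsum.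
have s3 k : summ (F k).
  apply/summP; rewrite (eq_esum (b := fun j => (F k j)%:E)); last first.
    by move=> j _; rewrite ger0_norm.
  apply: le_lt_trans (ltry (zsum (fun j => zsum (F ^~ j)))); rewrite -E.
  apply: esum_ge; exists [set k]; first by split.
  by rewrite fsbig_set1.
have E2 : (\esum_(k in [set: int]) (zsum (F k))%:E =
   (zsum (fun j => zsum (F ^~ j)))%:E)%E.
  by rewrite -E; apply: eq_esum => k _; rewrite ge0_EFin_zsum.
have s4 : summ (fun k => zsum (F k)).
  apply/summP; rewrite (eq_esum (b := fun k => (zsum (F k))%:E)) ?E2 ?ltry// => k _.
  by rewrite ger0_norm//; exact: zsum_ge0.
split; [exact: s3|exact: s4|].
by apply: EFin_inj; rewrite -E2 (ge0_EFin_zsum s4)// => k; exact: zsum_ge0.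
Qed.

Definition l2 f : Prop := summ (fun k => f k ^+ 2).
Definition n2 f : R := zsum (fun k => f k ^+ 2).

Lemma n2_ge0 f : 0 <= n2 f.
Proof. by apply: zsum_ge0 => k; exact: sqr_ge0. Qed.

Lemma l2_0 : l2 (fun=> 0).
Proof. by apply: eq_summ summ0 => k; rewrite expr0n. Qed.

Lemma le_l2 f g : (forall k, `|f k| <= `|g k|) -> l2 g -> l2 f.
Proof.
move=> fg; apply: le_summ => k; rewrite !normrX.
by rewrite lerXn2r ?nnegrE.
Qed.

Lemma le_n2 f g : (forall k, `|f k| <= `|g k|) -> l2 g -> n2 f <= n2 g.
Proof.
move=> fg lg; apply: le_zsum => //; first exact: le_l2 lg.
by move=> k; rewrite -[f k ^+ 2]ger0_norm ?sqr_ge0// -[g k ^+ 2]ger0_norm ?sqr_ge0// !normrX lerXn2r ?nnegrE.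
Qed.

Lemma summ_mul f g : l2 f -> l2 g -> summ (fun k => f k * g k).
Proof.
move=> lf lg; apply: le_summ_ge0 (summD lf lg) => k.
rewrite ler_norml; apply/andP; split.
  by have := sqr_ge0 (f k + g k); have := sqr_ge0 (f k); have := sqr_ge0 (g k); nra.
by have := sqr_ge0 (f k - g k); have := sqr_ge0 (f k); have := sqr_ge0 (g k); nra.
Qed.

Lemma l2D f g : l2 f -> l2 g -> l2 (fun k => f k + g k).
Proof.
move=> lf lg.
apply: le_summ_ge0 (summZ 2 (summD lf lg)) => k; rewrite ger0_norm ?sqr_ge0//.
by have := sqr_ge0 (f k - g k); nra.
Qed.

Lemma l2Z c f : l2 f -> l2 (fun k => c * f k).
Proof. by move=> /(summZ (c ^+ 2)); apply: eq_summ => k; rewrite exprMn. Qed.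

Lemma n2Z c f : l2 f -> n2 (fun k => c * f k) = c ^+ 2 * n2 f.
Proof. by move=> lf; rewrite -zsumZ//; apply: eq_zsum => k; rewrite exprMn. Qed.

Lemma n2D_le f g : l2 f -> l2 g -> n2 (fun k => f k + g k) <= 2 * (n2 f + n2 g).
Proof.
move=> lf lg; rewrite -zsumD// -zsumZ; last exact: summD.
apply: le_zsum; [exact: l2D|exact/summZ/summD|].
by move=> k; have := sqr_ge0 (f k - g k); nra.
Qed.

Lemma cauchy_schwarz f g : l2 f -> l2 g ->
  (zsum (fun k => f k * g k)) ^+ 2 <= n2 f * n2 g.
Proof.
move=> lf lg; have sfg := summ_mul lf lg.
set A := n2 f; set C := n2 g; set B := zsum _.
have Cge0 : 0 <= C by exact: n2_ge0.
have [C0|C0] := eqVneq C 0.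
  have g0 k : g k = 0.
    apply/eqP; rewrite -sqrf_eq0 eq_le sqr_ge0 andbT -C0.
    by apply: (@le_zsum_term _ (fun k => g k ^+ 2)) => // ?; exact: sqr_ge0.
  rewrite /B (@eq_zsum _ _ (fun=> 0)) ?zsum0; last by move=> k; rewrite g0 mulr0.
  by rewrite expr0n/= C0 mulr0.
have Cgt0 : 0 < C by rewrite lt_def C0.
have : 0 <= n2 (fun k => C * f k - B * g k) by exact: n2_ge0.
rewrite /n2 (@eq_zsum _ _ (fun k => C ^+ 2 * f k ^+ 2 +
    (B ^+ 2 * g k ^+ 2 - (2 * B * C) * (f k * g k)))); last by move=> k; ring.
rewrite zsumD ?zsumB ?zsumZ//; [|exact: summZ|exact: summZ|exact: summZ|].
  rewrite -/A -/C -/B -/(n2 f) -/(n2 g) -/A -/C => H.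
  have {H}: 0 <= C * (A * C - B ^+ 2) by rewrite (le_trans H)// le_eqVlt; apply/orP; left; apply/eqP; ring.
  by rewrite pmulr_rge0// subr_ge0.
by apply: summB; exact: summZ.
Qed.

Lemma l2_shift_mul a b k : l2 a -> l2 b -> l2 (fun j => a j * b (k - j)).
Proof.
move=> la lb; apply: le_summ_ge0 (summZ (n2 b) la) => j.
rewrite ger0_norm ?sqr_ge0// exprMn mulrC ler_wpM2r ?sqr_ge0//.
by apply: (@le_zsum_term _ (fun k => b k ^+ 2)) => // ?; exact: sqr_ge0.
Qed.

Lemma l2_sub f k : l2 f -> l2 (fun j => f (k - j)) /\ n2 (fun j => f (k - j)) = n2 f.
Proof. by move=> lf; exact: (zsum_reindex (bij_subz k) lf). Qed.

Lemma l2_opp f : l2 f -> l2 (fun j => f (- j)) /\ n2 (fun j => f (- j)) = n2 f.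
Proof. by move=> lf; exact: (zsum_reindex bij_oppz lf). Qed.

(** Tonelli's theorem and invariance under translation. It is what remains to be summed over [k]
    after a Cauchy-Schwarz inequality in [j]. *)
Lemma zsum_conv_sq a b : l2 a -> l2 b ->
  summ (fun k => n2 (fun j => a j * b (k - j))) /\
  zsum (fun k => n2 (fun j => a j * b (k - j))) = n2 a * n2 b.
Proof.
move=> la lb.
have [|||_ s e] := @zsum_tonelli (fun k j => (a j * b (k - j)) ^+ 2).
- by move=> k j; exact: sqr_ge0.
- move=> j; have [sj _] := zsum_reindex (bij_addz (- j)) lb.
  by apply: eq_summ (summZ (a j ^+ 2) sj) => k; rewrite exprMn.
- apply: eq_summ (summZ (n2 b) la) => j.
  have [sj ej] := zsum_reindex (bij_addz (- j)) lb.
  rewrite [RHS](@eq_zsum _ _ (fun k => a j ^+ 2 * b (k - j) ^+ 2)); last by move=> k; rewrite exprMn.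
  by rewrite zsumZ// ej mulrC.
split; [exact: s|].
rewrite [LHS]e mulrC -(zsumZ _ la); apply: eq_zsum => j.
have [sj ej] := zsum_reindex (bij_addz (- j)) lb.
rewrite (@eq_zsum _ _ (fun k => a j ^+ 2 * b (k - j) ^+ 2)); last by move=> k; rewrite exprMn.
by rewrite zsumZ// ej mulrC.
Qed.

Definition zabs k : R := (absz k)%:R.

Lemma zabs_ge0 k : 0 <= zabs k. Proof. exact: ler0n. Qed.
Lemma zabs_gt0 k : (0 < zabs k) = (k != 0).
Proof. by rewrite ltr0n absz_gt0. Qed.
Lemma zabs_ge1 k : k != 0 -> 1 <= zabs k.
Proof. by rewrite ler1n absz_gt0. Qed.
Lemma zabsN k : zabs (- k) = zabs k.
Proof. by rewrite /zabs abszN. Qed.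
Lemma zabs0 : zabs 0 = 0. Proof. by []. Qed.
Lemma zabs_le k j : (zabs k <= zabs j) = (absz k <= absz j)%N.
Proof. by rewrite ler_nat. Qed.
Lemma zabsE k : zabs k = `|k%:~R|.
Proof. by rewrite -intr_norm /zabs pmulrn abszE. Qed.
Lemma sqr_zabs k : zabs k ^+ 2 = k%:~R ^+ 2.
Proof. by rewrite zabsE real_normK ?num_real. Qed.
Lemma zabsD k j : zabs (k + j) <= zabs k + zabs j.
Proof. by rewrite !zabsE intrD ler_normD. Qed.
Lemma zabsB k j : zabs (k - j) <= zabs k + zabs j.
Proof. by rewrite -(zabsN j); exact: zabsD. Qed.

(* |k|^x, but 0 at k = 0 for every x, including x <= 0. *)
Definition wt (x : R) k : R := if k == 0 then 0 else zabs k `^ x.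

Lemma wt_ge0 x k : 0 <= wt x k.
Proof. by rewrite /wt; case: ifP => // _; exact: powR_ge0. Qed.
Lemma wtN x k : wt x (- k) = wt x k.
Proof. by rewrite /wt oppr_eq0 zabsN. Qed.
Lemma wt0 x : wt x 0 = 0. Proof. by rewrite /wt eqxx. Qed.
Lemma wtE x k : k != 0 -> wt x k = zabs k `^ x.
Proof. by rewrite /wt => /negbTE ->. Qed.
Lemma powRDp (c x y : R) : 0 < c -> c `^ (x + y) = c `^ x * c `^ y.
Proof. by move=> c0; rewrite powRD// (gt_eqF c0)/= implybT. Qed.

Lemma wtD x y k : wt (x + y) k = wt x k * wt y k.
Proof.
rewrite /wt; case: eqVneq => [_|k0]; first by rewrite mul0r.
by rewrite powRDp// zabs_gt0.
Qed.
Lemma wt_le1 x k : x <= 0 -> wt x k <= 1.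
Proof.
move=> x0; rewrite /wt; case: eqVneq => // k0.
by rewrite -(powRr0 (zabs k)) ler_powR// zabs_ge1.
Qed.
Lemma wt_mono x y k : x <= y -> wt x k <= wt y k.
Proof.
by move=> xy; rewrite /wt; case: eqVneq => // k0; rewrite ler_powR// zabs_ge1.
Qed.
Lemma wt1 k : wt 1 k = zabs k.
Proof. by rewrite /wt; case: eqVneq => [->//|_]; rewrite powRr1// zabs_ge0. Qed.
Lemma wt00 k : k != 0 -> wt 0 k = 1.
Proof. by move=> k0; rewrite wtE// powRr0. Qed.

(* Bernoulli's inequality (1 - 1/n)^(1-r) <= 1 - (1-r)/n, multiplied by n^(1-r). *)
Lemma powR_telescope (r : R) (n : nat) : 0 < r < 1 ->
  n.+1%:R `^ (- r) * (1 - r) <= n.+1%:R `^ (1 - r) - n%:R `^ (1 - r).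
Proof.
move=> /andP[r0 r1]; set N : R := n.+1%:R.
have N0 : 0 < N by rewrite ltr0n.
have E : N `^ (1 - r) = N * N `^ (- r).
  by rewrite powRDp// powRr1// ltW.
have nN : n%:R = N * (1 - N^-1) :> R.
  by rewrite mulrBr mulfV ?gt_eqF// mulr1 /N -natr1 addrK.
have q0 : 0 <= 1 - N^-1 by rewrite subr_ge0 invf_le1// ler1n.
rewrite nN (powRM _ (ltW N0) q0) E.
have H : (1 - N^-1) `^ (1 - r) <= (1 - r) * (1 - N^-1) + r.
  have := @conjugate_powR _ ((1 - N^-1) `^ (1 - r)) 1 (1 - r)^-1 r^-1 (powR_ge0 _ _) ler01.
  rewrite !invr_gt0 subr_gt0 r1 r0 !invrK => /(_ erefl erefl).
  rewrite subrK => /(_ erefl); rewrite mulr1 -powRrM mulfV ?gt_eqF ?subr_gt0//.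
  by rewrite powRr1// powR1 mul1r mulrC.
have P0 : 0 < N * N `^ (- r) by rewrite mulr_gt0// powR_gt0.
apply: (@le_trans _ _ (N * N `^ (- r) - N * N `^ (- r) * ((1 - r) * (1 - N^-1) + r))).
  rewrite le_eqVlt; apply/orP; left; apply/eqP.
  by field; rewrite gt_eqF.
by rewrite lerD2l lerN2 ler_wpM2l// ltW.
Qed.

Lemma esum_int_split (F : int -> \bar R) : (forall k, 0 <= F k)%E ->
  (\esum_(k in [set: int]) F k =
   \sum_(0 <= n <oo) F (Posz n) + \sum_(0 <= n <oo) F (Negz n))%E.
Proof.
move=> F0; rewrite (esumID (Posz @` [set: nat]))// !setTI; congr (_ + _)%E.
  rewrite esum_image; last by move=> x y _ _ [].
  by rewrite nneseries_esumT.
have -> : ~` (Posz @` [set: nat]) = Negz @` [set: nat].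
  apply/seteqP; split=> [[n|n]/=|_ [n _ <-] [m _]//]; last by exists n.
  by case; exists n.
rewrite esum_image; last by move=> x y _ _ [].
by rewrite nneseries_esumT.
Qed.

(* Kernel of the discrete Hardy inequality; the square of the kernel in [hls] is
   dominated by three copies of it, one for each choice of the smallest frequency. *)
Definition hker r j k : R :=
  if (j != 0) && (absz j <= absz k)%N then zabs j `^ (- r) * zabs k `^ (r - 1) else 0.

Lemma hker_ge0 r j k : 0 <= hker r j k.
Proof. by rewrite /hker; case: ifP => // _; rewrite mulr_ge0// powR_ge0. Qed.

(** By [powR_telescope] the sum of m^(-r) over 0 < m <= |k| is at most |k|^(1-r) / (1-r), which the
    factor |k|^(r-1) normalizes. The 2 counts the two signs of [j]. *)
Lemma hker_sum r k : 0 < r < 1 ->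
  summ (hker r ^~ k) /\ zsum (hker r ^~ k) <= 2 / (1 - r).
Proof.
move=> r01; have /andP[r0 r1] := r01.
have d0 : 0 < 1 - r by rewrite subr_gt0.
apply: summ_esum_le; first by move=> j; exact: hker_ge0.
have [k0|k0] := eqVneq k 0.
  rewrite esum1 ?lee_fin ?divr_ge0// ?ltW// => j _; rewrite /hker k0 leqn0 absz_eq0.
  by case: eqVneq.
set K : R := zabs k; have K0 : 0 < K by rewrite zabs_gt0.
(* The kernel vanishes beyond |k|, hence the minimum: the partial sums stop growing there. *)
have B n : \sum_(0 <= m < n) hker r (Posz m.+1) k * (1 - r) <=
    K `^ (r - 1) * (minn n (absz k))%:R `^ (1 - r).
  elim: n => [|n IH]; first by rewrite big_nil mulr_ge0// powR_ge0.
  rewrite big_nat_recr//=; have [nk|kn] := ltnP n (absz k); last first.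
    rewrite [hker r (Posz n.+1) k]/hker [X in _ && X]leqNgt ltnS kn andbF mul0r addr0 (le_trans IH)//.
    by rewrite (minn_idPr kn) (minn_idPr (leqW kn)).
  rewrite /hker /= nk/= (minn_idPl nk); rewrite (minn_idPl (ltnW nk)) in IH.
  apply: le_trans (lerD IH (lexx _)) _.
  rewrite -[zabs n.+1]/(n.+1%:R) -[zabs k]/K -mulrA (mulrC (_ `^ (- r))) -mulrA -mulrDr ler_wpM2l ?powR_ge0//.
  rewrite (mulrC (1 - r)).
  by have := powR_telescope n r01; lra.
have B2 n : \sum_(0 <= m < n) hker r (Posz m.+1) k <= (1 - r)^-1.
  rewrite -(ler_pM2r d0) mulVf ?gt_eqF// mulr_suml (le_trans (B n))//.
  apply: (@le_trans _ _ (K `^ (r - 1) * K `^ (1 - r))).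
    rewrite ler_wpM2l ?powR_ge0// ge0_ler_powR ?nnegrE//; first exact: ltW.
    by rewrite ler_nat geq_minr.
  by rewrite -powRDp// addrC subrKA subrr powRr0.
have S : (\sum_(0 <= n <oo) (hker r (Posz n.+1) k)%:E <= ((1 - r)^-1)%:E)%E.
  apply: lime_le; first by apply: is_cvg_nneseries => n _ _; rewrite lee_fin hker_ge0.
  by apply: nearW => n; rewrite sumEFin lee_fin.
rewrite esum_int_split; last by move=> j; rewrite lee_fin hker_ge0.
rewrite (_ : (2 / (1 - r))%:E = ((1 - r)^-1)%:E + ((1 - r)^-1)%:E)%E; last first.
  by rewrite -EFinD; congr EFin; ring.
(* [Negz n] has absolute value n + 1 and reproduces the shifted series [S]; in the other series the
   term at 0 vanishes and is peeled off. *)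
apply: leeD; last first.
  apply: le_trans S; apply: lee_nneseries => // n _ _; rewrite lee_fin ?hker_ge0//.
apply: lime_le; first by apply: is_cvg_nneseries => n _ _; rewrite lee_fin hker_ge0.
apply: nearW => n; rewrite sumEFin lee_fin; case: n => [|n].
  by rewrite big_nil invr_ge0 ltW.
by rewrite big_nat_recl// {1}/hker eqxx/= add0r.
Qed.

Lemma powR_comparable (n n' y : R) : 0 < n -> n / 2 <= n' -> n' <= 2 * n ->
  n' `^ (- (2 * y)) <= 2 `^ (2 * `|y|) * n `^ (- (2 * y)).
Proof.
move=> n0 h1 h2; have n'0 : 0 < n' by apply: lt_le_trans h1; rewrite divr_gt0.
have [y0|y0] := lerP 0 y.
  rewrite (ger0_norm y0) !powRN -invf_div lef_pV2 ?posrE ?powR_gt0//; last first.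
    by rewrite divr_gt0// powR_gt0.
  rewrite ler_pdivrMr ?powR_gt0// -powRM ?ler0n ?(ltW n'0)//.
  apply: ge0_ler_powR; rewrite ?nnegrE; lra.
rewrite (ltr0_norm y0) mulrN -powRM ?ler0n ?(ltW n0)//.
apply: ge0_ler_powR; rewrite ?nnegrE; lra.
Qed.

(* When the smallest of the three frequencies is m, the two others are
   comparable to n. *)
Lemma triple_weight (x y z r m n n' : R) : x + y + z = 2^-1 -> 2 * x <= r ->
  0 < m -> m <= n -> n / 2 <= n' -> n' <= 2 * n ->
  (m `^ (- x) * n' `^ (- y) * n `^ (- z)) ^+ 2 <=
  2 `^ (2 * `|y|) * (m `^ (- r) * n `^ (r - 1)).
Proof.
move=> xyz xr m0 mn h1 h2; have n0 : 0 < n by exact: lt_le_trans mn.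
have sq (c w : R) : (c `^ w) ^+ 2 = c `^ (2 * w).
  by rewrite mulrC powRrM -powR_mulrn// powR_ge0.
rewrite !exprMn !sq !mulrN.
apply: (@le_trans _ _ (m `^ (- (2 * x)) * (2 `^ (2 * `|y|) * n `^ (- (2 * y))) * n `^ (- (2 * z)))).
  by rewrite ler_wpM2r ?powR_ge0// ler_wpM2l ?powR_ge0// powR_comparable.
have -> : m `^ (- (2 * x)) * (2 `^ (2 * `|y|) * n `^ (- (2 * y))) * n `^ (- (2 * z)) =
    2 `^ (2 * `|y|) * (m `^ (- (2 * x)) * n `^ (2 * x - 1)).
  have -> : 2 * x - 1 = - (2 * y) + - (2 * z) by lra.
  by rewrite powRDp//; ring.
rewrite ler_wpM2l ?powR_ge0//.
rewrite (_ : - (2 * x) = (r - 2 * x) + - r); last by ring.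
rewrite (_ : r - 1 = (r - 2 * x) + (2 * x - 1)); last by ring.
rewrite (powRDp _ _ m0) (powRDp _ _ n0) -mulrA [leRHS]mulrCA.
rewrite ler_wpM2r ?mulr_ge0 ?powR_ge0//.
by apply: ge0_ler_powR; rewrite ?nnegrE ?subr_ge0// ltW.
Qed.

Lemma hls_kernel (x y z r : R) k j : x + y + z = 2^-1 ->
  2 * x <= r -> 2 * y <= r -> 2 * z <= r ->
  (wt (- x) j * wt (- y) (k - j) * wt (- z) k) ^+ 2 <=
  2 `^ (2 * (`|x| + `|y|)) * (hker r j k + hker r (k - j) k + hker r k j).
Proof.
move=> xyz xr yr zr.
have RHS0 : 0 <= 2 `^ (2 * (`|x| + `|y|)) * (hker r j k + hker r (k - j) k + hker r k j).
  by rewrite mulr_ge0 ?powR_ge0// !addr_ge0// hker_ge0.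
have [j0|j0] := eqVneq j 0; first by rewrite j0 wt0 !mul0r expr0n; rewrite j0 in RHS0.
have [l0|l0] := eqVneq (k - j) 0; first by rewrite l0 wt0 mulr0 !mul0r expr0n; rewrite l0 in RHS0.
have [k0|k0] := eqVneq k 0; first by rewrite k0 wt0 !mulr0 expr0n; rewrite k0 in RHS0.
rewrite !wtE//; set l := k - j; set J := zabs j; set L := zabs l; set K := zabs k.
have J0 : 0 < J by rewrite zabs_gt0.
have L0 : 0 < L by rewrite zabs_gt0.
have K0 : 0 < K by rewrite zabs_gt0.
have KJL : K <= J + L by rewrite /K (_ : k = j + l) ?zabsD// /l; ring.
have JKL : J <= K + L by rewrite /J (_ : j = k - l) ?zabsB// /l; ring.
have LKJ : L <= K + J by exact: zabsB.
have le2 (u v : R) : u <= v -> (2 : R) `^ (2 * u) <= 2 `^ (2 * v).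
  by move=> uv; rewrite ler_powR ?ler_wpM2l// ler1n.
have hk0 p q : 0 <= hker r p q by exact: hker_ge0.
have fin1 w (c d e f : R) : 0 <= w <= `|x| + `|y| -> 0 <= d -> 0 <= e -> 0 <= f -> c <= 2 `^ (2 * w) * d -> c <= 2 `^ (2 * (`|x| + `|y|)) * (d + e + f).
  move=> /andP[_ w1] d0 e0 f0 /le_trans; apply.
  apply: ler_pM; [exact: powR_ge0|exact: d0|exact: le2|].
  by rewrite -addrA lerDl addr_ge0.
have hE p q : p != 0 -> (absz p <= absz q)%N -> hker r p q = zabs p `^ (- r) * zabs q `^ (r - 1).
  by move=> p0 pq; rewrite /hker p0 pq.
have nx := normr_ge0 x; have ny := normr_ge0 y.
(* In the four cases the smallest frequency is [j], [l], [k] and [l]. The other two are then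
   comparable up to a factor 2 by the triangle inequalities above. *)
have [jk|kj] := leqP (absz j) (absz k); [have [jl|lj] := leqP (absz j) (absz l)|have [kl|lk] := leqP (absz k) (absz l)].
- have JK : J <= K by rewrite zabs_le.
  have JL : J <= L by rewrite zabs_le.
  apply: (@fin1 `|y|) => //; first lra.
  by rewrite hE//; apply: triple_weight => //; lra.
- have JK : J <= K by rewrite zabs_le.
  have LJ : L <= J by rewrite zabs_le ltnW.
  rewrite (addrC (hker r j k)); apply: (@fin1 `|x|) => //; first lra.
  have lk : (absz l <= absz k)%N by rewrite (leq_trans (ltnW lj)).
  rewrite hE//; rewrite (mulrC (J `^ _)); apply: triple_weight => //; try lra.
- have KJ : K <= J by rewrite zabs_le ltnW.
  have KL : K <= L by rewrite zabs_le.
  rewrite [_ + hker r k j]addrC addrA; apply: (@fin1 `|y|) => //; first lra.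
  rewrite hE//; last exact: ltnW.
  rewrite (_ : _ * _ * _ = K `^ (- z) * L `^ (- y) * J `^ (- x)); last by ring.
  by apply: triple_weight => //; lra.
- have LK : L <= K by rewrite zabs_le ltnW.
  have KJ : K <= J by rewrite zabs_le ltnW.
  rewrite (addrC (hker r j k)); apply: (@fin1 `|x|) => //; first lra.
  rewrite hE//; last exact: ltnW.
  by rewrite (mulrC (J `^ _)); apply: triple_weight => //; lra.
Qed.

End SquareSummable.

(** * The discrete Hardy-Littlewood-Sobolev inequality *)

Section HLS.
Context {R : realType}.
Implicit Types (a b : int -> R) (k j : int).

Lemma sumsq3_le (p q s : R) : 0 <= p -> 0 <= q -> 0 <= s ->
  p ^+ 2 + q ^+ 2 + s ^+ 2 <= (p + q + s) ^+ 2.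
Proof.
move=> p0 q0 s0; have := mulr_ge0 p0 q0; have := mulr_ge0 p0 s0.
by have := mulr_ge0 q0 s0; nra.
Qed.

Lemma sumsq3_ge (p q s : R) : (p + q + s) ^+ 2 <= 3 * (p ^+ 2 + q ^+ 2 + s ^+ 2).
Proof.
by have := sqr_ge0 (p - q); have := sqr_ge0 (p - s); have := sqr_ge0 (q - s); nra.
Qed.

Lemma le_9 (p q s X : R) : p <= X -> q <= X -> s <= X -> 3 * (p + q + s) <= 9 * X.
Proof. by lra. Qed.

(** A convolution conjugated by power weights, so that its arguments are the normalized coefficients
    in l^2. As [wt] vanishes at 0, the zero modes drop out. *)
Definition bilin (x y z : R) a b k : R :=
  wt (- z) k * zsum (fun j => wt (- x) j * wt (- y) (k - j) * (a j * b (k - j))).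

Lemma l2_sqrt (f : int -> R) : (forall k, 0 <= f k) -> summ f ->
  l2 (fun k => Num.sqrt (f k)) /\ n2 (fun k => Num.sqrt (f k)) = zsum f.
Proof.
move=> f0 sf; have E : (fun k => Num.sqrt (f k) ^+ 2) = f.
  by apply/funext => k; rewrite sqr_sqrtr.
by rewrite /l2 /n2 E.
Qed.

Lemma hls_piece1 (h : int -> int -> R) C a b :
  (forall j k, 0 <= h j k) -> (forall k, summ (h ^~ k) /\ zsum (h ^~ k) <= C) ->
  l2 a -> l2 b ->
  let G k := zsum (fun j => Num.sqrt (h j k) * (a j * b (k - j))) in
  (forall k, summ (fun j => Num.sqrt (h j k) * (a j * b (k - j)))) /\
  l2 G /\ n2 G <= C * (n2 a * n2 b).
Proof.
move=> h0 hC la lb G.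
have S k := l2_sqrt (h0 ^~ k) (hC k).1.
have T k := l2_shift_mul k la lb.
have s k : summ (fun j => Num.sqrt (h j k) * (a j * b (k - j))).
  exact: summ_mul (S k).1 (T k).
have C0 : 0 <= C by apply: le_trans (hC 0).2; apply: zsum_ge0.
have GB k : G k ^+ 2 <= C * n2 (fun j => a j * b (k - j)).
  apply: (le_trans (cauchy_schwarz (S k).1 (T k))).
  by rewrite ler_wpM2r ?n2_ge0// (S k).2 (hC k).2.
have [sc ec] := zsum_conv_sq la lb.
have lG : l2 G.
  by apply: le_summ_ge0 (summZ C sc) => k; rewrite ger0_norm ?sqr_ge0//; exact: GB.
split; [exact: s|split; [exact: lG|]].
by rewrite -ec -(zsumZ _ sc); apply: le_zsum; [exact: lG|exact: summZ|exact: GB].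
Qed.

(** Here the kernel has bounded sums over the output index [k] rather than over [j]. It therefore
    stays with [a] in Cauchy-Schwarz, and Tonelli's theorem sums over [k] first. *)
Lemma hls_piece3 (h : int -> int -> R) C a b :
  (forall j k, 0 <= h j k) -> (forall k, summ (h ^~ k) /\ zsum (h ^~ k) <= C) ->
  l2 a -> l2 b ->
  let G k := zsum (fun j => Num.sqrt (h k j) * (a j * b (k - j))) in
  (forall k, summ (fun j => Num.sqrt (h k j) * (a j * b (k - j)))) /\
  l2 G /\ n2 G <= C * (n2 a * n2 b).
Proof.
move=> h0 hC la lb G.
have C0 : 0 <= C by apply: le_trans (hC 0).2; apply: zsum_ge0.
have [|||] := @zsum_tonelli R (fun k j => h k j * a j ^+ 2).
- by move=> k j; rewrite mulr_ge0// sqr_ge0.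
- move=> j; apply: eq_summ (summZ (a j ^+ 2) (hC j).1) => k; exact: mulrC.
- apply: le_summ_ge0 (summZ C la) => j; rewrite ger0_norm; last first.
    by apply: zsum_ge0 => k; rewrite mulr_ge0// sqr_ge0.
  rewrite (@eq_zsum _ _ (fun k => a j ^+ 2 * h k j)); last by move=> k; exact: mulrC.
  by rewrite (zsumZ _ (hC j).1) mulrC ler_wpM2r ?sqr_ge0// (hC j).2.
move=> s1 s2 e.
have eL : zsum (fun k => zsum (fun j => h k j * a j ^+ 2)) <= C * n2 a.
  rewrite e -(zsumZ _ la); apply: le_zsum; [|exact: summZ|].
    apply: le_summ_ge0 (summZ C la) => j; rewrite ger0_norm; last first.
      by apply: zsum_ge0 => k; rewrite mulr_ge0// sqr_ge0.
    rewrite (@eq_zsum _ _ (fun k => a j ^+ 2 * h k j)); last by move=> k; exact: mulrC.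
    by rewrite (zsumZ _ (hC j).1) mulrC ler_wpM2r ?sqr_ge0// (hC j).2.
  move=> j; rewrite (@eq_zsum _ _ (fun k => a j ^+ 2 * h k j)); last by move=> k; exact: mulrC.
  by rewrite (zsumZ _ (hC j).1) mulrC ler_wpM2r ?sqr_ge0// (hC j).2.
have S k : l2 (fun j => Num.sqrt (h k j) * a j) /\
    n2 (fun j => Num.sqrt (h k j) * a j) = zsum (fun j => h k j * a j ^+ 2).
  have E : (fun j => (Num.sqrt (h k j) * a j) ^+ 2) = (fun j => h k j * a j ^+ 2).
    by apply/funext => j; rewrite exprMn sqr_sqrtr.
  by rewrite /l2 /n2 E.
have GE k : (fun j => Num.sqrt (h k j) * (a j * b (k - j))) =
    (fun j => (Num.sqrt (h k j) * a j) * b (k - j)).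
  by apply/funext => j; rewrite mulrA.
have B k := l2_sub k lb.
have s k : summ (fun j => Num.sqrt (h k j) * (a j * b (k - j))).
  by rewrite GE; exact: summ_mul (S k).1 (B k).1.
have GB k : G k ^+ 2 <= n2 b * zsum (fun j => h k j * a j ^+ 2).
  rewrite /G GE; apply: (le_trans (cauchy_schwarz (S k).1 (B k).1)).
  by rewrite (S k).2 (B k).2 mulrC.
have lG : l2 G.
  by apply: le_summ_ge0 (summZ (n2 b) s2) => k; rewrite ger0_norm ?sqr_ge0//; exact: GB.
split; [exact: s|split; [exact: lG|]].
rewrite mulrA mulrC; apply: (@le_trans _ _ (n2 b * zsum (fun k => zsum (fun j => h k j * a j ^+ 2)))).
  by rewrite -(zsumZ _ s2); apply: le_zsum; [exact: lG|exact: summZ|exact: GB].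
by rewrite ler_wpM2l ?n2_ge0.
Qed.

(** A sum of squares of nonnegative numbers is at most the square of their sum, so the bound on the
    squared kernel gives a bound on the kernel by three square roots, one for each of the preceding
    pieces. *)
Lemma kernel_bound (K h1 h2 : int -> int -> R) (w : int -> R) C D a b :
  (forall j k, 0 <= K j k) -> (forall k, 0 <= w k) ->
  (forall j k, 0 <= h1 j k) -> (forall j k, 0 <= h2 j k) -> 0 <= D ->
  (forall k, summ (h1 ^~ k) /\ zsum (h1 ^~ k) <= C) ->
  (forall k, summ (h2 ^~ k) /\ zsum (h2 ^~ k) <= C) ->
  (forall j k, (K j k * w k) ^+ 2 <= D * (h1 j k + h2 j k + h1 k j)) ->
  (forall k, 0 <= a k) -> (forall k, 0 <= b k) -> l2 a -> l2 b ->
  let G k := w k * zsum (fun j => K j k * (a j * b (k - j))) in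
  [/\ forall k, w k != 0 -> summ (fun j => K j k * (a j * b (k - j))),
    l2 G & n2 G <= D * (9 * (C * (n2 a * n2 b)))].
Proof.
move=> K0 w0 h10 h20 D0 h1C h2C KD a0 b0 la lb G.
have [s1 [l1 n1]] := hls_piece1 h10 h1C la lb.
have [s2 [l2' n2']] := hls_piece1 h20 h2C la lb.
have [s3 [l3 n3]] := hls_piece3 h10 h1C la lb.
move: s1 l1 n1 s2 l2' n2' s3 l3 n3.
set G1 := (fun k => zsum (fun j => Num.sqrt (h1 j k) * _)).
set G2 := (fun k => zsum (fun j => Num.sqrt (h2 j k) * _)).
set G3 := (fun k => zsum (fun j => Num.sqrt (h1 k j) * _)).
move=> s1 l1 n1 s2 l2' n2' s3 l3 n3.
have ptw j k : K j k * w k <=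
    Num.sqrt D * (Num.sqrt (h1 j k) + Num.sqrt (h2 j k) + Num.sqrt (h1 k j)).
  rewrite -(@ler_pXn2r _ 2) ?nnegrE ?mulr_ge0 ?addr_ge0 ?sqrtr_ge0//.
  apply: (le_trans (KD j k)).
  rewrite exprMn (sqr_sqrtr D0) (ler_wpM2l D0)//.
  apply: le_trans (sumsq3_le _ _ _); rewrite ?sqrtr_ge0//.
  by rewrite !sqr_sqrtr.
have ab0 j k : 0 <= a j * b (k - j) by rewrite mulr_ge0.
pose M k j := Num.sqrt D * (Num.sqrt (h1 j k) * (a j * b (k - j)) +
  Num.sqrt (h2 j k) * (a j * b (k - j)) + Num.sqrt (h1 k j) * (a j * b (k - j))).
have s12 k := summD (s1 k) (s2 k).
have s123 k := summD (s12 k) (s3 k).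
have sM k : summ (M k) := summZ _ (s123 k).
have zM k : zsum (M k) = Num.sqrt D * (G1 k + G2 k + G3 k).
  by rewrite (zsumZ _ (s123 k)) (zsumD (s12 k) (s3 k)) (zsumD (s1 k) (s2 k)).
have ptw2 k j : w k * (K j k * (a j * b (k - j))) <= M k j.
  rewrite /M -!mulrDl [leLHS]mulrA [leRHS]mulrA (ler_wpM2r (ab0 j k))// mulrC.
  exact: ptw.
have term0 k j : 0 <= w k * (K j k * (a j * b (k - j))).
  by rewrite mulr_ge0// mulr_ge0.
have stw k : summ (fun j => w k * (K j k * (a j * b (k - j)))).
  by apply: le_summ_ge0 (sM k) => j; rewrite (ger0_norm (term0 k j)); exact: ptw2.
have st k : w k != 0 -> summ (fun j => K j k * (a j * b (k - j))).
  move=> wk; apply: eq_summ (summZ (w k)^-1 (stw k)) => j.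
  by rewrite mulrA (mulVf wk) mul1r.
have GM k : 0 <= G k <= Num.sqrt D * (G1 k + G2 k + G3 k).
  rewrite mulr_ge0 ?zsum_ge0//=; last by move=> j; rewrite mulr_ge0.
  rewrite /G; have [wk|wk] := eqVneq (w k) 0.
    rewrite wk mul0r -zM; apply: zsum_ge0 => j.
    exact: le_trans (term0 k j) (ptw2 k j).
  by rewrite -(zsumZ _ (st k wk)) -zM; exact: le_zsum.
have BM k : `|G k| <= `|Num.sqrt D * (G1 k + G2 k + G3 k)|.
  have /andP[g0 gM] := GM k; rewrite (ger0_norm g0) (le_trans gM)//.
  exact: ler_norm.
suff : l2 G /\ n2 G <= D * (9 * (C * (n2 a * n2 b))) by case; split; first exact: st.
clear GM st stw term0 ptw2 zM sM s123 s12 ptw s1 s2 s3 KD.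
clearbody G G1 G2 G3; clear M.
have l12 := l2D l1 l2'; have l123 := l2D l12 l3.
have lM := l2Z (Num.sqrt D) l123.
split; first exact: le_l2 lM.
apply: (le_trans (le_n2 BM lM)); rewrite (n2Z _ l123) (sqr_sqrtr D0).
rewrite (ler_wpM2l D0)//.
apply: le_trans (le_9 n1 n2' n3).
have s12 := summD l1 l2'; have s123 := summD s12 l3.
rewrite -(zsumD l1 l2') -(zsumD s12 l3) -(zsumZ _ s123).
apply: le_zsum; [exact: l123|exact: summZ|].
by move=> k; exact: sumsq3_ge.
Qed.

(* Discrete Hardy-Littlewood-Sobolev inequality. *)
Theorem hls (x y z r : R) : x + y + z = 2^-1 ->
  2 * x <= r -> 2 * y <= r -> 2 * z <= r -> 0 < r < 1 ->
  exists2 C, 0 <= C & forall a b,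
  (forall k, 0 <= a k) -> (forall k, 0 <= b k) -> l2 a -> l2 b ->
  [/\ forall k, k != 0 -> summ (fun j => wt (- x) j * wt (- y) (k - j) * (a j * b (k - j))),
    l2 (bilin x y z a b) &
    n2 (bilin x y z a b) <= C * (n2 a * n2 b)].
Proof.
move=> xyz xr yr zr r01.
pose C : R := 2 / (1 - r); pose D : R := 2 `^ (2 * (`|x| + `|y|)).
have C0 : 0 <= C by rewrite divr_ge0// subr_ge0 ltW//; case/andP: r01.
have D0 : 0 <= D by exact: powR_ge0.
have KD j k : (wt (- x) j * wt (- y) (k - j) * wt (- z) k) ^+ 2 <=
  D * (hker r j k + hker r (k - j) k + hker r k j) by exact: hls_kernel.
have h1C k : summ (hker r ^~ k) /\ zsum (hker r ^~ k) <= C by exact: hker_sum.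
have h2C k : summ (fun j => hker r (k - j) k) /\ zsum (fun j => hker r (k - j) k) <= C.
  have [s e] := zsum_reindex (bij_subz k) (h1C k).1.
  by split; [exact: s|rewrite e; exact: (h1C k).2].
exists (D * (9 * C)); first by rewrite mulr_ge0// mulr_ge0.
clearbody C D => a b a0 b0 la lb.
have [||||s l n] := @kernel_bound (fun j k => wt (- x) j * wt (- y) (k - j))
  (hker r) (fun j k => hker r (k - j) k) (wt (- z)) C D a b _ _ _ _ D0 h1C h2C KD a0 b0 la lb.
- by move=> j k; rewrite mulr_ge0// wt_ge0.
- by move=> k; exact: wt_ge0.
- by move=> j k; exact: hker_ge0.
- by move=> j k; exact: hker_ge0.
split; [|exact: l|by rewrite -!mulrA].
move=> k k0; apply: s; rewrite wtE// gt_eqF// powR_gt0// zabs_gt0//.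
Qed.

Lemma bilin0 x y z a b : bilin x y z a b 0 = 0.
Proof. by rewrite /bilin {1}/wt eqxx mul0r. Qed.

Lemma bilin_ge0 x y z a b k : (forall k, 0 <= a k) -> (forall k, 0 <= b k) ->
  0 <= bilin x y z a b k.
Proof.
move=> a0 b0; rewrite mulr_ge0 ?wt_ge0//; apply: zsum_ge0 => j.
by rewrite !mulr_ge0 ?wt_ge0.
Qed.

End HLS.

(** * The nonlinearity in Hartley coefficients *)

Section HartleyProduct.
Context {R : realType}.
Implicit Types (f g u v U V : int -> R) (k j : int).

Definition even_seq f : Prop := forall k, f (- k) = f k.

(** The product formula [cas_mul] sends two frequencies to four, whence four terms where complex
    exponentials would give a single one; see [har_syn_mul]. *)
Definition conv_term f g k j : R :=
  f j * (g (k - j) + g (j - k) + g (k + j) - g (- k - j)).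

Definition conv f g k : R := 2^-1 * zsum (conv_term f g k).

(** Evenness of the majorant folds the four terms into two, at [k - j] and [k + j]; in [conv_dom]
    the second one is reflected onto the first. *)
Lemma conv_term_le f g F G k j : even_seq G ->
  (forall j, `|f j| <= F j) -> (forall j, `|g j| <= G j) ->
  `|conv_term f g k j| <= 2 * (F j * G (k - j) + F j * G (k + j)).
Proof.
move=> eG fF gG; rewrite /conv_term normrM -mulrDr mulrCA; apply: ler_pM => //.
apply: (le_trans (ler_normB _ _)).
apply: (@le_trans _ _ (G (k - j) + G (j - k) + G (k + j) + G (- k - j))).
  apply: lerD => //; apply: (le_trans (ler_normD _ _)); apply: lerD => //.
  by apply: (le_trans (ler_normD _ _)); apply: lerD.
rewrite -(eG (j - k)) -(eG (- k - j)) !opprB (_ : j - - k = k + j); last by ring.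
by rewrite le_eqVlt; apply/orP; left; apply/eqP; ring.
Qed.

Lemma conv_dom F G k : even_seq F -> even_seq G -> summ (fun j => F j * G (k - j)) ->
  summ (fun j => 2 * (F j * G (k - j) + F j * G (k + j))) /\
  zsum (fun j => 2 * (F j * G (k - j) + F j * G (k + j))) = 4 * zsum (fun j => F j * G (k - j)).
Proof.
move=> eF eG sFG.
have sFG' : summ (fun j => F j * G (k + j)).
  by apply: eq_summ (summ_opp sFG) => j; rewrite eF opprK.
have zFG' : zsum (fun j => F j * G (k + j)) = zsum (fun j => F j * G (k - j)).
  by rewrite -[RHS](zsum_opp sFG); apply: eq_zsum => j; rewrite eF opprK.
have sS := summD sFG sFG'.
split; first exact: summZ.
by rewrite (zsumZ _ sS) (zsumD sFG sFG') zFG'; ring.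
Qed.

Lemma conv_bound f g F G k : even_seq F -> even_seq G ->
  (forall j, `|f j| <= F j) -> (forall j, `|g j| <= G j) ->
  summ (fun j => F j * G (k - j)) ->
  summ (conv_term f g k) /\ `|conv f g k| <= 2 * zsum (fun j => F j * G (k - j)).
Proof.
move=> eF eG fF gG sFG.
have [sS zS] := conv_dom eF eG sFG.
have B j := conv_term_le k j eG fF gG.
have s : summ (conv_term f g k) by exact: le_summ_ge0 B sS.
split; first exact: s.
rewrite /conv normrM ger0_norm ?invr_ge0//.
rewrite ler_pdivrMl//; apply: (le_trans (ler_norm_zsum s)).
rewrite mulrA -natrM -zS.
by apply: le_zsum B; [exact: summ_norm|exact: sS].
Qed.

Lemma convD f f' g k : summ (conv_term f g k) -> summ (conv_term f' g k) ->
  summ (conv_term (fun j => f j + f' j) g k) /\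
  conv (fun j => f j + f' j) g k = conv f g k + conv f' g k.
Proof.
move=> s s'; have E : conv_term (fun j => f j + f' j) g k =
    (fun j => conv_term f g k j + conv_term f' g k j).
  by apply/funext => j; rewrite /conv_term mulrDl.
rewrite /conv E (zsumD s s') mulrDr; split=> //; exact: summD.
Qed.

Lemma convDr f g g' k : summ (conv_term f g k) -> summ (conv_term f g' k) ->
  summ (conv_term f (fun j => g j + g' j) k) /\
  conv f (fun j => g j + g' j) k = conv f g k + conv f g' k.
Proof.
move=> s s'; have E : conv_term f (fun j => g j + g' j) k =
    (fun j => conv_term f g k j + conv_term f g' k j).
  by apply/funext => j; rewrite /conv_term; ring.
rewrite /conv E (zsumD s s') mulrDr; split=> //; exact: summD.
Qed.

(* Hartley coefficients of d/dx Lambda v, d/dx v (up to sign) and Lambda u. *)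
Definition hDL v : int -> R := fun l => l%:~R * zabs l * v (- l).
Definition hD v : int -> R := fun l => l%:~R * v (- l).
Definition hL u : int -> R := fun l => zabs l * u l.

(* With J = - Lambda B, the coefficients of - (a B J_x + b J B_x) at B = u = v. *)
Definition nl (a b : R) u v k : R :=
  - (a * conv u (hDL v) k + b * conv (hL u) (hD v) k).

Definition domt U V k j : R := (zabs j + zabs k) * zabs (k - j) * (U j * V (k - j)).

Lemma norm_intr k : `|k%:~R : R| = zabs k.
Proof. by rewrite zabsE. Qed.

Section Majorant.
Variables (U V : int -> R) (k : int).
Hypotheses (eU : even_seq U) (eV : even_seq V).
Hypothesis sUV : summ (domt U V k).

(** With l = k - j, the product B J_x puts |l|^2 on one factor and J B_x puts |j| |l| on both; each
    weight is at most (|j| + |k|) |l|, which is why [domt] covers the two products. *)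
Lemma nl_term_bounds u v : (forall j, `|u j| <= U j) -> (forall j, `|v j| <= V j) ->
  [/\ summ (conv_term u (hDL v) k), `|conv u (hDL v) k| <= 2 * zsum (domt U V k),
   summ (conv_term (hL u) (hD v) k) & `|conv (hL u) (hD v) k| <= 2 * zsum (domt U V k)].
Proof.
move=> uU vV.
have U0 j : 0 <= U j by exact: le_trans (uU j).
have V0 j : 0 <= V j by exact: le_trans (vV j).
have UV0 j : 0 <= U j * V (k - j) by rewrite mulr_ge0.
have D1 j : 0 <= U j * (zabs (k - j) ^+ 2 * V (k - j)) <= domt U V k j.
  rewrite mulr_ge0 ?mulr_ge0//= ?exprn_ge0 ?zabs_ge0// /domt mulrCA ler_wpM2r//.
  by rewrite expr2 ler_wpM2r ?zabs_ge0// (addrC (zabs j)) zabsB.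
have D2 j : 0 <= (zabs j * U j) * (zabs (k - j) * V (k - j)) <= domt U V k j.
  rewrite !mulr_ge0 ?zabs_ge0//= /domt mulrACA ler_wpM2r// ler_wpM2r ?zabs_ge0//.
  by rewrite lerDl zabs_ge0.
have s1 : summ (fun j => U j * (zabs (k - j) ^+ 2 * V (k - j))).
  by apply: le_summ_ge0 sUV => j; have /andP[p q] := D1 j; rewrite ger0_norm.
have s2 : summ (fun j => (zabs j * U j) * (zabs (k - j) * V (k - j))).
  by apply: le_summ_ge0 sUV => j; have /andP[p q] := D2 j; rewrite ger0_norm.
have z1 : zsum (fun j => U j * (zabs (k - j) ^+ 2 * V (k - j))) <= zsum (domt U V k).
  by apply: le_zsum s1 sUV _ => j; have /andP[] := D1 j.
have z2 : zsum (fun j => (zabs j * U j) * (zabs (k - j) * V (k - j))) <= zsum (domt U V k).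
  by apply: le_zsum s2 sUV _ => j; have /andP[] := D2 j.
have [|||c1 c2] := @conv_bound u (hDL v) U (fun l => zabs l ^+ 2 * V l) k eU _ _ _ s1.
- by move=> l; rewrite zabsN eV.
- exact: uU.
- by move=> l; rewrite /hDL !normrM norm_intr (ger0_norm (zabs_ge0 _)) -expr2 ler_wpM2l ?exprn_ge0 ?zabs_ge0// -eV vV.
have [||||c3 c4] := @conv_bound (hL u) (hD v) (fun l => zabs l * U l) (fun l => zabs l * V l) k _ _ _ _ s2.
- by move=> l; rewrite zabsN eU.
- by move=> l; rewrite zabsN eV.
- by move=> l; rewrite /hL normrM (ger0_norm (zabs_ge0 _)) ler_wpM2l ?zabs_ge0.
- by move=> l; rewrite /hD normrM norm_intr ler_wpM2l ?zabs_ge0// -eV vV.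
split; [exact: c1| |exact: c3|].
  by apply: (le_trans c2); rewrite ler_pM2l.
by apply: (le_trans c4); rewrite ler_pM2l.
Qed.

(** The dominating sequences must not depend on [u] and [v], in view of the dominated convergence in
    [nl_cvg]. *)
Lemma nl_term_dom : exists g1 g2, [/\ summ g1, summ g2 &
  forall u v, (forall j, `|u j| <= U j) -> (forall j, `|v j| <= V j) ->
  forall j, `|conv_term u (hDL v) k j| <= g1 j /\ `|conv_term (hL u) (hD v) k j| <= g2 j].
Proof.
have [U0 V0] : (forall j, 0 <= `|U j|) /\ (forall j, 0 <= `|V j|) by split.
pose F1 := U; pose G1 l := zabs l ^+ 2 * V l.
pose F2 l := zabs l * U l; pose G2 l := zabs l * V l.
have eG1 : even_seq G1 by move=> l; rewrite /G1 zabsN eV.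
have eF2 : even_seq F2 by move=> l; rewrite /F2 zabsN eU.
have eG2 : even_seq G2 by move=> l; rewrite /G2 zabsN eV.
have s1 : summ (fun j => F1 j * G1 (k - j)).
  apply: le_summ sUV => j; rewrite /F1 /G1 /domt mulrCA !normrM ler_wpM2r ?mulr_ge0//.
  rewrite -!normrM !ger0_norm ?mulr_ge0 ?addr_ge0 ?zabs_ge0//.
  by rewrite ler_wpM2r ?zabs_ge0// (addrC (zabs j)) zabsB.
have s2 : summ (fun j => F2 j * G2 (k - j)).
  apply: le_summ sUV => j; rewrite /F2 /G2 /domt mulrACA normrM [leRHS]normrM.
  rewrite ler_wpM2r// !ger0_norm ?mulr_ge0 ?addr_ge0 ?zabs_ge0//.
  by rewrite ler_wpM2r ?zabs_ge0// lerDl zabs_ge0.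
have [t1 _] := conv_dom eU eG1 s1; have [t2 _] := conv_dom eF2 eG2 s2.
exists (fun j => 2 * (F1 j * G1 (k - j) + F1 j * G1 (k + j))).
exists (fun j => 2 * (F2 j * G2 (k - j) + F2 j * G2 (k + j))).
split; [exact: t1|exact: t2|] => u v uU vV j; split; apply: conv_term_le => //.
- by move=> l; rewrite /hDL !normrM norm_intr (ger0_norm (zabs_ge0 _)) -expr2 ler_wpM2l ?exprn_ge0 ?zabs_ge0// -eV vV.
- by move=> l; rewrite /hL normrM (ger0_norm (zabs_ge0 _)) ler_wpM2l ?zabs_ge0.
- by move=> l; rewrite /hD normrM norm_intr ler_wpM2l ?zabs_ge0// -eV vV.
Qed.

Lemma nl_cvg a b (u v : nat -> int -> R) u' v' :
  (forall n j, `|u n j| <= U j) -> (forall n j, `|v n j| <= V j) ->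
  (forall j, u n j @[n --> \oo] --> u' j) -> (forall j, v n j @[n --> \oo] --> v' j) ->
  nl a b (u n) (v n) k @[n --> \oo] --> nl a b u' v' k.
Proof.
move=> uU vV cu cv; have [g1 [g2 [s1 s2 H]]] := nl_term_dom.
rewrite /nl; apply: cvgN; apply: cvgD; apply: cvgM; try exact: cvg_cst;
  apply: cvgM; try exact: cvg_cst.
  apply: (zsum_cvg s1) => [n j|j]; first by have [] := H _ _ (uU n) (vV n) j.
  rewrite /conv_term; apply: cvgM; first exact: cu.
  have C l : hDL (v n) l @[n --> \oo] --> hDL v' l by apply: cvgM; [exact: cvg_cst|exact: cv].
  by apply: cvgB; [apply: cvgD; [apply: cvgD|]|]; exact: C.
apply: (zsum_cvg s2) => [n j|j]; first by have [] := H _ _ (uU n) (vV n) j.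
rewrite /conv_term; apply: cvgM; first by apply: cvgM; [exact: cvg_cst|exact: cu].
have C l : hD (v n) l @[n --> \oo] --> hD v' l by apply: cvgM; [exact: cvg_cst|exact: cv].
by apply: cvgB; [apply: cvgD; [apply: cvgD|]|]; exact: C.
Qed.

Lemma nl_bound a b u v : (forall j, `|u j| <= U j) -> (forall j, `|v j| <= V j) ->
  `|nl a b u v k| <= 2 * (`|a| + `|b|) * zsum (domt U V k).
Proof.
move=> uU vV; have [_ c1 _ c2] := nl_term_bounds uU vV.
rewrite /nl normrN (le_trans (ler_normD _ _))// (normrM a) (normrM b).
rewrite (_ : 2 * _ * _ = `|a| * (2 * zsum (domt U V k)) + `|b| * (2 * zsum (domt U V k))); last by ring.
by apply: lerD; rewrite ler_wpM2l.
Qed.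

End Majorant.

(** Conservation of the mean: at frequency 0 the terms of both convolutions are odd in [j]. *)
Lemma nl_zero a b u : nl a b u u 0 = 0.
Proof.
rewrite /nl /conv [X in a * (_ * X)]zsum_odd ?[X in b * (_ * X)]zsum_odd; first by ring.
  move=> j; rewrite /conv_term /hL /hD !sub0r !subr0 !add0r !opprK !zabsN !rmorphN /=.
  by ring.
move=> j; rewrite /conv_term /hDL !sub0r !subr0 !add0r !opprK !zabsN !rmorphN /=.
by ring.
Qed.

Lemma nlBl a b u u' v k U V : even_seq U -> even_seq V -> summ (domt U V k) ->
  (forall j, `|u j| <= U j) -> (forall j, `|u' j| <= U j) -> (forall j, `|v j| <= V j) ->
  nl a b (fun j => u j - u' j) v k = nl a b u v k - nl a b u' v k.
Proof.
move=> eU eV sUV uU u'U vV.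
have nu'U j : `|- u' j| <= U j by rewrite normrN.
have [s1 _ s2 _] := nl_term_bounds eU eV sUV uU vV.
have [s3 _ s4 _] := nl_term_bounds eU eV sUV nu'U vV.
have N1 : conv (fun j => - u' j) (hDL v) k = - conv u' (hDL v) k.
  have [s5 _ _ _] := nl_term_bounds eU eV sUV u'U vV.
  rewrite /conv -mulrN -(zsumN s5); congr (_ * _); apply: eq_zsum => j.
  by rewrite /conv_term mulNr.
have N2 : conv (hL (fun j => - u' j)) (hD v) k = - conv (hL u') (hD v) k.
  have [_ _ s5 _] := nl_term_bounds eU eV sUV u'U vV.
  rewrite /conv -mulrN -(zsumN s5); congr (_ * _); apply: eq_zsum => j.
  by rewrite /conv_term /hL mulrN mulNr.
rewrite /nl; have [_ ->] := convD s1 s3; rewrite N1.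
have -> : hL (fun j => u j - u' j) = (fun j => hL u j + hL (fun j => - u' j) j).
  by apply/funext => j; rewrite /hL; ring.
by have [_ ->] := convD s2 s4; rewrite N2; ring.
Qed.

Lemma nlBr a b u v v' k U V : even_seq U -> even_seq V -> summ (domt U V k) ->
  (forall j, `|u j| <= U j) -> (forall j, `|v j| <= V j) -> (forall j, `|v' j| <= V j) ->
  nl a b u (fun j => v j - v' j) k = nl a b u v k - nl a b u v' k.
Proof.
move=> eU eV sUV uU vV v'V.
have nv'V j : `|- v' j| <= V j by rewrite normrN.
have [s1 _ s2 _] := nl_term_bounds eU eV sUV uU vV.
have [s3 _ s4 _] := nl_term_bounds eU eV sUV uU nv'V.
have [s5 _ s6 _] := nl_term_bounds eU eV sUV uU v'V.
have N1 : conv u (hDL (fun j => - v' j)) k = - conv u (hDL v') k.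
  rewrite /conv -mulrN -(zsumN s5); congr (_ * _); apply: eq_zsum => j.
  by rewrite /conv_term /hDL; ring.
have N2 : conv (hL u) (hD (fun j => - v' j)) k = - conv (hL u) (hD v') k.
  rewrite /conv -mulrN -(zsumN s6); congr (_ * _); apply: eq_zsum => j.
  by rewrite /conv_term /hD; ring.
rewrite /nl.
have -> : hDL (fun j => v j - v' j) = (fun j => hDL v j + hDL (fun j => - v' j) j).
  by apply/funext => j; rewrite /hDL; ring.
have [_ ->] := convDr s1 s3; rewrite N1.
have -> : hD (fun j => v j - v' j) = (fun j => hD v j + hD (fun j => - v' j) j).
  by apply/funext => j; rewrite /hD; ring.
by have [_ ->] := convDr s2 s4; rewrite N2; ring.
Qed.

Lemma nl_diff a b u u' k U V : even_seq U -> even_seq V ->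
  (forall j, U j <= V j) -> summ (domt V V k) ->
  (forall j, `|u j| <= V j) -> (forall j, `|u' j| <= V j) -> (forall j, `|u j - u' j| <= U j) ->
  nl a b u u k - nl a b u' u' k =
  nl a b (fun j => u j - u' j) u k + nl a b u' (fun j => u j - u' j) k.
Proof.
move=> eU eV UV s uV u'V d.
by rewrite (nlBl a b eV eV s uV u'V uV) (nlBr a b eV eV s u'V uV u'V); ring.
Qed.

End HartleyProduct.

(** Sequential continuity by [nl_cvg]; the sequence is shifted so as to lie entirely in the interval
    where [U] is a majorant. *)
Lemma nl_continuous (R : realType) (a b : R) (u : R -> int -> R) (U : int -> R) k p q :
  even_seq U -> summ (domt U U k) ->
  (forall t j, p < t < q -> `|u t j| <= U j) ->
  (forall t j, p < t < q -> {for t, continuous (u ^~ j)}) ->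
  forall t, p < t < q -> {for t, continuous (fun s => nl a b (u s) (u s) k)}.
Proof.
move=> eU sU uU cu t tpq; apply/(@cvg_nbhsP _ R^o) => w wt.
have tI : t \in `]p, q[ by rewrite in_itv.
have /near_in_itvoo[e /= e0 he] := tI.
move/cvgrPdist_lt : (wt) => /(_ _ e0)[N _ HN].
have wI n : p < w (n + N)%N < q.
  by have := he (w (n + N)%N); rewrite /ball/= in_itv/=; apply; apply: HN => /=; exact: leq_addl.
rewrite -(cvg_shiftn N); apply: (nl_cvg (U := U) (V := U) (k := k)) => // [n j|n j|j|j].
- exact: uU.
- exact: uU.
- by have := cu t j tpq => /(@cvg_nbhsP _ R^o) /(_ _ wt); rewrite -(cvg_shiftn N).
- by have := cu t j tpq => /(@cvg_nbhsP _ R^o) /(_ _ wt); rewrite -(cvg_shiftn N).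
Qed.

(** * Calculus in one variable *)

Section Calculus.
Context {R : realType}.
Implicit Types (f F : R -> R) (a b c x s t : R).
Local Notation leb := (@lebesgue_measure R).

Lemma continuous_at_within f a b : (forall x, a <= x <= b -> {for x, continuous f}) ->
  {within `[a, b], continuous f}.
Proof.
move=> cf; apply: continuous_in_subspaceT => x; rewrite inE/= in_itv/=.
exact: cf.
Qed.

Lemma continuous_at_integrable f a b :
  (forall x, a <= x <= b -> {for x, continuous f}) ->
  leb.-integrable `[a, b] (EFin \o f).
Proof.
move=> cf; apply: continuous_compact_integrable; first exact: segment_compact.
exact: continuous_at_within.
Qed.

Lemma is_derive_continuous F f x : is_derive x 1 F (f x) -> {for x, continuous F}.
Proof. by move=> [dF _]; apply: differentiable_continuous; apply/derivable1_diffP. Qed.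

Lemma FTC2 f F a b : a <= b ->
  (forall x, a <= x <= b -> {for x, continuous f}) ->
  (forall x, a <= x <= b -> is_derive x 1 F (f x)) ->
  (\int[leb]_(x in `[a, b]) (f x)%:E = (F b - F a)%:E)%E.
Proof.
rewrite le_eqVlt => /predU1P[<- _ _|ab cf dF].
  by rewrite set_itv1 integral_set1 subrr.
have cF x : a <= x <= b -> {for x, continuous F}.
  by move=> /dF; exact: is_derive_continuous.
rewrite (@continuous_FTC2 _ f F a b ab (continuous_at_within cf))//.
- split.
  + by move=> x; rewrite in_itv/= => /andP[ax xb]; apply: ex_derive; apply: dF; rewrite !ltW.
  + by apply: cvg_at_right_filter; apply: cF; rewrite lexx ltW.
  + by apply: cvg_at_left_filter; apply: cF; rewrite lexx ltW.
- move=> x; rewrite in_itv/= => /andP[ax xb].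
  by rewrite derive1E; apply: derive_val; apply: dF; rewrite !ltW.
Qed.

Lemma FTC2_R f F a b : a <= b ->
  (forall x, a <= x <= b -> {for x, continuous f}) ->
  (forall x, a <= x <= b -> is_derive x 1 F (f x)) ->
  \int[leb]_(x in `[a, b]) f x = F b - F a.
Proof. by move=> ab cf dF; rewrite /Rintegral (FTC2 ab cf dF). Qed.

Lemma continuous_at_measurable f a c (D : set R) :
  D `<=` `]a, c[ -> measurable D ->
  (forall x, a < x < c -> {for x, continuous f}) -> measurable_fun D f.
Proof.
move=> DS mD cf; apply: (measurable_funS _ DS) => //.
apply: open_continuous_measurable_fun => // x; rewrite inE/= in_itv/=.
exact: cf.
Qed.

(** The integrand may blow up at [a]. Monotone convergence along [[a + e n, b]] gives integrability
    and the bound together, and the lower bound [m] replaces a limit of [F] at [a]. *)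
Lemma ge0_FTC_le f F a b c m : a < b -> b < c ->
  (forall x, a < x < c -> {for x, continuous f}) ->
  (forall x, a < x < c -> is_derive x 1 F (f x)) ->
  (forall x, a < x <= b -> 0 <= f x) ->
  (forall x, a < x <= b -> m <= F x) ->
  leb.-integrable `]a, b] (EFin \o f) /\ \int[leb]_(x in `]a, b]) f x <= F b - m.
Proof.
move=> ab bc cf dF f0 mF.
pose e n : R := (b - a) / n.+1%:R.
have e0 n : 0 < e n by rewrite divr_gt0// subr_gt0.
have eb n : a + e n <= b.
  by rewrite -lerBrDl ler_pdivrMr// ler_peMr ?ler1n// subr_ge0 ltW.
pose I n := [set` `[a + e n, b]] : set R.
have UI : \bigcup_n I n = `]a, b]%classic.
  apply/seteqP; split=> x.
    by move=> [n _]; rewrite /I/= !in_itv/= => /andP[h ->]; rewrite andbT (lt_le_trans _ h)// ltrDl.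
  rewrite /= in_itv/= => /andP[ax xb].
  have xa : 0 < x - a by rewrite subr_gt0.
  pose n := Num.bound ((b - a) / (x - a)).
  exists n => //; rewrite /I/= in_itv/= xb andbT addrC -lerBrDr /e.
  rewrite ler_pdivrMr// mulrC -ler_pdivrMr//.
  have := @archi_boundP _ ((b - a) / (x - a)).
  rewrite divr_ge0 ?subr_ge0 ?(ltW ab) ?(ltW ax)// => /(_ isT) /ltW/le_trans; apply.
  by rewrite ler_nat.
have mf : measurable_fun `]a, b] f.
  apply: (@continuous_at_measurable _ a c) => //.
  by move=> x /=; rewrite !in_itv/= => /andP[-> h] /=; exact: le_lt_trans bc.
have In n : (\int[leb]_(x in I n) (f x)%:E = (F b - F (a + e n))%:E)%E.
  apply: FTC2 => // x /andP[h1 h2]; [apply: cf|apply: dF];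
  by rewrite (lt_le_trans _ h1) ?ltrDl//= (le_lt_trans h2).
have cv : (\int[leb]_(x in I n) (f x)%:E @[n --> \oo] --> \int[leb]_(x in `]a, b]) (f x)%:E)%E.
  rewrite -UI; apply: ge0_nondecreasing_set_cvg_integral.
  - apply/nondecreasing_seqP => n; rewrite subsetEset => x; rewrite /I/= !in_itv/=.
    move=> /andP[h ->]; rewrite andbT (le_trans _ h)// lerD2l.
    by rewrite ler_pM2l ?subr_gt0// lef_pV2 ?posrE// ler_nat.
  - by move=> n; exact: measurable_itv.
  - move=> n; apply/measurable_EFinP; apply: measurable_funS mf => // x.
    by move=> Ix; rewrite -UI; exists n.
  - move=> n x Ix; rewrite lee_fin f0//.
    by have : `]a, b]%classic x by [rewrite -UI; exists n]; rewrite /= in_itv.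
have le : (\int[leb]_(x in `]a, b]) (f x)%:E <= (F b - m)%:E)%E.
  rewrite -(cvg_lim _ cv)//; apply: lime_le; first by apply/cvg_ex; exists (\int[leb]_(x in `]a, b]) (f x)%:E)%E.
  by apply: nearW => n; rewrite In lee_fin lerD2l lerN2 mF// ltrDl e0 eb.
have i0 : (0 <= \int[leb]_(x in `]a, b]) (f x)%:E)%E.
  by apply: integral_ge0 => x /=; rewrite in_itv/= lee_fin => /f0.
split.
  apply/integrableP; split; first exact/measurable_EFinP.
  have -> : (\int[leb]_(x in `]a, b]) `|(EFin \o f) x| = \int[leb]_(x in `]a, b]) (f x)%:E)%E.
    by apply: eq_integral => x; rewrite inE/= in_itv/= => /f0 h; rewrite ger0_norm.
  by apply: le_lt_trans le _; rewrite ltry.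
rewrite /Rintegral -lee_fin fineK//.
by rewrite fin_numE gt_eqF ?lt_eqF//; [exact: le_lt_trans le (ltry _)|exact: lt_le_trans i0].
Qed.

(** The inequality y <= exp y at y = ga x / be, raised to the power [be]. *)
Lemma le_powR_expR (be ga : R) : 0 < be -> 0 < ga ->
  forall x, 0 < x -> x `^ be <= (be / ga) `^ be * expR (ga * x).
Proof.
move=> be0 ga0 x x0.
have y0 : 0 < ga * x / be by rewrite divr_gt0// mulr_gt0.
have -> : x = (be / ga) * (ga * x / be) by field; rewrite !gt_eqF.
rewrite powRM ?(ltW y0) ?divr_ge0 ?(ltW be0) ?(ltW ga0)//.
rewrite ler_wpM2l ?powR_ge0//.
have -> : ga * (be / ga * (ga * x / be)) = (ga * x / be) * be by field; rewrite !gt_eqF.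
rewrite expRM; apply: ge0_ler_powR; rewrite ?nnegrE ?expR_ge0// ?ltW//.
by rewrite (lt_le_trans _ (expR_ge1Dx _))// ltrDr.
Qed.

(** A ratio in [0, 1] is at most its p-th power; apply this to x / (x + y) and y / (x + y), whose
    sum is 1. *)
Lemma powR_subadd (x y p : R) : 0 <= x -> 0 <= y -> 0 < p <= 1 ->
  (x + y) `^ p <= x `^ p + y `^ p.
Proof.
move=> x0 y0 /andP[p0 p1].
have [xy|xy] := eqVneq (x + y) 0.
  by rewrite xy powR0 ?gt_eqF// addr_ge0 ?powR_ge0.
have s0 : 0 < x + y by rewrite lt_def xy addr_ge0.
have H z : 0 <= z -> z <= x + y -> (x + y) `^ p * (z / (x + y)) <= z `^ p.
  move=> z0 zs; have [->|zn] := eqVneq z 0; first by rewrite mul0r mulr0 powR_ge0.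
  have zp : 0 < z by rewrite lt_def zn.
  have -> : z `^ p = (x + y) `^ p * (z / (x + y)) `^ p.
    rewrite -powRM ?divr_ge0 ?(ltW s0)//; congr (_ `^ _); field.
    by rewrite gt_eqF.
  rewrite ler_wpM2l ?powR_ge0// ger1_powR// divr_gt0//=.
  by rewrite ler_pdivrMr// mul1r.
apply: (@le_trans _ _ ((x + y) `^ p * (x / (x + y)) + (x + y) `^ p * (y / (x + y)))).
  rewrite -mulrDr -mulrDl divff// mulr1//.
by apply: lerD; apply: H => //; rewrite ?lerDl ?lerDr.
Qed.

(** The two terms of the majorant [f] take care of the two halves of []0, t]]: to the right of t / 2
    the power is bounded by its value there, to the left the exponential is at most exp (- nu t /
    2). The parameter [th] interpolates between the trivial size t^(1-de) and the size t^(-de) / nu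
    due to dissipation. *)
Lemma singular_kernel (nu de th t : R) : 0 < nu -> 0 <= de < 1 -> 0 <= th <= 1 -> 0 < t ->
  leb.-integrable `]0, t] (EFin \o (fun s => expR (- (nu * (t - s))) * s `^ (- de))) /\
  \int[leb]_(s in `]0, t]) (expR (- (nu * (t - s))) * s `^ (- de)) <=
   (2 + 2 / (1 - de)) * (t `^ (1 - de) * (nu * t) `^ (- th)).
Proof.
move=> nu0 /andP[de0 de1] /andP[th0 th1] t0.
have d0 : 0 < 1 - de by rewrite subr_gt0.
pose X := nu * t; have X0 : 0 < X by rewrite mulr_gt0.
pose f s := (t / 2) `^ (- de) * expR (- (nu * (t - s))) + expR (- (X / 2)) * s `^ (- de).
pose F s := (t / 2) `^ (- de) * (nu^-1 * expR (- (nu * (t - s)))) +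
   expR (- (X / 2)) * ((1 - de)^-1 * s `^ (1 - de)).
have dF s : 0 < s -> is_derive s 1 F (f s).
  move=> s0; have H := is_derive1_powR (1 - de) s0.
  rewrite /F /f; apply: is_derive_eq.
  rewrite /GRing.scale/= (_ : 1 - de - 1 = - de); last by ring.
  by field; rewrite !gt_eqF.
have cf s : 0 < s -> {for s, continuous f}.
  move=> s0; have H := is_derive1_powR (- de) s0.
  apply: (@is_derive_continuous _ (fun s => (t / 2) `^ (- de) * (expR (- (nu * (t - s))) * nu) + expR (- (X / 2)) * (- de * s `^ (- de - 1)))).
  rewrite /f; apply: is_derive_eq.
  by rewrite /GRing.scale/=; ring.
have f0 s : 0 <= f s by rewrite addr_ge0// mulr_ge0 ?powR_ge0 ?expR_ge0.
pose m := (t / 2) `^ (- de) * (nu^-1 * expR (- (nu * t))).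
have mF s : 0 < s <= t -> m <= F s.
  move=> /andP[s0 st]; rewrite -[m]addr0; apply: lerD.
    rewrite ler_wpM2l ?powR_ge0// ler_pM2l ?invr_gt0// ler_expR lerN2 ler_pM2l//.
    by rewrite gerBl ltW.
  by rewrite mulr_ge0 ?expR_ge0// mulr_ge0 ?powR_ge0// invr_ge0 ltW.
have [|||||fi fle] := @ge0_FTC_le f F 0 t (t + 1) m t0.
- by rewrite ltrDl.
- by move=> s /andP[s0 _]; exact: cf.
- by move=> s /andP[s0 _]; exact: dF.
- by move=> s _; exact: f0.
- exact: mF.
have gf s : `]0, t]%classic s -> 0 <= expR (- (nu * (t - s))) * s `^ (- de) <= f s.
  rewrite /= in_itv/= => /andP[s0 st]; rewrite mulr_ge0 ?expR_ge0 ?powR_ge0//=.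
  have [ts|ts] := lerP (t / 2) s.
    apply: (@le_trans _ _ ((t / 2) `^ (- de) * expR (- (nu * (t - s))))).
      rewrite mulrC ler_wpM2r ?expR_ge0// !powRN lef_pV2 ?posrE ?powR_gt0 ?divr_gt0//.
      by apply: ge0_ler_powR; rewrite ?nnegrE ?divr_ge0 ?(ltW t0) ?(ltW s0).
    by rewrite lerDl mulr_ge0 ?expR_ge0 ?powR_ge0.
  apply: (@le_trans _ _ (expR (- (X / 2)) * s `^ (- de))).
    rewrite ler_wpM2r ?powR_ge0// ler_expR lerN2 /X -mulrA ler_pM2l//; lra.
  by rewrite lerDr mulr_ge0 ?expR_ge0 ?powR_ge0.
have mg : measurable_fun `]0, t] (fun s => expR (- (nu * (t - s))) * s `^ (- de)).
  apply: (@continuous_at_measurable _ 0 (t + 1)) => //.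
    by move=> s /=; rewrite !in_itv/= => /andP[-> h] /=; rewrite (le_lt_trans h)// ltrDl.
  move=> s /andP[s0 _]; have H := is_derive1_powR (- de) s0.
  apply: (@is_derive_continuous _ (fun s => (expR (- (nu * (t - s))) * nu) * s `^ (- de) + expR (- (nu * (t - s))) * (- de * s `^ (- de - 1)))).
  apply: is_derive_eq.
  by rewrite /GRing.scale/=; ring.
have gi : leb.-integrable `]0, t] (EFin \o (fun s => expR (- (nu * (t - s))) * s `^ (- de))).
  apply: le_integrable fi => //; first exact/measurable_EFinP.
  move=> s /gf /andP[g0 gle]; rewrite /= lee_fin (ger0_norm g0) (ger0_norm (f0 s))//.
split; first exact: gi.
apply: (@le_trans _ _ (\int[leb]_(s in `]0, t]) f s)).
  by apply: le_Rintegral => // s /gf /andP[].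
apply: (le_trans fle).
have P1 : F t - m = t `^ (1 - de) * (2 `^ de * ((1 - expR (- X)) / X) + expR (- (X / 2)) / (1 - de)).
  rewrite /F /m subrr mulr0 oppr0 expR0 powRM ?invr_ge0 ?(ltW t0)//.
  rewrite -[2^-1]powR_inv1// -powRrM mulN1r opprK (powRDp 1 (- de) t0) powRr1 ?(ltW t0)//.
  by rewrite /X; field; rewrite !gt_eqF.
rewrite P1 [leRHS]mulrCA ler_wpM2l ?powR_ge0//.
have m1 : expR (- X) <= 1 by rewrite expR_le1 oppr_le0 ltW.
(* A quantity bounded by both 1 and 1 / X is bounded by every intermediate power of 1 / X. *)
have key y : 0 <= y -> y <= 1 -> y * X <= 1 -> y <= X `^ (- th).
  move=> y0 y1 yX; have [X1|X1] := lerP X 1.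
    apply: (le_trans y1); rewrite powRN invf_ge1 ?powR_gt0//.
    by rewrite -(powRr0 X) ger_powR// X0.
  apply: (@le_trans _ _ (X `^ (- 1))).
    by rewrite powR_inv1 ?(ltW X0)// -div1r ler_pdivlMr.
  by rewrite ler_powR ?(ltW X1)// lerN2.
have X21 : X / 2 < expR (X / 2) by have := expR_ge1Dx (X / 2); lra.
have k1 : (1 - expR (- X)) / X <= X `^ (- th).
  apply: key.
  - by rewrite divr_ge0 ?subr_ge0 ?(ltW X0).
  - by rewrite ler_pdivrMr// mul1r; have := expR_ge1Dx (- X); lra.
  - by rewrite divfK ?gt_eqF// gerBl expR_ge0.
have k2 : expR (- (X / 2)) <= 2 * X `^ (- th).
  rewrite -ler_pdivrMl// mulrC; apply: key.
  - by rewrite divr_ge0 ?expR_ge0.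
  - rewrite ler_pdivrMr// mul1r (@le_trans _ _ 1)//; last by lra.
    by rewrite expR_le1 oppr_le0 divr_ge0 ?(ltW X0).
  - rewrite expRN -mulrA mulrC (mulrC 2^-1) ler_pdivrMr ?expR_gt0// mul1r.
    exact: ltW.
have k3 : (2 : R) `^ de <= 2.
  by rewrite -[leRHS](@powRr1 _ 2)// ler_powR ?ler1n// ltW.
have X0' : 0 <= X `^ (- th) by exact: powR_ge0.
apply: (@le_trans _ _ (2 * X `^ (- th) + 2 * X `^ (- th) / (1 - de))).
  apply: lerD.
    by apply: ler_pM; rewrite ?powR_ge0// divr_ge0 ?subr_ge0 ?(ltW X0).
  by rewrite ler_wpM2r// invr_ge0 ltW.
by rewrite le_eqVlt; apply/orP; left; apply/eqP; field; rewrite gt_eqF.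
Qed.

End Calculus.

(** * Duhamel estimates *)

Section Envelope.
Context {R : realType} (mu alpha : R).
Hypotheses (mu0 : 0 < mu) (al2 : 2 < alpha) (al5 : alpha <= 5 / 2).
Implicit Types (b d : int -> R) (k j : int) (s t T : R).
Local Notation leb := (@lebesgue_measure R).

Definition reg0 : R := 5 / 2 - alpha.
Definition beta1 : R := alpha / 2 - 1.
Definition beta2 : R := 3 * alpha / 4 - 3 / 4.
(** Equal to [reg0 + beta1], while [kap / 2] is [reg0 + beta2 - 1]: the weights left on the two
    factors once the derivatives are distributed. The range 2 < alpha <= 5/2 is 1/4 <= kap < 1/2. *)
Definition kap : R := 3 / 2 - alpha / 2.

Lemma reg0E : reg0 = 5 / 2 - alpha. Proof. by []. Qed.
Lemma kapE : kap = 3 / 2 - alpha / 2. Proof. by []. Qed.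

(* The weight exp (- mu |k|^alpha t / 2) would not pass through a convolution;
   this one, linear in |k|, is submultiplicative (decay_sub). *)
Definition decay k t : R := expR (- (mu / 2 * (zabs k * t `^ alpha^-1))).

Definition env be k t : R := wt (- (reg0 + be)) k * t `^ (- (be / alpha)) * decay k t.

Lemma decayE k t : decay k t = expR (- (mu / 2 * (zabs k * t `^ alpha^-1))). Proof. by []. Qed.
Lemma envE be k t : env be k t = wt (- (reg0 + be)) k * t `^ (- (be / alpha)) * decay k t.
Proof. by []. Qed.

(* beta1 and beta2 are the two gains of regularity at which the factors of the
   quadratic term are measured in the Duhamel integral. *)
Definition envm k t : R := Num.min (env beta1 k t) (env beta2 k t).

Lemma decay_ge0 k t : 0 <= decay k t. Proof. exact: expR_ge0. Qed.
Lemma decayN k t : decay (- k) t = decay k t.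
Proof. by rewrite /decay zabsN. Qed.
Lemma decay_sub k j t : decay j t * decay (k - j) t <= decay k t.
Proof.
rewrite /decay -expRD ler_expR -opprD lerN2 -mulrDr -mulrDl.
rewrite ler_pM2l ?divr_gt0// ler_wpM2r ?powR_ge0//.
by rewrite [X in zabs X](_ : k = j + (k - j)) ?zabsD//; ring.
Qed.
Lemma env_ge0 be k t : 0 <= env be k t.
Proof. by rewrite !mulr_ge0 ?wt_ge0 ?powR_ge0 ?decay_ge0. Qed.
Lemma envN be k t : env be (- k) t = env be k t.
Proof. by rewrite /env wtN decayN. Qed.
Lemma env0 be t : env be 0 t = 0. Proof. by rewrite /env wt0 !mul0r. Qed.
Lemma envm_ge0 k t : 0 <= envm k t.
Proof. by rewrite le_min !env_ge0. Qed.
Lemma envmN k t : envm (- k) t = envm k t.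
Proof. by rewrite /envm !envN. Qed.
Lemma envm_le1 k t : envm k t <= env beta1 k t.
Proof. by rewrite ge_min lexx. Qed.
Lemma envm_le2 k t : envm k t <= env beta2 k t.
Proof. by rewrite ge_min lexx orbT. Qed.

Lemma alpha_gt0 : 0 < alpha. Proof. by have := al2; lra. Qed.

Lemma decay_decr k s t : 0 < s -> s <= t -> decay k t <= decay k s.
Proof.
move=> s0 st; rewrite ler_expR lerN2 ler_pM2l ?divr_gt0// ler_wpM2l ?zabs_ge0//.
apply: ge0_ler_powR; rewrite ?nnegrE ?invr_ge0 ?(ltW alpha_gt0) ?(ltW s0)//.
by rewrite (le_trans (ltW s0)).
Qed.

Lemma env_decr be k s t : 0 <= be -> 0 < s -> s <= t -> env be k t <= env be k s.
Proof.
move=> be0 s0 st; have t0 : 0 < t by exact: lt_le_trans st.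
apply: ler_pM; rewrite ?mulr_ge0 ?wt_ge0 ?powR_ge0 ?decay_ge0//; last exact: decay_decr.
rewrite ler_wpM2l ?wt_ge0// !powRN lef_pV2 ?posrE ?powR_gt0//.
by apply: ge0_ler_powR; rewrite ?nnegrE ?divr_ge0 ?(ltW alpha_gt0) ?(ltW s0) ?(ltW t0).
Qed.

Lemma beta1_ge0 : 0 <= beta1. Proof. by rewrite /beta1; have := al2; lra. Qed.
Lemma beta2_ge0 : 0 <= beta2. Proof. by rewrite /beta2; have := al2; lra. Qed.

Lemma envm_decr k s t : 0 < s -> s <= t -> envm k t <= envm k s.
Proof.
move=> s0 st; rewrite le_min !ge_min !env_decr ?orbT ?beta1_ge0 ?beta2_ge0//.
Qed.

(** Time singularities of a product of two envelopes: one factor at [beta1] and one at [beta2] for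
    [del1], both at [beta2] for [del2]. *)
Definition del1 : R := (beta1 + beta2) / alpha.
Definition del2 : R := 2 * beta2 / alpha.

(** The first summand handles the part |k| |l| of the kernel, with the factors at [beta1] and
    [beta2]; the second one handles |j| |l|, with both factors at [beta2]. *)
Definition quad b d k : R :=
  bilin kap (kap / 2) (1 / 2 - 3 * kap / 2) b d k + bilin (kap / 2) (kap / 2) (1 / 2 - kap) b d k.

(** Each weight in [k] undoes the outer weight of one summand of [quad]; the exponent 3/2 - 3 kap /
    2 includes the derivative |k| that falls on the output. *)
Definition src k s : R :=
  decay k s * (s `^ (- del2) * wt (1 / 2 - kap) k + s `^ (- del1) * wt (3 / 2 - 3 * kap / 2) k).

(** Both applications of [hls] take r = 2 kap. That r < 1 is the condition alpha > 2, and the last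
    exponent 1/2 - kap is at most kap exactly when alpha <= 5/2. *)
Lemma quad_spec : exists2 C, 0 <= C & forall b d,
  (forall k, 0 <= b k) -> (forall k, 0 <= d k) -> l2 b -> l2 d ->
  [/\ forall k, k != 0 ->
        summ (fun j => wt (- kap) j * wt (- (kap / 2)) (k - j) * (b j * d (k - j))) /\
        summ (fun j => wt (- (kap / 2)) j * wt (- (kap / 2)) (k - j) * (b j * d (k - j))),
    l2 (quad b d) & n2 (quad b d) <= C * (n2 b * n2 d)].
Proof.
have h2 := al2; have h5 := al5.
have r01 : 0 < 2 * kap < 1 by rewrite /kap; apply/andP; split; lra.
have [||||C1 C10 H1] := @hls R kap (kap / 2) (1 / 2 - 3 * kap / 2) (2 * kap) _ _ _ _ r01;
  rewrite /kap; [lra|lra|lra|lra|].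
have [||||C2 C20 H2] := @hls R (kap / 2) (kap / 2) (1 / 2 - kap) (2 * kap) _ _ _ _ r01;
  rewrite /kap; [lra|lra|lra|lra|].
rewrite -/kap in H1 H2 *.
exists (2 * (C1 + C2)); first by rewrite mulr_ge0// addr_ge0.
move=> b d b0 d0 lb ld.
have [s1 l1 n1] := H1 b d b0 d0 lb ld; have [s2 l2' n2'] := H2 b d b0 d0 lb ld.
split; [|exact: l2D|].
  by move=> k k0; split; [exact: s1|exact: s2].
apply: (le_trans (n2D_le l1 l2')); rewrite -[leRHS]mulrA ler_pM2l// (mulrDl C1).
exact: lerD.
Qed.

Lemma quad_ge0 b d k : (forall k, 0 <= b k) -> (forall k, 0 <= d k) -> 0 <= quad b d k.
Proof. by move=> b0 d0; rewrite addr_ge0// bilin_ge0. Qed.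

Lemma zsum_bilin x y z b d k : k != 0 ->
  zsum (fun j => wt (- x) j * wt (- y) (k - j) * (b j * d (k - j))) =
  wt z k * bilin x y z b d k.
Proof.
move=> k0; rewrite /bilin mulrA -wtD subrr wt00// mul1r//.
Qed.

Lemma dom_bound b d k s : k != 0 -> 0 < s ->
  (forall k, 0 <= b k) -> (forall k, 0 <= d k) -> l2 b -> l2 d ->
  let U j := b j * envm j s in let V j := d j * envm j s in
  summ (domt U V k) /\ zsum (domt U V k) <= quad b d k * src k s.
Proof.
move=> k0 s0 b0 d0 lb ld U V.
have [C _ /(_ b d b0 d0 lb ld)[S _ _]] := quad_spec.
have [s1 s2] := S k k0 => {S C}.
pose c1 := decay k s * (s `^ (- del1) * zabs k).
pose c2 := decay k s * s `^ (- del2).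
have UV0 j : 0 <= U j * V (k - j) by rewrite !mulr_ge0 ?envm_ge0.
pose M j := c2 * (wt (- (kap / 2)) j * wt (- (kap / 2)) (k - j) * (b j * d (k - j))) +
   c1 * (wt (- kap) j * wt (- (kap / 2)) (k - j) * (b j * d (k - j))).
have sM : summ M by apply: summD; exact: summZ.
(* [src k s * quad b d k] is a product of two sums; the subtracted terms are its two cross products,
   which are nonnegative and will be discarded. *)
have zM : zsum M = src k s * quad b d k -
  (decay k s * (s `^ (- del2) * wt (1 / 2 - kap) k) * bilin kap (kap / 2) (1 / 2 - 3 * kap / 2) b d k +
   decay k s * (s `^ (- del1) * wt (3 / 2 - 3 * kap / 2) k) * bilin (kap / 2) (kap / 2) (1 / 2 - kap) b d k).
  rewrite (zsumD (summZ c2 s2) (summZ c1 s1)) (zsumZ c2 s2) (zsumZ c1 s1).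
  rewrite (zsum_bilin (kap / 2) (kap / 2) (1 / 2 - kap) b d k0).
  rewrite (zsum_bilin kap (kap / 2) (1 / 2 - 3 * kap / 2) b d k0).
  rewrite /src /quad /c1 /c2 -[zabs k]wt1 (_ : 3 / 2 - 3 * kap / 2 = 1 + (1 / 2 - 3 * kap / 2)); last by field.
  rewrite (wtD 1); move: (bilin _ _ _ b d k) (bilin _ _ _ b d k) => B1 B2.
  by clear; ring.
have ptw j : 0 <= domt U V k j <= M j.
  apply/andP; split; first by rewrite mulr_ge0// mulr_ge0 ?addr_ge0 ?zabs_ge0.
  rewrite /domt (mulrDl (zabs j)) mulrDl.
  have E j' (be x : R) : x = reg0 + be - 1 -> zabs j' * env be j' s = wt (- x) j' * s `^ (- (be / alpha)) * decay j' s.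
    move=> ->; rewrite /env -[zabs j']wt1 !mulrA -wtD; congr (wt _ _ * _ * _); ring.
  have kx : kap / 2 = reg0 + beta2 - 1 by rewrite /kap /reg0 /beta2; field.
  have bd0 : 0 <= b j * d (k - j) by rewrite mulr_ge0.
  have dj := decay_sub k j s.
  apply: lerD.
    apply: (@le_trans _ _ ((zabs j * env beta2 j s) * (zabs (k - j) * env beta2 (k - j) s) * (b j * d (k - j)))).
      rewrite /U /V; rewrite (_ : zabs j * zabs (k - j) * _ = (zabs j * envm j s) * (zabs (k - j) * envm (k - j) s) * (b j * d (k - j))); last by ring.
      rewrite ler_wpM2r//; apply: ler_pM; rewrite ?mulr_ge0 ?zabs_ge0 ?envm_ge0// ler_wpM2l ?zabs_ge0 ?envm_le2//.
    rewrite !(E _ beta2 _ kx) [leRHS]mulrA ler_wpM2r// /c2 (_ : del2 = beta2 / alpha + beta2 / alpha); last by rewrite /del2; field; rewrite gt_eqF// alpha_gt0.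
    rewrite opprD (powRDp _ _ s0); set P := s `^ _; set w1 := wt _ j; set w2 := wt _ (k - j).
    rewrite (_ : _ * _ * _ = (decay j s * decay (k - j) s) * (P * P * w1 * w2)); last by ring.
    rewrite (_ : _ * (w1 * w2) = decay k s * (P * P * w1 * w2)); last by ring.
    by rewrite ler_wpM2r// !mulr_ge0 ?powR_ge0 ?wt_ge0.
  apply: (@le_trans _ _ (zabs k * env beta1 j s * (zabs (k - j) * env beta2 (k - j) s) * (b j * d (k - j)))).
    rewrite /U /V; rewrite (_ : zabs k * zabs (k - j) * _ = (zabs k * envm j s) * (zabs (k - j) * envm (k - j) s) * (b j * d (k - j))); last by ring.
    rewrite ler_wpM2r//; apply: ler_pM; rewrite ?mulr_ge0 ?zabs_ge0 ?envm_ge0// ler_wpM2l ?zabs_ge0 ?envm_le1 ?envm_le2//.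
  rewrite (E _ beta2 _ kx) [leRHS]mulrA ler_wpM2r// /c1 /env.
  have -> : reg0 + beta1 = kap by rewrite /kap /reg0 /beta1; field.
  rewrite (_ : del1 = beta1 / alpha + beta2 / alpha); last by rewrite /del1 mulrDl.
  rewrite (opprD (beta1 / alpha)) (powRDp _ _ s0); set P1 := s `^ _; set P2 := s `^ _; set w1 := wt _ j; set w2 := wt _ (k - j).
  rewrite (_ : _ * _ * _ = (decay j s * decay (k - j) s) * (zabs k * P1 * P2 * w1 * w2)); last by ring.
  rewrite (_ : _ * (w1 * w2) = decay k s * (zabs k * P1 * P2 * w1 * w2)); last by ring.
  by rewrite ler_wpM2r// !mulr_ge0 ?powR_ge0 ?wt_ge0 ?zabs_ge0.
have sD : summ (domt U V k).
  by apply: le_summ_ge0 sM => j; have /andP[p q] := ptw j; rewrite ger0_norm.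
split; first exact: sD.
apply: (@le_trans _ _ (zsum M)).
  by apply: le_zsum sD sM _ => j; have /andP[] := ptw j.
rewrite zM mulrC gerBl addr_ge0// mulr_ge0 ?bilin_ge0// mulr_ge0 ?decay_ge0// mulr_ge0 ?wt_ge0 ?powR_ge0//.
Qed.

Definition rate k : R := mu * wt alpha k.

Lemma rateE k : rate k = mu * wt alpha k. Proof. by []. Qed.

Lemma wt_alphaE k : wt alpha k = zabs k `^ alpha.
Proof.
rewrite /wt; case: eqVneq => // ->.
by rewrite zabs0 powR0// gt_eqF// alpha_gt0.
Qed.

(** For y = |k| t^(1/alpha) this is y <= 1 + y^alpha. *)
Lemma zabs_root_le k t : 0 <= t -> zabs k * t `^ alpha^-1 <= 1 + wt alpha k * t.
Proof.
move=> t0; set y := _ * _; have y0 : 0 <= y by rewrite mulr_ge0 ?zabs_ge0 ?powR_ge0.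
have -> : wt alpha k * t = y `^ alpha.
  rewrite powRM ?zabs_ge0 ?powR_ge0// -powRrM mulVf ?gt_eqF ?alpha_gt0// powRr1//.
  by rewrite wt_alphaE.
have [y1|y1] := lerP y 1; first by rewrite (le_trans y1)// lerDl powR_ge0.
rewrite (@le_trans _ _ (y `^ alpha))//; last by rewrite lerDr.
by apply: le1r_powR; rewrite ?(ltW y1)//; have := al2; lra.
Qed.

(** Half of the dissipation pays for the analytic weight by [zabs_root_le], whose constant 1 costs
    the factor exp (mu / 2); the other half is kept. *)
Lemma heat_decay0 k t : 0 <= t ->
  expR (- (rate k * t)) <= expR (mu / 2) * decay k t * expR (- (mu / 2 * wt alpha k * t)).
Proof.
move=> t0; rewrite /decay -!expRD ler_expR /rate.
have := zabs_root_le k t0; set y := _ * _; set w := wt _ _ => H.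
have {}H : mu / 2 * y <= mu / 2 * (1 + w * t) by rewrite ler_pM2l ?divr_gt0.
by lra.
Qed.

(** The same trade over the time t - s; subadditivity of t^(1/alpha) then moves the analytic weight
    from time [s] to time [t]. *)
Lemma heat_decay k s t : 0 < s -> s <= t ->
  expR (- (rate k * (t - s))) * decay k s <=
  expR (mu / 2) * decay k t * expR (- (mu / 2 * wt alpha k * (t - s))).
Proof.
move=> s0 st; have ts : 0 <= t - s by rewrite subr_ge0.
rewrite /decay -!expRD ler_expR /rate.
have := zabs_root_le k ts; set y := _ * _; set w := wt _ _ => H.
have S : zabs k * t `^ alpha^-1 <= zabs k * s `^ alpha^-1 + y.
  rewrite -mulrDr ler_wpM2l ?zabs_ge0// -[in leLHS](subrK s t) [leRHS]addrC.
  apply: powR_subadd => //; first exact: ltW.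
  rewrite invr_gt0 alpha_gt0/= invf_le1 ?alpha_gt0//; have := al2; lra.
have {}H : mu / 2 * y <= mu / 2 * (1 + w * (t - s)) by rewrite ler_pM2l ?divr_gt0.
have {}S : mu / 2 * (zabs k * t `^ alpha^-1) <= mu / 2 * (zabs k * s `^ alpha^-1 + y).
  by rewrite ler_pM2l ?divr_gt0.
by lra.
Qed.

Lemma del_bounds : [/\ 0 <= del1, del1 < 1, 0 <= del2 & del2 < 1].
Proof.
have a0 := alpha_gt0; have h2 := al2; have h5 := al5.
rewrite /del1 /del2 /beta1 /beta2; split.
- by rewrite divr_ge0 ?(ltW a0)//; lra.
- by rewrite ltr_pdivrMr//; lra.
- by rewrite divr_ge0 ?(ltW a0)//; lra.
- by rewrite ltr_pdivrMr//; lra.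
Qed.

(** The homogeneity that makes [reg0] critical: the powers of t and of |k| match those of [env]
    exactly, with no positive power of t to spare. *)
Lemma scaling_identity (de th z be : R) k t : k != 0 -> 0 < t ->
  th = 1 - de + be / alpha -> z - alpha * th = - (reg0 + be) ->
  t `^ (1 - de) * ((mu / 2 * wt alpha k) * t) `^ (- th) * wt z k =
  (mu / 2) `^ (- th) * (wt (- (reg0 + be)) k * t `^ (- (be / alpha))).
Proof.
move=> k0 t0 thE zE; have W0 : 0 < wt alpha k by rewrite wtE// powR_gt0 ?zabs_gt0.
have g0 : 0 < mu / 2 by rewrite divr_gt0.
rewrite (powRM _ (mulr_ge0 (ltW g0) (ltW W0)) (ltW t0)) (powRM _ (ltW g0) (ltW W0)) -zE wtD.
rewrite (_ : wt (- (alpha * th)) k = wt alpha k `^ (- th)); last first.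
  by rewrite !wtE// -powRrM mulrN.
rewrite (_ : t `^ (- (be / alpha)) = t `^ (1 - de) * t `^ (- th)); last first.
  by rewrite -powRDp// thE; congr (_ `^ _); ring.
by ring.
Qed.

Definition duh_const : R :=
  expR (mu / 2) * ((1 + 2 / mu) * ((2 + 2 / (1 - del1)) + (2 + 2 / (1 - del2)))).

Lemma duh_const_ge0 : 0 <= duh_const.
Proof.
have [d10 d11 d20 d21] := del_bounds.
by rewrite /duh_const !mulr_ge0 ?expR_ge0 ?addr_ge0 ?divr_ge0 ?subr_ge0 ?(ltW mu0) ?(ltW d11) ?(ltW d21).
Qed.

Lemma mu_powN_le (th : R) : 0 <= th <= 1 -> (mu / 2) `^ (- th) <= 1 + 2 / mu.
Proof.
move=> /andP[th0 th1]; have g0 : 0 < mu / 2 by rewrite divr_gt0.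
have i0 : 0 <= 2 / mu by rewrite divr_ge0 ?(ltW mu0).
have [g1|g1] := lerP 1 (mu / 2).
  apply: (@le_trans _ _ 1); last by rewrite lerDl.
  by rewrite -[leRHS](powRr0 (mu / 2)) ler_powR// oppr_le0.
apply: (@le_trans _ _ (2 / mu)); last by rewrite lerDr.
rewrite (_ : 2 / mu = (mu / 2) `^ (- 1)); last by rewrite powR_inv1 ?(ltW g0)// invf_div.
by apply: ger_powR; rewrite ?g0 ?(ltW g1)// lerN2.
Qed.

(** For the singularity s^(-de), the exponent th = 1 - de + be / alpha is the share of dissipation
    that turns the weights of [src] into those of [env be]. It is at most 1 when be <= alpha de,
    which for both singularities follows from be <= beta2. *)
Lemma duhamel k t (N : R -> R) A : k != 0 -> 0 < t -> 0 <= A ->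
  measurable_fun `]0, t] N ->
  (forall s, 0 < s <= t -> `|N s| <= A * src k s) ->
  leb.-integrable `]0, t] (EFin \o (fun s => expR (- (rate k * (t - s))) * N s)) /\
  forall be, 0 <= be <= beta2 ->
  `|\int[leb]_(s in `]0, t]) (expR (- (rate k * (t - s))) * N s)| <=
     duh_const * A * env be k t.
Proof.
move=> k0 t0 A0 mN NA.
have [d10 d11 d20 d21] := del_bounds.
have nu0 : 0 < mu / 2 * wt alpha k.
  by rewrite mulr_gt0 ?divr_gt0// wtE// powR_gt0 ?zabs_gt0.
pose g (de : R) s := expR (- (mu / 2 * wt alpha k * (t - s))) * s `^ (- de).
pose z2 : R := 1 / 2 - kap; pose z1 : R := 3 / 2 - 3 * kap / 2.
have ig1 : leb.-integrable `]0, t] (EFin \o g del1).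
  by have [] := @singular_kernel R _ del1 0 t nu0 _ _ t0; rewrite ?d10 ?lexx ?ler01.
have ig2 : leb.-integrable `]0, t] (EFin \o g del2).
  by have [] := @singular_kernel R _ del2 0 t nu0 _ _ t0; rewrite ?d20 ?lexx ?ler01.
pose c := A * (expR (mu / 2) * decay k t).
have c0 : 0 <= c by rewrite mulr_ge0// mulr_ge0 ?expR_ge0 ?decay_ge0.
pose M s := c * (wt z2 k * g del2 s + wt z1 k * g del1 s).
have iM1 : leb.-integrable `]0, t] (EFin \o (fun s => wt z2 k * g del2 s + wt z1 k * g del1 s)).
  apply: eq_integrable (integrableD _ (integrableZl _ (wt z2 k) ig2) (integrableZl _ (wt z1 k) ig1)) => //.
have iM : leb.-integrable `]0, t] (EFin \o M).
  by apply: eq_integrable (integrableZl _ c iM1).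
have bd s : `]0, t]%classic s -> `|expR (- (rate k * (t - s))) * N s| <= M s.
  rewrite /= in_itv/= => /andP[s0 st].
  rewrite normrM (ger0_norm (expR_ge0 _)).
  apply: (@le_trans _ _ (expR (- (rate k * (t - s))) * (A * src k s))).
    by rewrite ler_wpM2l ?expR_ge0// NA// s0.
  rewrite /src -/z1 -/z2 [leLHS](_ : _ = (A * (s `^ (- del2) * wt z2 k + s `^ (- del1) * wt z1 k)) *
     (expR (- (rate k * (t - s))) * decay k s)); last by ring.
  apply: (@le_trans _ _ ((A * (s `^ (- del2) * wt z2 k + s `^ (- del1) * wt z1 k)) * (expR (mu / 2) * decay k t * expR (- (mu / 2 * wt alpha k * (t - s)))))).
    by rewrite ler_wpM2l ?heat_decay// mulr_ge0// addr_ge0// mulr_ge0 ?powR_ge0 ?wt_ge0.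
  by rewrite le_eqVlt; apply/orP; left; apply/eqP; rewrite /M /c /g; ring.
have mI : measurable_fun `]0, t] (fun s => expR (- (rate k * (t - s))) * N s).
  apply: measurable_funM => //; apply: measurable_funTS.
  apply: continuous_measurable_fun => s.
  apply: (@is_derive_continuous _ _ (fun s => expR (- (rate k * (t - s))) * rate k)).
  by apply: is_derive_eq; rewrite /GRing.scale/=; ring.
have iI : leb.-integrable `]0, t] (EFin \o (fun s => expR (- (rate k * (t - s))) * N s)).
  apply: le_integrable iM => //; first exact/measurable_EFinP.
  by move=> s st; rewrite /= lee_fin (le_trans (bd s st))// ler_norm.
split; first exact: iI.
move=> be /andP[be0 be2].
have a0 := alpha_gt0; have h2 := al2; have h5 := al5.
apply: (le_trans (le_normr_Rintegral _ iI)) => //.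
apply: (@le_trans _ _ (\int[leb]_(s in `]0, t]) M s)).
  by apply: le_Rintegral => //; exact: (integrable_norm iI).
rewrite (RintegralZl _ _ iM1)// RintegralD//; last 2 first.
  by apply: eq_integrable (integrableZl _ (wt z2 k) ig2).
  by apply: eq_integrable (integrableZl _ (wt z1 k) ig1).
rewrite (RintegralZl _ _ ig1)// (RintegralZl _ _ ig2)//.
pose th2 := 1 - del2 + be / alpha; pose th1 := 1 - del1 + be / alpha.
have thb (de : R) : be / alpha <= de -> de < 1 -> 0 <= 1 - de + be / alpha <= 1.
  move=> h1 h3; have : 0 <= be / alpha by rewrite divr_ge0// ltW.
  by move=> h4; apply/andP; split; lra.
have t2 : 0 <= th2 <= 1.
  by apply: thb => //; rewrite /del2 ler_pM2r ?invr_gt0//; move: be2; rewrite /beta2; lra.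
have t1 : 0 <= th1 <= 1.
  by apply: thb => //; rewrite /del1 ler_pM2r ?invr_gt0//; move: be2; rewrite /beta2 /beta1; lra.
have J (de th z : R) : 0 <= de -> de < 1 -> 0 <= th <= 1 -> th = 1 - de + be / alpha ->
    z - alpha * th = - (reg0 + be) ->
    wt z k * \int[leb]_(s in `]0, t]) g de s <=
    (1 + 2 / mu) * (2 + 2 / (1 - de)) * (wt (- (reg0 + be)) k * t `^ (- (be / alpha))).
  move=> q0 q1 tb thE zE.
  have [||_ H] := @singular_kernel R _ de th t nu0 _ _ t0 => //; first by rewrite q0.
  have C0 : 0 <= 2 + 2 / (1 - de) by rewrite addr_ge0// divr_ge0 ?subr_ge0 ?(ltW q1).
  apply: (@le_trans _ _ (wt z k * ((2 + 2 / (1 - de)) * (t `^ (1 - de) * (mu / 2 * wt alpha k * t) `^ (- th))))).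
    by rewrite ler_wpM2l ?wt_ge0.
  rewrite (_ : wt z k * _ = (2 + 2 / (1 - de)) * (t `^ (1 - de) * (mu / 2 * wt alpha k * t) `^ (- th) * wt z k)); last by ring.
  rewrite (scaling_identity k0 t0 thE zE); set X := wt _ k * _.
  rewrite [leLHS]mulrCA -[leRHS]mulrA ler_wpM2r ?mu_powN_le//.
  by rewrite mulr_ge0// mulr_ge0 ?wt_ge0 ?powR_ge0.
have z2E : z2 - alpha * th2 = - (reg0 + be).
  by rewrite /z2 /th2 /del2 /kap /beta2 /reg0; field; rewrite gt_eqF.
have z1E : z1 - alpha * th1 = - (reg0 + be).
  by rewrite /z1 /th1 /del1 /kap /beta2 /beta1 /reg0; field; rewrite gt_eqF.
have J2 := J del2 th2 z2 d20 d21 t2 erefl z2E.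
have J1 := J del1 th1 z1 d10 d11 t1 erefl z1E.
apply: (le_trans (ler_wpM2l c0 (lerD J2 J1))).
rewrite /c /duh_const /env le_eqVlt; apply/orP; left; apply/eqP.
move: (wt _ _ * _) (1 - del1)^-1 (1 - del2)^-1 (decay k t) (expR _) => x1 x2 x3 x4 x5.
by clear; ring.
Qed.

(** The weights of [env be] cancel against [wt reg0] and the power [be] of |k| t^(1/alpha), leaving
    [decay] alone (identity [E]). What remains is [heat_decay0]. *)
Lemma lin_bound k t (h be : R) : k != 0 -> 0 < t -> 0 <= be ->
  `|expR (- (rate k * t)) * h| <= `|h| * wt reg0 k * (expR (mu / 2) * expR (- (mu / 2 * wt alpha k * t)) * (zabs k * t `^ alpha^-1) `^ be) * env be k t.
Proof.
move=> k0 t0 be0; have a0 := alpha_gt0; rewrite normrM (ger0_norm (expR_ge0 _)) mulrC.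
have K0 : (0 : R) < zabs k by rewrite zabs_gt0.
have E : wt reg0 k * (zabs k * t `^ alpha^-1) `^ be * env be k t = decay k t.
  rewrite powRM ?zabs_ge0 ?powR_ge0// -powRrM /env (mulrC alpha^-1) -(wtE be k0).
  rewrite powRN (opprD reg0) (wtD (- reg0)); have T0 : t `^ (be / alpha) != 0 by rewrite gt_eqF ?powR_gt0.
  have W (x : R) : wt x k * wt (- x) k = 1 by rewrite -wtD subrr wt00.
  rewrite (_ : _ * _ = (wt reg0 k * wt (- reg0) k) * (wt be k * wt (- be) k) * (t `^ (be / alpha) / t `^ (be / alpha)) * decay k t); last by ring.
  by rewrite !W divff// !mul1r.
apply: (le_trans (ler_wpM2l (normr_ge0 h) (heat_decay0 k (ltW t0)))).
rewrite -[in leLHS]E le_eqVlt; apply/orP; left; apply/eqP; ring.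
Qed.

End Envelope.

(** * Differentiation of Duhamel's formula *)

Section DuhamelDerive.
Context {R : realType}.
Local Notation leb := (@lebesgue_measure R).

Lemma expR_lin_continuous (c t : R) : {for t, continuous (fun s : R => expR (c * s))}.
Proof.
apply: (@is_derive_continuous _ _ (fun s => expR (c * s) * c)).
by apply: is_derive_eq; rewrite /GRing.scale/=; ring.
Qed.

Lemma is_derive_integral (f : R -> R) t q : 0 < t -> t < q ->
  leb.-integrable `]0, q] (EFin \o f) -> {for t, continuous f} ->
  is_derive t 1 (fun x => \int[leb]_(s in `]0, x]) f s) (f t).
Proof.
move=> t0 tq fi cf.
have [dG GE] := @continuous_FTC1 R f (BRight 0) t q tq fi t0 cf.
by apply: DeriveDef; [exact: dG|rewrite -derive1E; exact: GE].
Qed.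

(** With exp (- nu t) taken out of the integral, what is left is a primitive of exp (nu s) N s, to
    which the fundamental theorem and the product rule apply. *)
Lemma duhamel_derive (nu h T : R) (N : R -> R) :
  (forall t, 0 < t < T -> {for t, continuous N}) ->
  (forall t, 0 < t < T -> leb.-integrable `]0, t] (EFin \o (fun s => expR (- (nu * (t - s))) * N s))) ->
  let c t := expR (- (nu * t)) * h + \int[leb]_(s in `]0, t]) (expR (- (nu * (t - s))) * N s) in
  (forall t, 0 < t < T -> is_derive t 1 c (- nu * c t + N t)) /\
  (0 < T -> c t @[t --> 0^'+] --> h).
Proof.
move=> cN iN c.
pose f s := expR (nu * s) * N s.
pose G t := \int[leb]_(s in `]0, t]) f s.
have fE t : (fun s => expR (- (nu * (t - s))) * N s) = (fun s => expR (- (nu * t)) * f s).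
  by apply/funext => s; rewrite /f mulrA -expRD; congr (expR _ * _); ring.
have fi t : 0 < t < T -> leb.-integrable `]0, t] (EFin \o f).
  move=> tT; apply: eq_integrable (integrableZl _ (expR (nu * t)) (iN t tT)) => // s _ /=.
  by rewrite /f -EFinM mulrA -expRD; congr (expR _ * _)%:E; ring.
have cE t : 0 < t < T -> c t = expR (- (nu * t)) * (h + G t).
  by move=> tT; rewrite /c fE (RintegralZl _ _ (fi t tT))// mulrDr.
split=> [t tT|T0].
  have /andP[t0 tT'] := tT.
  pose q := (t + T) / 2.
  have tq : t < q by rewrite /q; lra.
  have qT : 0 < q < T by rewrite /q; apply/andP; split; lra.
  have cf : {for t, continuous f}.
    apply: cvgM; last exact: cN.
    exact: expR_lin_continuous.
  have iG : is_derive t 1 G (f t) := is_derive_integral t0 tq (fi q qT) cf.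
  apply: (@near_eq_is_derive _ _ _ (fun t => expR (- (nu * t)) * (h + G t))).
    near=> x; rewrite cE//; apply/andP; split; near: x.
      exact: lt_nbhsr.
    exact: lt_nbhsl.
  apply: is_derive_eq; rewrite cE// /GRing.scale/= /f.
  have EF : expR (- (nu * t)) * expR (nu * t) = 1 by rewrite -expRD addNr expR0.
  have E2 : N t = expR (- (nu * t)) * expR (nu * t) * N t by rewrite EF mul1r.
  by rewrite [X in _ = _ + X]E2; ring.
pose q := T / 2.
have qT : 0 < q < T by rewrite /q; apply/andP; split; lra.
have /andP[q0 _] := qT.
have fi0 : leb.-integrable `[0, q] (EFin \o f).
  have /integrableP[mf ff] := fi q qT.
  have mf' := mf; move/measurable_EFinP in mf'.
  apply/integrableP; split.
    by apply/measurable_EFinP/measurable_fun_itv_obnd_cbndP.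
  rewrite -integral_itv_obnd_cbnd//.
  exact: measurableT_comp.
have G0 : G t @[t --> 0^'+] --> 0.
  have := cvg_at_right_filter (parameterized_integral_cvg_left q0 fi0).
  apply: cvg_trans; apply: near_eq_cvg; near=> t.
  rewrite /G /parameterized_integral Rintegral_itv_obnd_cbnd//; apply: fi.
  by apply/andP; split; near: t; [exact: nbhs_right_gt|exact: nbhs_right_lt].
have e0 : expR (- (nu * t)) @[t --> (0 : R)^'+] --> (1 : R).
  have := @expR_lin_continuous (- nu) 0; rewrite /prop_for /continuous_at mulr0 expR0.
  by under eq_fun do rewrite mulNr; exact: cvg_at_right_filter.
have H : expR (- (nu * t)) * (h + G t) @[t --> 0^'+] --> 1 * (h + 0).
  by apply: cvgM => //; apply: cvgD => //; exact: cvg_cst.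
rewrite addr0 mul1r in H; apply: cvg_trans H; apply: near_eq_cvg; near=> t.
rewrite cE//; apply/andP; split; near: t; [exact: nbhs_right_gt|exact: nbhs_right_lt].
Unshelve. all: by end_near.
Qed.

End DuhamelDerive.

(** * Local existence for the coefficient system *)

Section Picard.
Context {R : realType} (mu alpha a b : R).
Hypotheses (mu0 : 0 < mu) (al2 : 2 < alpha) (al5 : alpha <= 5 / 2).
Implicit Types (B D : int -> R) (u v : R -> int -> R) (k j : int) (s t T : R).
Local Notation leb := (@lebesgue_measure R).
Local Notation rate := (rate mu alpha).
Local Notation env := (env mu alpha).
Local Notation envm := (envm mu alpha).
Local Notation quad := (quad alpha).
Local Notation src := (src mu alpha).

Definition duh u k t : R :=
  \int[leb]_(s in `]0, t]) (expR (- (rate k * (t - s))) * nl a b (u s) (u s) k).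

Definition picard (h : int -> R) u t k : R :=
  expR (- (rate k * t)) * h k + duh u k t.

Definition majorizes T B u : Prop :=
  forall t k, 0 < t < T -> `|u t k| <= B k * envm k t.

(** What one Picard step requires of its input and reproduces on its output. The majorant [B] is the
    same for all times in []0, T[]. *)
Record good T B u : Prop := Good {
  good_even : even_seq B;
  good_ge0 : forall k, 0 <= B k;
  good_l2 : l2 B;
  good_maj : majorizes T B u;
  good_cont : forall t k, 0 < t < T -> {for t, continuous (u ^~ k)} }.

Definition nlc : R := 2 * (`|a| + `|b|).
Lemma nlc_ge0 : 0 <= nlc. Proof. by rewrite mulr_ge0// addr_ge0. Qed.
Definition duhc : R := duh_const mu alpha * nlc.
Lemma duhc_ge0 : 0 <= duhc.
Proof. by rewrite mulr_ge0 ?nlc_ge0// duh_const_ge0. Qed.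

Lemma even_envm B t : even_seq B -> even_seq (fun j => B j * envm j t).
Proof. by move=> eB j; rewrite eB envmN. Qed.

(** Near [t] the envelope frozen at time t / 2 dominates, since [envm] decreases in time. *)
Lemma good_nl_cont T B u : good T B u -> forall k t, 0 < t < T ->
  {for t, continuous (fun s => nl a b (u s) (u s) k)}.
Proof.
move=> G k t /andP[t0 tT]; have [k0|k0] := eqVneq k 0.
  have -> : (fun s => nl a b (u s) (u s) k) = cst 0 by apply/funext => s; rewrite k0 nl_zero.
  exact: cst_continuous.
have B0 := good_ge0 G; have lB := good_l2 G.
have p0 : 0 < t / 2 by rewrite divr_gt0.
have [sU _] := dom_bound mu0 al2 al5 k0 p0 B0 B0 lB lB.
apply: (@nl_continuous R a b u (fun j => B j * envm j (t / 2)) k (t / 2) T) => //.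
- exact/even_envm/(good_even G).
- move=> s j /andP[s1 s2]; have s0 := lt_trans p0 s1.
  apply: (le_trans (good_maj G _ _)); first by rewrite s0.
  by rewrite ler_wpM2l// envm_decr// ltW.
- move=> s j /andP[s1 s2]; apply: (good_cont G); rewrite s2 andbT.
  exact: lt_trans s1.
- by rewrite tT andbT; lra.
Qed.

(** [nl_diff] splits the difference bilinearly; the increment of the majorants dominates the
    increment of the functions in each piece. *)
Lemma good_nl_diff T B B' u u' : good T B u -> good T B' u' ->
  (forall k, B k <= B' k) -> majorizes T (fun k => B' k - B k) (fun t k => u' t k - u t k) ->
  forall k s, k != 0 -> 0 < s < T ->
  `|nl a b (u' s) (u' s) k - nl a b (u s) (u s) k| <=
  nlc * (quad (fun k => B' k - B k) B' k + quad B (fun k => B' k - B k) k) * src k s.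
Proof.
move=> G G' BB M k s k0 sT; have /andP[s0 _] := sT.
have B0 := good_ge0 G; have lB := good_l2 G; have eB := good_even G.
have B'0 := good_ge0 G'; have lB' := good_l2 G'; have eB' := good_even G'.
pose D k := B' k - B k.
have D0 j : 0 <= D j by rewrite subr_ge0.
have eD : even_seq D by move=> j; rewrite /D eB eB'.
have lD : l2 D.
  apply: le_l2 lB' => j; rewrite !ger0_norm//.
  by rewrite /D gerBl.
have [s1 z1] := dom_bound mu0 al2 al5 k0 s0 D0 B'0 lD lB'.
have [s2 z2] := dom_bound mu0 al2 al5 k0 s0 B0 D0 lB lD.
have [s3 _] := dom_bound mu0 al2 al5 k0 s0 B'0 B'0 lB' lB'.
have uB' j : `|u s j| <= B' j * envm j s.
  by apply: (le_trans (good_maj G j sT)); rewrite ler_wpM2r// envm_ge0.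
have DB' j : D j * envm j s <= B' j * envm j s.
  by rewrite ler_wpM2r ?envm_ge0// /D gerBl.
rewrite (nl_diff a b (even_envm s eD) (even_envm s eB') DB' s3 (fun j => good_maj G' j sT) uB' (fun j => M s j sT)).
apply: (le_trans (ler_normD _ _)).
rewrite (_ : nlc * (_ + _) * _ = nlc * (quad D B' k * src k s) + nlc * (quad B D k * src k s)); last first.
  by move: (quad _ _ k) (quad _ _ k) => x y; ring.
apply: lerD.
  apply: (le_trans (nl_bound (even_envm s eD) (even_envm s eB') s1 a b (fun j => M s j sT) (fun j => good_maj G' j sT))).
  by rewrite ler_wpM2l ?nlc_ge0.
apply: (le_trans (nl_bound (even_envm s eB) (even_envm s eD) s2 a b (fun j => good_maj G j sT) (fun j => M s j sT))).
by rewrite ler_wpM2l ?nlc_ge0.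
Qed.

Lemma bilin_diff (x y z : R) B B' k :
  summ (fun j => wt (- x) j * wt (- y) (k - j) * (B j * B (k - j))) ->
  summ (fun j => wt (- x) j * wt (- y) (k - j) * (B' j * B' (k - j))) ->
  summ (fun j => wt (- x) j * wt (- y) (k - j) * (B j * B' (k - j))) ->
  bilin x y z B' B' k - bilin x y z B B k =
  bilin x y z (fun k => B' k - B k) B' k + bilin x y z B (fun k => B' k - B k) k.
Proof.
move=> s1 s2 s3; rewrite /bilin -mulrBr -mulrDr; congr (_ * _).
rewrite [X in _ = X + _](@eq_zsum _ _ (fun j => wt (- x) j * wt (- y) (k - j) * (B' j * B' (k - j)) -
  wt (- x) j * wt (- y) (k - j) * (B j * B' (k - j)))); last by move=> j; ring.
rewrite [X in _ = _ + X](@eq_zsum _ _ (fun j => wt (- x) j * wt (- y) (k - j) * (B j * B' (k - j)) -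
  wt (- x) j * wt (- y) (k - j) * (B j * B (k - j)))); last by move=> j; ring.
by rewrite (zsumB s2 s3) (zsumB s3 s1) addrA subrK.
Qed.

Lemma sum_diff_aux (p p' q q' x1 y1 x2 y2 : R) : p' - p = x1 + y1 -> q' - q = x2 + y2 ->
  (x1 + x2) + (y1 + y2) = (p' + q') - (p + q).
Proof. by move=> e1 e2; rewrite opprD (addrACA p') e1 e2 addrACA. Qed.

(** The bound produced by [good_nl_diff] is exactly the increment of the quadratic majorant, so that
    differences of iterates telescope together with those of majorants. *)
Lemma quad_diff B B' k : (forall k, 0 <= B k) -> (forall k, 0 <= B' k) -> l2 B -> l2 B' ->
  quad (fun k => B' k - B k) B' k + quad B (fun k => B' k - B k) k = quad B' B' k - quad B B k.
Proof.
move=> B0 B'0 lB lB'; have [k0|k0] := eqVneq k 0.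
  by rewrite k0 /quad !bilin0 !addr0 subrr.
have [C _ H] := quad_spec al2 al5.
have [/(_ k k0)[s1 s2] _ _] := H B B B0 B0 lB lB.
have [/(_ k k0)[s3 s4] _ _] := H B' B' B'0 B'0 lB' lB'.
have [/(_ k k0)[s5 s6] _ _] := H B B' B0 B'0 lB lB'.
have E1 := bilin_diff (1 / 2 - 3 * kap alpha / 2) s1 s3 s5.
have E2 := bilin_diff (1 / 2 - kap alpha) s2 s4 s6.
exact: sum_diff_aux E1 E2.
Qed.

Lemma zero_good T : good T (fun=> 0) (fun _ _ => 0).
Proof.
split; [by []|by []| | |].
- exact: l2_0.
- by move=> t k _; rewrite normr0 mul0r.
- by move=> t k _; exact: cst_continuous.
Qed.

Lemma nl00 k : nl a b (fun=> 0) (fun=> 0) k = 0.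
Proof.
rewrite /nl /conv !(@eq_zsum _ _ (fun=> 0)) ?zsum0; first by ring.
  by move=> j; rewrite /conv_term /hL mulr0 mul0r.
by move=> j; rewrite /conv_term mul0r.
Qed.

(** The difference estimate against the zero function, which is [good] with zero majorant. *)
Lemma good_nl_bound T B u : good T B u -> forall k s, k != 0 -> 0 < s < T ->
  `|nl a b (u s) (u s) k| <= nlc * quad B B k * src k s.
Proof.
move=> G k s k0 sT; have M : majorizes T (fun k => B k - 0) (fun t k => u t k - 0).
  by move=> t j tT; rewrite !subr0; exact: (good_maj G).
have := good_nl_diff (zero_good T) G (good_ge0 G) M k0 sT.
rewrite nl00 subr0; rewrite quad_diff//; [|exact: (good_ge0 G)|exact: (good_l2 (zero_good T))|exact: (good_l2 G)].
rewrite (_ : quad (fun=> 0) (fun=> 0) k = 0) ?subr0//.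
rewrite /quad /bilin !(@eq_zsum _ _ (fun=> 0)) ?zsum0 ?mulr0 ?addr0// => j; by rewrite !mulr0.
Qed.

Lemma good_quad_ge0 T B u k : good T B u -> 0 <= quad B B k.
Proof. by move=> G; apply: quad_ge0; exact: (good_ge0 G). Qed.

Lemma good_nl_meas T B u k t : good T B u -> 0 < t < T ->
  measurable_fun `]0, t] (fun s => nl a b (u s) (u s) k).
Proof.
move=> G /andP[t0 tT]; apply: (@continuous_at_measurable _ _ 0 T) => //.
  by move=> s /=; rewrite !in_itv/= => /andP[-> h] /=; exact: le_lt_trans tT.
by move=> s sT; exact: (good_nl_cont G).
Qed.

Lemma duh_integrable T B u k t : good T B u -> 0 < t < T ->
  leb.-integrable `]0, t] (EFin \o (fun s => expR (- (rate k * (t - s))) * nl a b (u s) (u s) k)).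
Proof.
move=> G /andP[t0 tT]; have [k0|k0] := eqVneq k 0.
  rewrite (_ : _ \o _ = cst 0%E) ?integrable0//.
  by apply/funext => s /=; rewrite k0 nl_zero mulr0.
apply: (duhamel mu0 al2 al5 k0 t0 (A := nlc * quad B B k) _ _ _).1.
- by rewrite mulr_ge0 ?nlc_ge0// (good_quad_ge0 _ G).
- by apply: (good_nl_meas k G); rewrite t0.
- by move=> s /andP[s0 st]; apply: (good_nl_bound G) => //; rewrite s0 (le_lt_trans st).
Qed.

Lemma duh_diff T B B' u u' : good T B u -> good T B' u' ->
  (forall k, B k <= B' k) -> majorizes T (fun k => B' k - B k) (fun t k => u' t k - u t k) ->
  forall k t be, 0 < t < T -> 0 <= be <= beta2 alpha ->
  `|duh u' k t - duh u k t| <= duhc * (quad B' B' k - quad B B k) * env be k t.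
Proof.
move=> G G' BB M k t be tT bebd; have /andP[t0 tT'] := tT; have [k0|k0] := eqVneq k 0.
  rewrite /duh k0 env0 mulr0 (_ : (fun s => _) = cst 0); last by apply/funext => s; rewrite nl_zero mulr0.
  by rewrite [X in _ - X](_ : _ = \int[leb]_(s in `]0, t]) 0) ?subrr ?normr0//; apply: eq_Rintegral => s _; rewrite nl_zero mulr0.
have i1 := duh_integrable k G' tT; have i2 := duh_integrable k G tT.
rewrite /duh -RintegralB//.
rewrite [X in `|X|](_ : _ = \int[leb]_(s in `]0, t]) (expR (- (rate k * (t - s))) * (nl a b (u' s) (u' s) k - nl a b (u s) (u s) k))); last first.
  by apply: eq_Rintegral => s _; rewrite [RHS]mulrBr.
have qE := quad_diff k (good_ge0 G) (good_ge0 G') (good_l2 G) (good_l2 G').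
have q0 : 0 <= quad B' B' k - quad B B k.
  have D0 j : 0 <= B' j - B j by rewrite subr_ge0.
  by rewrite -qE addr_ge0// quad_ge0//; [exact: (good_ge0 G')|exact: (good_ge0 G)].
have [|||_ H] := duhamel mu0 al2 al5 k0 t0 (A := nlc * (quad B' B' k - quad B B k))
   (N := fun s => nl a b (u' s) (u' s) k - nl a b (u s) (u s) k).
- by rewrite mulr_ge0 ?nlc_ge0.
- by apply: measurable_funB; [exact: (good_nl_meas k G')|exact: (good_nl_meas k G)].
- move=> s /andP[s0 st]; rewrite -qE; apply: (good_nl_diff G G') => //.
  by rewrite s0 (le_lt_trans st).
by rewrite /duhc -(mulrA (duh_const _ _)); exact: H.
Qed.

Lemma picard_ode T B u h : good T B u ->
  forall k, (forall t, 0 < t < T -> is_derive t 1 (fun t => picard h u t k)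
     (- rate k * picard h u t k + nl a b (u t) (u t) k)) /\
  (0 < T -> picard h u t k @[t --> 0^'+] --> h k).
Proof.
move=> G k; apply: duhamel_derive.
  by move=> t tT; exact: (good_nl_cont G).
by move=> t tT; exact: (duh_integrable k G tT).
Qed.

End Picard.

(** * Limits of sequences of coefficients *)

Section Limits.
Context {R : realType}.

Lemma cvg_sum_seq (I : Type) (s : seq I) (B : nat -> I -> R) (b : I -> R) :
  (forall k, B n k @[n --> \oo] --> b k) ->
  \sum_(k <- s) B n k @[n --> \oo] --> \sum_(k <- s) b k.
Proof.
move=> cB; elim: s => [|k s IH].
  by rewrite big_nil; under eq_fun do rewrite big_nil; exact: cvg_cst.
by rewrite big_cons; under eq_fun do rewrite big_cons; exact: cvgD.
Qed.

(** Fatou's lemma: the bound holds on finite sets of frequencies, where the limit is taken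
    termwise. *)
Lemma l2_lim (B : nat -> int -> R) (b : int -> R) (M : R) :
  (forall n, l2 (B n) /\ n2 (B n) <= M) -> (forall k, B n k @[n --> \oo] --> b k) ->
  l2 b /\ n2 b <= M.
Proof.
move=> BM cB; apply: summ_esum_le; first by move=> k; exact: sqr_ge0.
apply: ub_ereal_sup => _ [X [fX _] <-].
rewrite fsumEFin// lee_fin fsbig_finite//=.
have cS : \sum_(k <- finmap.enum_fset (fset_set X)) B n k ^+ 2 @[n --> \oo] -->
    \sum_(k <- finmap.enum_fset (fset_set X)) b k ^+ 2.
  by apply: (cvg_sum_seq (B := fun n k => B n k ^+ 2)) => k; apply: cvgM; exact: cB.
apply: (cvgr_to_le cS); apply: nearW => n.
apply: le_trans (BM n).2; rewrite -lee_fin ge0_EFin_zsum; [|exact: (BM n).1|].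
  by apply: esum_ge; exists X => //; rewrite fsumEFin// fsbig_finite.
by move=> k; exact: sqr_ge0.
Qed.

Lemma is_derive_cont (F : R -> R) (x l : R) : is_derive x 1 F l -> {for x, continuous F}.
Proof. by move=> [dF _]; apply: differentiable_continuous; apply/derivable1_diffP. Qed.

Lemma powR_seq_cvg0 (p : R) : 0 < p -> (n.+1%:R^-1 : R) `^ p @[n --> \oo] --> 0.
Proof.
move=> p0; have /cvg_at_rightP H := @powR_cvg0 R p p0.
apply: H; split; first by move=> n; rewrite invr_gt0.
by have := @cvg_harmonic R; rewrite /harmonic.
Qed.

End Limits.

(** * Convergence of the Picard iteration *)

Section Flow.
Context {R : realType} (mu alpha a b : R).
Hypotheses (mu0 : 0 < mu) (al2 : 2 < alpha) (al5 : alpha <= 5 / 2).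
Implicit Types (B D : int -> R) (u v : R -> int -> R) (k j : int) (s t T : R).
Local Notation rate := (rate mu alpha).
Local Notation env := (env mu alpha).
Local Notation envm := (envm mu alpha).
Local Notation quad := (quad alpha).
Local Notation good := (good mu alpha).
Local Notation majorizes := (majorizes mu alpha).
Local Notation picard := (picard mu alpha a b).
Local Notation duh := (duh mu alpha a b).
Local Notation duhc := (duhc mu alpha a b).

Lemma bilin_even (x y z : R) B D k : even_seq B -> even_seq D ->
  (k != 0 -> summ (fun j => wt (- x) j * wt (- y) (k - j) * (B j * D (k - j)))) ->
  bilin x y z B D (- k) = bilin x y z B D k.
Proof.
move=> eB eD s; have [->|k0] := eqVneq k 0; first by rewrite oppr0.
rewrite /bilin wtN; congr (_ * _).
rewrite -[RHS](zsum_opp (s k0)); apply: eq_zsum => j.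
by rewrite (_ : - k - j = - (k - - j)) ?wtN ?eB ?eD//; ring.
Qed.

Lemma quad_even B : even_seq B -> (forall k, 0 <= B k) -> l2 B -> even_seq (quad B B).
Proof.
move=> eB B0 lB k; have [C _ H] := quad_spec al2 al5.
have [H1 _ _] := H B B B0 B0 lB lB.
rewrite /quad; congr (_ + _); apply: bilin_even => // k0.
  by have [] := H1 k k0.
by have [] := H1 k k0.
Qed.

Lemma quad_mono B B' k : (forall k, 0 <= B k) -> (forall k, B k <= B' k) -> l2 B -> l2 B' ->
  quad B B k <= quad B' B' k.
Proof.
move=> B0 BB lB lB'; have B'0 j : 0 <= B' j by exact: le_trans (BB j).
rewrite -subr_ge0 -(quad_diff al2 al5)//.
by rewrite addr_ge0// quad_ge0// => j; rewrite subr_ge0.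
Qed.

Lemma duh0 k t : duh (fun _ _ => 0) k t = 0.
Proof.
rewrite /duh (@eq_Rintegral _ _ _ _ _ (fun=> 0)).
  by rewrite /Rintegral integral0.
by move=> s _; rewrite nl00 mulr0.
Qed.

Lemma picard_diff h u v t k : picard h u t k - picard h v t k = duh u k t - duh v k t.
Proof. by rewrite /picard opprD addrACA subrr add0r. Qed.

Lemma quad_00 k : quad (fun=> 0) (fun=> 0) k = 0.
Proof.
rewrite /quad /bilin !(@eq_zsum _ _ (fun=> 0)) ?zsum0 ?mulr0 ?addr0// => j; by rewrite !mulr0.
Qed.

Lemma duh_bound T B u k t be : good T B u -> 0 < t < T -> 0 <= be <= beta2 alpha ->
  `|duh u k t| <= duhc * quad B B k * env be k t.
Proof.
move=> G tT bb; have M : majorizes T (fun k => B k - 0) (fun t k => u t k - 0).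
  by move=> s j sT; rewrite !subr0; exact: (good_maj G).
have := duh_diff a b mu0 al2 al5 (zero_good mu alpha T) G (good_ge0 G) M k tT bb.
by rewrite duh0 quad_00 !subr0.
Qed.

Section Iteration.
Variables (h b0 : int -> R) (T eta CQ : R).
Hypotheses (eb0 : even_seq b0) (b00 : forall k, 0 <= b0 k) (lb0 : l2 b0).
Hypothesis Mb0 : majorizes T b0 (fun t k => expR (- (rate k * t)) * h k).
Hypotheses (CQ0 : 0 <= CQ) (CQP : forall B, (forall k, 0 <= B k) -> l2 B ->
  l2 (quad B B) /\ n2 (quad B B) <= CQ * (n2 B * n2 B)).
Hypotheses (eta0 : 0 <= eta) (nb0 : n2 b0 <= eta) (small : 16 * duhc ^+ 2 * CQ * eta <= 1).

(** The scheme for the majorants follows the Picard scheme step by step. Both start from 0, which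
    makes [Bs] nondecreasing in n. *)
Fixpoint Bs (n : nat) : int -> R :=
  if n is n'.+1 then fun k => b0 k + duhc * quad (Bs n') (Bs n') k else fun=> 0.
Fixpoint us (n : nat) : R -> int -> R :=
  if n is n'.+1 then picard h (us n') else fun _ _ => 0.

Lemma BsS n k : Bs n.+1 k = b0 k + duhc * quad (Bs n) (Bs n) k. Proof. by []. Qed.

Let c0 : 0 <= duhc := duhc_ge0 a b mu0 al2 al5.
Let b2 : 0 <= beta2 alpha := beta2_ge0 al2.
Let b1 : 0 <= beta1 alpha := beta1_ge0 al2.
Lemma beta12 : beta1 alpha <= beta2 alpha.
Proof. by rewrite /beta1 /beta2; have := al2; lra. Qed.

Lemma min_bound k t (x y : R) : 0 <= y -> (forall be, 0 <= be <= beta2 alpha -> x <= y * env be k t) ->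
  x <= y * envm k t.
Proof.
move=> y0 H; rewrite /envm minEle; case: ifP => _; apply: H.
  by rewrite b1 beta12.
by rewrite b2 lexx.
Qed.

Lemma next_majorant T' B u : good T' B u -> n2 B <= 4 * eta ->
  let B' k := b0 k + duhc * quad B B k in
  [/\ even_seq B', forall k, 0 <= B' k, l2 B' & n2 B' <= 4 * eta].
Proof.
move=> G nB B'; have [lQ nQ] := CQP (good_ge0 G) (good_l2 G).
have lcQ := l2Z duhc lQ.
split.
- by move=> k; rewrite /B' eb0 (quad_even (good_even G) (good_ge0 G) (good_l2 G)).
- by move=> k; rewrite addr_ge0// mulr_ge0// (good_quad_ge0 _ G).
- exact: l2D lb0 lcQ.
apply: (le_trans (n2D_le lb0 lcQ)); rewrite (n2Z _ lQ).
have nB0 := n2_ge0 B.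
have BB : n2 B * n2 B <= 4 * eta * (4 * eta) by apply: ler_pM.
have H1 : duhc ^+ 2 * n2 (quad B B) <= duhc ^+ 2 * (CQ * (4 * eta * (4 * eta))).
  rewrite ler_wpM2l ?exprn_ge0//; apply: (le_trans nQ).
  by rewrite ler_wpM2l.
(* Origin of the 16: if [n2 B] is at most 4 eta, the quadratic part contributes at most eta, and
   [n2D_le] returns 2 (eta + eta). *)
have H2 : duhc ^+ 2 * (CQ * (4 * eta * (4 * eta))) <= eta.
  rewrite (_ : _ * _ = (16 * duhc ^+ 2 * CQ * eta) * eta); last by ring.
  by rewrite -[leRHS]mul1r ler_wpM2r.
have := le_trans H1 H2; move: nb0; move: (n2 b0) (duhc ^+ 2 * _) => x y.
by move=> *; lra.
Qed.

Lemma next_good B u : good T B u -> n2 B <= 4 * eta ->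
  good T (fun k => b0 k + duhc * quad B B k) (picard h u).
Proof.
move=> G nB; have [e1 e2 e3 _] := next_majorant G nB.
split => //.
- move=> t k tT; apply: (le_trans (ler_normD _ _)); rewrite mulrDl; apply: lerD.
    exact: Mb0.
  apply: min_bound; first by rewrite mulr_ge0// (good_quad_ge0 _ G).
  by move=> be beb; exact: duh_bound G tT beb.
- move=> t k tT; have [H _] := picard_ode a b mu0 al2 al5 h G k.
  by apply: is_derive_cont; exact: H.
Qed.

(** The four properties are proved together: the difference estimate for one step uses the previous
    difference and that both iterates are [good]. *)
Lemma iter_good n : [/\ good T (Bs n) (us n), n2 (Bs n) <= 4 * eta,
  forall k, Bs n k <= Bs n.+1 k &
  majorizes T (fun k => Bs n.+1 k - Bs n k) (fun t k => us n.+1 t k - us n t k)].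
Proof.
elim: n => [|n [G nB mono M]].
  have G0 := zero_good mu alpha T.
  have n0 : n2 (Bs 0) <= 4 * eta.
    rewrite /n2 (@eq_zsum _ _ (fun=> 0)) ?zsum0 ?mulr_ge0// => k /=.
    by rewrite expr0n.
  have G1 := next_good G0 n0.
  split; [exact: G0|exact: n0| |].
    by move=> k; rewrite BsS quad_00 mulr0 addr0; exact: b00.
  move=> t k tT; rewrite (_ : Bs 0 k = 0)// (_ : us 0 t k = 0)// !subr0.
  exact: (good_maj G1).
have G1 := next_good G nB; have [_ _ _ nB1] := next_majorant G nB.
have mono1 k : Bs n.+1 k <= Bs n.+2 k.
  rewrite [leLHS]BsS [leRHS]BsS lerD2l ler_wpM2l//.
  apply: quad_mono mono _ _; [exact: (good_ge0 G)|exact: (good_l2 G)|exact: (good_l2 G1)].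
split; [exact: G1|exact: nB1|exact: mono1|] => t k tT.
have -> : us n.+2 t k - us n.+1 t k = duh (us n.+1) k t - duh (us n) k t.
  exact: (picard_diff h (us n.+1) (us n)).
have -> : Bs n.+2 k - Bs n.+1 k = duhc * (quad (Bs n.+1) (Bs n.+1) k - quad (Bs n) (Bs n) k).
  by rewrite [in LHS]BsS [X in _ - X]BsS opprD addrACA subrr add0r mulrBr.
apply: min_bound.
  by rewrite mulr_ge0// subr_ge0 quad_mono//; [exact: (good_ge0 G)|exact: (good_l2 G)|exact: (good_l2 G1)].
by move=> be beb; exact: (duh_diff a b mu0 al2 al5 G G1 mono M).
Qed.

Lemma Bs_mono n m k : (n <= m)%N -> Bs n k <= Bs m k.
Proof.
elim: m => [|m IH]; first by rewrite leqn0 => /eqP ->.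
rewrite leq_eqVlt => /predU1P[->//|nm].
by apply: (le_trans (IH nm)); have [_ _ H _] := iter_good m; exact: H.
Qed.

Lemma us_diff n m t k : (n <= m)%N -> 0 < t < T ->
  `|us m t k - us n t k| <= (Bs m k - Bs n k) * envm k t.
Proof.
move=> + tT; elim: m => [|m IH]; first by rewrite leqn0 => /eqP ->; rewrite !subrr normr0 mul0r.
rewrite leq_eqVlt => /predU1P[->|nm]; first by rewrite !subrr normr0 mul0r.
have [_ _ _ M] := iter_good m.
have := lerD (IH nm) (M t k tT); rewrite -mulrDl => H.
rewrite (_ : us m.+1 t k - us n t k = (us m t k - us n t k) + (us m.+1 t k - us m t k)); last by ring.
apply: (le_trans (ler_normD _ _)); apply: (le_trans H).
by rewrite le_eqVlt; apply/orP; left; apply/eqP; ring.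
Qed.

Lemma Bs_le n k : Bs n k <= 1 + 4 * eta.
Proof.
have [G nB _ _] := iter_good n.
have := le_zsum_term (f := fun k => Bs n k ^+ 2) k (good_l2 G) (fun k => sqr_ge0 _).
move=> /le_trans/(_ nB); have := sqr_ge0 (Bs n k - 1); move: (Bs n k) => x.
by move=> *; nra.
Qed.

Definition Binf k : R := limn (fun n => Bs n k).
Definition uinf t k : R := limn (fun n => us n t k).

Lemma Bs_cvg k : Bs n k @[n --> \oo] --> Binf k.
Proof.
apply: nondecreasing_is_cvgn; first by move=> n m; exact: Bs_mono.
by exists (1 + 4 * eta) => _ [n _ <-]; exact: Bs_le.
Qed.

(** By [us_diff] the sequence [us n t k + Bs n k * envm k t] is nondecreasing, and it is bounded;
    the convergent majorant part is then subtracted. *)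
Lemma us_cvg t k : 0 < t < T -> us n t k @[n --> \oo] --> uinf t k.
Proof.
move=> tT; pose e := envm k t.
have e0 : 0 <= e by exact: envm_ge0.
have cw : cvgn (fun n => us n t k + Bs n k * e).
  apply: nondecreasing_is_cvgn.
    move=> n m nm; have := us_diff k nm tT; rewrite -/e ler_norml => /andP[H _].
    move: H; rewrite mulrBl; move: (us n t k) (us m t k) (Bs n k * e) (Bs m k * e) => x y z w; lra.
  exists (2 * ((1 + 4 * eta) * e)) => _ [n _ <-].
  have [G _ _ _] := iter_good n.
  have := good_maj G k tT; have := Bs_le n k => H1 H2.
  have H3 : Bs n k * e <= (1 + 4 * eta) * e by rewrite ler_wpM2r.
  by have := ler_norm (us n t k); move: H2; rewrite -/e; lra.
apply: (cvgP (lim ((fun n => us n t k + Bs n k * e) @ \oo) - Binf k * e)).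
have -> : (fun n => us n t k) = (fun n => (us n t k + Bs n k * e) - Bs n k * e).
  by apply/funext => n; ring.
apply: cvgB; first exact: cw.
by apply: cvgMl; exact: Bs_cvg.
Qed.

Lemma uinf_diff n t k : 0 < t < T -> `|uinf t k - us n t k| <= (Binf k - Bs n k) * envm k t.
Proof.
move=> tT.
have c1 : `|us m t k - us n t k| @[m --> \oo] --> `|uinf t k - us n t k|.
  by apply: cvg_norm; apply: cvgB; [exact: us_cvg|exact: cvg_cst].
have c2 : (Bs m k - Bs n k) * envm k t @[m --> \oo] --> (Binf k - Bs n k) * envm k t.
  by apply: cvgMl; apply: cvgB; [exact: Bs_cvg|exact: cvg_cst].
apply: (ler_cvg_to c1 c2); near=> m; apply: us_diff => //.
by near: m; exact: nbhs_infty_ge.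
Unshelve. all: by end_near. Qed.

Lemma Bs_le_Binf n k : Bs n k <= Binf k.
Proof.
apply: (cvgr_to_ge (@Bs_cvg k)); near=> m; apply: Bs_mono.
by near: m; exact: nbhs_infty_ge.
Unshelve. all: by end_near. Qed.

Lemma Binf_l2 : l2 Binf /\ n2 Binf <= 4 * eta.
Proof.
apply: (l2_lim (B := Bs)) => [n|k]; last exact: Bs_cvg.
by have [G nB _ _] := iter_good n; split; [exact: (good_l2 G)|exact: nB].
Qed.

Lemma Binf_even : even_seq Binf.
Proof.
move=> k; rewrite /Binf; congr (limn _); apply/funext => n.
by have [G _ _ _] := iter_good n; exact: (good_even G).
Qed.

Lemma Binf_ge0 k : 0 <= Binf k. Proof. exact: (Bs_le_Binf 0). Qed.

(** On []t / 2, T[] the envelopes are bounded by their value at t / 2, so the convergence is uniform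
    there for fixed [k] and continuity passes to the limit. *)
Lemma uinf_good : good T Binf uinf.
Proof.
split; [exact: Binf_even|exact: Binf_ge0|exact: Binf_l2.1| |].
  by move=> t k tT; have := uinf_diff 0 k tT; rewrite /= !subr0.
move=> t k tT; have /andP[t0 tT'] := tT.
have p0 : 0 < t / 2 by rewrite divr_gt0.
apply/cvgrPdist_lt => /= e e0.
pose M := envm k (t / 2); have M0 : 0 <= M by exact: envm_ge0.
have e3 : 0 < e / 3 / (M + 1) by rewrite !divr_gt0// ltr_wpDl.
have [n _ Hn] : \forall n \near \oo, Binf k - Bs n k < e / 3 / (M + 1).
  have /cvgrPdist_lt /(_ _ e3) := @Bs_cvg k; apply: filterS => n /=.
  by apply: le_lt_trans; exact: ler_norm.
have {}Hn := Hn n (leqnn n).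
have Hd s : t / 2 < s -> s < T -> `|uinf s k - us n s k| < e / 3.
  move=> s1 s2; have s0 := lt_trans p0 s1.
  apply: (@le_lt_trans _ _ ((Binf k - Bs n k) * M)).
    apply: (@le_trans _ _ ((Binf k - Bs n k) * envm k s)).
      by apply: uinf_diff; rewrite s0.
    by rewrite ler_wpM2l ?subr_ge0 ?Bs_le_Binf// envm_decr// ltW.
  apply: (@le_lt_trans _ _ (e / 3 / (M + 1) * M)).
    by rewrite ler_wpM2r// ltW.
  rewrite -mulrA -[ltRHS]mulr1 ltr_pM2l ?divr_gt0//.
  by rewrite mulrC ltr_pdivrMr ?ltr_wpDl// mul1r ltrDl.
have [G _ _ _] := iter_good n.
have /cvgrPdist_lt /(_ (e / 3)) := good_cont G (k:=k) tT; rewrite divr_gt0// => /(_ isT) Hc.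
have tt : t / 2 < t by lra.
near=> s.
have h1 := Hd t tt tT'.
have h2 : `|uinf s k - us n s k| < e / 3.
  apply: Hd; near: s; [exact: lt_nbhsr|exact: lt_nbhsl].
have h3 : `|us n t k - us n s k| < e / 3 by near: s.
rewrite (_ : uinf t k - uinf s k = (uinf t k - us n t k) + (us n t k - us n s k) + (us n s k - uinf s k)); last by ring.
apply: (le_lt_trans (ler_normD _ _)); rewrite distrC in h2.
have := ler_normD (uinf t k - us n t k) (us n t k - us n s k).
by move: h1 h2 h3; lra.
Unshelve. all: by end_near. Qed.

Lemma quad_Bs_cvg k : quad (Bs n) (Bs n) k @[n --> \oo] --> quad Binf Binf k.
Proof.
have [k0|k0] := eqVneq k 0.
  rewrite k0 /quad !bilin0; under eq_fun do rewrite !bilin0; exact: cvg_cst.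
have [C _ H] := quad_spec al2 al5; have [lB _] := Binf_l2.
have [/(_ k k0)[s1 s2] _ _] := H Binf Binf Binf_ge0 Binf_ge0 lB lB.
have Bn0 n j : 0 <= Bs n j by have [G _ _ _] := iter_good n; exact: (good_ge0 G).
have aux (x y : R) : summ (fun j => wt (- x) j * wt (- y) (k - j) * (Binf j * Binf (k - j))) ->
    zsum (fun j => wt (- x) j * wt (- y) (k - j) * (Bs n j * Bs n (k - j))) @[n --> \oo] -->
    zsum (fun j => wt (- x) j * wt (- y) (k - j) * (Binf j * Binf (k - j))).
  move=> s; apply: (zsum_cvg s) => [n j|j].
    rewrite ger0_norm; last by rewrite !mulr_ge0// wt_ge0.
    rewrite ler_wpM2l ?mulr_ge0 ?wt_ge0//; apply: ler_pM => //; exact: Bs_le_Binf.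
  by apply: cvgMr; apply: cvgM; exact: Bs_cvg.
by apply: cvgD; apply: cvgMr; exact: aux.
Qed.

(** [duh_diff] at be = 0 bounds the error in the Duhamel term by the increment of [quad] from [Bs n]
    to [Binf], which tends to 0 by [quad_Bs_cvg]. *)
Lemma uinf_picard t k : 0 < t < T -> uinf t k = picard h uinf t k.
Proof.
move=> tT; have c1 : us n.+1 t k @[n --> \oo] --> uinf t k.
  by have := @us_cvg t k tT; rewrite -(cvg_shiftS (fun n => us n t k)).
apply: (cvg_unique _ c1) => //.
have c2 : duhc * (quad Binf Binf k - quad (Bs n) (Bs n) k) * env 0 k t @[n --> \oo] --> 0.
  rewrite -[X in _ --> X](mul0r (env 0 k t)); apply: cvgMl.
  rewrite -[X in _ --> X](mulr0 duhc); apply: cvgMr.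
  rewrite -[X in _ --> X](subrr (quad Binf Binf k)); apply: cvgB; first exact: cvg_cst.
  exact: quad_Bs_cvg.
apply/cvgrPdist_le => e e0.
have /cvgrPdist_le /(_ _ e0) := c2; apply: filterS => n /=.
rewrite sub0r normrN => /(le_trans (ler_norm _)); apply: le_trans.
rewrite (_ : picard h uinf t k - picard h (us n) t k = duh uinf k t - duh (us n) k t); last exact: picard_diff.
have [G _ _ _] := iter_good n.
have M : majorizes T (fun k => Binf k - Bs n k) (fun t k => uinf t k - us n t k).
  by move=> s j sT; exact: uinf_diff.
by apply: (duh_diff a b mu0 al2 al5 G uinf_good (Bs_le_Binf n) M) => //; rewrite lexx.
Qed.

Lemma uinf_ode k : (forall t, 0 < t < T -> is_derive t 1 (uinf ^~ k)
     (- rate k * uinf t k + nl a b (uinf t) (uinf t) k)) /\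
  (0 < T -> uinf t k @[t --> 0^'+] --> h k).
Proof.
have [H1 H2] := picard_ode a b mu0 al2 al5 h uinf_good k; split.
  move=> t tT; have /andP[t0 tT'] := tT; rewrite uinf_picard//.
  apply: near_eq_is_derive (H1 t tT); near=> s; rewrite uinf_picard//.
  by apply/andP; split; near: s; [exact: lt_nbhsr|exact: lt_nbhsl].
move=> T0; apply: cvg_trans (H2 T0); apply: near_eq_cvg; near=> s.
by rewrite uinf_picard//; apply/andP; split; near: s; [exact: nbhs_right_gt|exact: nbhs_right_lt].
Unshelve. all: by end_near. Qed.

End Iteration.
End Flow.

(** * Smallness of the free evolution and local existence *)

Section LocalFlow.
Context {R : realType} (mu alpha a b : R).
Hypotheses (mu0 : 0 < mu) (al2 : 2 < alpha) (al5 : alpha <= 5 / 2).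
Implicit Types (h : int -> R) (k : int) (t T : R).
Local Notation rate := (rate mu alpha).
Local Notation env := (env mu alpha).
Local Notation envm := (envm mu alpha).
Local Notation quad := (quad alpha).
Local Notation good := (good mu alpha).
Local Notation majorizes := (majorizes mu alpha).
Local Notation duhc := (duhc mu alpha a b).
Local Notation reg0 := (reg0 alpha).
Local Notation beta1 := (beta1 alpha).
Local Notation beta2 := (beta2 alpha).

(** Bounds the factor that [lin_bound] leaves, for both values of [be] and all t < T. The first
    entry of the minimum is uniform in [k] and [T]; the second one tends to 0 with [T] for each
    [k]. *)
Definition heat_gain T k : R :=
  Num.min (1 + 2 / mu) ((zabs k * T `^ alpha^-1) `^ beta1 + (zabs k * T `^ alpha^-1) `^ beta2).

(** Symmetrized in [k] because majorants have to be even. *)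
Definition heat_majorant h T k : R :=
  (`|h k| + `|h (- k)|) * wt reg0 k * (expR (mu / 2) * heat_gain T k).

Lemma heat_gain_ge0 T k : 0 <= heat_gain T k.
Proof.
rewrite /heat_gain le_min; apply/andP; split; last by rewrite addr_ge0 ?powR_ge0.
by rewrite addr_ge0// divr_ge0// ltW.
Qed.

Lemma heat_gainP T k t be : 0 < t < T -> be = beta1 \/ be = beta2 ->
  expR (- (mu / 2 * wt alpha k * t)) * (zabs k * t `^ alpha^-1) `^ be <= heat_gain T k.
Proof.
move=> /andP[t0 tT] be12; have h2 := al2; have h5 := al5.
have bea : 0 <= be <= alpha.
  by case: be12 => ->; rewrite /beta1 /beta2; apply/andP; split; lra.
move: bea => /andP[be0 bea].
have y0 : 0 <= zabs k * t `^ alpha^-1 by rewrite mulr_ge0 ?zabs_ge0 ?powR_ge0.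
have w0 : 0 <= wt alpha k * t by rewrite mulr_ge0 ?wt_ge0 ?ltW.
have e0 := expR_ge0 (- (mu / 2 * wt alpha k * t)).
rewrite /heat_gain le_min; apply/andP; split.
  have H : (zabs k * t `^ alpha^-1) `^ be <= 1 + wt alpha k * t.
    have [y1|y1] := leP (zabs k * t `^ alpha^-1) 1.
      apply: (@le_trans _ _ 1); last by rewrite lerDl.
      have -> : (1 : R) = 1 `^ be by rewrite powR1.
      by rewrite ge0_ler_powR ?nnegrE.
    apply: (@le_trans _ _ ((zabs k * t `^ alpha^-1) `^ alpha)).
      by rewrite ler_powR// ltW.
    rewrite powRM ?zabs_ge0 ?powR_ge0// -powRrM mulVf ?gt_eqF ?(alpha_gt0 al2)//.
    by rewrite powRr1 ?(ltW t0)// wt_alphaE// lerDr.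
  apply: (le_trans (ler_wpM2l e0 H)).
  have -> : mu / 2 * wt alpha k * t = mu / 2 * (wt alpha k * t) by rewrite mulrA.
  move: w0; move: (wt alpha k * t) => x x0.
  have m2 : 0 < mu / 2 by rewrite divr_gt0.
  rewrite expRN mulrC ler_pdivrMr ?expR_gt0//.
  have H1 := expR_ge1Dx (mu / 2 * x).
  have E1 : 1 + x <= (1 + 2 / mu) * (1 + mu / 2 * x).
    have -> : (1 + 2 / mu) * (1 + mu / 2 * x) = 1 + x + 2 / mu + mu / 2 * x.
      by field; rewrite gt_eqF.
    have : 0 <= 2 / mu by rewrite divr_ge0// ltW.
    have : 0 <= mu / 2 * x by rewrite mulr_ge0// ltW.
    by lra.
  apply: (le_trans E1); rewrite ler_wpM2l//.
  by rewrite addr_ge0// divr_ge0// ltW.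
apply: (@le_trans _ _ ((zabs k * t `^ alpha^-1) `^ be)).
  rewrite -[leRHS]mul1r ler_wpM2r ?powR_ge0// -expR0 ler_expR oppr_le0.
  by rewrite -mulrA mulr_ge0// divr_ge0// ltW.
have M : (zabs k * t `^ alpha^-1) `^ be <= (zabs k * T `^ alpha^-1) `^ be.
  apply: ge0_ler_powR; rewrite ?nnegrE// ?mulr_ge0 ?zabs_ge0 ?powR_ge0//.
  rewrite ler_wpM2l ?zabs_ge0// ge0_ler_powR ?nnegrE ?(ltW t0) ?(ltW tT) ?invr_ge0 ?(ltW (alpha_gt0 al2))//.
  exact: ltW (lt_trans t0 tT).
apply: (le_trans M); case: be12 => ->; first by rewrite lerDl powR_ge0.
by rewrite lerDr powR_ge0.
Qed.

Lemma heat_majorant_ge0 h T k : 0 <= heat_majorant h T k.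
Proof. by rewrite !mulr_ge0 ?addr_ge0 ?wt_ge0 ?expR_ge0 ?heat_gain_ge0. Qed.

Lemma heat_majorant_even h T : even_seq (heat_majorant h T).
Proof. by move=> k; rewrite /heat_majorant /heat_gain wtN zabsN opprK (addrC `|h (- k)|). Qed.

Lemma heat_majorizes h T : h 0 = 0 ->
  majorizes T (heat_majorant h T) (fun t k => expR (- (rate k * t)) * h k).
Proof.
move=> h0 t k tT; have [k0|k0] := eqVneq k 0.
  by rewrite k0 h0 mulr0 normr0 mulr_ge0 ?heat_majorant_ge0// envm_ge0.
have /andP[t0 _] := tT.
have B be : be = beta1 \/ be = beta2 -> `|expR (- (rate k * t)) * h k| <= heat_majorant h T k * env be k t.
  move=> be12; have be0 : 0 <= be by case: be12 => ->; [exact: beta1_ge0|exact: beta2_ge0].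
  apply: (le_trans (lin_bound mu0 al2 _ k0 t0 be0)).
  rewrite ler_wpM2r ?env_ge0// /heat_majorant.
  apply: ler_pM; rewrite ?mulr_ge0 ?wt_ge0 ?expR_ge0 ?powR_ge0//.
    by rewrite ler_wpM2r ?wt_ge0// lerDl.
  by rewrite -mulrA ler_wpM2l ?expR_ge0// heat_gainP.
by rewrite /envm minEle; case: ifP => _; apply: B; [left|right].
Qed.

Lemma l2_sym_weight h (x : R) : l2 (fun k => wt x k * h k) ->
  l2 (fun k => (`|h k| + `|h (- k)|) * wt x k).
Proof.
move=> lh; apply: (@le_l2 _ _ (fun k => `|wt x k * h k| + `|wt x (- k) * h (- k)|)).
  move=> k; rewrite ger0_norm; last by rewrite mulr_ge0 ?addr_ge0 ?wt_ge0.
  rewrite [leRHS]ger0_norm; last by rewrite addr_ge0.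
  by rewrite !normrM wtN (ger0_norm (wt_ge0 _ _)) mulrC mulrDr.
apply: l2D; first by apply: le_l2 lh => k; rewrite normr_id.
by apply: le_l2 (l2_opp lh).1 => k; rewrite normr_id.
Qed.

Lemma heat_majorant_l2 h T : l2 (fun k => wt reg0 k * h k) -> l2 (heat_majorant h T).
Proof.
move=> /l2_sym_weight lh.
apply: le_l2 (l2Z (expR (mu / 2) * (1 + 2 / mu)) lh) => k.
rewrite /heat_majorant mulrC !normrM ler_wpM2r ?mulr_ge0//.
rewrite ler_wpM2l// !ger0_norm ?heat_gain_ge0//.
  by rewrite /heat_gain ge_min lexx.
by rewrite addr_ge0// divr_ge0// ltW.
Qed.

(** Dominated convergence over the frequencies: no rate in T is available for a datum that is merely
    in the critical space. *)
Lemma heat_majorant_small h : l2 (fun k => wt reg0 k * h k) ->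
  n2 (heat_majorant h n.+1%:R^-1) @[n --> \oo] --> 0.
Proof.
move=> lh; have lh' := l2_sym_weight lh.
have s := l2Z (expR (mu / 2) * (1 + 2 / mu)) lh'.
have -> : (0 : R) = zsum (fun _ : int => 0 : R) by rewrite zsum0.
apply: (zsum_cvg s) => [n k|k].
  rewrite normrX -[leRHS](ger0_norm (sqr_ge0 _)) normrX; apply: lerXn2r; rewrite ?nnegrE//.
  rewrite /heat_majorant mulrC !normrM ler_wpM2r ?mulr_ge0//.
  rewrite ler_wpM2l// !ger0_norm ?heat_gain_ge0//.
    by rewrite /heat_gain ge_min lexx.
  by rewrite addr_ge0// divr_ge0// ltW.
have P be : 0 < be -> (zabs k * n.+1%:R^-1 `^ alpha^-1) `^ be @[n --> \oo] --> (0 : R).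
  move=> be0; have E n : (zabs k * n.+1%:R^-1 `^ alpha^-1) `^ be = zabs k `^ be * (n.+1%:R^-1 : R) `^ (alpha^-1 * be).
    by rewrite powRM ?zabs_ge0 ?powR_ge0// -powRrM.
  under eq_fun do rewrite E.
  suff : zabs k `^ be * (n.+1%:R^-1 : R) `^ (alpha^-1 * be) @[n --> \oo] --> zabs k `^ be * 0.
    by rewrite mulr0.
  apply: cvgMr; by apply: powR_seq_cvg0; rewrite mulr_gt0// invr_gt0 (alpha_gt0 al2).
have h2 := al2.
have b1 : 0 < beta1 by rewrite /beta1; lra.
have b2 : 0 < beta2 by rewrite /beta2; lra.
have G : heat_gain n.+1%:R^-1 k @[n --> \oo] --> (0 : R).
  apply: (@squeeze_cvgr _ _ _ _ (fun=> 0) (fun n : nat => (zabs k * n.+1%:R^-1 `^ alpha^-1) `^ beta1 + (zabs k * n.+1%:R^-1 `^ alpha^-1) `^ beta2)).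
  - apply: nearW => n; apply/andP; split; first exact: heat_gain_ge0.
    by rewrite /heat_gain ge_min lexx orbT.
  - exact: cvg_cst.
  - by rewrite -[X in _ --> X](addr0 0); apply: cvgD; exact: P.
have M : heat_majorant h n.+1%:R^-1 k @[n --> \oo] --> (0 : R).
  rewrite -[X in _ --> X](mulr0 ((`|h k| + `|h (- k)|) * wt reg0 k)); apply: cvgMr.
  by rewrite -[X in _ --> X](mulr0 (expR (mu / 2))); apply: cvgMr.
by rewrite -[X in _ --> X](mulr0 0) /=; apply: cvgM.
Qed.

(** Besides the majorant of the iteration, which lives in the envelopes at [beta1] and [beta2], a
    majorant [D] in the envelope at 0 is produced; all the weighted norms are read off from it. *)
Lemma local_flow h : h 0 = 0 -> l2 (fun k => wt reg0 k * h k) ->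
  exists T u D, [/\ 0 < T, even_seq D, forall k, 0 <= D k, l2 D &
    [/\ forall t k, 0 < t < T -> `|u t k| <= D k * env 0 k t,
      exists B, good T B u,
      forall t k, 0 < t < T ->
        is_derive t 1 (u ^~ k) (- rate k * u t k + nl a b (u t) (u t) k) &
      forall k, u t k @[t --> 0^'+] --> h k]].
Proof.
move=> h0 lh; have [CQ CQ0 HQ] := quad_spec al2 al5.
have CQP B : (forall k, 0 <= B k) -> l2 B -> l2 (quad B B) /\ n2 (quad B B) <= CQ * (n2 B * n2 B).
  by move=> B0 lB; have [_ ] := HQ B B B0 B0 lB lB.
pose c := 16 * duhc ^+ 2 * CQ; have c0 : 0 <= c by apply: mulr_ge0 => //; apply: mulr_ge0 => //; exact: sqr_ge0.
(* Chosen so that c eta = c / (1 + c) <= 1, also when c = 0. *)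
pose eta := (1 + c)^-1; have eta0 : 0 < eta by rewrite invr_gt0 ltr_wpDr.
have small : 16 * duhc ^+ 2 * CQ * eta <= 1.
  by rewrite -/c /eta ler_pdivrMr ?ltr_wpDr// mul1r lerDr.
have /cvgrPdist_lt /(_ _ eta0)[n _ /(_ n (leqnn n)) /=] := heat_majorant_small lh.
rewrite sub0r normrN => /(le_lt_trans (ler_norm _)) /ltW nb0.
set T := n.+1%:R^-1 in nb0; have T0 : 0 < T by rewrite invr_gt0.
have eb0 := heat_majorant_even h T; have b00 := heat_majorant_ge0 h T.
have lb0 := heat_majorant_l2 T lh; have Mb0 := heat_majorizes h0 (T := T).
have G := uinf_good mu0 al2 al5 eb0 b00 lb0 Mb0 CQ0 CQP (ltW eta0) nb0 small.
have P := uinf_picard mu0 al2 al5 eb0 b00 lb0 Mb0 CQ0 CQP (ltW eta0) nb0 small.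
have O := uinf_ode mu0 al2 al5 eb0 b00 lb0 Mb0 CQ0 CQP (ltW eta0) nb0 small.
move: G P O; set B := Binf _ _ _ _ _; set u := uinf _ _ _ _ _ => G P O.
have [lQ _] := CQP _ (good_ge0 G) (good_l2 G).
have Q0 k : 0 <= quad B B k by exact: (good_quad_ge0 k G).
have cd := duhc_ge0 a b mu0 al2 al5.
(* At be = 0 the free evolution costs only exp (mu / 2), and [duh_bound] estimates the Duhamel term
   by the same [quad B B]. *)
exists T, u, (fun k => expR (mu / 2) * ((`|h k| + `|h (- k)|) * wt reg0 k) + duhc * quad B B k); split.
- exact: T0.
- move=> k; rewrite wtN opprK (addrC `|h (- k)|) (quad_even al2 al5 (good_even G) (good_ge0 G) (good_l2 G))//.
- move=> k; have w0 : 0 <= (`|h k| + `|h (- k)|) * wt reg0 k by rewrite mulr_ge0 ?wt_ge0 ?addr_ge0.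
  exact: addr_ge0 (mulr_ge0 (expR_ge0 _) w0) (mulr_ge0 cd (Q0 k)).
- by apply: l2D; apply: l2Z => //; exact: l2_sym_weight.
split.
- move=> t k tT; rewrite P//; apply: (le_trans (ler_normD _ _)); rewrite mulrDl; apply: lerD.
    have /andP[t0 _] := tT.
    have w0 : 0 <= (`|h k| + `|h (- k)|) * wt reg0 k by rewrite mulr_ge0 ?wt_ge0 ?addr_ge0.
    have [k0|k0] := eqVneq k 0.
      have r0 : 0 <= expR (mu / 2) * ((`|h k| + `|h (- k)|) * wt reg0 k) * env 0 k t.
        exact: mulr_ge0 (mulr_ge0 (expR_ge0 _) w0) (env_ge0 _ _ _ _ _).
      by apply: le_trans r0; rewrite k0 h0 mulr0 normr0.
    apply: (le_trans (lin_bound mu0 al2 _ k0 t0 (lexx 0))).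
    rewrite ler_wpM2r ?env_ge0// powRr0 mulr1 [leRHS]mulrC; apply: ler_pM.
    + by rewrite mulr_ge0 ?wt_ge0.
    + by rewrite mulr_ge0 ?expR_ge0.
    + by rewrite ler_wpM2r ?wt_ge0// lerDl.
    rewrite -[leRHS]mulr1 ler_wpM2l ?expR_ge0// -expR0 ler_expR oppr_le0.
    by rewrite !mulr_ge0 ?wt_ge0 ?(ltW t0)// ltW.
  have be2 : 0 <= (0 : R) <= beta2 by rewrite lexx; exact: (beta2_ge0 al2).
  exact: (duh_bound a b mu0 al2 al5 k G tT be2).
- by exists B.
- by move=> t k tT; have [H _] := O k; exact: H.
- by move=> k; have [_ H] := O k; exact: H.
Qed.

End LocalFlow.

(** * Exchange of sums and integrals *)

Section Exchange.
Context {R : realType}.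
Implicit Types (f c : int -> R).

(** Sum over |k| <= n, given by recursion so that measurability and integrability follow by
    induction on n. *)
Fixpoint psum f n : R :=
  if n is n'.+1 then psum f n' + (f n'.+1%:Z + f (- n'.+1%:Z)) else f 0.

Lemma zsum_psum f n : zsum (fun k => if (absz k <= n)%N then f k else 0) = psum f n /\
  summ (fun k => if (absz k <= n)%N then f k else 0).
Proof.
elim: n => [|n [IH1 IH2]].
  have [|H1 H2] := @zsum_delta R (fun k => if (absz k <= 0)%N then f k else 0) 0.
    by move=> k; rewrite leqn0 absz_eq0 => /negbTE ->.
  by split => //; rewrite H2.
have [a1 a2] := @zsum_delta R (fun k => if k == n.+1%:Z then f k else 0) n.+1%:Z (fun k kn => ifN _ _ kn).
have [b1 b2] := @zsum_delta R (fun k => if k == - n.+1%:Z then f k else 0) (- n.+1%:Z) (fun k kn => ifN _ _ kn).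
have E k : (if (absz k <= n.+1)%N then f k else 0) =
    (if (absz k <= n)%N then f k else 0) + ((if k == n.+1%:Z then f k else 0) + (if k == - n.+1%:Z then f k else 0)).
  case: ifP => h1; case: ifP => h2; case: ifP => h3; case: ifP => h4; rewrite ?addr0 ?add0r//; exfalso; lia.
have s1 := summD a1 b1; split; last by apply: eq_summ (summD IH2 s1) => k; rewrite E.
by rewrite (eq_zsum E) (zsumD IH2 s1) (zsumD a1 b1) IH1 a2 b2 !eqxx.
Qed.

Lemma psum_cvg f : summ f -> psum f n @[n --> \oo] --> zsum f.
Proof.
move=> sf.
have : zsum (fun k => if (absz k <= n)%N then f k else 0) @[n --> \oo] --> zsum f.
  apply: (zsum_cvg (summ_norm sf)) => [n k|k]; first by case: ifP; rewrite ?normr0.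
  apply: cvg_near_cst; near=> n.
  by have -> : (absz k <= n)%N by near: n; exact: nbhs_infty_ge.
by under eq_fun do rewrite (zsum_psum f _).1.
Unshelve. all: by end_near. Qed.

Lemma ler_norm_psum f c n : summ c -> (forall k, `|f k| <= c k) -> `|psum f n| <= zsum c.
Proof.
move=> sc fc; have [<- s] := zsum_psum f n.
apply: (le_trans (ler_norm_zsum s)); apply: le_zsum => //; first exact: summ_norm.
by move=> k; case: ifP => _; rewrite ?normr0// (le_trans _ (fc k)).
Qed.

Context d (T : measurableType d) (m : {measure set T -> \bar R}) (D : set T).
Hypothesis mD : measurable D.
Implicit Types (G : int -> T -> R).

Lemma measurable_psum G n : (forall k, measurable_fun D (G k)) ->
  measurable_fun D (fun x => psum (G ^~ x) n).
Proof.
move=> mG; elim: n => [|n IH] /=; first exact: mG.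
by apply: measurable_funD => //; apply: measurable_funD; exact: mG.
Qed.

Lemma measurable_zsum G : (forall k, measurable_fun D (G k)) ->
  (forall x, D x -> summ (G ^~ x)) -> measurable_fun D (fun x => zsum (G ^~ x)).
Proof.
move=> mG sG; apply: (measurable_fun_cvg (h := fun n x => psum (G ^~ x) n)).
  by move=> n; exact: measurable_psum.
by move=> x Dx; apply: psum_cvg; exact: sG.
Qed.

Lemma integrable_psum G n : (forall k, m.-integrable D (EFin \o G k)) ->
  m.-integrable D (EFin \o (fun x => psum (G ^~ x) n)) /\
  \int[m]_(x in D) psum (G ^~ x) n = psum (fun k => \int[m]_(x in D) G k x) n.
Proof.
move=> iG; elim: n => [|n [IH1 IH2]] /=; first by split.
have i1 : m.-integrable D (EFin \o (fun x => G n.+1%:Z x + G (- n.+1%:Z) x)).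
  by rewrite (_ : _ \o _ = (EFin \o G n.+1%:Z) \+ (EFin \o G (- n.+1%:Z)))//; exact: integrableD.
split.
  rewrite (_ : _ \o _ = (EFin \o (fun x => psum (G ^~ x) n)) \+ (EFin \o (fun x => G n.+1%:Z x + G (- n.+1%:Z) x)))//.
  exact: integrableD.
rewrite RintegralD// IH2 RintegralD//; exact: iG.
Qed.

(** Dominated convergence for the symmetric partial sums, which are all bounded by [zsum c * w]. *)
Lemma zsum_integral G c (w : T -> R) : summ c -> m.-integrable D (EFin \o w) ->
  (forall k, measurable_fun D (G k)) ->
  (forall k x, D x -> `|G k x| <= c k * w x) ->
  [/\ m.-integrable D (EFin \o (fun x => zsum (G ^~ x))),
      summ (fun k => \int[m]_(x in D) G k x) &
      \int[m]_(x in D) zsum (G ^~ x) = zsum (fun k => \int[m]_(x in D) G k x)].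
Proof.
move=> sc iw mG Gc.
have sG x : D x -> summ (G ^~ x).
  move=> Dx; apply: (@le_summ _ _ (fun k => w x * c k)); last exact: summZ.
  by move=> k; rewrite mulrC; apply: (le_trans (Gc k x Dx)); exact: ler_norm.
have icw k : m.-integrable D (EFin \o (fun x => c k * w x)).
  rewrite (_ : _ \o _ = (fun x => (c k)%:E * (EFin \o w) x)%E)//; exact: integrableZl.
have iG k : m.-integrable D (EFin \o G k).
  apply: (le_integrable _ _ _ (icw k)) => //; first exact/measurable_EFinP.
  move=> x Dx /=; rewrite lee_fin; apply: (le_trans (Gc k x Dx)); exact: ler_norm.
have iS : m.-integrable D (EFin \o (fun x => zsum c * w x)).
  rewrite (_ : _ \o _ = (fun x => (zsum c)%:E * (EFin \o w) x)%E)//; exact: integrableZl.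
have [||||H1 _ H3] := @dominated_convergence _ T R m D mD
  (fun n x => (psum (G ^~ x) n)%:E) (fun x => (zsum (G ^~ x))%:E) (EFin \o (fun x => zsum c * w x))
  _ _ _ iS _.
- by move=> n; apply/measurable_EFinP; exact: measurable_psum.
- by apply/measurable_EFinP; exact: measurable_zsum.
- apply: aeW => x Dx; apply: cvg_EFin; first by apply: nearW => n.
  by have := psum_cvg (sG x Dx).
- apply: aeW => x n Dx /=; rewrite lee_fin.
  have sc' : summ (fun k => c k * w x).
    by apply: eq_summ (summZ (w x) sc) => k; rewrite mulrC.
  apply: (le_trans (ler_norm_psum n sc' (fun k => Gc k x Dx))).
  rewrite (@eq_zsum _ _ (fun k => w x * c k)); last by move=> k; rewrite mulrC.
  by rewrite zsumZ// mulrC.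
have sI : summ (fun k => \int[m]_(x in D) G k x).
  apply: (@le_summ _ _ (fun k => (\int[m]_(x in D) w x) * c k)); last exact: summZ.
  move=> k; apply: (le_trans (le_normr_Rintegral mD (iG k))).
  have ib : m.-integrable D (EFin \o (fun x => `|G k x|)).
    by rewrite (_ : _ \o _ = (abse \o (EFin \o G k)))//; exact: integrable_abse.
  apply: (le_trans (le_Rintegral mD ib (icw k) (Gc k))).
  by rewrite RintegralZl// mulrC; exact: ler_norm.
split => //.
have H4 := psum_cvg sI; apply: (@cvg_unique _ _ (psum (fun k => \int[m]_(x in D) G k x) n @[n --> \oo]) _ _ _ _ H4) => //.
move: H3; rewrite (_ : (\int[m]_(x in D) (zsum (G ^~ x))%:E)%E = (\int[m]_(x in D) zsum (G ^~ x))%:E); last first.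
  by rewrite fineK//; exact: integrable_fin_num.
move=> /fine_cvg; apply: cvg_trans; apply: near_eq_cvg; apply: nearW => n /=.
have [i1 i2] := integrable_psum n iG.
by rewrite -i2 /Rintegral.
Qed.

End Exchange.

(** * Hartley series on the circle *)

Section Circle.
Context {R : realType}.
Implicit Types (f g h : int -> R) (k j : int) (x : R) (F G : R -> R).
Local Notation leb := (@lebesgue_measure R).

(* The Hartley basis: it keeps the coefficients of real functions real. *)
Definition cas k x : R := cos (k%:~R * x) + sin (k%:~R * x).
Definition cint F : R := \int[leb]_(x in circle) F x.
Definition cintg F : Prop := leb.-integrable circle (EFin \o F).
Definition har F k : R := (2 * pi)^-1 * cint (fun x => F x * cas k x).

Lemma pi2_gt0 : 0 < 2 * pi :> R. Proof. by rewrite mulr_gt0// pi_gt0. Qed.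
Lemma measurable_circle : measurable (@circle R). Proof. exact: measurable_itv. Qed.

Lemma is_derive_mulc (m x : R) : is_derive x 1 (fun y => m * y) m.
Proof. by apply: is_derive_eq; rewrite /GRing.scale/=; ring. Qed.

Lemma is_derive_cosM (m x : R) : is_derive x 1 (fun y => cos (m * y)) (- sin (m * x) * m).
Proof. by have := is_derive1_comp (is_derive_cos (m * x)) (is_derive_mulc m x). Qed.

Lemma is_derive_sinM (m x : R) : is_derive x 1 (fun y => sin (m * y)) (cos (m * x) * m).
Proof. by have := is_derive1_comp (is_derive_sin (m * x)) (is_derive_mulc m x). Qed.

Lemma is_derive_cas k x : is_derive x 1 (cas k) (k%:~R * cas (- k) x).
Proof.
have c := is_derive_cosM k%:~R x; have s := is_derive_sinM k%:~R x.
rewrite (_ : k%:~R * _ = - sin (k%:~R * x) * k%:~R + cos (k%:~R * x) * k%:~R); first exact: is_deriveD.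
by rewrite /cas rmorphN mulNr cosN sinN; ring.
Qed.

Lemma continuous_cas k : continuous (cas k).
Proof. by move=> x; have [d _] := is_derive_cas k x; apply: differentiable_continuous; apply/derivable1_diffP. Qed.

Lemma cas_le2 k x : `|cas k x| <= 2.
Proof.
apply: (le_trans (ler_normD _ _)); rewrite (_ : 2 = 1 + 1 :> R); last by ring.
apply: lerD; rewrite ler_norml; [rewrite cos_geN1 cos_le1|rewrite sin_geN1 sin_le1]; by [].
Qed.

Lemma sin_kpi k : sin (k%:~R * pi) = 0 :> R.
Proof.
have N n : sin (n%:R * pi) = 0 :> R.
  elim: n => [|n IH]; first by rewrite mul0r sin0.
  by rewrite -natr1 mulrDl mul1r sinDpi IH oppr0.
case: k => n; first exact: N.
by rewrite NegzE rmorphN mulNr sinN (N n.+1) oppr0.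
Qed.

Lemma continuous_cosM (m : R) : continuous (fun x => cos (m * x)).
Proof. by move=> x; have [d _] := is_derive_cosM m x; apply: differentiable_continuous; apply/derivable1_diffP. Qed.

Lemma continuous_sinM (m : R) : continuous (fun x => sin (m * x)).
Proof. by move=> x; have [d _] := is_derive_sinM m x; apply: differentiable_continuous; apply/derivable1_diffP. Qed.

Lemma cint_FTC F G : continuous F -> (forall x, is_derive x 1 G (F x)) -> cint F = G pi - G (- pi).
Proof.
move=> cF dG; have pip : - pi <= pi :> R by rewrite ge0_cp// pi_ge0.
by apply: (@FTC2_R R F G (- pi) pi pip) => x _; exact: cF.
Qed.

Lemma cint_cos k : cint (fun x => cos (k%:~R * x)) = if k == 0 then 2 * pi else 0.
Proof.
have c := @continuous_cosM k%:~R; have [k0|k0] := eqVneq k 0.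
  have d x : is_derive x 1 id (cos (k%:~R * x)) by rewrite k0 mul0r cos0; exact: is_derive_id.
  by rewrite (cint_FTC c d); ring.
have kr : k%:~R != 0 :> R by rewrite intr_eq0.
have d x : is_derive x 1 (fun x => k%:~R^-1 * sin (k%:~R * x)) (cos (k%:~R * x)).
  have s := is_derive_sinM k%:~R x.
  by apply: is_derive_eq; rewrite /GRing.scale/=; field.
by rewrite (cint_FTC c d) mulrN sinN sin_kpi; ring.
Qed.

Lemma cint_sin k : cint (fun x => sin (k%:~R * x)) = 0.
Proof.
have c := @continuous_sinM k%:~R; have [k0|k0] := eqVneq k 0.
  have d x : is_derive x 1 (fun=> 0) (sin (k%:~R * x)) by rewrite k0 mul0r sin0; exact: is_derive_cst.
  by rewrite (cint_FTC c d) subrr.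
have kr : k%:~R != 0 :> R by rewrite intr_eq0.
have d x : is_derive x 1 (fun x => - k%:~R^-1 * cos (k%:~R * x)) (sin (k%:~R * x)).
  have s := is_derive_cosM k%:~R x.
  by apply: is_derive_eq; rewrite /GRing.scale/=; field.
by rewrite (cint_FTC c d) mulrN cosN; ring.
Qed.

Lemma cas_mul j k x : cas j x * cas k x = 2^-1 *
  (cas (j - k) x + cas (k - j) x + cas (j + k) x - cas (- j - k) x).
Proof.
rewrite /cas !(rmorphB, rmorphD, rmorphN)/= !mulrDl !mulNr !(cosD, sinD, cosN, sinN).
by field.
Qed.

Lemma continuous_cintg F : continuous F -> cintg F.
Proof. by move=> cF; apply: continuous_at_integrable => x _; exact: cF. Qed.

Lemma cint_cas k : cint (cas k) = if k == 0 then 2 * pi else 0.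
Proof.
rewrite /cint /cas RintegralD ?[X in _ + X]cint_sin ?addr0 -?cint_cos//.
- exact: measurable_circle.
- exact: continuous_cintg (@continuous_cosM _).
- exact: continuous_cintg (@continuous_sinM _).
Qed.

Lemma cintg_mul_bounded F G M : cintg F -> measurable_fun circle G ->
  (forall x, circle x -> `|G x| <= M) -> cintg (fun x => F x * G x).
Proof.
move=> iF mG GM; have mF : measurable_fun circle F by apply/measurable_EFinP; exact: measurable_int iF.
have iM : leb.-integrable circle (EFin \o (fun x => M * F x)).
  rewrite (_ : _ \o _ = (fun x => M%:E * (EFin \o F) x)%E)//; apply: integrableZl => //; exact: measurable_circle.
apply: (le_integrable _ _ _ iM); first exact: measurable_circle.
  by apply/measurable_EFinP; exact: measurable_funM.
move=> x cx /=; rewrite lee_fin !normrM mulrC ler_wpM2r//.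
by apply: (le_trans (GM x cx)); exact: ler_norm.
Qed.

Lemma measurable_cas k (D : set R) : measurable_fun D (cas k).
Proof. by apply: measurable_funTS; apply: continuous_measurable_fun; exact: continuous_cas. Qed.

Lemma cintg_cas F k : cintg F -> cintg (fun x => F x * cas k x).
Proof.
move=> iF; apply: (cintg_mul_bounded (M := 2)) => //; first exact: measurable_cas.
by move=> x _; exact: cas_le2.
Qed.

Lemma cintD F G : cintg F -> cintg G -> cint (fun x => F x + G x) = cint F + cint G.
Proof. by move=> iF iG; rewrite /cint RintegralD//; exact: measurable_circle. Qed.
Lemma cintB F G : cintg F -> cintg G -> cint (fun x => F x - G x) = cint F - cint G.
Proof. by move=> iF iG; rewrite /cint RintegralB//; exact: measurable_circle. Qed.
Lemma cintZ (c : R) F : cintg F -> cint (fun x => c * F x) = c * cint F.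
Proof. by move=> iF; rewrite /cint RintegralZl//; exact: measurable_circle. Qed.
Lemma cintgD F G : cintg F -> cintg G -> cintg (fun x => F x + G x).
Proof. by move=> iF iG; rewrite /cintg (_ : _ \o _ = (EFin \o F) \+ (EFin \o G))//; apply: integrableD => //; exact: measurable_circle. Qed.
Lemma cintgB F G : cintg F -> cintg G -> cintg (fun x => F x - G x).
Proof. by move=> iF iG; rewrite /cintg (_ : _ \o _ = ((EFin \o F) \- (EFin \o G))%E)//; apply: integrableB => //; exact: measurable_circle. Qed.
Lemma cintgZ (c : R) F : cintg F -> cintg (fun x => c * F x).
Proof. by move=> iF; rewrite /cintg (_ : _ \o _ = (fun x => c%:E * (EFin \o F) x)%E)//; apply: integrableZl => //; exact: measurable_circle. Qed.
Lemma eq_cint F G : (forall x, circle x -> F x = G x) -> cint F = cint G.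
Proof. by move=> FG; apply: eq_Rintegral => x; rewrite inE; exact: FG. Qed.

Lemma har_mul_cas F j k : cintg F ->
  har (fun x => F x * cas j x) k = 2^-1 * (har F (j - k) + har F (k - j) + har F (j + k) - har F (- j - k)).
Proof.
move=> iF; rewrite /har.
rewrite (@eq_cint _ (fun x => 2^-1 * (F x * cas (j - k) x + F x * cas (k - j) x + F x * cas (j + k) x - F x * cas (- j - k) x))); last first.
  by move=> x _; rewrite -mulrA cas_mul; ring.
have i n := cintg_cas n iF.
have i1 := cintgD (i (j - k)) (i (k - j)); have i2 := cintgD i1 (i (j + k)).
rewrite cintZ; last exact: cintgB i2 (i _).
by rewrite (cintB i2 (i _)) (cintD i1 (i _)) (cintD (i _) (i _)); ring.
Qed.

Lemma har_cas j k : har (cas j) k = (j == k)%:R.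
Proof.
have i1 : cintg (fun=> 1 : R) by apply: continuous_cintg => x; exact: cvg_cst.
have -> : har (cas j) k = har (fun x => 1 * cas j x) k.
  by rewrite /har; congr (_ * _); apply: eq_cint => x _; rewrite mul1r.
rewrite (har_mul_cas _ _ i1).
have H n : har (fun=> 1) n = (n == 0)%:R.
  rewrite /har (@eq_cint _ (cas n)); last by move=> x _; rewrite mul1r.
  by rewrite cint_cas; case: eqP => _; rewrite ?mulr0// mulVf// gt_eqF// pi2_gt0.
rewrite !H subr_eq0 (subr_eq0 k) (eq_sym k) -opprD oppr_eq0.
by case: (j == k); case: (j + k == 0); rewrite /=; field.
Qed.

Definition syn h x : R := zsum (fun k => h k * cas k x).

Lemma syn_term_le h k x : `|h k * cas k x| <= 2 * `|h k|.
Proof. by rewrite normrM mulrC ler_wpM2r// cas_le2. Qed.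

Lemma summ_syn h x : summ h -> summ (fun k => h k * cas k x).
Proof.
move=> sh; apply: (@le_summ _ _ (fun k => 2 * `|h k|)); last exact: (summZ _ (summ_norm sh)).
by move=> k; apply: (le_trans (syn_term_le h k x)); exact: ler_norm.
Qed.

Lemma continuous_syn h : summ h -> continuous (syn h).
Proof.
move=> sh x; apply/(@cvg_nbhsP _ R^o) => w wx.
apply: (zsum_cvg (g := fun k => 2 * `|h k|)); first exact: (summZ _ (summ_norm sh)).
  by move=> n k; exact: syn_term_le.
move=> k; apply: cvgMr; have /(@cvg_nbhsP _ R^o) H := @continuous_cas k x.
exact: H.
Qed.

Lemma cint_syn h F : summ h -> cintg F ->
  summ (fun k => h k * cint (fun x => cas k x * F x)) /\
  cint (fun x => syn h x * F x) = zsum (fun k => h k * cint (fun x => cas k x * F x)).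
Proof.
move=> sh iF.
have mF : measurable_fun circle F by apply/measurable_EFinP; exact: measurable_int iF.
have iF' : leb.-integrable circle (EFin \o (fun x => `|F x|)).
  by rewrite (_ : _ \o _ = (abse \o (EFin \o F)))//; exact: integrable_abse.
have [||_ H2 H3] := @zsum_integral R _ _ leb _ measurable_circle (fun k x => h k * cas k x * F x) _ _ (summZ 2 (summ_norm sh)) iF'.
- by move=> k; apply: measurable_funM => //; apply: measurable_funM => //; exact: measurable_cas.
- by move=> k x _; rewrite normrM ler_wpM2r// syn_term_le.
have E k : \int[leb]_(x in circle) (h k * cas k x * F x) = h k * cint (fun x => cas k x * F x).
  rewrite -cintZ; last by under eq_fun do rewrite mulrC; exact: cintg_cas.
  by apply: eq_cint => x _; rewrite mulrA.
split; first exact: (eq_summ E H2).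
rewrite -(eq_zsum E) -H3; apply: eq_cint => x _.
rewrite /syn mulrC -zsumZ; last exact: summ_syn.
by apply: eq_zsum => k; rewrite mulrC.
Qed.

Lemma har_syn h k : summ h -> har (syn h) k = h k.
Proof.
move=> sh; rewrite /har (cint_syn sh (continuous_cintg (@continuous_cas k))).2.
have E j : h j * cint (fun x => cas j x * cas k x) = h j * (2 * pi * (j == k)%:R).
  by rewrite -har_cas /har mulVKf// gt_eqF// pi2_gt0.
rewrite (eq_zsum E) (zsum_delta (j := k) _).2; first by rewrite eqxx mulr1 mulrCA mulVf ?mulr1// gt_eqF// pi2_gt0.
by move=> j /negbTE ->; rewrite !mulr0.
Qed.

Lemma har_syn_mul h F k : summ h -> cintg F -> har (fun x => syn h x * F x) k = conv h (har F) k.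
Proof.
move=> sh iF; rewrite /har /conv.
rewrite (@eq_cint _ (fun x => syn h x * (F x * cas k x))); last by move=> x _; rewrite mulrA.
have [s ->] := cint_syn sh (cintg_cas k iF).
rewrite -!zsumZ//; last first.
  apply: eq_summ (summZ (2 * (2 * pi)^-1) s) => j.
  rewrite (@eq_cint _ (fun x => F x * cas k x * cas j x)); last by move=> x _; rewrite mulrC.
  have := har_mul_cas k j iF; rewrite /har => /(congr1 (fun z => 2 * h j * z)).
  rewrite /conv_term /har; move: (cint _) (cint _) => a b; move=> H.
  by have := H; lra.
apply: eq_zsum => j.
rewrite (@eq_cint _ (fun x => F x * cas k x * cas j x)); last by move=> x _; rewrite mulrC.
have := har_mul_cas k j iF; rewrite /har => /(congr1 (fun z => h j * z)).
by rewrite /conv_term /har => H; rewrite mulrCA H; ring.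
Qed.

End Circle.

(** * Functions with vanishing Hartley coefficients *)

Section FourierUniqueness.
Context {R : realType}.
Implicit Types (k j : int) (x : R) (F G : R -> R).
Local Notation leb := (@lebesgue_measure R).

Definition trig_null F : Prop := cintg F /\ forall k, har F k = 0.

(* Contains the trigonometric polynomials and is an algebra closed under bounded
   pointwise limits. *)
Definition null_multiplier G : Prop :=
  [/\ measurable_fun circle G, exists M, forall x, circle x -> `|G x| <= M &
      forall F, trig_null F -> trig_null (fun x => F x * G x)].

Lemma null_cas j : null_multiplier (cas j).
Proof.
split; [exact: measurable_cas|by exists 2 => x _; exact: cas_le2|].
move=> F [iF hF]; split; first exact: cintg_cas.
by move=> k; rewrite har_mul_cas// !hF; ring.
Qed.

Lemma harD F G k : cintg F -> cintg G -> har (fun x => F x + G x) k = har F k + har G k.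
Proof.
move=> iF iG; rewrite /har -mulrDr -cintD; [|exact: cintg_cas|exact: cintg_cas].
by congr (_ * _); apply: eq_cint => x _; rewrite mulrDl.
Qed.

Lemma harB F G k : cintg F -> cintg G -> har (fun x => F x - G x) k = har F k - har G k.
Proof.
move=> iF iG; rewrite /har -mulrBr -cintB; [|exact: cintg_cas|exact: cintg_cas].
by congr (_ * _); apply: eq_cint => x _; rewrite mulrBl.
Qed.

Lemma harZ c F k : cintg F -> har (fun x => c * F x) k = c * har F k.
Proof.
move=> iF; rewrite /har [RHS]mulrCA -(cintZ _ (cintg_cas k iF)).
by congr (_ * _); apply: eq_cint => x _; rewrite mulrA.
Qed.

Lemma null_const c : null_multiplier (fun=> c).
Proof.
split; [exact: measurable_cst|by exists (`|c|)|] => F [iF hF].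
have E : (fun x => F x * c) = (fun x => c * F x) by apply/funext => x; rewrite mulrC.
by rewrite E; split; [exact: cintgZ|move=> k; rewrite harZ// hF mulr0].
Qed.

Lemma null_add G1 G2 : null_multiplier G1 -> null_multiplier G2 ->
  null_multiplier (fun x => G1 x + G2 x).
Proof.
move=> [m1 [M1 b1] H1] [m2 [M2 b2] H2]; split; first exact: measurable_funD.
  exists (M1 + M2) => x cx; apply: (le_trans (ler_normD _ _)).
  by apply: lerD; [exact: b1|exact: b2].
move=> F nF; have [i1 h1] := H1 F nF; have [i2 h2] := H2 F nF.
have E : (fun x => F x * (G1 x + G2 x)) = (fun x => F x * G1 x + F x * G2 x).
  by apply/funext => x; rewrite mulrDr.
by rewrite E; split; [exact: cintgD|move=> k; rewrite harD// h1 h2 addr0].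
Qed.

Lemma null_mul G1 G2 : null_multiplier G1 -> null_multiplier G2 ->
  null_multiplier (fun x => G1 x * G2 x).
Proof.
move=> [m1 [M1 b1] H1] [m2 [M2 b2] H2]; split; first exact: measurable_funM.
  exists (M1 * M2) => x cx; rewrite normrM.
  by apply: ler_pM => //; [exact: b1|exact: b2].
move=> F nF; have := H2 _ (H1 F nF).
by rewrite (_ : (fun x => F x * G1 x * G2 x) = (fun x => F x * (G1 x * G2 x)))//; apply/funext => x; rewrite mulrA.
Qed.

Lemma null_scale c G : null_multiplier G -> null_multiplier (fun x => c * G x).
Proof. exact: null_mul (null_const c). Qed.

Lemma null_lim (G : nat -> R -> R) G' M : (forall n, null_multiplier (G n)) ->
  (forall n x, circle x -> `|G n x| <= M) ->
  (forall x, circle x -> G n x @[n --> \oo] --> G' x) -> null_multiplier G'.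
Proof.
move=> nG GM cG.
have mG' : measurable_fun circle G'.
  by apply: (measurable_fun_cvg (h := G)) => // n; have [] := nG n.
have G'M x : circle x -> `|G' x| <= M.
  move=> cx; apply: (cvgr_to_le (cvg_norm (cG x cx))).
  by apply: nearW => n; exact: GM.
split=> //; first by exists M.
move=> F nF; have [iF hF] := nF; have iFG' := cintg_mul_bounded iF mG' G'M.
split=> // k; rewrite /har.
have mF : measurable_fun circle F by apply/measurable_EFinP; exact: measurable_int iF.
have mc := measurable_circle (R := R).
have iM : leb.-integrable circle (EFin \o (fun x => M * 2 * `|F x|)).
  rewrite (_ : _ \o _ = (fun x => (M * 2)%:E * (abse \o (EFin \o F)) x)%E)//; apply: integrableZl => //.
  exact: integrable_abse.
have [||||_ _ H3] := @dominated_convergence _ _ R leb circle mc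
  (fun n x => (F x * G n x * cas k x)%:E) (fun x => (F x * G' x * cas k x)%:E)
  (EFin \o (fun x => M * 2 * `|F x|)) _ _ _ iM _.
- move=> n; apply/measurable_EFinP; apply: measurable_funM; last exact: measurable_cas.
  by apply: measurable_funM => //; have [] := nG n.
- apply/measurable_EFinP; apply: measurable_funM; last exact: measurable_cas.
  exact: measurable_funM.
- apply: aeW => x Dx; apply: cvg_EFin; first by apply: nearW => n.
  by apply: cvgMl; apply: cvgMr; exact: cG.
- apply: aeW => x n Dx /=; rewrite lee_fin !normrM -[leRHS]mulrC -mulrA.
  by rewrite ler_wpM2l// ler_pM ?GM ?cas_le2.
have H4 : cint (fun x => F x * G n x * cas k x) @[n --> \oo] --> cint (fun x => F x * G' x * cas k x).
  move: H3; rewrite (_ : (\int[leb]_(x in circle) (F x * G' x * cas k x)%:E)%E = (cint (fun x => F x * G' x * cas k x))%:E).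
    by move=> /fine_cvg; apply.
  by rewrite fineK//; apply: integrable_fin_num => //; exact: cintg_cas.
have H5 n : cint (fun x => F x * G n x * cas k x) = 0.
  have [_ _ /(_ F nF)[_ /(_ k)]] := nG n; rewrite /har => /eqP.
  by rewrite mulf_eq0 invr_eq0 gt_eqF ?pi2_gt0//= => /eqP.
suff -> : cint (fun x => F x * G' x * cas k x) = 0 by rewrite mulr0.
have H6 : cint (fun x => F x * G n x * cas k x) @[n --> \oo] --> (0 : R).
  by under eq_fun do rewrite H5; exact: cvg_cst.
exact: (cvg_unique _ H4 H6).
Qed.

Lemma null_sum (G : nat -> R -> R) n : (forall n, null_multiplier (G n)) ->
  null_multiplier (fun x => \sum_(0 <= i < n) G i x).
Proof.
move=> nG; elim: n => [|n IH].
  by under eq_fun do rewrite big_nil; exact: null_const.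
by under eq_fun do rewrite big_nat_recr//=; exact: null_add.
Qed.

Lemma null_pow G n : null_multiplier G -> null_multiplier (fun x => G x ^+ n).
Proof.
move=> nG; elim: n => [|n IH]; first exact: null_const.
by under eq_fun do rewrite exprS; exact: null_mul.
Qed.

(** The Taylor polynomials of the exponential are multipliers, and on the circle they are bounded by
    exp |M|. *)
Lemma null_exp G : null_multiplier G -> null_multiplier (fun x => expR (G x)).
Proof.
move=> nG; have [_ [M GM] _] := nG.
apply: (@null_lim (fun n x => series (exp_coeff (G x)) n) _ (expR `|M|)).
- move=> n; apply: (@null_sum (fun i x => exp_coeff (G x) i)) => i.
  rewrite /exp_coeff /=; under eq_fun do rewrite mulrC.
  by apply: null_scale; exact: null_pow.
- move=> n x cx; have GM' : `|G x| <= `|M| by apply: (le_trans (GM x cx)); exact: ler_norm.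
  apply: (@le_trans _ _ (series (exp_coeff `|M|) n)).
    rewrite /series /=; apply: (le_trans (ler_norm_sum _ _ _)); apply: ler_sum => i _.
    rewrite /exp_coeff /= normrM normrX (ger0_norm (x := _^-1)) ?invr_ge0//.
    by rewrite ler_wpM2r ?invr_ge0// lerXn2r ?nnegrE.
  apply: nondecreasing_cvgn_le; last exact: is_cvg_series_exp_coeff.
  apply/nondecreasing_seqP => i; rewrite /series /= big_nat_recr//= lerDl.
  exact: exp_coeff_ge0.
- by move=> x cx; exact: is_cvg_series_exp_coeff.
Qed.

(** exp (- exp (- n G)) tends to 1, exp (-1) or 0 according to the sign of [G]. A second limit, of
    exp (- n (1 - f')), sends the value exp (-1) to 0 and leaves an indicator function. *)
Lemma null_step G : null_multiplier G -> null_multiplier (fun x => (0 < G x)%R%:R).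
Proof.
move=> nG.
pose f n x := expR (- expR (- (n%:R * G x))).
have nf n : null_multiplier (f n).
  apply: null_exp; under eq_fun do rewrite -mulN1r; apply: null_scale; apply: null_exp.
  by under eq_fun do rewrite -mulN1r; apply: null_scale; exact: null_scale.
pose f' x : R := if 0 < G x then 1 else if G x == 0 then expR (-1) else 0.
have cexp (u : nat -> R) : u n @[n --> \oo] --> +oo -> expR (- u n) @[n --> \oo] --> (0 : R).
  by move=> cu; exact: cvg_comp cu (@cvgr_expR R).
have cn (g : R) : 0 < g -> (n%:R * g) @[n --> \oo] --> +oo.
  by move=> g0; exact: cvg_comp (@cvgr_idn R) (gt0_cvgMly g0 cvg_id).
have cf x : f n x @[n --> \oo] --> f' x.
  rewrite /f /f'; case: ltgtP => [g0|g0|g0].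
  - rewrite -[X in _ --> X](expR0) -[X in _ --> expR X]oppr0.
    have H : - expR (- (n%:R * G x)) @[n --> \oo] --> (- 0 : R) by apply: cvgN; apply: cexp; exact: cn.
    exact: (cvg_comp _ _ H (@continuous_expR R (- 0))).
  - apply/cvgrPdist_lt => e e0.
    have := cexp _ (cn (- G x) _); rewrite oppr_gt0 => /(_ g0) /cvgrPdist_lt /(_ _ e0).
    apply: filterS => n /=; rewrite !sub0r !normrN; apply: le_lt_trans.
    rewrite !ger0_norm ?expR_ge0// ler_expR lerN2 mulrN.
    by apply: le_trans (expR_ge1Dx _); rewrite lerDr.
  - by rewrite -g0 ?eqxx; under eq_fun do rewrite mulr0 oppr0 expR0; exact: cvg_cst.
have nf' : null_multiplier f'.
  apply: (@null_lim f _ 1) => // n x _; rewrite ger0_norm ?expR_ge0// -expR0 ler_expR oppr_le0.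
  exact: expR_ge0.
have e1 : expR (-1) < 1 :> R by rewrite -expR0 ltr_expR oppr_lt0.
apply: (@null_lim (fun n x => expR (- (n%:R * (1 - f' x)))) _ 1).
- move=> n; apply: null_exp; under eq_fun do rewrite -mulN1r; apply: null_scale; apply: null_scale.
  by under eq_fun do rewrite -mulN1r; apply: null_add; [exact: null_const|exact: null_scale].
- move=> n x _; rewrite ger0_norm ?expR_ge0// -[leRHS]expR0 ler_expR oppr_le0 mulr_ge0//.
  rewrite subr_ge0 /f'; case: ifP => _; first exact: lexx.
  by case: ifP => _; [exact: ltW|exact: ler01].
- move=> x _; rewrite /f'; case: ifP => _.
    by under eq_fun do rewrite subrr mulr0 oppr0 expR0; exact: cvg_cst.
  apply: cexp; apply: cn; rewrite subr_gt0; by case: ifP.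
Qed.

Lemma null_cos_shift c : null_multiplier (fun x => cos (x - c)).
Proof.
have -> : (fun x => cos (x - c)) =
    (fun x => (2^-1 * (cos c + sin c)) * cas 1 x + (2^-1 * (cos c - sin c)) * cas (-1) x).
  apply/funext => x; rewrite /cas cosB mulrNz !mulr1z mulN1r mul1r cosN sinN; by field.
by apply: null_add; apply: null_scale; exact: null_cas.
Qed.

(** If |z - c| exceeds pi, it is reflected to 2 pi - |z - c|, which is still at least [d]; on
    [0, pi] the cosine is decreasing. *)
Lemma cos_arc c d z : - pi <= c - d -> c + d <= pi -> 0 < d -> circle z ->
  (0 < cos (z - c) - cos d :> R) = (c - d < z < c + d).
Proof.
move=> cd1 cd2 d0; rewrite /circle /= in_itv/= => /andP[z1 z2].
rewrite subr_gt0.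
have dpi : d <= pi by lra.
have -> : (c - d < z < c + d) = (`|z - c| < d) by rewrite ltr_distl.
have -> : cos (z - c) = cos `|z - c| by rewrite cos_norm.
have w0 := normr_ge0 (z - c); have w2 : `|z - c| <= 2 * pi - d.
  by rewrite ler_norml; apply/andP; split; lra.
move: w0 w2; move: `|z - c| => w w0 w2.
have [wpi|wpi] := leP w pi.
  by rewrite ltr_cos//; rewrite in_itv/=; apply/andP; split; lra.
have -> : cos w = cos (2 * pi - w).
  rewrite -[RHS]cosN opprB -(cosD2pi (w - 2 * pi)); congr cos; by rewrite -mulr_natl; ring.
rewrite ltr_cos//; last 2 first.
- by rewrite in_itv/=; apply/andP; split; lra.
- by rewrite in_itv/=; apply/andP; split; lra.
by apply/idP/idP => ?; exfalso; lra.
Qed.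

(** The interval is the arc where a trigonometric polynomial of degree 1 is positive, so [null_step]
    applies to that polynomial. *)
Lemma null_interval x y : - pi <= x -> x < y -> y <= pi ->
  null_multiplier (fun z => (x < z < y)%R%:R).
Proof.
move=> x1 xy y1; pose c := (x + y) / 2; pose d := (y - x) / 2.
have nS : null_multiplier (fun z => (0 < cos (z - c) - cos d)%R%:R).
  by apply: null_step; apply: null_add; [exact: null_cos_shift|exact: null_const].
apply: (@null_lim (fun _ z => (0 < cos (z - c) - cos d)%R%:R) _ 1) => //.
  by move=> _ z _; case: (_ < _); rewrite ?normr1// normr0.
move=> z cz; rewrite cos_arc//; rewrite /c /d; try lra.
have -> : (x + y) / 2 - (y - x) / 2 = x by field.
have -> : (x + y) / 2 + (y - x) / 2 = y by field.
exact: cvg_cst.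
Qed.

Lemma trig_null_interval F x y : trig_null F -> - pi <= x -> x < y -> y <= pi ->
  \int[leb]_(z in `]x, y[) F z = 0.
Proof.
move=> nF x1 xy y1; have [_ _ /(_ F nF)[_ /(_ 0)]] := null_interval x1 xy y1.
rewrite /har => /eqP; rewrite mulf_eq0 invr_eq0 gt_eqF ?pi2_gt0//= => /eqP H.
have S : `]x, y[ `<=` circle.
  move=> z; rewrite /circle /= !in_itv/= => /andP[zx zy]; apply/andP; split; lra.
have -> : `]x, y[%classic = `]x, y[ `&` circle by apply/esym/setIidPl.
rewrite Rintegral_mkcondl -[RHS]H; apply: eq_cint => z cz.
rewrite /cas mulr0z mul0r cos0 sin0 addr0 mulr1 patchE.
case: ifPn; first by rewrite inE/= in_itv/= => ->; rewrite mulr1.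
by rewrite notin_setE/= in_itv/= => /negP/negbTE ->; rewrite mulr0.
Qed.

(** All integrals over intervals vanish, hence the primitive [G] is constant inside the circle; by
    Lebesgue's differentiation theorem its derivative is almost everywhere the function. *)
Lemma trig_null_ae F : trig_null F -> circle_eq F (fun=> 0).
Proof.
move=> nF; have [iF _] := nF; have mc := measurable_circle (R := R).
pose f := F \_ circle.
have lf : locally_integrable [set: R] f by exact: integrable_locally_restrict.
have intf : leb.-integrable [set: R] (EFin \o f).
  by have /integrable_mkcond := iF; rewrite restrict_EFin; apply.
have ity (y : R) : leb.-integrable `]-oo, y] (EFin \o f).
  by apply: integrableS intf.
have := FTC1Ny ity lf; pose G (x : R) := \int[leb]_(t in `]-oo, x]) f t; rewrite -/G => aeG.
have Gz x y : - pi < x -> x < y -> y < pi -> G y = G x.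
  move=> x1 xy y1; apply/eqP; rewrite -subr_eq0; apply/eqP.
  rewrite /G Rintegral_itvB; [|exact: ity|by rewrite bnd_simp|by rewrite bnd_simp ltW].
  rewrite -Rintegral_itv_bndo_bndc; last by apply: integrableS intf.
  rewrite -[RHS](trig_null_interval nF (ltW x1) xy (ltW y1)).
  apply: eq_Rintegral => z; rewrite inE/= in_itv/= => /andP[zx zy].
  by rewrite /f patchE mem_set// /circle/= in_itv/=; apply/andP; split; lra.
(* [Gz] concerns interior points only; the two end points form a null set. *)
have npi : \forall x \ae leb, x != - pi /\ x != pi.
  have N c : leb.-negligible [set c] by exists [set c]; split=> //; exact: lebesgue_measure_set1.
  apply: negligibleS (negligibleU (N (- pi)) (N pi)) => z /=.
  by move=> H; apply: contrapT => /not_orP[/eqP h1 /eqP h2]; apply: H.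
have ff : Filter (almost_everywhere leb) by exact: ae_filter_ringOfSetsType.
apply: (@filterS2 _ _ ff _ _ _ _ aeG npi) => x Gx [xp xq] cx.
move: (cx); rewrite /circle/= in_itv/= => /andP[]; rewrite le_eqVlt eq_sym (negbTE xp)/= => x1.
rewrite le_eqVlt (negbTE xq)/= => x2.
have [dG] := Gx.
rewrite derive1E => D.
have <- : f x = F x by rewrite /f patchE mem_set.
rewrite -D.
have H : is_derive x 1 G 0.
  apply: near_eq_is_derive (is_derive_cst (G x) x 1); near=> z.
  have z1 : - pi < z by near: z; exact: lt_nbhsr.
  have z2 : z < pi by near: z; exact: lt_nbhsl.
  have [zx|zx|->//] := ltgtP z x; [by rewrite (@Gz z x)|by rewrite (@Gz x z)].
by have [_ ->] := H.
Unshelve. all: by end_near. Qed.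

End FourierUniqueness.

(** * Rapidly decreasing coefficients *)

Section RapidDecay.
Context {R : realType}.
Implicit Types (h c : int -> R) (k j : int) (p : R).

(** Telescoping: the sum of m^(-2) over 1 <= m <= n is at most 2 (1 - 1 / (n + 1)). *)
Lemma summ_inv_sqr : summ (fun k => wt (-2) k : R).
Proof.
have E n : wt (-2) n.+1%:Z = (n.+1%:R ^- 2 : R).
  by rewrite wtE// powRN /zabs /= -powR_mulrn.
have B n : \sum_(0 <= m < n) (wt (-2) m.+1%:Z : R) <= 2 * (1 - n.+1%:R^-1).
  elim: n => [|n IH]; first by rewrite big_nil invr1 subrr mulr0.
  rewrite big_nat_recr//= E; apply: (le_trans (lerD IH (lexx _))).
  have n1 : 1 <= n.+1%:R :> R by rewrite ler1n.
  have n0 : 0 < n.+1%:R :> R by rewrite ltr0n.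
  rewrite -[n.+2%:R]natr1; move: n1 n0; move: (n.+1%:R : R) => x x1' x0.
  have x1 : 0 < x + 1 by lra.
  rewrite -subr_ge0 (_ : _ - _ = (x - 1) / (x ^+ 2 * (x + 1))); last by field; lra.
  rewrite divr_ge0 ?mulr_ge0 ?exprn_ge0 ?(ltW x0) ?(ltW x1)//.
  by rewrite subr_ge0.
have B2 n : \sum_(0 <= m < n) (wt (-2) m.+1%:Z : R) <= 2.
  by apply: (le_trans (B n)); rewrite -[leRHS]mulr1 ler_wpM2l// gerBl.
have S : (\sum_(0 <= n <oo) (wt (-2) (Posz n.+1) : R)%:E <= 2%:E)%E.
  apply: lime_le; first by apply: is_cvg_nneseries => n _ _; rewrite lee_fin wt_ge0.
  by apply: nearW => n; rewrite sumEFin lee_fin.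
suff : (\esum_(k in [set: int]) (wt (-2) k : R)%:E <= (2 + 2)%:E)%E.
  by move=> /(summ_esum_le (fun k => wt_ge0 _ k))[].
rewrite esum_int_split; last by move=> j; rewrite lee_fin wt_ge0.
rewrite EFinD; apply: leeD; last first.
  apply: le_trans S; apply: lee_nneseries => // n _ _; rewrite ?lee_fin ?wt_ge0//.
apply: lime_le; first by apply: is_cvg_nneseries => n _ _; rewrite lee_fin wt_ge0.
apply: nearW => n; rewrite sumEFin lee_fin; case: n => [|n].
  by rewrite big_nil.
by rewrite big_nat_recl// wt0 add0r.
Qed.

(** Nothing is asked at k = 0, where every weight [wt p] vanishes. *)
Definition rapid h : Prop := forall p, exists C, forall k, wt p k * `|h k| <= C.

Lemma rapid_le h c : (forall k, `|h k| <= `|c k|) -> rapid c -> rapid h.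
Proof.
move=> hc rc p; have [C H] := rc p; exists C => k; apply: le_trans (H k).
by rewrite ler_wpM2l ?wt_ge0.
Qed.

Lemma rapid_bound h p : rapid h -> exists2 C, 0 <= C & forall k, `|h k| <= C * wt (- p) k + (k == 0)%:R * `|h 0|.
Proof.
move=> rh; have [C H] := rh p; exists `|C| => // k.
have [->|k0] := eqVneq k 0; first by rewrite wt0 mulr0 add0r mul1r.
rewrite mul0r addr0 -[leLHS]mul1r -(wt00 k0) -[X in wt X _](subrr p) wtD (mulrC (wt p k)) -mulrA mulrC.
by rewrite ler_wpM2r ?wt_ge0// (le_trans (H k))// ler_norm.
Qed.

Lemma rapid_summ h : rapid h -> summ h.
Proof.
move=> /(rapid_bound 2)[C C0 H].
have [|s _] := @zsum_delta R (fun k => (k == 0)%:R * `|h 0|) 0.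
  by move=> k /negbTE ->; rewrite mul0r.
apply: (le_summ _ (summD (summZ C summ_inv_sqr) s)) => k.
by apply: (le_trans (H k)); exact: ler_norm.
Qed.

Lemma rapid_wt h p : rapid h -> rapid (fun k => wt p k * h k).
Proof.
move=> rh q; have [C H] := rh (q + p); exists C => k; apply: le_trans (H k).
by rewrite normrM (ger0_norm (wt_ge0 _ _)) mulrA -wtD.
Qed.

Lemma rapidN h : rapid h -> rapid (fun k => h (- k)).
Proof. by move=> rh p; have [C H] := rh p; exists C => k; rewrite -wtN. Qed.

Lemma rapidZ h (c : R) : rapid h -> rapid (fun k => c * h k).
Proof.
move=> rh p; have [C H] := rh p; exists (`|c| * C) => k.
by rewrite normrM mulrCA ler_wpM2l.
Qed.

Lemma rapidD h c : rapid h -> rapid c -> rapid (fun k => h k + c k).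
Proof.
move=> rh rc p; have [C H] := rh p; have [C' H'] := rc p; exists (C + C') => k.
apply: (le_trans (ler_wpM2l (wt_ge0 p k) (ler_normD _ _))); rewrite mulrDr.
exact: lerD.
Qed.

Lemma rapid_mulZ h : rapid h -> rapid (fun k => k%:~R * h k).
Proof.
move=> /(rapid_wt 1); apply: rapid_le => k.
by rewrite !normrM norm_intr wt1 (ger0_norm (zabs_ge0 _)).
Qed.

Lemma rapid_zabs h : rapid h -> rapid (fun k => zabs k * h k).
Proof. by move=> /(rapid_wt 1); apply: rapid_le => k; rewrite wt1. Qed.

End RapidDecay.

(** * Fourier coefficients, Sobolev norms and multipliers in Hartley coefficients *)

Section Coefficients.
Context {R : realType}.
Implicit Types (f g phi : R -> R) (h : int -> R) (k j : int) (s t x : R).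
Local Notation leb := (@lebesgue_measure R).

Lemma L2_cintg f : L2 f -> cintg f.
Proof.
move=> [mf i2]; have mc := measurable_circle (R := R).
have i1 : cintg (fun x => 1 + f x ^+ 2).
  by apply: cintgD => //; apply: continuous_cintg => x; exact: cvg_cst.
apply: (le_integrable _ _ _ i1) => //; first exact/measurable_EFinP.
move=> x _ /=; rewrite lee_fin.
rewrite [leRHS]ger0_norm ?addr_ge0 ?sqr_ge0// ler_norml.
by have := sqr_ge0 (f x - 1); have := sqr_ge0 (f x + 1); move: (f x) => y *; apply/andP; split; nra.
Qed.

Lemma continuous_L2 f : continuous f -> L2 f.
Proof.
move=> cf; split; first by apply: measurable_funTS; exact: continuous_measurable_fun.
by apply: continuous_cintg => x; apply: (@continuousM _ _ f f); exact: cf.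
Qed.

Lemma L2_sub f g : L2 f -> L2 g -> L2 (fun x => f x - g x).
Proof.
move=> [mf i2] [mg j2]; split; first exact: measurable_funB.
have mc := measurable_circle (R := R).
apply: (le_integrable _ _ _ (cintgD (cintgZ 2 i2) (cintgZ 2 j2))) => //.
  by apply/measurable_EFinP; apply: measurable_funX; exact: measurable_funB.
move=> x _ /=; rewrite lee_fin ger0_norm ?sqr_ge0//; apply: le_trans (ler_norm _).
by have := sqr_ge0 (f x + g x); move: (f x) (g x) => y z *; nra.
Qed.

Lemma eq_har f g k : (forall x, circle x -> f x = g x) -> har f k = har g k.
Proof. by move=> fg; rewrite /har; congr (_ * _); apply: eq_cint => x cx; rewrite fg. Qed.

Lemma circle_eq_cint f g phi : measurable_fun circle f -> measurable_fun circle g ->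
  measurable_fun circle phi -> circle_eq f g -> cint (fun x => f x * phi x) = cint (fun x => g x * phi x).
Proof.
move=> mf mg mp fg; rewrite /cint /Rintegral; congr fine; have mc := measurable_circle (R := R).
apply: ae_eq_integral => //.
- by apply/measurable_EFinP; exact: measurable_funM.
- by apply/measurable_EFinP; exact: measurable_funM.
have ff : Filter (almost_everywhere leb) by exact: ae_filter_ringOfSetsType.
by move: fg; apply: filterS => x fg cx; rewrite fg.
Qed.

Lemma circle_eq_har f g k : measurable_fun circle f -> measurable_fun circle g ->
  circle_eq f g -> har f k = har g k.
Proof. by move=> mf mg fg; rewrite /har (circle_eq_cint mf mg _ fg)//; exact: measurable_cas. Qed.

Lemma har_inj f g : cintg f -> cintg g -> (forall k, har f k = har g k) -> circle_eq f g.
Proof.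
move=> iF iG H.
have : trig_null (fun x => f x - g x).
  by split; [exact: cintgB|move=> k; rewrite harB// H subrr].
move=> /trig_null_ae.
have ff : Filter (almost_everywhere leb) by exact: ae_filter_ringOfSetsType.
by apply: filterS => x fg cx; apply/eqP; rewrite -subr_eq0 fg.
Qed.

Lemma zero_mean_har f : zero_mean f <-> har f 0 = 0.
Proof.
rewrite /har (@eq_cint _ _ f); last by move=> x _; rewrite /cas mul0r cos0 sin0 addr0 mulr1.
split=> [H|/eqP]; first by rewrite /cint H mulr0.
by rewrite mulf_eq0 invr_eq0 gt_eqF ?pi2_gt0//= => /eqP.
Qed.

Lemma fourierE f k : cintg f ->
  fourier f k = Complex ((har f k + har f (- k)) / 2) ((har f (- k) - har f k) / 2).
Proof.
move=> iF; rewrite /fourier -!/(cint _).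
have i n := cintg_cas n iF.
have Ec : cint (fun x => f x * cos (k%:~R * x)) = 2^-1 * (cint (fun x => f x * cas k x) + cint (fun x => f x * cas (- k) x)).
  rewrite -cintD// -cintZ; last exact: cintgD.
  by apply: eq_cint => x _; rewrite /cas rmorphN mulNr cosN sinN; field.
have Es : cint (fun x => f x * sin (k%:~R * x)) = 2^-1 * (cint (fun x => f x * cas k x) - cint (fun x => f x * cas (- k) x)).
  rewrite -cintB// -cintZ; last exact: cintgB.
  by apply: eq_cint => x _; rewrite /cas rmorphN mulNr cosN sinN; field.
rewrite Ec Es /har; move: ((2 * pi)^-1) (cint (fun x => f x * cas k x)) (cint (fun x => f x * cas (- k) x)) => c y z.
by congr Complex; field.
Qed.

Definition sobw s k : R := (1 + k%:~R ^+ 2) `^ s.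

Lemma sobwN s k : sobw s (- k) = sobw s k.
Proof. by rewrite /sobw rmorphN sqrrN. Qed.
Lemma sobw_ge0 s k : 0 <= sobw s k. Proof. exact: powR_ge0. Qed.

Lemma normc_fourier f k : cintg f ->
  ComplexField.Normc.normc (fourier f k) ^+ 2 = (har f k ^+ 2 + har f (- k) ^+ 2) / 2.
Proof.
move=> iF; rewrite fourierE// /ComplexField.Normc.normc sqr_sqrtr ?addr_ge0 ?sqr_ge0//.
by field.
Qed.

Lemma esum_opp (F : int -> \bar R) : (forall k, 0 <= F k)%E ->
  (\esum_(k in [set: int]) F (- k)%R = \esum_(k in [set: int]) F k)%E.
Proof.
move=> F0; rewrite [RHS](reindex_esum [set: int] [set: int] (@GRing.opp int))//.

Qed.

(** The squared modulus of the Fourier coefficient is the mean of the squared Hartley coefficients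
    at [k] and - k; as the weight is even, the mean disappears in the sum. *)
Lemma sobolev_normE s f : cintg f ->
  sobolev_norm s f = ((\esum_(k in [set: int]) (sobw s k * har f k ^+ 2)%:E) `^ 2^-1)%E.
Proof.
move=> iF; rewrite /sobolev_norm; congr (_ `^ _)%E.
under eq_esum => k _ do rewrite normc_fourier//.
pose G k : \bar R := (2^-1 * (sobw s k * har f k ^+ 2))%:E.
have G0 k : (0 <= G k)%E by rewrite lee_fin mulr_ge0// mulr_ge0 ?sobw_ge0 ?sqr_ge0.
have -> : (\esum_(k in [set: int]) ((1 + k%:~R ^+ 2) `^ s * ((har f k ^+ 2 + har f (- k) ^+ 2) / 2))%:E =
    \esum_(k in [set: int]) (G k + G (- k)%R))%E.
  apply: eq_esum => k _; rewrite /G -EFinD sobwN; congr EFin; rewrite /sobw; ring.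
rewrite esumD// esum_opp// -esumD//; apply: eq_esum => k _; rewrite /G -EFinD; congr EFin; by field.
Qed.

Definition sob s h : R := zsum (fun k => sobw s k * h k ^+ 2).

Lemma sob_term_ge0 s h k : 0 <= sobw s k * h k ^+ 2.
Proof. by rewrite mulr_ge0 ?sobw_ge0 ?sqr_ge0. Qed.

Lemma sob_ge0 s h : 0 <= sob s h. Proof. by apply: zsum_ge0 => k; exact: sob_term_ge0. Qed.

Lemma sobolev_norm_fin s f : cintg f -> summ (fun k => sobw s k * har f k ^+ 2) ->
  sobolev_norm s f = (sob s (har f) `^ 2^-1)%:E.
Proof.
move=> iF sf; rewrite sobolev_normE// -ge0_EFin_zsum//; first by move=> k; exact: sob_term_ge0.
Qed.

Lemma sobolev_norm_lty s f : cintg f ->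
  (sobolev_norm s f < +oo)%E <-> summ (fun k => sobw s k * har f k ^+ 2).
Proof.
move=> iF; split=> [|sf]; last by rewrite sobolev_norm_fin// ltry.
rewrite sobolev_normE// => H; apply/summP.
rewrite (eq_esum (b := fun k => (sobw s k * har f k ^+ 2)%:E)); last first.
  by move=> k _; rewrite ger0_norm// sob_term_ge0.
by apply: lty_poweRy H; rewrite invr_eq0.
Qed.

(** The real part of [fourier] minus its imaginary part is [har], and the symbol is real. *)
Lemma Lambda_har s f g : cintg f -> Lambda s f g -> forall k, har g k = zabs k `^ s * har f k.
Proof.
move=> iF [L H] k; have iG := L2_cintg L.
have := H k; rewrite !fourierE//= => -[]; rewrite !mul0r subr0 addr0 -zabsE => E1 E2.
have := congr1 (fun z => z - ((har g (- k) - har g k) / 2)) E1; rewrite {2}E2.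
by move=> E; lra.
Qed.

Lemma har_Lambda s f g : cintg f -> L2 g -> (forall k, har g k = zabs k `^ s * har f k) -> Lambda s f g.
Proof.
move=> iF L H; split=> // k; rewrite !fourierE//; last exact: L2_cintg.
rewrite !H zabsN -zabsE; congr Complex; rewrite /=; ring.
Qed.

End Coefficients.

(** * Test functions, Parseval's identity and weak derivatives *)

Section TestFunctions.
Context {R : realType}.
Implicit Types (f g phi F G : R -> R) (h : int -> R) (k j : int) (s t x : R).
Local Notation leb := (@lebesgue_measure R).

Lemma derivable_continuous F : (forall x, derivable F x 1) -> continuous F.
Proof. by move=> dF x; apply: differentiable_continuous; apply/derivable1_diffP. Qed.

Lemma test_derivable phi x : test_function phi -> derivable phi x 1.
Proof. by move=> [/(_ 0%N)]. Qed.

Lemma test_is_derive phi x : test_function phi -> is_derive x 1 phi (derive1 phi x).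
Proof. by move=> tp; apply: DeriveDef; [exact: test_derivable|rewrite derive1E]. Qed.

Lemma test_continuous phi : test_function phi -> continuous phi.
Proof. by move=> tp; apply: derivable_continuous => x; exact: test_derivable. Qed.

Lemma test_derive1 phi : test_function phi -> test_function (derive1 phi).
Proof.
move=> tp; have [dp pp] := tp; split=> [n x|x].
  have -> : derive1n n (derive1 phi) = derive1n n.+1 phi.
    by elim: n => [//|n IH]; rewrite !derive1nS IH derive1nS.
  exact: dp.
have H : is_derive x 1 phi (derive1 phi (x + 2 * pi)).
  have D : is_derive x 1 (fun y : R => y + 2 * pi) 1.
    by apply: is_derive_eq; rewrite addr0.
  have := @is_derive1_comp R phi (fun y => y + 2 * pi) x _ _ (test_is_derive (x + 2 * pi) tp) D.
  by rewrite mulr1 (_ : phi \o _ = phi)//; apply/funext => y /=; rewrite pp.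
by rewrite [RHS]derive1E; have [_ ->] := H.
Qed.

Lemma cint_parts F G f g : continuous f -> continuous g ->
  (forall x, is_derive x 1 F (f x)) -> (forall x, is_derive x 1 G (g x)) ->
  F pi * G pi = F (- pi) * G (- pi) ->
  cint (fun x => f x * G x) = - cint (fun x => F x * g x).
Proof.
move=> cf cg dF dG e.
have cF : continuous F by apply: derivable_continuous => x; have [] := dF x.
have cG : continuous G by apply: derivable_continuous => x; have [] := dG x.
have c1 : continuous (fun x => f x * G x) by move=> x; apply: cvgM; [exact: cf|exact: cG].
have c2 : continuous (fun x => F x * g x) by move=> x; apply: cvgM; [exact: cF|exact: cg].
have c3 : continuous (fun x => f x * G x + F x * g x) by move=> x; apply: cvgD; [exact: c1|exact: c2].
have d x : is_derive x 1 (fun x => F x * G x) (f x * G x + F x * g x).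
  by have d1 := dF x; have d2 := dG x; apply: is_derive_eq; rewrite /GRing.scale/=; ring.
apply/eqP; rewrite -addr_eq0 -cintD; [|exact: continuous_cintg|exact: continuous_cintg].
by rewrite (cint_FTC c3 d) e subrr.
Qed.

Lemma periodicN_pi phi : (forall x, phi (x + 2 * pi) = phi x) -> phi pi = phi (- pi).
Proof. by move=> pp; rewrite -(pp (- pi)); congr phi; ring. Qed.

Lemma cas_periodic k x : cas k (x + 2 * pi) = cas k x :> R.
Proof.
have s0 := @sin_kpi R k.
have c0 : cos (k%:~R * pi) ^+ 2 = 1 :> R by rewrite -[RHS](cos2Dsin2 (k%:~R * pi)) s0 expr0n addr0.
rewrite /cas (_ : k%:~R * (x + 2 * pi) = k%:~R * x + (k%:~R * pi + k%:~R * pi)); last by ring.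
rewrite !(cosD, sinD) s0 !mulr0 !mul0r !subr0 !addr0 -expr2 c0 !mulr1; ring.
Qed.

Lemma derive1_cas k : derive1 (cas k) = (fun x => k%:~R * cas (- k) x) :> (R -> R).
Proof. by apply/funext => x; rewrite derive1E; have [_ ->] := is_derive_cas k x. Qed.

Lemma cas_test k : test_function (cas k : R -> R).
Proof.
split=> [n x|x]; last exact: cas_periodic.
have [c [j ->]] : exists c j, derive1n n (cas k) = (fun x : R => c * cas j x).
  elim: n => [|n [c [j IH]]].
    by exists 1, k; apply/funext => y; rewrite mul1r.
  exists (c * j%:~R), (- j); rewrite derive1nS IH; apply/funext => y.
  rewrite derive1E; have d := is_derive_cas j y.
  have [_ ->] : is_derive y 1 (fun x => c * cas j x) (c * (j%:~R * cas (- j) y)).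
    by apply: is_derive_eq.
  by rewrite mulrA.
by have d := is_derive_cas j x; have [] : is_derive x 1 (fun x => c * cas j x) (c * (j%:~R * cas (- j) x)) by apply: is_derive_eq.
Qed.

Lemma har_derive1 phi k : test_function phi -> har (derive1 phi) k = - k%:~R * har phi (- k).
Proof.
move=> tp; have tp' := test_derive1 tp.
have d1 x := test_is_derive x tp; have d2 x := @is_derive_cas R k x.
have c2 : continuous (fun x => k%:~R * cas (- k) x : R) by move=> x; apply: cvgMr; exact: continuous_cas.
have e : phi pi * cas k pi = phi (- pi) * cas k (- pi).
  by rewrite (periodicN_pi tp.2) (periodicN_pi (@cas_periodic k)).
rewrite /har (cint_parts (test_continuous tp') c2 d1 d2 e).
rewrite (@eq_cint _ _ (fun x => k%:~R * (phi x * cas (- k) x))); last by move=> x _; ring.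
rewrite cintZ; first by ring.
by apply: cintg_cas; apply: continuous_cintg; exact: test_continuous.
Qed.

Lemma har_bounded F : cintg F -> exists C, forall k, `|har F k| <= C.
Proof.
move=> iF; have mc := measurable_circle (R := R).
have iF' : cintg (fun x => `|F x|).
  by rewrite /cintg (_ : _ \o _ = (abse \o (EFin \o F)))//; exact: integrable_abse.
exists ((2 * pi)^-1 * cint (fun x => 2 * `|F x|)) => k.
have c0 : 0 <= (2 * pi : R)^-1 by rewrite invr_ge0 ltW// pi2_gt0.
rewrite /har normrM (ger0_norm c0); apply: ler_wpM2l => //.
have iFk := cintg_cas k iF.
have H := @le_normr_Rintegral _ _ R leb circle (fun x => F x * cas k x) mc iFk.
rewrite /cint; apply: (le_trans H).
apply: le_Rintegral => //.
- by rewrite (_ : _ \o _ = (abse \o (EFin \o (fun x => F x * cas k x))))//; exact: integrable_abse.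
- exact: cintgZ.
by move=> x _; rewrite normrM mulrC ler_wpM2r// cas_le2.
Qed.

(** Two integrations by parts give a decay |k|^(-2), which is enough. *)
Lemma test_summ phi : test_function phi -> summ (har phi).
Proof.
move=> tp; have tp1 := test_derive1 tp; have tp2 := test_derive1 tp1.
have [C HC] := har_bounded (continuous_cintg (test_continuous tp2)).
have [|s _] := @zsum_delta R (fun k => (k == 0)%:R * `|har phi 0|) 0.
  by move=> k /negbTE ->; rewrite mul0r.
apply: (le_summ _ (summD (summZ C summ_inv_sqr) s)) => k.
apply: le_trans (ler_norm _); have [->|k0] := eqVneq k 0.
  by rewrite wt0 mulr0 add0r mul1r.
rewrite mul0r addr0 wtE// powRN ler_pdivlMr; last by rewrite powR_gt0// zabs_gt0.
apply: le_trans (HC k); have -> : har (derive1 (derive1 phi)) k = - k%:~R ^+ 2 * har phi k.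
  by rewrite har_derive1// har_derive1// opprK rmorphN opprK; ring.
by rewrite [leRHS]normrM normrN normrX norm_intr powR_mulrn ?zabs_ge0// mulrC.
Qed.

(** Parseval's identity when one factor is a test function. By uniqueness of coefficients [phi]
    equals its absolutely convergent series almost everywhere, and that series is integrated
    termwise against [F]. *)
Lemma test_pairing F phi : cintg F -> test_function phi ->
  summ (fun k => har phi k * har F k) /\
  cint (fun x => F x * phi x) = 2 * pi * zsum (fun k => har phi k * har F k).
Proof.
move=> iF tp; have sp := test_summ tp; have cp := test_continuous tp; have cs := continuous_syn sp.
have mF : measurable_fun circle F by apply/measurable_EFinP; exact: measurable_int iF.
have mp : measurable_fun circle phi by apply: measurable_funTS; exact: continuous_measurable_fun.
have ms : measurable_fun circle (syn (har phi)) by apply: measurable_funTS; exact: continuous_measurable_fun.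
have E : circle_eq phi (syn (har phi)).
  apply: har_inj; [exact: continuous_cintg|exact: continuous_cintg|move=> k; by rewrite har_syn].
rewrite (@eq_cint _ _ (fun x => phi x * F x)); last by move=> x _; rewrite mulrC.
rewrite (circle_eq_cint mp ms mF E).
have [s ->] := cint_syn sp iF.
have Ek k : har phi k * cint (fun x => cas k x * F x) = (2 * pi) * (har phi k * har F k).
  rewrite (@eq_cint _ _ (fun x => F x * cas k x)); last by move=> x _; rewrite mulrC.
  by rewrite [in RHS]/har (mulrCA (2 * pi)) mulVKf ?gt_eqF ?pi2_gt0.
have s' : summ (fun k => har phi k * har F k).
  apply: eq_summ (summZ (2 * pi)^-1 s) => k.
  by rewrite Ek mulKf ?gt_eqF ?pi2_gt0.
by split=> //; rewrite (eq_zsum Ek) zsumZ.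
Qed.

Lemma syn_weak_derivative h : summ h -> summ (fun k => - k%:~R * h (- k)) ->
  weak_derivative (syn h) (syn (fun k => - k%:~R * h (- k))).
Proof.
move=> sh sh'; have c := continuous_syn sh; have c' := continuous_syn sh'.
split; first exact: continuous_L2.
move=> phi tp; rewrite -!/(cint _).
have [s1 ->] := test_pairing (continuous_cintg c) (test_derive1 tp).
have [s2 ->] := test_pairing (continuous_cintg c') tp.
rewrite -mulrN -zsumN//; congr (_ * _); rewrite -[LHS]zsum_opp//; apply: eq_zsum => k.
by rewrite har_derive1// !har_syn// opprK rmorphN; ring.
Qed.

Lemma weak_derivative_har f g k : cintg f -> weak_derivative f g -> har g k = - k%:~R * har f (- k).
Proof.
move=> iF [L /(_ _ (cas_test k))]; rewrite -!/(cint _) derive1_cas => H.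
have : cint (fun x => g x * cas k x) = - cint (fun x => f x * (k%:~R * cas (- k) x)) by rewrite H opprK.
rewrite (@eq_cint _ (fun x => f x * _) (fun x => k%:~R * (f x * cas (- k) x))); last by move=> x _; ring.
rewrite cintZ; last exact: cintg_cas.
by rewrite /har => ->; ring.
Qed.

End TestFunctions.

(** * The Hilbert transform of a Hartley series *)

Section HilbertTransform.
Context {R : realType}.
Implicit Types (h : int -> R) (k : int) (n : nat) (u x y e : R).
Local Notation leb := (@lebesgue_measure R).

Definition cotk u : R := cos (u / 2) / sin (u / 2).

(** [icos] and [isin] are antiderivatives of cos (n u) and of - sin (n u), with the frequency 0
    treated apart. *)
Definition icos n u : R := if n is 0%N then u else sin (n%:R * u) / n%:R.
Definition isin n u : R := if n is 0%N then 0 else cos (n%:R * u) / n%:R.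

(* Antiderivatives of sin (n u) cotk u and cos (n u) cotk u, obtained from
   (sin ((n + 1) u) - sin (n u)) cotk u = cos (n u) + cos ((n + 1) u) and
   (cos ((n + 1) u) - cos (n u)) cotk u = - sin (n u) - sin ((n + 1) u). *)
Fixpoint icotsin n u : R := if n is n'.+1 then icotsin n' u + (icos n' u + icos n u) else 0.
Fixpoint icotcos n u : R :=
  if n is n'.+1 then icotcos n' u + (isin n' u + isin n u) else ln (sin (u / 2) ^+ 2).

Arguments icos : simpl never.
Arguments isin : simpl never.

Lemma icotsinS n u : icotsin n.+1 u = icotsin n u + (icos n u + icos n.+1 u).
Proof. by []. Qed.

Lemma is_derive_icos n u : is_derive u 1 (icos n) (cos (n%:R * u)).
Proof.
case: n => [|n]; first by rewrite mul0r cos0; exact: is_derive_id.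
have s := is_derive_sinM n.+1%:R u.
by rewrite /icos; apply: is_derive_eq; rewrite /GRing.scale/=; have := @pnatr_eq0 R n.+1; move: (n.+1%:R : R) => N /negbT N0; field.
Qed.

Lemma is_derive_isin n u : is_derive u 1 (isin n) (- sin (n%:R * u)).
Proof.
case: n => [|n]; first by rewrite mul0r sin0 oppr0; exact: is_derive_cst.
have s := is_derive_cosM n.+1%:R u.
by rewrite /isin; apply: is_derive_eq; rewrite /GRing.scale/=; have := @pnatr_eq0 R n.+1; move: (n.+1%:R : R) => N /negbT N0; field.
Qed.

Lemma double_half u : [/\ cos u = cos (u / 2) ^+ 2 - sin (u / 2) ^+ 2,
  sin u = 2 * sin (u / 2) * cos (u / 2) & cos (u / 2) ^+ 2 = 1 - sin (u / 2) ^+ 2].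
Proof.
have E : u = u / 2 + u / 2 by field.
split; [by rewrite {1}E cosD !expr2|by rewrite {1}E sinD; ring|].
by rewrite -[X in X - _](cos2Dsin2 (u / 2)) addrK.
Qed.

Lemma is_derive_icotsin n u : sin (u / 2) != 0 ->
  is_derive u 1 (icotsin n) (sin (n%:R * u) * cotk u).
Proof.
move=> s0; elim: n => [|n IH] /=; first by rewrite mul0r sin0 mul0r; exact: is_derive_cst.
have d1 := is_derive_icos n u; have d2 := is_derive_icos n.+1 u.
apply: (is_derive_eq (is_deriveD IH (is_deriveD d1 d2))).
have -> : n.+1%:R * u = n%:R * u + u by rewrite -natr1 mulrDl mul1r.
have [E1 E2 E3] := double_half u; rewrite cosD sinD E1 E2 /cotk.
move: E3 s0; move: (sin (u / 2)) (cos (u / 2)) (sin (n%:R * u)) (cos (n%:R * u)) => s c S C E3 s0.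
apply/eqP; rewrite eq_sym -subr_eq0; apply/eqP.
rewrite (_ : _ - _ = (c ^+ 2 - (1 - s ^+ 2)) * (S * c + C * s) / s); last by field.
by rewrite E3 subrr !mul0r.
Qed.

Lemma is_derive_icotcos n u : sin (u / 2) != 0 ->
  is_derive u 1 (icotcos n) (cos (n%:R * u) * cotk u).
Proof.
move=> s0; elim: n => [|n IH] /=.
  rewrite mul0r cos0 mul1r.
  have d1 : is_derive u 1 (fun u => sin (u / 2)) (cos (u / 2) / 2).
    have -> : (fun u : R => sin (u / 2)) = (fun u => sin (2^-1 * u)) by apply/funext => z; rewrite mulrC.
    by have := is_derive_sinM 2^-1 u; rewrite (mulrC 2^-1 u).
  have d2 : is_derive u 1 (fun u => sin (u / 2) ^+ 2) (2 * sin (u / 2) * (cos (u / 2) / 2)).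
    by apply: is_derive_eq; rewrite /GRing.scale/=; ring.
  have p0 : 0 < sin (u / 2) ^+ 2 by rewrite exprn_even_gt0.
  have := @is_derive1_comp R (@ln R) (fun u => sin (u / 2) ^+ 2) u _ _ (is_derive1_ln p0) d2.
  rewrite /cotk (_ : _ * (2 * _ * _) = cos (u / 2) / sin (u / 2))//; by field.
have d1 := is_derive_isin n u; have d2 := is_derive_isin n.+1 u.
apply: (is_derive_eq (is_deriveD IH (is_deriveD d1 d2))).
have -> : n.+1%:R * u = n%:R * u + u by rewrite -natr1 mulrDl mul1r.
have [E1 E2 E3] := double_half u; rewrite cosD sinD E1 E2 /cotk.
move: E3 s0; move: (sin (u / 2)) (cos (u / 2)) (sin (n%:R * u)) (cos (n%:R * u)) => s c S C E3 s0.
apply/eqP; rewrite eq_sym -subr_eq0; apply/eqP.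
rewrite (_ : _ - _ = (c ^+ 2 - (1 - s ^+ 2)) * (C * c - S * s) / s); last by field.
by rewrite E3 subrr !mul0r.
Qed.

Lemma cosM_periodic n u : cos (n%:R * (u + 2 * pi)) = cos (n%:R * u).
Proof.
have := cas_periodic n%:Z u; have := cas_periodic (- n%:Z) u.
rewrite /cas rmorphN /= !mulNr !cosN !sinN -pmulrn => H1 H2.
by have := congr2 +%R H1 H2; lra.
Qed.

Lemma sinM_periodic n u : sin (n%:R * (u + 2 * pi)) = sin (n%:R * u).
Proof.
have := cas_periodic n%:Z u; have := cosM_periodic n u.
by rewrite /cas -pmulrn => -> H; have := H; lra.
Qed.

Lemma icotsinN n u : icotsin n (- u) = - icotsin n u.
Proof.
have H m : icos m (- u) = - icos m u by case: m => [//|m]; rewrite /icos mulrN sinN mulNr.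
by elim: n => [|n IH] /=; [rewrite oppr0|rewrite IH !H; ring].
Qed.

Lemma icotcosN n u : icotcos n (- u) = icotcos n u.
Proof.
have H m : isin m (- u) = isin m u by case: m => [//|m]; rewrite /isin mulrN cosN.
by elim: n => [|n IH] /=; [rewrite mulNr sinN sqrrN|rewrite IH !H].
Qed.

(** Only the summand [icos 0], which is u itself, fails to be periodic. Its increment 2 pi is the
    integral of sin (n u) cot (u / 2) over a period, that is, the source of the Hilbert
    multiplier. *)
Lemma icotsin_period n u : icotsin n.+1 (u + 2 * pi) = icotsin n.+1 u + 2 * pi.
Proof.
have H m : icos m.+1 (u + 2 * pi) = icos m.+1 u by rewrite /icos sinM_periodic.
elim: n => [|n IH]; first by rewrite !icotsinS /= H /icos; ring.
by rewrite icotsinS IH [in RHS]icotsinS !H; ring.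
Qed.

Lemma icotcos_period n u : icotcos n (u + 2 * pi) = icotcos n u.
Proof.
have H m : isin m (u + 2 * pi) = isin m u by case: m => [//|m]; rewrite /isin cosM_periodic.
elim: n => [|n IH] /=; last by rewrite IH !H.
rewrite (_ : (u + 2 * pi) / 2 = u / 2 + pi); last by field.
by rewrite sinDpi sqrrN.
Qed.

Lemma icotsin_cvg0 n : icotsin n e @[e --> 0] --> (0 : R).
Proof.
have c m : icos m e @[e --> 0] --> (0 : R).
  have E : icos m 0 = 0 by case: m => [//|m]; rewrite /icos mulr0 sin0 mul0r.
  by rewrite -[X in _ --> X]E; exact: is_derive_cont (is_derive_icos m 0).
elim: n => [|n IH] /=; first exact: cvg_cst.
by rewrite -[X in _ --> X]addr0; apply: cvgD => //; rewrite -[X in _ --> X]addr0; apply: cvgD.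
Qed.

(** Linear growth in n suffices to dominate the series in [syn_Hilbert], where |k| h_k is assumed to
    be summable. *)
Lemma icotsin_le n e : 0 <= e <= pi -> `|icotsin n e| <= n%:R * (2 * (pi + 1)).
Proof.
move=> /andP[e0 ep].
have c m : `|icos m e| <= pi + 1.
  case: m => [|m]; first by rewrite /icos ger0_norm//; lra.
  rewrite /icos normrM; apply: (@le_trans _ _ (1 * 1)); last by rewrite mulr1; have := pi_gt0 R; lra.
  by apply: ler_pM => //; rewrite ?sin_max// ger0_norm ?invr_ge0// invf_le1 ?ltr0n// ler1n.
elim: n => [|n IH] /=; first by rewrite normr0 mul0r.
rewrite -natr1 mulrDl mul1r; apply: (le_trans (ler_normD _ _)); apply: lerD => //.
by apply: (le_trans (ler_normD _ _)); have := c n; have := c n.+1; lra.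
Qed.

(** Separates the parts even and odd in [u]. Against the cotangent the even part has an even
    periodic antiderivative, so that it does not contribute to a symmetric principal value. *)
Lemma cas_diff k x u : cas k (x - u) =
  cos ((absz k)%:R * u) * cas k x - Num.sg k%:~R * sin ((absz k)%:R * u) * cas (- k) x.
Proof.
have E : k%:~R = Num.sg k%:~R * (absz k)%:R :> R.
  by rewrite {1}[LHS]numEsg -zabsE.
have Ec : cos (k%:~R * u) = cos ((absz k)%:R * u).
  rewrite {1}E; case: sgrP => k0; rewrite ?mul1r ?mulN1r ?mulNr ?cosN//.
  by rewrite -/(zabs k) zabsE k0 normr0 mulr0.
have Es : sin (k%:~R * u) = Num.sg k%:~R * sin ((absz k)%:R * u).
  rewrite {1}E; case: sgrP => _; rewrite ?mul0r ?sin0 ?mul1r ?mulN1r ?mulNr ?sinN//.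
rewrite -Ec -Es /cas rmorphN !mulNr mulrBr cosB sinB cosN sinN; ring.
Qed.

Lemma sin_half_neq0 u : 0 < `|u| -> `|u| < 2 * pi -> sin (u / 2) != 0.
Proof.
move=> u0 u2; suff H (v : R) : 0 < v -> v < 2 * pi -> sin (v / 2) != 0.
  have [u0'|u0'] := leP 0 u; first by move: u0 u2; rewrite ger0_norm//; exact: H.
  move: u0 u2; rewrite ltr0_norm// => h1 h2; have := H _ h1 h2.
  by rewrite mulNr sinN oppr_eq0.
by move=> v0 v2; rewrite gt_eqF// sin_gt0_pi//; apply/andP; split; lra.
Qed.

Lemma continuous_cotk u : sin (u / 2) != 0 -> {for u, continuous cotk}.
Proof.
move=> s0; apply: cvgM.
  have -> : (fun u : R => cos (u / 2)) = (fun u => cos (2^-1 * u)) by apply/funext => z; rewrite mulrC.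
  by rewrite (mulrC u); exact: continuous_cosM.
apply: cvgV => //.
have -> : (fun u : R => sin (u / 2)) = (fun u => sin (2^-1 * u)) by apply/funext => z; rewrite mulrC.
by rewrite (mulrC u); exact: continuous_sinM.
Qed.

Lemma integrable_setU2 (A B : set R) (f : R -> R) : measurable A -> measurable B ->
  [disjoint A & B] -> leb.-integrable A (EFin \o f) -> leb.-integrable B (EFin \o f) ->
  leb.-integrable (A `|` B) (EFin \o f).
Proof.
move=> mA mB dAB /integrableP[mfA iA] /integrableP[mfB iB]; apply/integrableP.
have m : measurable_fun (A `|` B) (EFin \o f) by apply/measurable_funU.
split => //; rewrite ge0_integral_setU//; first exact: lte_add_pinfty.
by apply: measurableT_comp.
Qed.

Section PrincipalValue.
Variables (x : R).
Hypotheses (x1 : - pi < x) (x2 : x < pi).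

Lemma cut_circle e : 0 < e -> e < x + pi -> e < pi - x ->
  circle `&` [set y | e < `|x - y|] = `[- pi, x - e[ `|` `]x + e, pi].
Proof.
have p1 := x1; have p2 := x2; move=> e0 ex1 ex2; apply/seteqP; split=> y /=; rewrite /circle /= !in_itv/=.
  move=> [/andP[y1 y2]]; rewrite ltr_normr => /orP[]h; [left|right]; apply/andP; split; lra.
by case=> /andP[h1 h2]; split; [apply/andP; split; lra|rewrite ltr_normr; apply/orP; left; lra|
  apply/andP; split; lra|rewrite ltr_normr; apply/orP; right; lra].
Qed.

Lemma kernel_neq0 y : - pi <= y <= pi -> y != x -> sin ((x - y) / 2) != 0.
Proof.
have h1 := x1; have h2 := x2; move=> /andP[y1 y2] yx; apply: sin_half_neq0.
  by rewrite normr_gt0 subr_eq0 eq_sym.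
by rewrite ltr_norml; apply/andP; split; lra.
Qed.

Lemma continuous_kernel k y : - pi <= y <= pi -> y != x ->
  {for y, continuous (fun y => cas k y * cotk (x - y))}.
Proof.
move=> yp yx; apply: cvgM; first exact: continuous_cas.
apply: (@continuous_comp _ _ _ (fun y => x - y) cotk); last exact: continuous_cotk (kernel_neq0 yp yx).
by apply: cvgB; [exact: cvg_cst|exact: cvg_id].
Qed.

Definition kprim k y : R :=
  - (cas k x * icotcos (absz k) (x - y) - Num.sg k%:~R * cas (- k) x * icotsin (absz k) (x - y)).

Lemma is_derive_kprim k y : - pi <= y <= pi -> y != x ->
  is_derive y 1 (kprim k) (cas k y * cotk (x - y)).
Proof.
move=> yp yx; have s0 := kernel_neq0 yp yx.
have d0 : is_derive y 1 (fun y : R => x - y) (-1).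
  by have := is_deriveB (is_derive_cst x y 1) (is_derive_id y 1); rewrite sub0r.
have d1 := @is_derive1_comp R (icotcos (absz k)) (fun y => x - y) y _ _ (is_derive_icotcos (absz k) s0) d0.
have d2 := @is_derive1_comp R (icotsin (absz k)) (fun y => x - y) y _ _ (is_derive_icotsin (absz k) s0) d0.
have -> : cas k y = cas k (x - (x - y)) by congr cas; ring.
rewrite cas_diff.
move: d1 d2; rewrite /kprim; set f1 := _ \o _; set f2 := _ \o _ => d1 d2.
have : is_derive y 1 (fun y => - (cas k x * f1 y - Num.sg k%:~R * cas (- k) x * f2 y))
  (- (cas k x * (cos (`|k|%N%:R * (x - y)) * cotk (x - y) * -1) -
     Num.sg k%:~R * cas (- k) x * (sin (`|k|%N%:R * (x - y)) * cotk (x - y) * -1))).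
  by apply: is_derive_eq; rewrite /GRing.scale/=; ring.
by move=> D; apply: (is_derive_eq D); ring.
Qed.

(** The cut is symmetric about [x]: the terms in [icotcos] cancel by evenness and periodicity, and
    [icotsin] leaves 2 pi from the period minus twice its value at the cut. *)
Lemma pv_cas k e : 0 < e -> e < x + pi -> e < pi - x ->
  leb.-integrable (circle `&` [set y | e < `|x - y|]) (EFin \o (fun y => cas k y * cotk (x - y))) /\
  \int[leb]_(y in circle `&` [set y | e < `|x - y|]) (cas k y * cotk (x - y)) =
  - (Num.sg k%:~R * cas (- k) x) * (2 * pi - 2 * icotsin (absz k) e).
Proof.
have p1 := x1; have p2 := x2; move=> e0 ex1 ex2; rewrite cut_circle//.
have H1 y : - pi <= y <= x - e -> - pi <= y <= pi /\ y != x.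
  by move=> /andP[h1 h2]; split; [apply/andP; split; lra|rewrite lt_eqF//; lra].
have H2 y : x + e <= y <= pi -> - pi <= y <= pi /\ y != x.
  by move=> /andP[h1 h2]; split; [apply/andP; split; lra|rewrite gt_eqF//; lra].
have c1 y : - pi <= y <= x - e -> {for y, continuous (fun y => cas k y * cotk (x - y))}.
  by move=> /H1[h1 h2]; exact: continuous_kernel.
have c2 y : x + e <= y <= pi -> {for y, continuous (fun y => cas k y * cotk (x - y))}.
  by move=> /H2[h1 h2]; exact: continuous_kernel.
have d1 y : - pi <= y <= x - e -> is_derive y 1 (kprim k) (cas k y * cotk (x - y)).
  by move=> /H1[h1 h2]; exact: is_derive_kprim.
have d2 y : x + e <= y <= pi -> is_derive y 1 (kprim k) (cas k y * cotk (x - y)).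
  by move=> /H2[h1 h2]; exact: is_derive_kprim.
have i1 := continuous_at_integrable c1; have i2 := continuous_at_integrable c2.
have i1' : leb.-integrable `[- pi, x - e[ (EFin \o (fun y => cas k y * cotk (x - y))).
  by apply: integrableS i1 => //; apply: subset_itvl; rewrite bnd_simp.
have i2' : leb.-integrable `]x + e, pi] (EFin \o (fun y => cas k y * cotk (x - y))).
  by apply: integrableS i2 => //; apply: subset_itvr; rewrite bnd_simp.
have dis : [disjoint `[- pi, x - e[ & `]x + e, pi]].
  apply/disj_setPS => y [] /=; rewrite !in_itv/= => /andP[a1 a2] /andP[a3 a4]; lra.
have iU := integrable_setU2 (measurable_itv _) (measurable_itv _) dis i1' i2'.
split; first exact: iU.
rewrite Rintegral_setU// Rintegral_itv_bndo_bndc// Rintegral_itv_obnd_cbnd//.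
rewrite (FTC2_R _ c1 d1) ?(FTC2_R _ c2 d2); [|lra|lra].
have E1 : icotcos (absz k) (x + pi) = icotcos (absz k) (x - pi).
  by rewrite -[RHS]icotcos_period; congr icotcos; ring.
have K u : kprim k (x - u) = - (cas k x * icotcos (absz k) u - Num.sg k%:~R * cas (- k) x * icotsin (absz k) u).
  by rewrite /kprim subKr.
have -> : kprim k (- pi) = kprim k (x - (x + pi)) by congr kprim; ring.
have -> : kprim k pi = kprim k (x - (x - pi)) by congr kprim; ring.
have -> : kprim k (x + e) = kprim k (x - (- e)) by congr kprim; ring.
(* Frequency 0 is separate because [icotsin 0] has no increment over a period; there the sign of [k]
   annihilates the terms. *)
rewrite !K icotcosN icotsinN E1; case: (absz k =P 0%N) => [/eqP|].
  by rewrite absz_eq0 => /eqP ->; rewrite sgr0 !mul0r; ring.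
case: (absz k) => // n _.
have -> : icotsin n.+1 (x + pi) = icotsin n.+1 (x - pi) + 2 * pi.
  by rewrite -icotsin_period; congr icotsin; ring.
by ring.
Qed.

End PrincipalValue.

(** For a fixed cut the series is integrated termwise, the kernel being integrable away from the
    singularity. The limit of small cuts is then dominated convergence over [k]. *)
Lemma syn_Hilbert h : summ h -> summ (fun k => zabs k * h k) ->
  Hilbert (syn h) (syn (fun k => Num.sg k%:~R * h (- k))).
Proof.
move=> sh sh'; apply: aeW => x /andP[x1 x2].
pose q e k := h k * (- (Num.sg k%:~R * cas (- k) x) * (2 * pi - 2 * icotsin (absz k) e)).
have E e : 0 < e -> e < x + pi -> e < pi - x ->
    \int[leb]_(y in circle `&` [set y | e < `|x - y|])
         (syn h y * (cos ((x - y) / 2) / sin ((x - y) / 2))) = zsum (q e).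
  move=> e0 e1 e2; have P k := pv_cas x1 x2 k e0 e1 e2.
  have mE : measurable (circle `&` [set y : R | e < `|x - y|]) by rewrite cut_circle//; exact: measurableU.
  have iw : leb.-integrable (circle `&` [set y | e < `|x - y|]) (EFin \o (fun y => `|cotk (x - y)|)).
    have [i0 _] := P 0; have := integrable_abse i0; apply: eq_integrable => // y _ /=.
    by rewrite /cas mul0r cos0 sin0 addr0 mul1r.
  have mk : measurable_fun (circle `&` [set y | e < `|x - y|]) (fun y => cotk (x - y)).
    have [i0 _] := P 0; have /measurable_EFinP := measurable_int _ i0; apply: eq_measurable_fun => y _ /=.
    by rewrite /cas mul0r cos0 sin0 addr0 mul1r.
  have [||_ _ H3] := @zsum_integral R _ _ leb _ mE (fun k y => h k * cas k y * cotk (x - y)) _ _ (summZ 2 (summ_norm sh)) iw.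
  - by move=> k; apply: measurable_funM => //; apply: measurable_funM => //; exact: measurable_cas.
  - by move=> k y _; rewrite normrM ler_wpM2r// syn_term_le.
  transitivity (zsum (fun k => \int[leb]_(y in circle `&` [set y | e < `|x - y|]) (h k * cas k y * cotk (x - y)))).
    rewrite -H3; apply: eq_Rintegral => y _; rewrite -/(cotk _) /syn mulrC -zsumZ; last exact: summ_syn.
    by apply: eq_zsum => k; rewrite mulrC.
  apply: eq_zsum => k; rewrite /q -(P k).2 -RintegralZl//; last by have [] := P k.
  by apply: eq_Rintegral => y _; rewrite mulrA.
(* Capping the cut at pi makes [icotsin_le] valid along whole sequences and does not affect the
   limit. *)
have Lim : (2 * pi)^-1 * zsum (q (Num.min e pi)) @[e --> 0^'+] -->
    syn (fun k => Num.sg k%:~R * h (- k)) x.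
  have -> : syn (fun k => Num.sg k%:~R * h (- k)) x =
      (2 * pi)^-1 * zsum (fun k => h k * (- (Num.sg k%:~R * cas (- k) x) * (2 * pi - 2 * 0))).
    have sf : summ (fun k => Num.sg k%:~R * h (- k) * cas k x).
      apply: (@le_summ _ _ (fun k => 2 * `|h (- k)|)); last exact: (summZ 2 (summ_norm (summ_opp sh))).
      move=> k; apply: le_trans (ler_norm _); apply: (le_trans (syn_term_le (fun k => Num.sg k%:~R * h (- k)) _ _)).
      by rewrite ler_wpM2l// normrM normr_sg; case: (_ != 0); rewrite ?mul1r// mul0r.
    have E1 k : h k * (- (Num.sg k%:~R * cas (- k) x) * (2 * pi - 2 * 0)) =
        2 * pi * (Num.sg (- k)%:~R * h (- - k) * cas (- k) x).
      by rewrite rmorphN sgrN opprK; ring.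
    have [so _] := zsum_reindex bij_oppz sf.
    by rewrite (eq_zsum E1) (zsumZ _ so) (zsum_opp sf) mulKf// gt_eqF// pi2_gt0.
  apply/cvg_at_rightP => w [w0 cw]; apply: cvgMr.
  apply: (zsum_cvg (g := fun k => `|h k| * (4 * pi) + zabs k * `|h k| * (8 * (pi + 1)))).
  - apply: summD; first by apply: eq_summ (summZ (4 * pi) (summ_norm sh)) => k; rewrite mulrC.
    apply: eq_summ (summZ (8 * (pi + 1)) (summ_norm sh')) => k.
    by rewrite normrM (ger0_norm (zabs_ge0 _)) mulrC.
  - move=> n k; have me : 0 <= Num.min (w n) pi <= pi.
      by rewrite le_min (ltW (w0 n)) pi_ge0 ge_min lexx orbT.
    have b1 : `|- (Num.sg k%:~R * cas (- k) x)| <= 2.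
      rewrite normrN normrM normr_sg; case: (_ != 0); rewrite ?mul1r ?mul0r//; exact: cas_le2.
    have b2 : `|2 * pi - 2 * icotsin (absz k) (Num.min (w n) pi)| <= 2 * pi + 2 * (zabs k * (2 * (pi + 1))).
      apply: (le_trans (ler_normB _ _)); apply: lerD.
        by rewrite ger0_norm//; exact: ltW pi2_gt0.
      by rewrite normrM ger0_norm// ler_wpM2l// icotsin_le.
    rewrite /q normrM [X in _ * X]normrM.
    rewrite (_ : _ + _ = `|h k| * (2 * (2 * pi + 2 * (zabs k * (2 * (pi + 1)))))); last by ring.
    by apply: ler_wpM2l => //; apply: ler_pM.
  - move=> k; apply: cvgMr; apply: cvgMr; apply: cvgB; first exact: cvg_cst.
    apply: cvgMr; have cm : Num.min (w n) pi @[n --> \oo] --> (0 : R).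
      have wpi := cvgr_le _ cw _ (pi_gt0 R).
      apply: cvg_trans cw; apply: near_eq_cvg; near=> n; rewrite min_l//.
      by near: n; exact: wpi.
    exact: cvg_comp cm (@icotsin_cvg0 (absz k)).
apply: cvg_trans Lim; apply: near_eq_cvg; near=> e.
have e0 : 0 < e by near: e; exact: nbhs_right_gt.
have e1 : e < x + pi by near: e; apply: nbhs_right_lt; lra.
have e2 : e < pi - x by near: e; apply: nbhs_right_lt; lra.
by rewrite E// min_l//; lra.
Unshelve. all: by end_near. Qed.

End HilbertTransform.

(** * Synthesis of smooth functions and the coefficients of the equation *)

Section Synthesis.
Context {R : realType}.
Implicit Types (f g phi : R -> R) (h U D : int -> R) (k j : int) (s t x : R).
Local Notation leb := (@lebesgue_measure R).

(** By |k| <= |j| + |l| with l = k - j, the weight is at most 2 |j| |l| + |l|^2. The factor in [l]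
    is bounded by rapid decay and the sum over [j] no longer depends on [k]. *)
Lemma domt_rapid U : (forall k, 0 <= U k) -> rapid U ->
  exists C, forall k, summ (domt U U k) /\ zsum (domt U U k) <= C.
Proof.
move=> U0 rU; have [M1 H1] := rU 1; have [M2 H2] := rU 2.
have sU := rapid_summ rU; have szU := rapid_summ (rapid_zabs rU).
have sT := summD (summZ (2 * M1) szU) (summZ M2 sU).
exists (zsum (fun k => 2 * M1 * (zabs k * U k) + M2 * U k)) => k.
have B j : `|domt U U k j| <= 2 * M1 * (zabs j * U j) + M2 * U j.
  have h1 := H1 (k - j); have h2 := H2 (k - j).
  rewrite ger0_norm// wt1 in h1; rewrite ger0_norm// in h2.
  have E2 : wt 2 (k - j) = zabs (k - j) ^+ 2 :> R.
    rewrite /wt; case: eqVneq => [->|_]; first by rewrite zabs0 expr0n.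
    by rewrite powR_mulrn// zabs_ge0.
  rewrite E2 in h2; have kj : (zabs k : R) <= zabs j + zabs (k - j).
    by rewrite -{1}(subrK j k) addrC zabsD.
  have := U0 j; have := U0 (k - j); have j0 := zabs_ge0 (R := R) j; have l0 := zabs_ge0 (R := R) (k - j).
  rewrite /domt ger0_norm; last by rewrite !mulr_ge0 ?addr_ge0 ?zabs_ge0.
  move: h1 h2 kj j0 l0; move: (zabs j) (zabs k) (zabs (k - j)) (U j) (U (k - j)) => J K L u v h1 h2 kj J0 L0 v0 u0.
  apply: (@le_trans _ _ (2 * (L * v) * (J * u) + (L ^+ 2 * v) * u)).
    rewrite -subr_ge0 (_ : _ - _ = (J + L - K) * (L * (u * v))); last by ring.
    by rewrite !mulr_ge0// subr_ge0.
  by apply: lerD; apply: ler_wpM2r => //; [exact: mulr_ge0|rewrite ler_wpM2l].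
have s := le_summ_ge0 B sT; split=> //; apply: le_zsum => // j.
exact: le_trans (ler_norm _) (B j).
Qed.

Lemma cintg_ae f g : cintg g -> measurable_fun circle f -> circle_eq f g -> cintg f.
Proof.
move=> ig mf fg; have mc := measurable_circle (R := R).
have mg : measurable_fun circle g by apply/measurable_EFinP; exact: measurable_int ig.
apply/integrableP; split; first exact/measurable_EFinP.
have /integrableP[_] := ig; congr (_ < _)%E.
apply: ae_eq_integral => //.
- by apply: measurableT_comp => //; exact/measurable_EFinP.
- by apply: measurableT_comp => //; exact/measurable_EFinP.
have ff : Filter (almost_everywhere leb) by exact: ae_filter_ringOfSetsType.
by move: fg; apply: filterS => x fg cx /=; rewrite fg.
Qed.

Lemma cintg_measurable f : cintg f -> measurable_fun circle f.
Proof. by move=> iF; apply/measurable_EFinP; exact: measurable_int iF. Qed.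

Lemma ae_syn f : cintg f -> rapid (har f) -> circle_eq f (syn (har f)).
Proof.
move=> iF rf; have sf := rapid_summ rf.
apply: har_inj => //; first exact: continuous_cintg (continuous_syn sf).
by move=> k; rewrite har_syn.
Qed.

Lemma continuous_syn_mul h U : summ h -> summ U -> continuous (fun x => syn h x * syn U x).
Proof. by move=> sh sU x; apply: cvgM; [exact: continuous_syn|exact: continuous_syn]. Qed.

Lemma syn_scale (c : R) h x : summ h -> c * syn h x = syn (fun k => c * h k) x.
Proof.
by move=> sh; rewrite /syn -zsumZ; [apply: eq_zsum => k; rewrite mulrA|exact: summ_syn].
Qed.

Lemma rapid_powR h (p : R) : p != 0 -> rapid h -> rapid (fun k => zabs k `^ p * h k).
Proof.
move=> p0 /(rapid_wt p); apply: rapid_le => k.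
by rewrite /wt; case: eqVneq => // ->; rewrite zabs0 powR0.
Qed.

(** The coefficients of all four functions decay rapidly, hence each factor of a product may be
    replaced almost everywhere by its continuous series; this makes the products integrable and
    gives access to [har_syn_mul]. *)
Lemma har_rhs (a b mu alpha : R) (B J Jx Bx LB : R -> R) : 2 < alpha -> cintg B -> cintg J ->
  cintg Jx -> cintg Bx -> cintg LB -> rapid (har B) ->
  (forall k, har J k = - (zabs k * har B k)) ->
  (forall k, har Jx k = - k%:~R * har J (- k)) ->
  (forall k, har Bx k = - k%:~R * har B (- k)) ->
  (forall k, har LB k = zabs k `^ alpha * har B k) ->
  let W x := a * B x * Jx x + b * J x * Bx x + mu * LB x in
  cintg W /\ forall k, har W k = - nl a b (har B) (har B) k + rate mu alpha k * har B k.
Proof.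
move=> al2 iB iJ iJx iBx iLB rB EJ EJx EBx ELB W.
have mB := cintg_measurable iB; have mJ := cintg_measurable iJ; have mJx := cintg_measurable iJx.
have mBx := cintg_measurable iBx; have mLB := cintg_measurable iLB.
have rJ : rapid (har J).
  by apply: rapid_le (rapid_zabs rB) => k; rewrite EJ normrN.
have rJx : rapid (har Jx).
  by apply: rapid_le (rapid_mulZ (rapidN rJ)) => k; rewrite EJx mulNr normrN.
have rBx : rapid (har Bx).
  by apply: rapid_le (rapid_mulZ (rapidN rB)) => k; rewrite EBx mulNr normrN.
have rLB : rapid (har LB).
  have al0 : alpha != 0 by rewrite gt_eqF// (alpha_gt0 al2).
  by apply: rapid_le (rapid_powR al0 rB) => k; rewrite ELB.
have [sB sJ sJx sBx] := And4 (rapid_summ rB) (rapid_summ rJ) (rapid_summ rJx) (rapid_summ rBx).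
have aB := ae_syn iB rB; have aJ := ae_syn iJ rJ; have aJx := ae_syn iJx rJx; have aBx := ae_syn iBx rBx.
have cJx := continuous_cintg (continuous_syn sJx); have cBx := continuous_cintg (continuous_syn sBx).
have ff : Filter (almost_everywhere leb) by exact: ae_filter_ringOfSetsType.
have m1 : measurable_fun circle (fun x => B x * Jx x) by exact: measurable_funM.
have m2 : measurable_fun circle (fun x => J x * Bx x) by exact: measurable_funM.
have a1 : circle_eq (fun x => B x * Jx x) (fun x => syn (har B) x * syn (har Jx) x).
  by apply: (@filterS2 _ _ ff _ _ _ _ aB aJx) => x e1 e2 cx; rewrite e1// e2.
have a2 : circle_eq (fun x => J x * Bx x) (fun x => syn (har J) x * syn (har Bx) x).
  by apply: (@filterS2 _ _ ff _ _ _ _ aJ aBx) => x e1 e2 cx; rewrite e1// e2.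
have c1 := continuous_syn_mul sB sJx; have c2 := continuous_syn_mul sJ sBx.
have i1 := cintg_ae (continuous_cintg c1) m1 a1; have i2 := cintg_ae (continuous_cintg c2) m2 a2.
have mc1 := cintg_measurable (continuous_cintg c1); have mc2 := cintg_measurable (continuous_cintg c2).
have EW : W = (fun x => (a * (B x * Jx x) + b * (J x * Bx x)) + mu * LB x).
  by apply/funext => x; rewrite /W !mulrA.
have i12 := cintgD (cintgZ a i1) (cintgZ b i2).
have iW : cintg W by rewrite EW; exact: cintgD i12 (cintgZ mu iLB).
split => // k; rewrite EW harD//; last exact: cintgZ.
rewrite harD//; [|exact: cintgZ|exact: cintgZ].
rewrite !harZ// ELB (circle_eq_har k m1 mc1 a1) (circle_eq_har k m2 mc2 a2) har_syn_mul// har_syn_mul//.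
have e1 : conv (har B) (har (syn (har Jx))) k = conv (har B) (hDL (har B)) k.
  congr (_ * _); apply: eq_zsum => j; rewrite /conv_term !har_syn// /hDL.
  have E l : har Jx l = l%:~R * zabs l * har B (- l) by rewrite EJx EJ zabsN; ring.
  by rewrite !E.
have e2 : conv (har J) (har (syn (har Bx))) k = conv (hL (har B)) (hD (har B)) k.
  congr (_ * _); apply: eq_zsum => j; rewrite /conv_term !har_syn// /hD /hL EJ.
  by rewrite !EBx; ring.
rewrite e1 e2 /nl /rate (wt_alphaE al2).
move: (conv _ (hDL _) k) (conv (hL _) _ k) (_ `^ alpha) (har B k) => X Y Z H; ring.
Qed.

End Synthesis.

(** * Envelopes at positive times *)

Section Envelopes.
Context {R : realType} (mu alpha : R).
Hypotheses (mu0 : 0 < mu) (al2 : 2 < alpha).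
Implicit Types (h U D : int -> R) (k j : int) (s t x p : R).
Local Notation env := (env mu alpha).

Lemma env0E k t : env 0 k t = wt (- reg0 alpha) k * decay mu alpha k t.
Proof. by rewrite envE addr0 mul0r oppr0 powRr0 mulr1. Qed.

Lemma l2_bounded D : l2 D -> forall k, `|D k| <= 1 + n2 D.
Proof.
move=> lD k; have := le_zsum_term (f := fun k => D k ^+ 2) k lD (fun k => sqr_ge0 _).
rewrite -/(n2 D) -[D k ^+ 2]real_normK ?num_real//.
by have := sqr_ge0 (`|D k| - 1); move: `|D k| (n2 D) => y z *; nra.
Qed.

Lemma wt_decay p t : 0 < t -> exists C, forall k, wt p k * decay mu alpha k t <= C.
Proof.
move=> t0; pose c := mu / 2 * t `^ alpha^-1.
have c0 : 0 < c by rewrite mulr_gt0 ?divr_gt0 ?powR_gt0.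
(* [le_powR_expR] asks for a positive exponent; raising [p] only increases the weight, as |k| >=
   1. *)
pose be := Num.max p 1; have be0 : 0 < be by rewrite lt_max ltr01 orbT.
exists ((be / c) `^ be) => k.
have [->|k0] := eqVneq k 0; first by rewrite wt0 mul0r powR_ge0.
have K0 : 0 < zabs k :> R by rewrite zabs_gt0.
apply: (@le_trans _ _ (wt be k * decay mu alpha k t)).
  by rewrite ler_wpM2r ?decay_ge0// wt_mono// le_max lexx.
rewrite /decay (_ : mu / 2 * (zabs k * t `^ alpha^-1) = c * zabs k); last by rewrite /c; ring.
rewrite expRN ler_pdivrMr ?expR_gt0// wtE//; exact: le_powR_expR.
Qed.

Lemma rapid_env D t : l2 D -> 0 < t -> rapid (fun k => D k * env 0 k t).
Proof.
move=> lD t0 p; have [C HC] := wt_decay (p - reg0 alpha) t0.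
exists ((1 + n2 D) * C) => k; rewrite env0E !normrM mulrCA.
rewrite (ger0_norm (wt_ge0 _ _)) (ger0_norm (decay_ge0 _ _ _ _)) (mulrA (wt p k)) -wtD.
apply: ler_pM => //; [by rewrite mulr_ge0 ?wt_ge0 ?decay_ge0|exact: l2_bounded].
Qed.

Lemma env0_decr k s t : 0 < s -> s <= t -> env 0 k t <= env 0 k s.
Proof. by move=> s0 st; exact: env_decr. Qed.

End Envelopes.

(** * From coefficients to a solution *)

Section Existence.
Context {R : realType} (mu alpha a b T : R).
Hypotheses (mu0 : 0 < mu) (al2 : 2 < alpha) (al5 : alpha <= 5 / 2).
Variables (h D Bm : int -> R) (u : R -> int -> R) (B0 : R -> R).
Hypotheses (eD : even_seq D) (D0 : forall k, 0 <= D k) (lD : l2 D).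
Hypothesis uD : forall t k, 0 < t < T -> `|u t k| <= D k * env mu alpha 0 k t.
Hypothesis Gu : good mu alpha T Bm u.
Hypothesis ode : forall t k, 0 < t < T ->
  is_derive t 1 (u ^~ k) (- rate mu alpha k * u t k + nl a b (u t) (u t) k).
Hypothesis u0 : forall k, u t k @[t --> 0^'+] --> h k.
Hypotheses (LB0 : L2 B0) (hB0 : forall k, har B0 k = h k) (h0 : h 0 = 0).
Implicit Types (k j : int) (s t x : R) (phi : R -> R).
Local Notation leb := (@lebesgue_measure R).
Local Notation env := (env mu alpha).
Local Notation rate := (rate mu alpha).

(** At t = 0 the datum itself is taken: its Hartley series need not converge absolutely. *)
Definition sol t : R -> R := if t == 0 then B0 else syn (u t).

Lemma sol0 : sol 0 = B0. Proof. by rewrite /sol eqxx. Qed.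

Lemma sol_gt0 t : 0 < t -> sol t = syn (u t).
Proof. by move=> t0; rewrite /sol gt_eqF. Qed.

Lemma rapid_u t : 0 < t < T -> rapid (u t).
Proof.
move=> tT; have /andP[t0 _] := tT; apply: rapid_le (rapid_env alpha mu0 lD t0) => k.
exact: le_trans (uD k tT) (ler_norm _).
Qed.

Lemma summ_u t : 0 < t < T -> summ (u t).
Proof. by move=> /rapid_u/rapid_summ. Qed.

Lemma sol_cintg t : 0 <= t < T -> cintg (sol t).
Proof.
move=> /andP[]; rewrite le_eqVlt => /predU1P[<- _|t0 tT].
  by rewrite /sol eqxx; exact: L2_cintg.
rewrite sol_gt0//; apply: continuous_cintg; apply: continuous_syn; apply: summ_u.
by rewrite t0.
Qed.

Lemma sol_L2 t : 0 <= t < T -> L2 (sol t).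
Proof.
move=> /andP[]; rewrite le_eqVlt => /predU1P[<- _|t0 tT]; first by rewrite /sol eqxx.
rewrite sol_gt0//; apply: continuous_L2; apply: continuous_syn; apply: summ_u.
by rewrite t0.
Qed.

Lemma har_sol t k : 0 < t < T -> har (sol t) k = u t k.
Proof. by move=> tT; have /andP[t0 _] := tT; rewrite sol_gt0// har_syn//; exact: summ_u. Qed.

Lemma u_zero t : 0 < t < T -> u t 0 = 0.
Proof.
move=> tT; apply/eqP; rewrite -normr_le0; apply: (le_trans (uD 0 tT)).
by rewrite env0E wt0 mul0r mulr0.
Qed.

Definition solJ t : R -> R := syn (fun k => - (zabs k * u t k)).
Definition solJx t : R -> R := syn (fun k => k%:~R * zabs k * u t (- k)).
Definition solBx t : R -> R := syn (fun k => - k%:~R * u t (- k)).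
Definition solLB t : R -> R := syn (fun k => zabs k `^ alpha * u t k).

Lemma summ_sol t : 0 < t < T ->
  [/\ summ (fun k => zabs k * u t k), summ (fun k => k%:~R * zabs k * u t (- k)),
      summ (fun k => - k%:~R * u t (- k)) & summ (fun k => zabs k `^ alpha * u t k)].
Proof.
move=> tT; have ru := rapid_u tT; have rN := rapidN ru; split; apply: rapid_summ.
- exact: rapid_zabs.
- by apply: rapid_le (rapid_mulZ (rapid_zabs rN)) => k; rewrite mulrA.
- by apply: rapid_le (rapid_mulZ rN) => k; rewrite mulNr normrN.
- by apply: rapid_powR ru; rewrite gt_eqF ?(alpha_gt0 al2).
Qed.

Lemma sol_operators t : 0 < t < T ->
  [/\ Lambda 1 (sol t) (fun x => - solJ t x), weak_derivative (sol t) (solBx t),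
      weak_derivative (solJ t) (solJx t), Hilbert (solJ t) (solBx t) &
      Lambda alpha (sol t) (solLB t)].
Proof.
move=> tT; have /andP[t0 tT'] := tT; have su := summ_u tT.
have [s1 s2 s3 s4] := summ_sol tT; have sJ := summN s1.
have iB : cintg (sol t) by apply: sol_cintg; rewrite (ltW t0).
have EJ : (fun x => - solJ t x) = syn (fun k => zabs k * u t k).
  apply/funext => x; rewrite /solJ -mulN1r syn_scale//.
  by apply: eq_zsum => k; rewrite mulN1r opprK.
split.
- rewrite EJ; apply: har_Lambda => //; first exact: continuous_L2 (continuous_syn s1).
  by move=> k; rewrite har_syn// har_sol// powRr1 ?zabs_ge0.
- by rewrite sol_gt0//; exact: syn_weak_derivative.
- have E : (fun k => k%:~R * zabs k * u t (- k)) = (fun k => - k%:~R * - (zabs (- k) * u t (- k))).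
    by apply/funext => k; rewrite zabsN; ring.
  by rewrite /solJx E; apply: syn_weak_derivative => //; rewrite -E.
(* The relation B_x = H J on coefficients is k = sg(k) |k|. *)
- have E : (fun k => - k%:~R * u t (- k)) = (fun k => Num.sg k%:~R * - (zabs (- k) * u t (- k))).
    by apply/funext => k; rewrite zabsN {1}[k%:~R]numEsg -zabsE; ring.
  rewrite /solBx E; apply: syn_Hilbert => //.
  by apply: rapid_summ; apply: rapid_zabs; apply: rapid_le (rapid_zabs (rapid_u tT)) => k; rewrite normrN.
- apply: har_Lambda => //; first exact: continuous_L2 (continuous_syn s4).
  by move=> k; rewrite har_syn// har_sol.
Qed.

Lemma sol_rhs phi t : 0 < t < T -> test_function phi ->
  cint (fun x => (a * sol t x * solJx t x + b * solJ t x * solBx t x + mu * solLB t x) * phi x) =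
  zsum (fun k => - (2 * pi) * har phi k * (- rate k * u t k + nl a b (u t) (u t) k)).
Proof.
move=> tT tp; have /andP[t0 tT'] := tT; have su := summ_u tT.
have [s1 s2 s3 s4] := summ_sol tT; have sJ := summN s1.
have iB : cintg (sol t) by apply: sol_cintg; rewrite (ltW t0).
have ci (h' : int -> R) : summ h' -> cintg (syn h') by move=> sh; exact: continuous_cintg (continuous_syn sh).
have E k : har (sol t) k = u t k by exact: har_sol.
have EB : har (sol t) = u t by apply/funext.
have [|||||iW hW] := @har_rhs R a b mu alpha (sol t) (solJ t) (solJx t) (solBx t) (solLB t) al2 iB (ci _ sJ) (ci _ s2) (ci _ s3) (ci _ s4).
- by rewrite EB; exact: rapid_u.
- by move=> k; rewrite EB har_syn.
- by move=> k; rewrite har_syn// har_syn// zabsN; ring.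
- by move=> k; rewrite EB har_syn.
- by move=> k; rewrite EB har_syn.
have [s ->] := test_pairing iW tp.
rewrite -zsumZ//; apply: eq_zsum => k; rewrite hW EB; ring.
Qed.

(** Each mode is integrated in time by the fundamental theorem. The sum over modes is exchanged with
    the time integral thanks to the envelope frozen at [t1], which dominates on the whole of
    [[t1, t2]]. *)
Lemma sol_evolution phi : test_function phi ->
  let F t := cint (fun x =>
    (a * sol t x * solJx t x + b * solJ t x * solBx t x + mu * solLB t x) * phi x) in
  forall t1 t2 : R, 0 < t1 -> t1 <= t2 -> t2 < T ->
  leb.-integrable `[t1, t2] (EFin \o F) /\
  cint (fun x => sol t2 x * phi x) - cint (fun x => sol t1 x * phi x) =
  - \int[leb]_(t in `[t1, t2]) F t.
Proof.
move=> tp F t1 t2 t10 t12 t2T.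
have tT t : t1 <= t <= t2 -> 0 < t < T by move=> /andP[h1 h2]; apply/andP; split; lra.
pose g k t := - (2 * pi) * har phi k * (- rate k * u t k + nl a b (u t) (u t) k).
have FE t : `[t1, t2]%classic t -> F t = zsum (g ^~ t).
  by rewrite /= in_itv/= => /tT tT'; rewrite /F sol_rhs.
pose U k := D k * env 0 k t1.
have U0 k : 0 <= U k by rewrite mulr_ge0// env_ge0.
have eU : even_seq U by move=> k; rewrite /U eD envN.
have rU : rapid U := rapid_env alpha mu0 lD t10.
have uU t k : t1 <= t <= t2 -> `|u t k| <= U k.
  move=> tt; have /andP[h1 h2] := tt; apply: (le_trans (uD k (tT t tt))).
  by rewrite ler_wpM2l// env0_decr.
have [C HC] := domt_rapid U0 rU; have [C' HC'] := rU alpha.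
have cg k t : t1 <= t <= t2 -> {for t, continuous (g k)}.
  move=> /tT tt; apply: cvgMr; apply: cvgD; first by apply: cvgMr; exact: (good_cont Gu).
  exact: (good_nl_cont mu0 al2 al5 Gu).
have mg k : measurable_fun `[t1, t2] (g k).
  by have /measurable_EFinP := measurable_int _ (continuous_at_integrable (cg k)).
have iw : leb.-integrable `[t1, t2] (EFin \o (fun _ : R => 2 * pi * (mu * C' + 2 * (`|a| + `|b|) * C))).
  by apply: continuous_at_integrable => x _; exact: cvg_cst.
have gB k t : `[t1, t2]%classic t -> `|g k t| <= `|har phi k| * (2 * pi * (mu * C' + 2 * (`|a| + `|b|) * C)).
  rewrite /= in_itv/= => tt; have [sU zU] := HC k.
  rewrite /g normrM normrM normrN (ger0_norm (ltW pi2_gt0)) -mulrA mulrCA.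
  rewrite ler_wpM2l// ler_wpM2l ?(ltW pi2_gt0)//.
  apply: (le_trans (ler_normD _ _)); apply: lerD.
    rewrite normrM normrN rateE normrM (gtr0_norm mu0) (ger0_norm (wt_ge0 _ _)) -mulrA ler_wpM2l ?(ltW mu0)//.
    apply: le_trans (HC' k); rewrite ler_wpM2l ?wt_ge0// (ger0_norm (U0 k)).
    exact: uU.
  apply: (le_trans (nl_bound eU eU sU a b (fun j => uU t j tt) (fun j => uU t j tt))).
  by rewrite ler_wpM2l ?mulr_ge0 ?addr_ge0.
have mI : measurable (`[t1, t2]%classic : set R) by exact: measurable_itv.
have [H1 _ H3] := @zsum_integral R _ _ leb _ mI g _ _ (summ_norm (test_summ tp)) iw mg gB.
split.
  by apply: eq_integrable H1 => // t; rewrite inE => /FE /= ->.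
have -> : \int[leb]_(t in `[t1, t2]) F t = \int[leb]_(t in `[t1, t2]) zsum (g ^~ t).
  by apply: eq_Rintegral => t; rewrite inE; exact: FE.
have t2' : 0 < t2 < T by apply/andP; split; lra.
have t1' : 0 < t1 < T by apply/andP; split; lra.
have i2 : cintg (sol t2) by apply: sol_cintg; apply/andP; split; lra.
have i1 : cintg (sol t1) by apply: sol_cintg; apply/andP; split; lra.
have [s2 ->] := test_pairing i2 tp; have [s1 ->] := test_pairing i1 tp.
rewrite H3 -mulrBr -zsumB// -zsumZ; last exact: summB.
have E k : \int[leb]_(t in `[t1, t2]) g k t = - (2 * pi * (har phi k * har (sol t2) k - har phi k * har (sol t1) k)).
  have dG t : t1 <= t <= t2 -> is_derive t 1 (fun t => - (2 * pi) * har phi k * u t k) (g k t).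
    by move=> /tT tt; have d := ode k tt; apply: is_derive_eq; rewrite /GRing.scale.
  rewrite (FTC2_R t12 (cg k) dG) (har_sol k t2') (har_sol k t1').
  move: (2 * pi) (har phi k) (u t2 k) (u t1 k) => c p y z; ring.
rewrite (eq_zsum E) (zsumN (summZ _ (summB s2 s1))) opprK; reflexivity.
Qed.

Lemma sol_is_solution : is_solution a b mu alpha T B0 sol.
Proof.
split.
- by rewrite /sol eqxx; apply: aeW.
- move=> t /andP[]; rewrite le_eqVlt => /predU1P[<- _|t0 tT]; apply/zero_mean_har.
    by rewrite /sol eqxx hB0.
  by rewrite har_sol ?u_zero ?t0.
exists solJ, solJx, solBx, solLB; split; first exact: sol_operators.
exact: sol_evolution.
Qed.

End Existence.

(** * Homogeneous and inhomogeneous weights *)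

Section Weights.
Context {R : realType}.
Implicit Types (k : int) (s : R).

Lemma wt_sqr s k : k != 0 -> wt s k ^+ 2 = (k%:~R ^+ 2) `^ s.
Proof.
by move=> k0; rewrite wtE// -sqr_zabs expr2 -powRM ?zabs_ge0// -expr2.
Qed.

Lemma sobw_ge s k : 0 <= s -> wt s k ^+ 2 <= sobw s k.
Proof.
move=> s0; have [->|k0] := eqVneq k 0; first by rewrite wt0 expr0n sobw_ge0.
rewrite wt_sqr// /sobw ge0_ler_powR ?nnegrE ?addr_ge0 ?sqr_ge0//.
by rewrite lerDr.
Qed.

Lemma sobw_le s k : 0 <= s -> k != 0 -> sobw s k <= 2 `^ s * wt s k ^+ 2.
Proof.
move=> s0 k0; rewrite wt_sqr// -powRM ?sqr_ge0//.
have q0 := sqr_ge0 (k%:~R : R).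
apply: ge0_ler_powR => //; rewrite ?nnegrE; [exact: addr_ge0|exact: mulr_ge0|].
have := zabs_ge1 (R := R) k0; rewrite -sqr_zabs; move: (zabs k) => y y1; nra.
Qed.

End Weights.

(** * Decay profiles and parabolic smoothing *)

Section Decay.
Context {R : realType} (mu alpha : R).
Hypotheses (mu0 : 0 < mu) (al2 : 2 < alpha).
Implicit Types (k : int) (s t be : R).
Local Notation decay := (decay mu alpha).
Local Notation leb := (@lebesgue_measure R).

(** For k <> 0 a function of the single variable |k| t^(1/alpha), see [profE]: bounded uniformly in
    [k] and [t], and small for fixed [k] as t tends to 0 when be > 0. *)
Definition decay_profile be k t : R := t `^ (be / alpha) * (wt be k * decay k t).
Local Notation prof := decay_profile.

Lemma prof_ge0 be k t : 0 <= prof be k t.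
Proof. by rewrite mulr_ge0 ?powR_ge0// mulr_ge0 ?wt_ge0 ?decay_ge0. Qed.

Lemma profE be k t : k != 0 ->
  prof be k t = (zabs k * t `^ alpha^-1) `^ be * expR (- (mu / 2 * (zabs k * t `^ alpha^-1))).
Proof.
move=> k0; rewrite powRM ?zabs_ge0 ?powR_ge0// -powRrM (mulrC alpha^-1) -wtE//.
by rewrite /decay_profile /decay; ring.
Qed.

Lemma prof_le be : 0 <= be -> exists2 C, 0 <= C & forall k t, prof be k t <= C.
Proof.
rewrite le_eqVlt => /predU1P[<-|be0].
  exists 1 => // k t; rewrite /decay_profile mul0r powRr0 mul1r -[leRHS]mulr1.
  apply: ler_pM; rewrite ?wt_ge0 ?decay_ge0 ?wt_le1// decayE -expR0 ler_expR oppr_le0.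
  by rewrite mulr_ge0 ?divr_ge0 ?(ltW mu0)// mulr_ge0 ?zabs_ge0 ?powR_ge0.
have c0 : 0 < mu / 2 by rewrite divr_gt0.
exists ((be / (mu / 2)) `^ be) => [|k t]; first exact: powR_ge0.
have [->|k0] := eqVneq k 0; first by rewrite /decay_profile wt0 mul0r mulr0 powR_ge0.
rewrite profE//; set y := zabs k * _; have y0 : 0 <= y by rewrite mulr_ge0 ?zabs_ge0 ?powR_ge0.
move: y0; rewrite le_eqVlt => /predU1P[<-|y0]; first by rewrite powR0 ?gt_eqF// mul0r powR_ge0.
by rewrite expRN ler_pdivrMr ?expR_gt0//; exact: le_powR_expR.
Qed.

Lemma prof_cvg0 be k : 0 < be -> prof be k t @[t --> 0^'+] --> 0.
Proof.
move=> be0; have p : 0 < be / alpha by rewrite divr_gt0// (alpha_gt0 al2).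
have H : t `^ (be / alpha) * wt be k @[t --> (0 : R)^'+] --> (0 : R).
  by rewrite -[X in _ --> X](mul0r (wt be k)); apply: cvgMl; exact: powR_cvg0.
apply: (@squeeze_cvgr _ _ _ _ (fun=> 0) (fun t => t `^ (be / alpha) * wt be k)) => //; last exact: cvg_cst.
apply: nearW => t; rewrite prof_ge0/= /decay_profile ler_wpM2l ?powR_ge0// -[leRHS]mulr1 ler_wpM2l ?wt_ge0//.
rewrite decayE -expR0 ler_expR oppr_le0.
by rewrite mulr_ge0 ?divr_ge0 ?(ltW mu0)// mulr_ge0 ?zabs_ge0 ?powR_ge0.
Qed.

Lemma decay_cont k t : 0 < t -> {for t, continuous (decay k)}.
Proof.
move=> t0; rewrite (_ : decay k = fun t => expR (- (mu / 2 * (zabs k * t `^ alpha^-1))))//.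
apply: (@continuous_comp _ _ _ (fun t => - (mu / 2 * (zabs k * t `^ alpha^-1))) expR); last exact: continuous_expR.
apply: cvgN; apply: cvgMr; apply: cvgMr.
exact: is_derive_cont (is_derive1_powR alpha^-1 t0).
Qed.

(* e^(-mu y) <= C / (1 + y^alpha)^2 with y^alpha = |k|^alpha t, whose integral
   in t is at most C |k|^(-alpha). *)
Lemma decay_smoothing T : 0 < T -> exists2 C, 0 <= C & forall k,
  (\int[leb]_(t in `]0%R, T[) ((wt (alpha / 2) k * decay k t) ^+ 2)%:E <= C%:E)%E.
Proof.
move=> T0; have a0 := alpha_gt0 al2.
have [C1 C10 H1] := prof_le (ltW a0).
exists (2 + 2 * C1 ^+ 2) => [|k]; first by rewrite addr_ge0// mulr_ge0// sqr_ge0.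
set C := 2 + _; have C0 : 0 <= C by rewrite addr_ge0// mulr_ge0// sqr_ge0.
have [k0|k0] := eqVneq k 0.
  rewrite (eq_integral (fun=> 0%E)) ?integral0 ?lee_fin// => t _.
  by rewrite k0 wt0 mul0r expr0n.
pose A : R := wt alpha k; have A0 : 0 < A by rewrite /A wtE// powR_gt0// zabs_gt0.
pose g t : R := C * (A / (1 + A * t) ^+ 2).
have p1 t : 0 <= t -> 0 < 1 + A * t by move=> t0; rewrite ltr_wpDr// mulr_ge0// ltW.
have B t : 0 < t -> (wt (alpha / 2) k * decay k t) ^+ 2 <= g t.
  move=> t0; have := H1 k t; rewrite /decay_profile divff ?gt_eqF// powRr1 ?(ltW t0)// -/A => H2.
  have W2 : wt (alpha / 2) k ^+ 2 = A by rewrite expr2 -wtD -splitr.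
  have d1 : decay k t <= 1.
    rewrite decayE -expR0 ler_expR oppr_le0.
    by rewrite mulr_ge0 ?divr_ge0 ?(ltW mu0)// mulr_ge0 ?zabs_ge0 ?powR_ge0.
  have -> : g t = A * (C / (1 + A * t) ^+ 2) by rewrite /g mulrCA.
  rewrite exprMn W2 ler_wpM2l ?(ltW A0)// ler_pdivlMr ?exprn_gt0 ?p1 ?(ltW t0)//.
  have := decay_ge0 mu alpha k t; move: d1 H2 (p1 t (ltW t0)); rewrite /C.
  have At : 0 <= A * t by rewrite mulr_ge0 ?ltW.
  rewrite (_ : t * (A * decay k t) = A * t * decay k t); last by ring.
  move: At; move: (A * t) (decay k t) => y dd y0 d1 H2 _ d0.
  have h1 : dd ^+ 2 <= 1 by rewrite expr_le1.
  have h2 : (y * dd) ^+ 2 <= C1 ^+ 2 by apply: lerXn2r; rewrite ?nnegrE// mulr_ge0.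
  by have := sqr_ge0 (dd - y * dd); move: h1 h2; rewrite exprMn; nra.
have cg t : 0 <= t <= T -> {for t, continuous g}.
  move=> /andP[t0 _]; apply: cvgMr; apply: cvgMr; apply: cvgV; first by rewrite expf_neq0// gt_eqF// p1.
  have c1 : {for t, continuous (fun t => 1 + A * t)}.
    by apply: cvgD; [exact: cvg_cst|apply: cvgMr; exact: cvg_id].
  by apply: (@continuousM _ _ (fun t => 1 + A * t) (fun t => 1 + A * t)).
have dg t : 0 <= t <= T -> is_derive t 1 (fun t => - C * (1 + A * t)^-1) (g t).
  move=> /andP[t0 _]; have n0 : 1 + A * t != 0 by rewrite gt_eqF// p1.
  have d0 := is_derive_mulc A t.
  have d1 : is_derive t 1 (fun t => 1 + A * t) A.
    by have := is_deriveD (is_derive_cst (1 : R) t 1) d0; rewrite add0r.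
  have d2 := is_deriveV (f := fun t => 1 + A * t) n0 d1.
  apply: is_derive_eq; rewrite /GRing.scale/= /g; by field.
apply: (@le_trans _ _ (\int[leb]_(t in `[0%R, T]) (g t)%:E)%E).
  apply: (@le_trans _ _ (\int[leb]_(t in `]0%R, T[) (g t)%:E)%E).
    apply: ge0_le_integral => //.
    - by move=> t _; rewrite lee_fin sqr_ge0.
    - apply/measurable_EFinP; apply: measurable_funX; apply: measurable_funM => //.
      apply: (@continuous_at_measurable _ _ 0 T) => // t /andP[t0 _]; exact: decay_cont.
    - apply/measurable_EFinP; apply: (@continuous_at_measurable _ _ 0 T) => // t /andP[t0 t1].
      by apply: cg; rewrite (ltW t0) (ltW t1).
    - by move=> t; rewrite /= in_itv/= => /andP[t0 _]; rewrite lee_fin B.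
  apply: ge0_subset_integral => //.
  - by have /measurable_int := continuous_at_integrable cg.
  - move=> t; rewrite /= in_itv/= => /andP[t0 _]; rewrite lee_fin /g mulr_ge0// divr_ge0 ?(ltW A0)//.
    exact: sqr_ge0.
  - by apply: subset_itv; rewrite bnd_simp.
rewrite (FTC2 (ltW T0) cg dg) lee_fin mulr0 addr0 invr1 mulr1 mulNr opprK.
by rewrite gerDr oppr_le0 mulr_ge0// invr_ge0 ltW// p1// ltW.
Qed.

End Decay.

(** * The constructed solution belongs to the class *)

Section SolutionClass.
Context {R : realType} (mu alpha a b T : R).
Hypotheses (mu0 : 0 < mu) (al2 : 2 < alpha) (al5 : alpha <= 5 / 2) (T0 : 0 < T).
Variables (h D Bm : int -> R) (u : R -> int -> R) (B0 : R -> R).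
Hypotheses (D0 : forall k, 0 <= D k) (lD : l2 D).
Hypothesis uD : forall t k, 0 < t < T -> `|u t k| <= D k * env mu alpha 0 k t.
Hypothesis Gu : good mu alpha T Bm u.
Hypothesis u0 : forall k, u t k @[t --> 0^'+] --> h k.
Hypotheses (SB0 : Sobolev (reg0 alpha) B0) (hB0 : forall k, har B0 k = h k) (h0 : h 0 = 0).
Implicit Types (k j : int) (s t x be : R) (phi : R -> R).
Local Notation leb := (@lebesgue_measure R).
Local Notation decay := (decay mu alpha).
Local Notation prof := (decay_profile mu alpha).
Local Notation sol := (sol u B0).
Local Notation reg0 := (reg0 alpha).

Let LB0 : L2 B0 := SB0.1.
Let iB t : 0 <= t < T -> cintg (sol t) := sol_cintg mu0 lD uD LB0 (t := t).
Let hs t k : 0 < t < T -> har (sol t) k = u t k := har_sol mu0 B0 lD uD (t := t) k.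

Lemma reg0_ge0 : 0 <= reg0. Proof. by have := al5; rewrite reg0E; lra. Qed.

(** The weight of order [reg0] in the Sobolev norm cancels the one in [env], leaving [D k] in l^2
    times the decay factor. The weighted bounds and limits and the L^2 bound in time are all
    summations of this estimate. *)
Lemma sob_term_le be k t : 0 <= be -> 0 < t < T ->
  sobw (reg0 + be) k * u t k ^+ 2 <= 2 `^ (reg0 + be) * (D k * (wt be k * decay k t)) ^+ 2.
Proof.
move=> be0 tT; have s0 : 0 <= reg0 + be by rewrite addr_ge0// reg0_ge0.
have [->|k0] := eqVneq k 0.
  by rewrite (u_zero uD tT) expr0n mulr0 mulr_ge0 ?powR_ge0 ?sqr_ge0.
apply: (le_trans (ler_wpM2r (sqr_ge0 _) (sobw_le s0 k0))).
rewrite -mulrA ler_wpM2l ?powR_ge0// -exprMn.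
rewrite -[X in X <= _]real_normK ?num_real// lerXn2r ?nnegrE//.
  by rewrite !mulr_ge0 ?wt_ge0 ?decay_ge0.
rewrite normrM (ger0_norm (wt_ge0 _ _)); apply: (le_trans (ler_wpM2l (wt_ge0 _ _) (uD k tT))).
have W : wt (reg0 + be) k * (wt (- reg0) k * decay k t) = wt be k * decay k t.
  by rewrite mulrA -wtD addrAC subrr add0r.
by rewrite env0E mulrCA W.
Qed.

Lemma t_sob_term_le be k t : 0 <= be -> 0 < t < T ->
  (t `^ (be / alpha)) ^+ 2 * (sobw (reg0 + be) k * u t k ^+ 2) <=
  2 `^ (reg0 + be) * (D k * prof be k t) ^+ 2.
Proof.
move=> be0 tT; apply: (le_trans (ler_wpM2l (sqr_ge0 _) (sob_term_le k be0 tT))).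
by rewrite le_eqVlt /decay_profile; apply/orP; left; apply/eqP; ring.
Qed.

Lemma summ_sob be t : 0 <= be -> 0 < t < T ->
  summ (fun k => sobw (reg0 + be) k * u t k ^+ 2).
Proof.
move=> be0 tT; have /andP[t0 _] := tT; have [C C0 HC] := prof_le alpha mu0 be0.
have p0 : 0 < (t `^ (be / alpha)) ^+ 2 by rewrite exprn_gt0// powR_gt0.
apply: le_summ_ge0 (summZ (2 `^ (reg0 + be) * C ^+ 2 / (t `^ (be / alpha)) ^+ 2) lD) => k.
rewrite ger0_norm ?sob_term_ge0// mulrAC ler_pdivlMr// mulrC.
apply: (le_trans (t_sob_term_le k be0 tT)); rewrite -mulrA ler_wpM2l ?powR_ge0//.
by rewrite exprMn mulrC ler_wpM2r ?sqr_ge0// lerXn2r ?nnegrE ?prof_ge0.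
Qed.

Lemma sol_sobolev_norm be t : 0 <= be -> 0 < t < T ->
  sobolev_norm (reg0 + be) (sol t) = (Num.sqrt (sob (reg0 + be) (u t)))%:E.
Proof.
move=> be0 tT; have /andP[t0 tT'] := tT.
have E : har (sol t) = u t by apply/funext => k; exact: hs.
rewrite sobolev_norm_fin ?E; last exact: summ_sob.
  by rewrite powR12_sqrt// sob_ge0.
by apply: iB; rewrite (ltW t0).
Qed.

Lemma sol_Sobolev be t : 0 <= be -> 0 < t < T -> Sobolev (reg0 + be) (sol t).
Proof.
move=> be0 tT; have /andP[t0 tT'] := tT; split; last by rewrite sol_sobolev_norm// ltry.
by apply: (sol_L2 mu0 lD uD LB0); rewrite (ltW t0).
Qed.

Lemma t_sobolev_le be t : 0 <= be -> 0 < t < T ->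
  ((t `^ (be / alpha))%:E * sobolev_norm (reg0 + be) (sol t))%E =
    (Num.sqrt ((t `^ (be / alpha)) ^+ 2 * sob (reg0 + be) (u t)))%:E /\
  summ (fun k => 2 `^ (reg0 + be) * (D k * prof be k t) ^+ 2) /\
  (t `^ (be / alpha)) ^+ 2 * sob (reg0 + be) (u t) <= zsum (fun k => 2 `^ (reg0 + be) * (D k * prof be k t) ^+ 2).
Proof.
move=> be0 tT; split.
  by rewrite sol_sobolev_norm// -EFinM sqrtrM ?sqr_ge0// sqrtr_sqr ger0_norm ?powR_ge0.
have [C C0 HC] := prof_le alpha mu0 be0.
have s : summ (fun k => 2 `^ (reg0 + be) * (D k * prof be k t) ^+ 2).
  apply: summZ; apply: le_summ_ge0 (summZ (C ^+ 2) lD) => k.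
  rewrite ger0_norm ?sqr_ge0// exprMn mulrC ler_wpM2r ?sqr_ge0//.
  by rewrite lerXn2r ?nnegrE ?prof_ge0.
split=> //; have s' := summ_sob be0 tT.
rewrite /sob -zsumZ//; apply: le_zsum => //; first exact: summZ.
by move=> k; exact: t_sob_term_le.
Qed.

Lemma sol_sup be : 0 <= be ->
  (ereal_sup [set (t `^ (be / alpha))%:E * sobolev_norm (reg0 + be) (sol t)
             | t in `]0%R, T[ ] < +oo)%E.
Proof.
move=> be0; have [C C0 HC] := prof_le alpha mu0 be0.
apply: (@le_lt_trans _ _ (Num.sqrt (2 `^ (reg0 + be) * C ^+ 2 * n2 D))%:E); last exact: ltry.
apply: ge_ereal_sup => _ [t + <-]; rewrite /= in_itv/= => tT.
have [-> [s H]] := t_sobolev_le be0 tT.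
rewrite lee_fin ler_wsqrtr//; apply: (le_trans H).
rewrite -zsumZ//; apply: le_zsum => //; first exact: summZ.
move=> k; rewrite -mulrA ler_wpM2l ?powR_ge0// exprMn mulrC ler_wpM2r ?sqr_ge0//.
by rewrite lerXn2r ?nnegrE ?prof_ge0.
Qed.

(** Dominated convergence over [k]: the profiles tend to 0 frequency by frequency and are uniformly
    bounded. *)
Lemma sol_lim be : 0 < be ->
  ((t `^ (be / alpha))%:E * sobolev_norm (reg0 + be) (sol t))%E @[t --> 0^'+] --> 0%E.
Proof.
move=> be0; have [C C0 HC] := prof_le alpha mu0 (ltW be0).
pose P t := zsum (fun k => 2 `^ (reg0 + be) * (D k * prof be k t) ^+ 2).
have cP : P t @[t --> 0^'+] --> (0 : R).
  apply/cvg_at_rightP => w [w0 cw]; have -> : (0 : R) = zsum (fun _ : int => 0 : R) by rewrite zsum0.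
  apply: (zsum_cvg (summZ (2 `^ (reg0 + be) * C ^+ 2) lD)) => [n k|k].
    rewrite (ger0_norm (mulr_ge0 (powR_ge0 _ _) (sqr_ge0 _))) -mulrA ler_wpM2l ?powR_ge0//.
    by rewrite exprMn mulrC ler_wpM2r ?sqr_ge0// lerXn2r ?nnegrE ?prof_ge0.
  have /cvg_at_rightP H := prof_cvg0 mu0 al2 k be0.
  have {}H := H w (conj w0 cw).
  rewrite -[X in _ --> X](mulr0 (2 `^ (reg0 + be))); apply: cvgMr.
  rewrite -[X in _ --> X](mulr0 (D k * 0)); under eq_fun do rewrite expr2.
  rewrite (_ : D k * 0 * 0 = (D k * 0) * (D k * 0)); last by ring.
  by apply: cvgM; apply: cvgMr.
have cS : Num.sqrt (P t) @[t --> 0^'+] --> (0 : R).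
  by rewrite -[X in _ --> X](sqrtr0 R); exact: cvg_comp cP (@sqrt_continuous R 0).
have E : \forall t \near 0^'+, (Num.sqrt ((t `^ (be / alpha)) ^+ 2 * sob (reg0 + be) (u t)))%:E =
    ((t `^ (be / alpha))%:E * sobolev_norm (reg0 + be) (sol t))%E.
  near=> t; have tT : 0 < t < T.
    by apply/andP; split; near: t; [exact: nbhs_right_gt|exact: nbhs_right_lt].
  by have [-> _] := t_sobolev_le (ltW be0) tT.
apply: cvg_trans (near_eq_cvg E) _; apply: cvg_EFin; first by apply: nearW.
apply: (@squeeze_cvgr _ _ _ _ (fun=> 0) (fun t => Num.sqrt (P t))) => //; last exact: cvg_cst.
near=> t; rewrite sqrtr_ge0/= ler_wsqrtr//.
have tT : 0 < t < T.
  by apply/andP; split; near: t; [exact: nbhs_right_gt|exact: nbhs_right_lt].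
by have [_ []] := t_sobolev_le (ltW be0) tT.
Unshelve. all: by end_near. Qed.

Lemma itv0_split : `[0, T[%classic = [set 0] `|` `]0, T[%classic :> set R.
Proof.
apply/seteqP; split=> t /=; rewrite !in_itv/=.
  by move=> /andP[]; rewrite le_eqVlt => /predU1P[<-|t0 tT]; [left|right; rewrite t0].
by case=> [->|/andP[t0 ->]]; [rewrite lexx|rewrite ltW].
Qed.

Lemma measurable_fun_itv0 d' (Y : measurableType d') (f : R -> Y) :
  measurable_fun `]0, T[ f -> measurable_fun `[0, T[ f.
Proof.
move=> mf; rewrite itv0_split; apply/measurable_funU => //; split=> //.
exact: measurable_fun_set1.
Qed.

Lemma measurable_u k : measurable_fun `]0, T[ (u ^~ k).
Proof. by apply: (@continuous_at_measurable _ _ 0 T) => // t; exact: (good_cont Gu). Qed.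

Lemma measurable_har_sol k : measurable_fun `[0, T[ (fun t => har (sol t) k).
Proof.
apply: measurable_fun_itv0; apply: eq_measurable_fun (measurable_u k) => t.
by rewrite inE/= in_itv/= => tT; rewrite hs.
Qed.

(** Tonelli's theorem brings the time integral inside the sum over modes, where [decay_smoothing]
    bounds it uniformly in [k]. The sum is split into two series over nat to obtain measurability
    and the exchange. *)
Lemma sol_L2_Sobolev : L2_Sobolev T (5 / 2 - alpha / 2) sol.
Proof.
have a20 : 0 <= alpha / 2 by rewrite divr_ge0// ltW// (alpha_gt0 al2).
have -> : 5 / 2 - alpha / 2 = reg0 + alpha / 2 by rewrite reg0E; field.
have m0 : measurable (`[0, T[%classic : set R) by exact: measurable_itv.
split.
- move=> k; have E t : `[0, T[%classic t -> fourier (sol t) k =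
      Complex ((har (sol t) k + har (sol t) (- k)) / 2) ((har (sol t) (- k) - har (sol t) k) / 2).
    by rewrite /= in_itv/= => tT; rewrite fourierE//; exact: iB.
  split.
    apply: (@eq_measurable_fun _ _ _ _ _ (fun t => (har (sol t) k + har (sol t) (- k)) / 2)).
      by move=> t; rewrite inE => /E ->.
    by apply: measurable_funM => //; apply: measurable_funD; exact: measurable_har_sol.
  apply: (@eq_measurable_fun _ _ _ _ _ (fun t => (har (sol t) (- k) - har (sol t) k) / 2)).
    by move=> t; rewrite inE => /E ->.
  by apply: measurable_funM => //; apply: measurable_funB; exact: measurable_har_sol.
- exists [set 0]; split=> //; first exact: lebesgue_measure_set1.
  move=> t /= H; apply: contrapT => t0; apply: H => /andP[]; rewrite le_eqVlt => /predU1P[t00|t00 tT].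
    by exfalso; apply: t0.
  by apply: sol_Sobolev => //; rewrite t00.
pose s := reg0 + alpha / 2.
pose F k t : \bar R := (sobw s k * u t k ^+ 2)%:E.
pose G k t : \bar R := (2 `^ s * D k ^+ 2 * (wt (alpha / 2) k * decay k t) ^+ 2)%:E.
have F0 k t : (0 <= F k t)%E by rewrite lee_fin sob_term_ge0.
have FG k t : 0 < t < T -> (F k t <= G k t)%E.
  by move=> tT; rewrite lee_fin -mulrA -exprMn; exact: sob_term_le.
have mF k : measurable_fun `]0, T[ (F k).
  apply/measurable_EFinP; apply: measurable_funM => //; apply: measurable_funX; exact: measurable_u.
have mS1 : measurable_fun `]0, T[ (fun t => \sum_(0 <= n <oo) F (Posz n) t)%E.
  by apply: ge0_emeasurable_sum => // n _; exact: mF.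
have mS2 : measurable_fun `]0, T[ (fun t => \sum_(0 <= n <oo) F (Negz n) t)%E.
  by apply: ge0_emeasurable_sum => // n _; exact: mF.
have E t : `]0, T[%classic t -> (sobolev_norm s (sol t) ^+ 2 =
    \sum_(0 <= n <oo) F (Posz n) t + \sum_(0 <= n <oo) F (Negz n) t)%E.
  move=> tI; have tT : 0 < t < T by move: tI; rewrite /= in_itv.
  rewrite /s (sol_sobolev_norm a20 tT) expe2 -EFinM -expr2 sqr_sqrtr ?sob_ge0//.
  rewrite /sob ge0_EFin_zsum; [|exact: summ_sob|by move=> k; exact: sob_term_ge0].
  by rewrite esum_int_split// => k; exact: F0.
have mf : measurable_fun `]0, T[ (fun t => sobolev_norm s (sol t) ^+ 2)%E.
  apply: (eq_measurable_fun (fun t => \sum_(0 <= n <oo) F (Posz n) t + \sum_(0 <= n <oo) F (Negz n) t)%E).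
    by move=> t; rewrite inE => /E.
  exact: emeasurable_funD.
rewrite -integral_itv_obnd_cbnd; last exact: mf.
have -> : (\int[leb]_(t in `]0%R, T[) (sobolev_norm s (sol t) ^+ 2) =
    \int[leb]_(t in `]0%R, T[) (\sum_(0 <= n <oo) F (Posz n) t + \sum_(0 <= n <oo) F (Negz n) t))%E.
  by apply: eq_integral => t; rewrite inE => /E.
rewrite ge0_integralD//; [|by move=> t _; exact: nneseries_ge0|by move=> t _; exact: nneseries_ge0].
rewrite integral_nneseries//; last by move=> n; exact: mF.
rewrite integral_nneseries//; last by move=> n; exact: mF.
rewrite -(esum_int_split (F := fun k => \int[leb]_(t in `]0%R, T[) F k t)%E); last first.
  by move=> k; apply: integral_ge0.
have [C C0 HC] := decay_smoothing mu0 al2 T0.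
have sD : summ (fun k => 2 `^ s * C * D k ^+ 2) by exact: summZ lD.
apply: (@le_lt_trans _ _ (\esum_(k in [set: int]) (2 `^ s * C * D k ^+ 2)%:E)%E); last first.
  rewrite -ge0_EFin_zsum ?ltry// => k; by rewrite mulr_ge0 ?sqr_ge0// mulr_ge0 ?powR_ge0.
apply: le_esum => k _.
apply: (@le_trans _ _ (\int[leb]_(t in `]0%R, T[) G k t)%E).
  apply: ge0_le_integral => //.
  - exact: mF.
  - apply/measurable_EFinP; apply: measurable_funM => //; apply: measurable_funX; apply: measurable_funM => //.
    by apply: (@continuous_at_measurable _ _ 0 T) => // t /andP[t0 _]; exact: decay_cont.
  - by move=> t; rewrite /= in_itv/=; exact: FG.
rewrite /G; under eq_integral => t _ do rewrite EFinM.
rewrite ge0_integralZl//.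
- rewrite (_ : (2 `^ s * C * D k ^+ 2)%:E = ((2 `^ s * D k ^+ 2)%:E * C%:E)%E); last by rewrite -EFinM; congr EFin; ring.
  by apply: lee_wpmul2l => //; rewrite lee_fin mulr_ge0 ?powR_ge0 ?sqr_ge0.
- apply/measurable_EFinP; apply: measurable_funX; apply: measurable_funM => //.
  by apply: (@continuous_at_measurable _ _ 0 T) => // t /andP[t0 _]; exact: decay_cont.
- by move=> t _; rewrite lee_fin sqr_ge0.
- by rewrite lee_fin mulr_ge0 ?powR_ge0 ?sqr_ge0.
Qed.

Lemma har_sol_cvg t0 k (w : nat -> R) : 0 <= t0 < T -> (forall n, 0 <= w n < T) ->
  w n @[n --> \oo] --> t0 -> har (sol (w n)) k @[n --> \oo] --> har (sol t0) k.
Proof.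
move=> /andP[]; rewrite le_eqVlt => /predU1P[<- _|t00 t0T] wT cw; last first.
  have cu : u (w n) k @[n --> \oo] --> u t0 k.
    apply: (cvg_comp _ _ cw (good_cont Gu (k := k) _)).
    by rewrite t00.
  rewrite hs ?t00//; have wp := cvgr_gt _ cw _ t00.
  apply: cvg_trans cu; apply: near_eq_cvg; near=> n.
  rewrite hs//; have /andP[_ ->] := wT n; rewrite andbT; near: n; exact: wp.
have -> : har (sol 0) k = h k by rewrite sol0 hB0.
apply/cvgrPdist_lt => e e0; have /cvgrPdist_lt /(_ _ e0) [d /= d0 Hd] := @u0 k.
have /cvgrPdist_lt /(_ _ d0) := cw; apply: filterS => n /= wd.
have /andP[] := wT n; rewrite le_eqVlt => /predU1P[<- _|wn0 wnT].
  by rewrite sol0 hB0 subrr normr0.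
by rewrite hs ?wn0//; exact: Hd.
Unshelve. all: by end_near. Qed.

Lemma har_sol_bound t k : 0 <= t < T -> wt reg0 k * `|har (sol t) k| <= D k + wt reg0 k * `|h k|.
Proof.
move=> /andP[]; rewrite le_eqVlt => /predU1P[<- _|t0 tT].
  by rewrite sol0 hB0 lerDr.
have tT' : 0 < t < T by rewrite t0.
rewrite hs//; apply: (@le_trans _ _ (D k)); last by rewrite lerDl mulr_ge0 ?wt_ge0.
apply: (le_trans (ler_wpM2l (wt_ge0 _ _) (uD k tT'))).
rewrite env0E mulrCA -[leRHS]mulr1; apply: ler_wpM2l => //; rewrite mulrA -wtD subrr.
rewrite -[leRHS]mulr1; apply: ler_pM; rewrite ?wt_ge0 ?decay_ge0 ?wt_le1//.
rewrite decayE -expR0 ler_expR oppr_le0.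
by rewrite mulr_ge0 ?divr_ge0 ?(ltW mu0)// mulr_ge0 ?zabs_ge0 ?powR_ge0.
Qed.

Lemma sol_Sobolev0 t : 0 <= t < T -> Sobolev reg0 (sol t).
Proof.
move=> /andP[]; rewrite le_eqVlt => /predU1P[<- _|t0 tT]; first by rewrite sol0.
by rewrite -[reg0]addr0; apply: sol_Sobolev; rewrite ?t0.
Qed.

(** Both values at times in [[0, T[] are dominated by one sequence [M], independent of time, so the
    convergence of each mode is enough, at t0 = 0 as well. *)
Lemma sol_continuous_Sobolev : continuous_Sobolev T reg0 sol.
Proof.
split; first exact: sol_Sobolev0.
move=> t0 t0T.
have har0 t : 0 <= t < T -> har (sol t) 0 = 0.
  move=> /andP[]; rewrite le_eqVlt => /predU1P[<- _|tp tT]; first by rewrite sol0 hB0.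
  by rewrite hs ?tp// (u_zero uD)// tp.
pose M k : R := 2 `^ reg0 * (2 * (D k + wt reg0 k * `|h k|)) ^+ 2.
have lh : l2 (fun k => D k + wt reg0 k * `|h k|).
  apply: l2D => //; have [_] := SB0; rewrite sobolev_norm_lty; last exact: L2_cintg.
  apply: le_summ_ge0 => k; rewrite ger0_norm ?sqr_ge0// hB0 exprMn real_normK ?num_real//.
  by rewrite ler_wpM2r ?sqr_ge0// sobw_ge// reg0_ge0.
have sM : summ M by apply: summZ; exact: l2Z lh.
pose d t k := har (sol t) k - har (sol t0) k.
have dM t k : 0 <= t < T -> `|sobw reg0 k * d t k ^+ 2| <= M k.
  move=> tT; rewrite ger0_norm ?sob_term_ge0//.
  have [k0|k0] := eqVneq k 0.
    by rewrite k0 /d !har0// subrr expr0n mulr0 /M mulr_ge0 ?powR_ge0 ?sqr_ge0.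
  apply: (le_trans (ler_wpM2r (sqr_ge0 _) (sobw_le reg0_ge0 k0))).
  rewrite /M -mulrA ler_wpM2l ?powR_ge0// -exprMn.
  rewrite -[X in X <= _]real_normK ?num_real// lerXn2r ?nnegrE//.
    by rewrite mulr_ge0// addr_ge0// mulr_ge0 ?wt_ge0.
  rewrite normrM (ger0_norm (wt_ge0 _ _)).
  apply: (le_trans (ler_wpM2l (wt_ge0 _ _) (ler_normB _ _))); rewrite mulrDr.
  have := har_sol_bound k tT; have := har_sol_bound k t0T.
  by move=> h1 h2; rewrite mulr_natl mulr2n; exact: (lerD h2 h1).
have sd t : 0 <= t < T -> summ (fun k => sobw reg0 k * d t k ^+ 2).
  by move=> tT; apply: le_summ_ge0 sM => k; exact: dM.
(* Extended by 0 outside [[0, T[], which turns the limit within the interval into an ordinary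
   one. *)
pose g t : R := if 0 <= t < T then Num.sqrt (sob reg0 (d t)) else 0.
have gE t : 0 <= t < T -> sobolev_norm reg0 (fun x => sol t x - sol t0 x) = (g t)%:E.
  move=> tT; rewrite /g tT.
  have Ed : har (fun x => sol t x - sol t0 x) = d t by apply/funext => k; rewrite harB//; exact: iB.
  rewrite sobolev_norm_fin ?Ed; first by rewrite powR12_sqrt// sob_ge0.
    by apply: cintgB; exact: iB.
  exact: sd.
have gt0 : g t0 = 0.
  rewrite /g t0T; have -> : sob reg0 (d t0) = 0.
    by rewrite /sob (@eq_zsum _ _ (fun=> 0)) ?zsum0// => k; rewrite /d subrr expr0n mulr0.
  by rewrite sqrtr0.
have cg : g t @[t --> t0] --> (0 : R).
  apply/(@cvg_nbhsP _ R^o) => w cw.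
  (* Terms outside the interval are moved to [t0], where [g] vanishes as well, so that the majorant
     holds for every n. *)
  pose w' n := if 0 <= w n < T then w n else t0.
  have w'T n : 0 <= w' n < T by rewrite /w'; case: ifP.
  have cw' : w' n @[n --> \oo] --> t0.
    apply/cvgrPdist_lt => e e0; have /cvgrPdist_lt /(_ _ e0) := cw.
    by apply: filterS => n; rewrite /w'; case: ifP => // _ _; rewrite subrr normr0.
  have c1 : sob reg0 (d (w' n)) @[n --> \oo] --> (0 : R).
    have -> : (0 : R) = zsum (fun _ : int => 0 : R) by rewrite zsum0.
    apply: (zsum_cvg sM) => [n k|k]; first exact: dM.
    rewrite -[X in _ --> X](mulr0 (sobw reg0 k)); apply: cvgMr.
    have c0 : d (w' n) k @[n --> \oo] --> (0 : R).
      rewrite -[X in _ --> X](subrr (har (sol t0) k)); apply: cvgB; last exact: cvg_cst.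
      exact: har_sol_cvg.
    by rewrite -[X in _ --> X](mulr0 0); apply: cvgM.
  have c2 : Num.sqrt (sob reg0 (d (w' n))) @[n --> \oo] --> (0 : R).
    by rewrite -[X in _ --> X](sqrtr0 R); exact: cvg_comp c1 (@sqrt_continuous R 0).
  apply: (@squeeze_cvgr _ _ _ _ (fun=> 0) (fun n => Num.sqrt (sob reg0 (d (w' n))))) => //; last exact: cvg_cst.
  apply: nearW => n; rewrite /g /w'; case: ifP => _; first by rewrite sqrtr_ge0 lexx.
  by rewrite lexx sqrtr_ge0.
have cg' : (g t)%:E @[t --> within `[0, T[ (nbhs t0)] --> 0%E.
  apply: cvg_EFin; first by apply: nearW.
  exact: cvg_within_filter cg.
apply: cvg_trans cg'; apply: near_eq_cvg; near=> t; rewrite gE//.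
have : `[0, T[%classic t by near: t; exact: withinT.
by rewrite /= in_itv.
Unshelve. all: by end_near. Qed.

Lemma sol_class : solution_class alpha T sol.
Proof.
split; [exact: sol_continuous_Sobolev|exact: sol_L2_Sobolev|exact: sol_sup|exact: sol_lim].
Qed.

End SolutionClass.

(** * The energy estimate *)

Section Interpolation.
Context {R : realType}.
Implicit Types (f g h : int -> R) (k j : int).

(** Interpolation with a free threshold [L] in place of a product of powers. Summed over frequencies
    it stays linear in the two norms, and Hoelder's inequality is avoided. *)
Lemma powR_interp (x L th : R) : 0 < x -> 0 < L -> 0 <= th <= 1 ->
  x `^ th <= L `^ th + L `^ (th - 1) * x.
Proof.
move=> x0 L0 /andP[t0 t1]; have [xL|/ltW Lx] := leP x L.
  apply: (@le_trans _ _ (L `^ th)); first by apply: ge0_ler_powR; rewrite ?nnegrE ?(ltW x0) ?(ltW L0).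
  by rewrite lerDl mulr_ge0 ?powR_ge0 ?(ltW x0).
apply: (@le_trans _ _ (L `^ (th - 1) * x)); last by rewrite lerDr powR_ge0.
have -> : x `^ th = x `^ (th - 1) * x.
  by rewrite -{3}(powRr1 (ltW x0)) -powRDp// subrK.
rewrite ler_pM2r// -(opprB 1) !powRN lef_pV2 ?posrE ?powR_gt0//.
by apply: ge0_ler_powR; rewrite ?nnegrE ?(ltW x0) ?(ltW L0)// subr_ge0.
Qed.

Lemma rapid_l2 h : rapid h -> l2 h.
Proof.
move=> rh; have [C HC] := rh 0; have sh := rapid_summ rh.
apply: (@le_summ_ge0 _ _ (fun k => (`|C| + `|h 0|) * `|h k|)); last exact: (summZ _ (summ_norm sh)).
move=> k; rewrite normrX expr2 ler_wpM2r// ?normr_ge0//.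
have [->|k0] := eqVneq k 0; first by rewrite lerDr normr_ge0.
have := HC k; rewrite wt00// mul1r => H; apply: (le_trans H).
by apply: (le_trans (ler_norm C)); rewrite lerDl normr_ge0.
Qed.

Lemma rapid_wt_l2 s h : rapid h -> l2 (fun k => wt s k * h k).
Proof. by move=> rh; apply: rapid_l2; exact: rapid_wt. Qed.

Definition hnorm2 s h : R := n2 (fun k => wt s k * h k).

Lemma hnorm2_ge0 s h : 0 <= hnorm2 s h. Proof. exact: n2_ge0. Qed.

Lemma wt_interp (s0 s1 th L : R) k : 0 < L -> 0 <= th <= 1 ->
  wt (s0 + th * (s1 - s0)) k <= L `^ th * wt s0 k + L `^ (th - 1) * wt s1 k.
Proof.
move=> L0 ht; have [->|k0] := eqVneq k 0; first by rewrite !wt0 !mulr0 addr0.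
have z0 : 0 < zabs k :> R by rewrite zabs_gt0.
have -> : wt s1 k = wt s0 k * zabs k `^ (s1 - s0) :> R.
  by rewrite -(wtE (s1 - s0) k0) -wtD addrC subrK.
have -> : wt (s0 + th * (s1 - s0)) k = wt s0 k * (zabs k `^ (s1 - s0)) `^ th.
  by rewrite wtD (wtE (th * _) k0) -powRrM (mulrC th).
have p0 : 0 < zabs k `^ (s1 - s0) by exact: powR_gt0.
have := ler_wpM2l (wt_ge0 s0 k) (powR_interp p0 L0 ht).
move: (wt s0 k) (_ `^ (s1 - s0)) (L `^ _) (L `^ _) (_ `^ th) => w z c d e; lra.
Qed.

Lemma n2_interp (s0 s1 s th L : R) h : rapid h -> 0 < L -> 0 <= th <= 1 ->
  s = s0 + th * (s1 - s0) ->
  hnorm2 s h <=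
  L `^ th * hnorm2 s0 h + L `^ (th - 1) * hnorm2 s1 h.
Proof.
move=> rh L0 ht ->; have l0 := rapid_wt_l2 s0 rh; have l1 := rapid_wt_l2 s1 rh.
rewrite /hnorm2 /n2 -(zsumZ _ l0) -(zsumZ _ l1) -(zsumD (summZ _ l0) (summZ _ l1)).
apply: le_zsum; [exact: rapid_wt_l2|exact: summD (summZ _ l0) (summZ _ l1)|].
move=> k; have E c : (wt c k * h k) ^+ 2 = wt (2 * c) k * h k ^+ 2.
  by rewrite exprMn expr2 -wtD mulr_natl mulr2n.
rewrite !E; have := sqr_ge0 (h k); move: (h k ^+ 2) => e e0; rewrite !mulrA -mulrDl ler_wpM2r//.
have -> : 2 * (s0 + th * (s1 - s0)) = 2 * s0 + th * (2 * s1 - 2 * s0) by ring.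
exact: wt_interp.
Qed.

Definition tri p q s f g h k : R :=
  wt s k * h k * zsum (fun j => wt p j * wt q (k - j) * (f j * g (k - j))).

(** Cauchy-Schwarz against the output of [hls]. The exponents x, y, z are the extra regularity, of
    total 1/2, that the three factors share out among themselves. *)
Lemma tri_bound (p q s x y z r : R) : x + y + z = 2^-1 ->
  2 * x <= r -> 2 * y <= r -> 2 * z <= r -> 0 < r < 1 ->
  exists2 C, 0 <= C & forall f g h,
  (forall k, 0 <= f k) -> (forall k, 0 <= g k) -> (forall k, 0 <= h k) ->
  rapid f -> rapid g -> rapid h ->
  [/\ forall k, k != 0 -> summ (fun j => wt p j * wt q (k - j) * (f j * g (k - j))),
      summ (tri p q s f g h) &
      zsum (tri p q s f g h) ^+ 2 <=
      C * (hnorm2 (p + x) f * hnorm2 (q + y) g * hnorm2 (s + z) h)].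
Proof.
move=> xyz xr yr zr r01; have [C C0 H] := hls xyz xr yr zr r01; exists C => // f g h f0 g0 h0 rf rg rh.
pose F k := wt (p + x) k * f k; pose G k := wt (q + y) k * g k; pose K k := wt (s + z) k * h k.
have [lF lG lK] : [/\ l2 F, l2 G & l2 K] by split; exact: rapid_wt_l2.
have [||H1 H2 H3] := H F G _ _ lF lG; try by move=> k; rewrite mulr_ge0 ?wt_ge0.
have E k j : wt (- x) j * wt (- y) (k - j) * (F j * G (k - j)) =
    wt p j * wt q (k - j) * (f j * g (k - j)).
  have e1 : wt p j = wt (- x) j * wt (p + x) j :> R by rewrite -wtD (addrC (- x)) addrK.
  have e2 : wt q (k - j) = wt (- y) (k - j) * wt (q + y) (k - j) :> R by rewrite -wtD (addrC (- y)) addrK.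
  rewrite /F /G e1 e2; move: (wt _ j) (wt _ j) (wt _ (k - j)) (wt _ (k - j)) => *; ring.
have TE k : tri p q s f g h k = K k * bilin x y z F G k.
  have [->|k0] := eqVneq k 0; first by rewrite /tri bilin0 /K !wt0 !mul0r.
  rewrite /tri -(eq_zsum (E k)) (zsum_bilin x y z F G k0) /K wtD.
  by move: (wt s k) (wt z k) (bilin _ _ _ _ _ _) => *; ring.
split.
- by move=> k k0; apply: eq_summ (H1 k k0).
- by apply: eq_summ (summ_mul lK H2) => k; rewrite TE.
- rewrite (eq_zsum TE); apply: (le_trans (cauchy_schwarz lK H2)).
  rewrite mulrC; have := ler_wpM2r (n2_ge0 K) H3.
  rewrite -!/(n2 _) /hnorm2 -/F -/G -/K; move: (n2 K) (n2 F) (n2 G) => c d e; rewrite -!mulrA; exact.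
Qed.

End Interpolation.

Section Energy.
Context {R : realType} (mu alpha a b : R).
Hypotheses (mu0 : 0 < mu) (al2 : 2 < alpha) (al5 : alpha <= 5 / 2).
Implicit Types (u v w f g h U V W X : int -> R) (k j : int).
Local Notation rate := (rate mu alpha).
Local Notation kap := (kap alpha).
Local Notation reg0 := (reg0 alpha).

Definition evened f k : R := `|f k| + `|f (- k)|.

Lemma evened_ge0 f k : 0 <= evened f k. Proof. by rewrite addr_ge0. Qed.
Lemma evened_even f : even_seq (evened f). Proof. by move=> k; rewrite /evened opprK addrC. Qed.
Lemma le_evened f k : `|f k| <= evened f k. Proof. by rewrite lerDl. Qed.
Lemma evened0 f : f 0 = 0 -> evened f 0 = 0. Proof. by move=> f0; rewrite /evened oppr0 f0 normr0 addr0. Qed.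

Lemma rapid_norm f : rapid f -> rapid (fun k => `|f k|).
Proof. by apply: rapid_le => k; rewrite normr_id. Qed.

Lemma rapid_evened f : rapid f -> rapid (evened f).
Proof. by move=> rf; apply: rapidD; apply: rapid_norm => //; exact: rapidN. Qed.

Lemma n2_evened s f : rapid f ->
  hnorm2 s (evened f) <= 4 * hnorm2 s f.
Proof.
move=> rf; have l1 := rapid_wt_l2 s (rapid_norm rf); have l2 := rapid_wt_l2 s (rapidN (rapid_norm rf)).
have -> : hnorm2 s (evened f) = n2 (fun k => wt s k * `|f k| + wt s k * `|f (- k)|).
  by apply: eq_zsum => k; rewrite mulrDr.
apply: (le_trans (n2D_le l1 l2)).
have -> : n2 (fun k => wt s k * `|f k|) = hnorm2 s f.
  by apply: eq_zsum => k; rewrite !exprMn real_normK ?num_real.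
have -> : n2 (fun k => wt s k * `|f (- k)|) = hnorm2 s f.
  rewrite /hnorm2; have [_ <-] := l2_opp (rapid_wt_l2 s rf).
  by apply: eq_zsum => k; rewrite !exprMn real_normK ?num_real// wtN.
by move: (hnorm2 _ _) => y; lra.
Qed.

Lemma n2_wtD s f g : rapid f -> rapid g ->
  hnorm2 s (fun k => f k + g k) <= 2 * (hnorm2 s f + hnorm2 s g).
Proof.
move=> rf rg; have -> : hnorm2 s (fun k => f k + g k) = n2 (fun k => wt s k * f k + wt s k * g k).
  by apply: eq_zsum => k; rewrite mulrDr.
by apply: n2D_le; exact: rapid_wt_l2.
Qed.

(** Young's inequality for the square root of C P Q, stated on squares because the trilinear bounds
    come in that form. *)
Lemma young_root (T C P Q e : R) : 0 <= P -> 0 <= Q -> 0 <= C -> 0 < e -> T ^+ 2 <= C * (P * Q) ->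
  T <= e * P + C / e * Q.
Proof.
move=> P0 Q0 C0 e0 H; have ce : 0 <= C / e by rewrite divr_ge0// ltW.
have [T0|T0] := leP T 0.
  by apply: (le_trans T0); rewrite addr_ge0// mulr_ge0// ltW.
have r0 : 0 <= e * P + C / e * Q by rewrite addr_ge0// mulr_ge0// ltW.
rewrite -[leLHS]ger0_norm ?(ltW T0)// -[leRHS]ger0_norm//.
rewrite -ler_sqr ?nnegrE// !real_normK ?num_real//; apply: (le_trans H).
have -> : (e * P + C / e * Q) ^+ 2 = (e * P) ^+ 2 + 2 * (C * (P * Q)) + (C / e * Q) ^+ 2.
  by field; rewrite gt_eqF.
have h1 := sqr_ge0 (e * P); have h2 := sqr_ge0 (C / e * Q); have h3 : 0 <= C * (P * Q) by rewrite !mulr_ge0.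
lra.
Qed.

(* The transport term carrying one derivative on each factor [W] interpolates
   both the |X|_{H^kap} and the |W|_{H^1} norm; the two parameters are tied so
   that the powers of [L] recombine into the linear factor 1 + |X|_{H^s1}^2. *)
Lemma kap_one_interp (M e : R) : 0 <= M -> 0 < e -> exists2 C, 0 <= C & forall X W,
  rapid X -> rapid W -> hnorm2 reg0 X <= M ->
  hnorm2 kap X * hnorm2 1 W <=
  e * hnorm2 (alpha / 2) W +
  C * (1 + hnorm2 (1 + kap) X) * hnorm2 0 W.
Proof.
move=> M0 e0; have h2 := al2; have h5 := al5; have a0 : 0 < alpha by lra.
pose th : R := 1 - 2 / alpha.
have th0 : 0 < th by rewrite subr_gt0 ltr_pdivrMr// mul1r.
have th1 : th <= 1 by rewrite gerBl divr_ge0// ltW.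
pose c := ((M + 1) / e) `^ th^-1.
have Me0 : 0 < (M + 1) / e by rewrite divr_gt0//; lra.
have c0 : 0 < c by exact: powR_gt0.
have cE : (M + 1) * c `^ (- th) = e.
  rewrite powRN /c -powRrM mulVf ?gt_eqF// powRr1 ?(ltW Me0)// invf_div mulrC divfK// gt_eqF//; lra.
exists ((M + 1) * c `^ (1 - th)); first by rewrite mulr_ge0 ?powR_ge0//; lra.
move=> X W rX rW XM; set N1 := hnorm2 (1 + kap) X.
set W1 := hnorm2 (alpha / 2) W; set W0 := hnorm2 0 W.
have N10 : 0 <= N1 by exact: n2_ge0.
have W10 : 0 <= W1 by exact: n2_ge0.
have W00 : 0 <= W0 by exact: n2_ge0.
pose L := 1 + N1; have L0 : 0 < L by rewrite /L; lra.
have LP : hnorm2 kap X <= (M + 1) * L `^ th.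
  apply: (le_trans (@n2_interp _ reg0 (1 + kap) kap th L X rX L0 _ _)).
  - by rewrite (ltW th0).
  - by rewrite !kapE !reg0E /th; field; rewrite gt_eqF.
  rewrite -/N1 mulrDl mul1r mulrC; apply: lerD; first by rewrite ler_wpM2r ?powR_ge0.
  rewrite powRDp// powRN powRr1 ?(ltW L0)// -mulrA ger_pMr ?powR_gt0//.
  by rewrite mulrC ler_pdivrMr// mul1r /L lerDr.
have cL0 : 0 < c * L by exact: mulr_gt0.
have LZ : hnorm2 1 W <= (c * L) `^ (1 - th) * W0 + (c * L) `^ (1 - th - 1) * W1.
  apply: (@n2_interp _ 0 (alpha / 2) 1 (1 - th) (c * L) W rW cL0).
  - by rewrite subr_ge0 th1 gerBl ltW.
  - by rewrite /th; field; rewrite gt_eqF.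
apply: (le_trans (ler_pM _ _ LP LZ)); try exact: n2_ge0.
have E1 : L `^ th * (c * L) `^ (1 - th) = c `^ (1 - th) * L.
  rewrite powRM ?(ltW c0) ?(ltW L0)// mulrCA -powRDp// (addrC th) subrK powRr1// ltW//.
have E2 : L `^ th * (c * L) `^ (1 - th - 1) = c `^ (- th).
  rewrite (_ : 1 - th - 1 = - th); last by ring.
  by rewrite powRM ?(ltW c0) ?(ltW L0)// mulrCA -powRDp// subrr powRr0 mulr1.
rewrite -cE -/L; move: E1 E2.
move: (L `^ th) ((c * L) `^ (1 - th)) ((c * L) `^ (1 - th - 1)) (c `^ (1 - th)) (c `^ (- th)).
move=> p q r s t E1 E2.
have -> : (M + 1) * p * (q * W0 + r * W1) = (M + 1) * ((p * q) * W0 + (p * r) * W1) by ring.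
by rewrite E1 E2 le_eqVlt; apply/orP; left; apply/eqP; ring.
Qed.

(** The part |j| |l| of the kernel puts one derivative on each factor; in the part |k| |l| the
    derivative |k| is transferred to [h]. The value of [f] at 0 matters because [wt 0] vanishes
    there instead of being 1. *)
Lemma domt_split f g h k : k != 0 -> f 0 = 0 ->
  summ (fun j => wt 1 j * wt 1 (k - j) * (f j * g (k - j))) ->
  summ (fun j => wt 0 j * wt 1 (k - j) * (f j * g (k - j))) ->
  summ (domt f g k) /\ h k * zsum (domt f g k) = tri 1 1 0 f g h k + tri 0 1 1 f g h k.
Proof.
move=> k0 f0 s1 s2.
have E j : domt f g k j = wt 1 j * wt 1 (k - j) * (f j * g (k - j)) +
    wt 1 k * (wt 0 j * wt 1 (k - j) * (f j * g (k - j))).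
  have [->|j0] := eqVneq j 0; first by rewrite /domt f0 !mul0r !mulr0 addr0.
  by rewrite /domt !wt1 (wt00 j0); ring.
split; first by apply: eq_summ (summD s1 (summZ (wt 1 k) s2)) => j; rewrite E.
by rewrite (eq_zsum E) (zsumD s1 (summZ _ s2)) (zsumZ _ s2) /tri (wt00 k0); ring.
Qed.

Lemma kap_bounds : [/\ 1 / 4 <= kap, kap < 1 / 2 & 0 < 2 * kap < 1].
Proof. by have h2 := al2; have h5 := al5; rewrite kapE; split; lra. Qed.

(** Absorption of the top norm [w1]. Four applications of Young's inequality and one of the
    interpolated bound on [p * z1] each cost d times [w1], hence the 5. *)
Lemma energy_arith (C1 C2 C3 C4 C5 c d e w1 w0 n1 z1 p y1 y2 y3 y4 : R) :
  0 <= C1 -> 0 <= C2 -> 0 <= C3 -> 0 <= C4 -> 0 <= C5 -> 0 <= c -> 0 < d -> c * (5 * d) <= e ->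
  0 <= w1 -> 0 <= w0 -> 0 <= n1 -> 0 <= z1 -> 0 <= p ->
  y1 ^+ 2 <= C1 * (w1 * n1 * w0) -> y2 ^+ 2 <= C2 * (w0 * n1 * w1) ->
  y3 ^+ 2 <= C3 * (n1 * w1 * w0) -> y4 ^+ 2 <= C4 * (p * w1 * z1) ->
  p * z1 <= d ^+ 2 / (C4 + 1) * w1 + C5 * (1 + n1) * w0 ->
  c * (y1 + y2 + (y3 + y4)) <=
  e * w1 + c * ((C1 + C2 + C3) / d + C4 / d * C5) * (1 + n1) * w0.
Proof.
move=> C10 C20 C30 C40 C50 c0 d0 cd w10 w00 n10 z10 p0 b1 b2 b3 b4 bp.
pose Q := (C1 + C2 + C3) / d + C4 / d * C5; rewrite -/Q.
have nw : 0 <= n1 * w0 by exact: mulr_ge0.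
have a1 : y1 <= d * w1 + C1 / d * (n1 * w0) by apply: young_root; rewrite // (mulrA w1).
have a2 : y2 <= d * w1 + C2 / d * (n1 * w0).
  by apply: young_root => //; apply: (le_trans b2); rewrite ler_wpM2l// [leLHS]mulrC (mulrC w0).
have a3 : y3 <= d * w1 + C3 / d * (n1 * w0).
  by apply: young_root => //; apply: (le_trans b3); rewrite ler_wpM2l// -mulrA mulrCA.
have a4 : y4 <= d * w1 + C4 / d * (p * z1).
  apply: young_root => //; first exact: mulr_ge0.
  by apply: (le_trans b4); rewrite ler_wpM2l// -mulrA mulrCA.
have a5 : C4 / d * (p * z1) <= d * w1 + C4 / d * C5 * ((1 + n1) * w0).
  have c4d : 0 <= C4 / d by rewrite divr_ge0// ltW.
  apply: (le_trans (ler_wpM2l c4d bp)); rewrite mulrDr; apply: lerD; last by rewrite !mulrA.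
  rewrite mulrA ler_wpM2r//.
  have -> : C4 / d * (d ^+ 2 / (C4 + 1)) = d * (C4 / (C4 + 1)).
    by field; rewrite !gt_eqF//; lra.
  by rewrite ger_pMr// ler_pdivrMr ?mul1r; lra.
have q1 : 0 <= (C1 + C2 + C3) / d by rewrite divr_ge0 ?addr_ge0 ?(ltW d0).
have a6 : (C1 + C2 + C3) / d * (n1 * w0) <= (C1 + C2 + C3) / d * ((1 + n1) * w0).
  by rewrite ler_wpM2l// mulrDl mul1r lerDr.
have tot : (y1 + y2) + (y3 + y4) <= 5 * d * w1 + Q * ((1 + n1) * w0).
  have E6 : (C1 + C2 + C3) / d * (n1 * w0) = C1 / d * (n1 * w0) + C2 / d * (n1 * w0) + C3 / d * (n1 * w0).
    by rewrite !mulrDl.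
  have E7 : Q * ((1 + n1) * w0) = (C1 + C2 + C3) / d * ((1 + n1) * w0) + C4 / d * C5 * ((1 + n1) * w0).
    exact: mulrDl.
  rewrite E7 -(mulrA 5); move: a1 a2 a3 a4 a5 a6; rewrite E6.
  move: (d * w1) (C1 / d * _) (C2 / d * _) (C3 / d * _) (C4 / d * (p * z1)) ((C1 + C2 + C3) / d * _) (_ * C5 * _).
  move=> x1 x2 x3 x4 x5 x6 x7; lra.
apply: (le_trans (ler_wpM2l c0 tot)); rewrite mulrDr; apply: lerD.
  by rewrite mulrA ler_wpM2r.
by rewrite !mulrA.
Qed.

(** In three of the four trilinear forms the exponents can be chosen so that [X] is measured in
    H^(1+kap), one factor [W] in H^(alpha/2) and the other in L^2. In the fourth, [X] carries no
    derivative and is measured in H^kap, which leaves the second [W] in H^1; that product is handled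
    by [kap_one_interp]. *)
Lemma transport_energy (M c e : R) : 0 <= M -> 0 <= c -> 0 < e -> exists2 C, 0 <= C & forall W X,
  (forall k, 0 <= W k) -> (forall k, 0 <= X k) -> rapid W -> rapid X -> W 0 = 0 -> X 0 = 0 ->
  hnorm2 reg0 X <= M ->
  let S k := W k * (zsum (domt W X k) + zsum (domt X W k)) in
  [/\ forall k, k != 0 -> summ (domt W X k) /\ summ (domt X W k), summ S &
  c * zsum S <= e * hnorm2 (alpha / 2) W + C * (1 + hnorm2 (1 + kap) X) * hnorm2 0 W].
Proof.
move=> M0 c0 e0; have [k1 k2 k3] := kap_bounds; have aE : alpha / 2 = 3 / 2 - kap by rewrite kapE; ring.
have [||||C1 C10 H1] := @tri_bound R 1 1 0 (2^-1 - kap) kap 0 (2 * kap) _ _ _ _ k3; try lra.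
have [||||C2 C20 H2] := @tri_bound R 0 1 1 0 kap (2^-1 - kap) (2 * kap) _ _ _ _ k3; try lra.
have [||||C3 C30 H3] := @tri_bound R 1 1 0 kap (2^-1 - kap) 0 (2 * kap) _ _ _ _ k3; try lra.
have [||||C4 C40 H4] := @tri_bound R 0 1 1 kap (2^-1 - kap) 0 (2 * kap) _ _ _ _ k3; try lra.
pose d := e / (5 * (c + 1)); have d0 : 0 < d by rewrite divr_gt0// mulr_gt0//; lra.
have cd : c * (5 * d) <= e.
  have -> : c * (5 * d) = e * (c / (c + 1)) by rewrite /d; field; rewrite gt_eqF//; lra.
  by rewrite ger_pMr// ler_pdivrMr ?mul1r; lra.
have [C5 C50 H5] := kap_one_interp M0 (divr_gt0 (exprn_gt0 2 d0) (ltr_wpDl C40 ltr01)).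
exists (c * ((C1 + C2 + C3) / d + C4 / d * C5)).
  have q1 : 0 <= (C1 + C2 + C3) / d by rewrite divr_ge0 ?addr_ge0 ?(ltW d0).
  have q2 : 0 <= C4 / d by rewrite divr_ge0 ?(ltW d0).
  by rewrite mulr_ge0// addr_ge0// mulr_ge0.
move=> W X W0 X0 rW rX W00 X00 XM S.
have [s1 t1 b1] := H1 W X W W0 X0 W0 rW rX rW.
have [s2 t2 b2] := H2 W X W W0 X0 W0 rW rX rW.
have [s3 t3 b3] := H3 X W W X0 W0 W0 rX rW rW.
have [s4 t4 b4] := H4 X W W X0 W0 W0 rX rW rW.
have bp := H5 X W rX rW XM.
have E1 : 1 + (2^-1 - kap) = alpha / 2 by rewrite aE; field.
rewrite E1 addr0 in b1; rewrite E1 add0r in b2; rewrite E1 addr0 in b3; rewrite E1 add0r addr0 in b4.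
have D k : k != 0 -> [/\ summ (domt W X k), W k * zsum (domt W X k) = tri 1 1 0 W X W k + tri 0 1 1 W X W k,
    summ (domt X W k) & W k * zsum (domt X W k) = tri 1 1 0 X W W k + tri 0 1 1 X W W k].
  move=> kn; have [d1 e1] := domt_split W kn W00 (s1 k kn) (s2 k kn).
  by have [d2 e2] := domt_split W kn X00 (s3 k kn) (s4 k kn).
have SE k : S k = (tri 1 1 0 W X W k + tri 0 1 1 W X W k) + (tri 1 1 0 X W W k + tri 0 1 1 X W W k).
  have [->|kn] := eqVneq k 0; first by rewrite /S /tri W00 !mulr0 !mul0r !addr0.
  by have [_ <- _ <-] := D k kn; rewrite /S mulrDr.
split.
- by move=> k /D[].
- by apply: eq_summ (summD (summD t1 t2) (summD t3 t4)) => k; rewrite SE.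
have -> : zsum S = zsum (tri 1 1 0 W X W) + zsum (tri 0 1 1 W X W) +
    (zsum (tri 1 1 0 X W W) + zsum (tri 0 1 1 X W W)).
  by rewrite -(zsumD t1 t2) -(zsumD t3 t4) -(zsumD (summD t1 t2) (summD t3 t4)); exact: eq_zsum.
exact: (energy_arith C10 C20 C30 C40 C50 c0 d0 cd (hnorm2_ge0 _ W) (hnorm2_ge0 _ W) (hnorm2_ge0 _ X)
  (hnorm2_ge0 _ W) (hnorm2_ge0 _ X) b1 b2 b3 b4 bp).
Qed.

(** The linear term gives the dissipation - 2 mu |w|^2 in H^(alpha/2), and the nonlinear one is
    controlled by [transport_energy] on even majorants of w and of |u| + |v|. *)
Lemma energy_estimate (M : R) : 0 <= M -> exists2 C, 0 <= C & forall u v,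
  rapid u -> rapid v -> u 0 = 0 -> v 0 = 0 -> hnorm2 reg0 u <= M -> hnorm2 reg0 v <= M ->
  let w k := u k - v k in
  let w' k := (- rate k * u k + nl a b u u k) - (- rate k * v k + nl a b v v k) in
  summ (fun k => 2 * (w k * w' k)) /\
  zsum (fun k => 2 * (w k * w' k)) <= C * (1 + hnorm2 (1 + kap) u + hnorm2 (1 + kap) v) * n2 w.
Proof.
move=> M0; pose nc := 2 * (2 * (`|a| + `|b|)).
have nc0 : 0 <= nc by rewrite /nc !mulr_ge0// addr_ge0.
(* Evening costs a factor 4 in squared norms, so mu / 2 becomes the available 2 mu. The bound 16 M
   is 8 (M + M) for the majorant [X]. *)
have [C C0 H] := @transport_energy (16 * M) nc (mu / 2) (mulr_ge0 (ler0n _ 16) M0) nc0 (divr_gt0 mu0 (ltr0n _ 2)).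
exists (4 * (C * 8)); first by rewrite !mulr_ge0.
move=> u v ru rv u0 v0 uM vM w w'.
pose W := evened w; pose X k := evened u k + evened v k.
have rw : rapid w by apply: rapidD => //; have := rapidZ (-1) rv; apply: rapid_le => k; rewrite mulN1r.
have w0 : w 0 = 0 by rewrite /w u0 v0 subrr.
have rW : rapid W by exact: rapid_evened.
have rX : rapid X by apply: rapidD; exact: rapid_evened.
have X0 k : 0 <= X k by rewrite addr_ge0 ?evened_ge0.
have eX : even_seq X by move=> k; rewrite /X !evened_even.
have WX k : W k <= X k.
  by apply: (le_trans (lerD (ler_normB _ _) (ler_normB _ _))); rewrite addrACA.
have XE s : hnorm2 s X <= 8 * (hnorm2 s u + hnorm2 s v).
  apply: (le_trans (n2_wtD s (rapid_evened ru) (rapid_evened rv))).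
  by have := n2_evened s ru; have := n2_evened s rv; move: (hnorm2 s _) (hnorm2 s _) (hnorm2 s _) (hnorm2 s _) => *; lra.
have [||S1 S2 S3] := H W X (evened_ge0 w) X0 rW rX (evened0 w0).
- by rewrite /X !evened0// addr0.
- by have := XE reg0; lra.
have [D HD] := domt_rapid X0 rX.
have uX k : `|u k| <= X k by apply: (le_trans (le_evened u k)); rewrite lerDl evened_ge0.
have vX k : `|v k| <= X k by apply: (le_trans (le_evened v k)); rewrite lerDr evened_ge0.
pose d k := nl a b u u k - nl a b v v k.
have dE k : k != 0 -> `|w k * d k| <= 2 * (`|a| + `|b|) * (W k * (zsum (domt W X k) + zsum (domt X W k))).
  move=> k0; have [sWX sXW] := S1 k k0.
  rewrite /d (@nl_diff _ a b u v k W X (evened_even w) eX WX (HD k).1 uX vX (le_evened w)).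
  rewrite normrM mulrCA ler_pM ?normr_ge0 ?le_evened// mulrDr.
  apply: (le_trans (ler_normD _ _)); apply: lerD.
    exact: (nl_bound (evened_even w) eX sWX a b (le_evened w) uX).
  exact: (nl_bound eX (evened_even w) sXW a b vX (le_evened w)).
have dle k : `|w k * d k| <= 2 * (`|a| + `|b|) * (W k * (zsum (domt W X k) + zsum (domt X W k))).
  have [->|] := eqVneq k 0; last exact: dE.
  by rewrite w0 mul0r normr0 /W evened0// mul0r mulr0.
have sd : summ (fun k => w k * d k) by apply: le_summ_ge0 dle (summZ _ S2).
have sr : summ (fun k => (wt (alpha / 2) k * w k) ^+ 2) by exact: rapid_wt_l2.
have E k : 2 * (w k * w' k) = - (2 * mu) * (wt (alpha / 2) k * w k) ^+ 2 + 2 * (w k * d k).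
  have -> : (wt (alpha / 2) k * w k) ^+ 2 = wt alpha k * w k ^+ 2.
    by rewrite exprMn (expr2 (wt _ _)) -wtD -mulrDl -mulr2n -[_ *+ 2]mulr_natr -mulrA divff ?mulr1.
  by rewrite /w' /d /w rateE; ring.
have s1 := summZ (- (2 * mu)) sr; have s2 := summZ 2 sd.
split; first by apply: eq_summ (summD s1 s2) => k; rewrite E.
rewrite (eq_zsum E) (zsumD s1 s2) (zsumZ _ sr) (zsumZ _ sd) -/(n2 _) -/(hnorm2 _ _).
have zd : 2 * zsum (fun k => w k * d k) <= nc * zsum (fun k => W k * (zsum (domt W X k) + zsum (domt X W k))).
  rewrite /nc -mulrA ler_pM2l// -(zsumZ _ S2); apply: le_zsum => //; first exact: summZ.
  by move=> k; exact: le_trans (ler_norm _) (dle k).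
have W0E : hnorm2 0 W <= 4 * n2 w.
  apply: (le_trans (n2_evened 0 rw)); rewrite ler_pM2l//; apply: le_n2 (rapid_l2 rw) => k.
  by rewrite normrM ger0_norm ?wt_ge0// ler_piMl// wt_le1.
have W1E := n2_evened (alpha / 2) rw.
have XE1 := XE (1 + kap).
have w10 := hnorm2_ge0 (alpha / 2) w; have x10 := hnorm2_ge0 (1 + kap) X.
have u10 := hnorm2_ge0 (1 + kap) u; have v10 := hnorm2_ge0 (1 + kap) v.
have fin : C * (1 + hnorm2 (1 + kap) X) * hnorm2 0 W <=
    4 * (C * 8) * (1 + hnorm2 (1 + kap) u + hnorm2 (1 + kap) v) * n2 w.
  rewrite (_ : 4 * (C * 8) * _ * _ = C * (8 * (1 + hnorm2 (1 + kap) u + hnorm2 (1 + kap) v)) * (4 * n2 w)); last by ring.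
  apply: ler_pM; rewrite ?mulr_ge0 ?addr_ge0 ?hnorm2_ge0// ler_wpM2l//; lra.
have dis : mu / 2 * hnorm2 (alpha / 2) W <= 2 * mu * hnorm2 (alpha / 2) w.
  by apply: (le_trans (ler_wpM2l (divr_ge0 (ltW mu0) (ler0n _ 2)) W1E)); rewrite le_eqVlt; apply/orP; left; apply/eqP; field.
move: S3 zd fin dis; rewrite -/W mulNr.
move: (zsum _) (zsum _) (hnorm2 _ W) (_ * hnorm2 _ w) (_ * n2 w) => z1 z2 h1 h2 h3 *; lra.
Qed.

End Energy.

(** * Uniqueness for the coefficient system *)

Section Flow.
Context {R : realType} (mu alpha a b : R).
Hypotheses (mu0 : 0 < mu) (al2 : 2 < alpha) (al5 : alpha <= 5 / 2).
Implicit Types (u v h : R -> int -> R) (k : int) (s t T M : R).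
Local Notation leb := (@lebesgue_measure R).
Local Notation rate := (rate mu alpha).
Local Notation kap := (kap alpha).
Local Notation reg0 := (reg0 alpha).

Lemma zsum_continuous (F : R -> int -> R) (g : int -> R) (p q : R) : summ g ->
  (forall t k, p < t < q -> `|F t k| <= g k) ->
  (forall t k, p < t < q -> {for t, continuous (F ^~ k)}) ->
  forall t, p < t < q -> {for t, continuous (fun s => zsum (F s))}.
Proof.
move=> sg Fg cF t tpq; apply/(@cvg_nbhsP _ R^o) => w wt.
have tI : t \in `]p, q[ by rewrite in_itv.
have /near_in_itvoo[e /= e0 he] := tI.
move/cvgrPdist_lt : (wt) => /(_ _ e0)[N _ HN].
have wI n : p < w (n + N)%N < q.
  by have := he (w (n + N)%N); rewrite /ball/= in_itv/=; apply; apply: HN => /=; exact: leq_addl.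
rewrite -(cvg_shiftn N); apply: (zsum_cvg sg) => [n k|k]; first exact: Fg.
by have := cF t k tpq => /(@cvg_nbhsP _ R^o) /(_ _ wt); rewrite -(cvg_shiftn N).
Qed.

Lemma continuous_sqr (f : R -> R) t : {for t, continuous f} -> {for t, continuous (fun s => f s ^+ 2)}.
Proof. by move=> cf; apply: (@cvgM _ _ _ _ f f _ _ cf cf). Qed.

Lemma rhs_continuous T h k : (forall t j, 0 < t < T -> {for t, continuous (h ^~ j)}) ->
  (forall t1, 0 < t1 -> exists U, [/\ forall k, 0 <= U k, even_seq U, rapid U &
    forall t k, t1 <= t < T -> `|h t k| <= U k]) ->
  forall t, 0 < t < T -> {for t, continuous (fun t => - rate k * h t k + nl a b (h t) (h t) k)}.
Proof.
move=> ch env t /andP[t0 tT]; have [|U [U0 eU rU hU]] := env (t / 2); first by rewrite divr_gt0.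
have [D HD] := domt_rapid U0 rU.
have c1 : (- rate k * h x k) @[x --> t] --> - rate k * h t k.
  by apply: cvgMr; apply: ch; rewrite t0.
apply: cvgD c1 _; apply: (@nl_continuous R a b h U k (t / 2) T eU (HD k).1).
- by move=> r j /andP[r1 r2]; rewrite hU// (ltW r1).
- by move=> r j /andP[r1 r2]; apply: ch; rewrite r2 andbT (lt_trans _ r1)// divr_gt0.
- by rewrite tT andbT; lra.
Qed.

(* The properties of t |-> har (B t), for B a solution in the class of the
   theorem, that determine it from its limit at 0. *)
Record flow T M h : Prop := Flow {
  flow0 : forall t, 0 < t < T -> h t 0 = 0;
  flow_env : forall t1, 0 < t1 -> exists U, [/\ forall k, 0 <= U k, even_seq U, rapid U &
    forall t k, t1 <= t < T -> `|h t k| <= U k];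
  flow_ode : forall t k, 0 < t < T -> is_derive t 1 (h ^~ k) (- rate k * h t k + nl a b (h t) (h t) k);
  flow_bound : forall t, 0 < t < T -> hnorm2 reg0 (h t) <= M;
  flow_energy : leb.-integrable `]0, T[ (fun t => (hnorm2 (1 + kap) (h t))%:E) }.

Section Properties.
Variables (T M : R) (h : R -> int -> R).
Hypothesis Fh : flow T M h.

Lemma flow_rapid t : 0 < t < T -> rapid (h t).
Proof.
move=> /andP[t0 tT]; have [U [U0 _ rU hU]] := flow_env Fh t0.
by apply: rapid_le rU => k; rewrite (ger0_norm (U0 k)) hU// lexx.
Qed.

Lemma flow_continuous t k : 0 < t < T -> {for t, continuous (h ^~ k)}.
Proof. by move=> tT; exact: is_derive_cont (flow_ode Fh k tT). Qed.

Lemma flow_hnorm2_continuous s t : 0 < t < T -> {for t, continuous (fun t => hnorm2 s (h t))}.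
Proof.
move=> /andP[t0 tT]; have [|U [U0 _ rU hU]] := @flow_env _ _ _ Fh (t / 2); first by rewrite divr_gt0.
apply: (@zsum_continuous _ (fun k => (wt s k * U k) ^+ 2) (t / 2) T).
- exact: rapid_wt_l2.
- move=> r k /andP[r1 r2]; rewrite normrX; apply: lerXn2r; rewrite ?nnegrE ?mulr_ge0 ?wt_ge0//.
  by rewrite normrM (ger0_norm (wt_ge0 s k)) ler_wpM2l ?wt_ge0// hU// (ltW r1).
- move=> r k /andP[r1 r2]; have cr : {for r, continuous (h ^~ k)}.
    by apply: flow_continuous; rewrite r2 andbT (lt_trans _ r1)// divr_gt0.
  by apply: continuous_sqr; apply: cvgMr.
- by rewrite tT andbT; lra.
Qed.

Lemma flow_nl_continuous t k : 0 < t < T ->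
  {for t, continuous (fun t => - rate k * h t k + nl a b (h t) (h t) k)}.
Proof.
by move=> tT; apply: (@rhs_continuous T h k) (flow_env Fh) _ tT => s j; exact: flow_continuous.
Qed.

End Properties.

Section Uniqueness.
Variables (T M : R) (u v : R -> int -> R).
Hypotheses (Fu : flow T M u) (Fv : flow T M v) (M0 : 0 <= M).
Let w t k := u t k - v t k.
Let w' t k := (- rate k * u t k + nl a b (u t) (u t) k) - (- rate k * v t k + nl a b (v t) (v t) k).

Lemma difference_derive t k : 0 < t < T -> is_derive t 1 (w ^~ k) (w' t k).
Proof. by move=> tT; apply: is_deriveB; [exact: (flow_ode Fu k tT)|exact: (flow_ode Fv k tT)]. Qed.

(** Majorants uniform on a compact time interval, which justify summing the energy identity
    termwise. *)
Lemma difference_bound t1 t2 : 0 < t1 -> t2 < T -> exists X A,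
  [/\ forall k, 0 <= X k, rapid X, 0 <= A & forall t k, t1 <= t <= t2 ->
   [/\ `|u t k| <= X k, `|v t k| <= X k, `|w t k| <= X k & `|w t k * w' t k| <= A * X k]].
Proof.
move=> t10 t2T; have [U [U0 eU rU hU]] := flow_env Fu t10; have [V [V0 eV rV hV]] := flow_env Fv t10.
pose X k := U k + V k; have X0 k : 0 <= X k by rewrite addr_ge0.
have rX : rapid X by exact: rapidD.
have eX : even_seq X by move=> k; rewrite /X eU eV.
have [D HD] := domt_rapid X0 rX; have [C HC] := rX alpha.
pose c := 2 * (`|a| + `|b|); have c0 : 0 <= c by rewrite /c mulr_ge0// addr_ge0.
exists X, (2 * (mu * `|C| + c * `|D|)); split=> //.
  by rewrite mulr_ge0// addr_ge0// mulr_ge0// ltW.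
move=> t k /andP[t1t tt2]; have tT : t1 <= t < T by rewrite t1t (le_lt_trans tt2).
have uX j : `|u t j| <= X j by apply: (le_trans (hU t j tT)); rewrite lerDl.
have vX j : `|v t j| <= X j by apply: (le_trans (hV t j tT)); rewrite lerDr.
have wX : `|w t k| <= X k.
  by apply: (le_trans (ler_normB _ _)); apply: lerD; [exact: hU|exact: hV].
split=> //; rewrite normrM mulrC; apply: ler_pM => //.
have B (g : int -> R) : (forall j, `|g j| <= X j) ->
    `|- rate k * g k + nl a b g g k| <= mu * `|C| + c * `|D|.
  move=> gX; apply: (le_trans (ler_normD _ _)); apply: lerD.
    rewrite mulNr normrN rateE -mulrA normrM (gtr0_norm mu0) ler_pM2l//.
    rewrite normrM (ger0_norm (wt_ge0 _ k)); apply: le_trans (le_trans (HC k) (ler_norm C)).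
    by rewrite ler_wpM2l ?wt_ge0// (ger0_norm (X0 k)).
  apply: (le_trans (nl_bound eX eX (HD k).1 a b gX gX)); rewrite -/c ler_wpM2l//.
  exact: le_trans (HD k).2 (ler_norm D).
apply: (le_trans (ler_normB _ _)); rewrite [2 * _]mulr_natl mulr2n; apply: lerD; exact: B.
Qed.

Section Gronwall.
Variables (psi Psi : R -> R).
Hypotheses (psi0 : forall t, 0 <= psi t) (Psi0 : forall t, 0 <= Psi t).
Hypothesis cpsi : forall t, 0 < t < T -> {for t, continuous psi}.
Hypothesis dPsi : forall t, 0 < t < T -> is_derive t 1 Psi (psi t).
Hypothesis energy : forall t, 0 < t < T -> zsum (fun k => 2 * (w t k * w' t k)) <= psi t * n2 (w t).

Let z k t := expR (- Psi t) * w t k ^+ 2.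
Let z' k t := expR (- Psi t) * (2 * (w t k * w' t k) - psi t * w t k ^+ 2).

Lemma damped_derive k t : 0 < t < T -> is_derive t 1 (z k) (z' k t).
Proof.
move=> tT; have d1 := dPsi tT; have d2 := difference_derive k tT.
have d3 : is_derive t 1 (fun t => - Psi t) (- psi t) by exact: is_deriveN.
have d4 : is_derive t 1 (fun t => expR (- Psi t)) (- psi t * expR (- Psi t)).
  by rewrite mulrC; exact: (@is_derive1_comp _ expR (fun t => - Psi t) t _ _ (is_derive_expR (- Psi t)) d3).
have d5 : is_derive t 1 (fun t => w t k ^+ 2) (2 * (w t k * w' t k)).
  have -> : 2 * (w t k * w' t k) = w t k *: w' t k + w t k *: w' t k by rewrite /GRing.scale/=; ring.
  have -> : (fun t => w t k ^+ 2) = (w ^~ k) * (w ^~ k) by apply/funext => s; rewrite expr2.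
  exact: is_deriveM.
have -> : z' k t = expR (- Psi t) *: (2 * (w t k * w' t k)) + w t k ^+ 2 *: (- psi t * expR (- Psi t)).
  by rewrite /z' /GRing.scale/=; ring.
exact: is_deriveM.
Qed.

Lemma damped_continuous k t : 0 < t < T -> {for t, continuous (z' k)}.
Proof.
move=> tT; have c1 := is_derive_cont (dPsi tT); have c2 := is_derive_cont (difference_derive k tT).
have c3 : {for t, continuous (w' ^~ k)}.
  by apply: cvgB; [exact: (flow_nl_continuous Fu tT)|exact: (flow_nl_continuous Fv tT)].
have c4 := cpsi tT.
have c5 : {for t, continuous (fun t => w t k ^+ 2)}.
  exact: continuous_sqr.
have c6 : {for t, continuous (fun t => expR (- Psi t))}.
  exact: (cvg_comp _ _ (cvgN c1) (@continuous_expR R (- Psi t))).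
apply: cvgM => //; apply: cvgB; last exact: cvgM.
by apply: cvgMr; exact: cvgM.
Qed.

(** Gronwall's inequality in integrated form: each damped square is integrated in time, then the sum
    over [k] is exchanged with the integral, so that no derivative of the infinite sum is taken. *)
Lemma damped_decr t1 t2 : 0 < t1 -> t1 <= t2 -> t2 < T ->
  expR (- Psi t2) * n2 (w t2) <= expR (- Psi t1) * n2 (w t1).
Proof.
move=> t10 t12 t2T; have [X [A [X0 rX A0 HX]]] := difference_bound t10 t2T.
have tT t : t1 <= t <= t2 -> 0 < t < T by move=> /andP[h1 h2]; apply/andP; split; lra.
have lw t : t1 <= t <= t2 -> l2 (w t).
  move=> tt; apply: le_l2 (rapid_l2 rX) => k.
  by have [_ _ h _] := HX t k tt; rewrite (ger0_norm (X0 k)).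
have sww t : t1 <= t <= t2 -> summ (fun k => 2 * (w t k * w' t k)).
  move=> tt; apply: summZ; apply: le_summ_ge0 (summZ A (rapid_summ rX)) => k.
  by have [_ _ _ h] := HX t k tt.
have [P P0 HP] : exists2 P, 0 <= P & forall t, t1 <= t <= t2 -> psi t <= P.
  have [|c _ Hc] := @EVT_max R psi t1 t2 t12.
    by apply: continuous_at_within => t tt; apply: cpsi; exact: tT.
  by exists (psi c) => // t tt; apply: Hc; rewrite in_itv.
have [B HB] := rX 0.
pose B' := `|B| + X 0.
have XB k : X k <= B'.
  have [->|k0] := eqVneq k 0; first by rewrite lerDr.
  have := HB k; rewrite wt00// mul1r (ger0_norm (X0 k)) => H.
  by apply: (le_trans H); apply: (le_trans (ler_norm B)); rewrite lerDl.
have mI : measurable (`[t1, t2]%classic : set R) by exact: measurable_itv.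
have zE t : t1 <= t <= t2 -> zsum (z ^~ t) = expR (- Psi t) * n2 (w t).
  by move=> tt; rewrite /z (zsumZ _ (lw t tt)).
have [|k|k t|i1 s1 E1] := @zsum_integral R _ _ leb `[t1, t2]%classic mI z' (fun k => (2 * A + P * B') * X k) (fun=> 1)
   (summZ _ (rapid_summ rX)).
- by apply: continuous_at_integrable => t _; exact: cvg_cst.
- apply: (@continuous_at_measurable _ _ 0 T) => //; last by move=> t tt; exact: damped_continuous.
- rewrite /= in_itv/= => tt; have [_ _ h1 h2] := HX t k tt.
  rewrite mulr1 normrM (ger0_norm (expR_ge0 _)).
  have e1 : expR (- Psi t) <= 1 by rewrite -expR0 ler_expR oppr_le0.
  apply: (@le_trans _ _ (1 * (2 * (A * X k) + P * (B' * X k)))); last first.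
    by rewrite le_eqVlt; apply/orP; left; apply/eqP; ring.
  apply: ler_pM => //.
  apply: (le_trans (ler_normB _ _)); apply: lerD.
    by rewrite normrM ger0_norm// ler_pM2l.
  rewrite normrM (ger0_norm (psi0 t)); apply: ler_pM => //; first exact: HP.
  by rewrite normrX expr2; apply: ler_pM => //; exact: le_trans h1 (XB k).
have E2 k : \int[leb]_(t in `[t1, t2]) z' k t = z k t2 - z k t1.
  apply: FTC2_R => // t tt; [exact/damped_continuous/tT|exact/damped_derive/tT].
have tt1 : t1 <= t1 <= t2 by rewrite lexx.
have tt2 : t1 <= t2 <= t2 by rewrite lexx andbT.
have E3 : zsum (fun k => \int[leb]_(t in `[t1, t2]) z' k t) =
    expR (- Psi t2) * n2 (w t2) - expR (- Psi t1) * n2 (w t1).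
  rewrite (eq_zsum E2) zsumB ?zE//; apply: summZ; exact: lw.
rewrite -subr_le0 -E3 -E1.
have -> : 0 = \int[leb]_(t in `[t1, t2]) (0 : R) by rewrite /Rintegral integral0.
apply: le_Rintegral => //.
  by apply: continuous_at_integrable => t _; exact: cvg_cst.
move=> t /=; rewrite in_itv/= => tt.
have s2 := summZ (psi t) (lw t tt).
rewrite /z' (zsumZ _ (summB (sww t tt) s2)) (zsumB (sww t tt) s2) (zsumZ _ (lw t tt)).
by rewrite mulr_ge0_le0 ?expR_ge0// subr_le0; exact/energy/tT.
Qed.

End Gronwall.

(** The energy coefficient is integrable down to 0, so [Psi] can start there. As [Psi] is
    nonnegative, [n2 (w t)] is at most exp (Psi t) times [n2 (w s)] for small s, and that tends to
    0. *)
Lemma flow_unique : n2 (w t) @[t --> 0^'+] --> 0 -> forall t k, 0 < t < T -> u t k = v t k.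
Proof.
move=> w0 t k tT; have [t0 tT'] := andP tT.
have [C C0 HC] := energy_estimate a b mu0 al2 al5 M0.
pose psi s := C * (1 + hnorm2 (1 + kap) (u s) + hnorm2 (1 + kap) (v s)).
pose Psi s := \int[leb]_(r in `]0, s]) psi r.
have psi0 s : 0 <= psi s by rewrite mulr_ge0// !addr_ge0// hnorm2_ge0.
have Psi0 s : 0 <= Psi s by apply: Rintegral_ge0.
have cpsi s : 0 < s < T -> {for s, continuous psi}.
  move=> sT; apply: cvgMr; apply: cvgD; last exact: (flow_hnorm2_continuous Fv sT).
  by apply: cvgD; [exact: cvg_cst|exact: (flow_hnorm2_continuous Fu sT)].
have ipsi : leb.-integrable `]0, T[ (EFin \o psi).
  have i1 : leb.-integrable `]0, T[ (fun _ : R => (1 : R)%:E).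
    apply: (@integrableS _ _ _ leb `[0, T]%classic) => //.
      by move=> x /=; rewrite !in_itv/= => /andP[h1 h2]; rewrite !ltW.
    by apply: continuous_at_integrable => x _; exact: cvg_cst.
  have mI : measurable (`]0, T[%classic : set (measurableTypeR R)) by exact: measurable_itv.
  have := integrableZl mI C (integrableD mI (integrableD mI i1 (flow_energy Fu)) (flow_energy Fv)).
  apply: eq_integrable => //.
have dPsi s : 0 < s < T -> is_derive s 1 Psi (psi s).
  move=> /andP[s0 sT]; apply: (@is_derive_integral _ psi s ((s + T) / 2)) => //; first lra.
    apply: integrableS ipsi => // x /=; rewrite !in_itv/= => /andP[-> h]; lra.
  by apply: cpsi; rewrite s0.
have energy s : 0 < s < T -> zsum (fun k => 2 * (w s k * w' s k)) <= psi s * n2 (w s).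
  move=> sT; exact: (HC (u s) (v s) (flow_rapid Fu sT) (flow_rapid Fv sT) (flow0 Fu sT) (flow0 Fv sT)
    (flow_bound Fu sT) (flow_bound Fv sT)).2.
have dec := damped_decr psi0 Psi0 cpsi dPsi energy.
have lw : l2 (w t).
  apply: rapid_l2; apply: rapidD; first exact: (flow_rapid Fu tT).
  by have := rapidZ (-1) (flow_rapid Fv tT); apply: rapid_le => j; rewrite mulN1r.
have : n2 (w t) <= 0.
  have c : expR (Psi t) * n2 (w s) @[s --> 0^'+] --> expR (Psi t) * 0 by apply: cvgMr.
  rewrite mulr0 in c; apply: (cvgr_to_ge c); near=> s.
  have s0 : 0 < s by near: s; exact: nbhs_right_gt.
  have st : s <= t by near: s; exact: nbhs_right_le.
  have := dec s t s0 st tT'; rewrite expRN => H.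
  rewrite -ler_pdivrMl ?expR_gt0//; apply: (le_trans H).
  by rewrite ler_piMl ?n2_ge0// -expR0 ler_expR oppr_le0.
move=> n0; apply/eqP; rewrite -subr_eq0 -sqrf_eq0 eq_le sqr_ge0 andbT.
apply: le_trans n0; exact: (le_zsum_term k lw (fun k => sqr_ge0 _)).
Unshelve. all: by end_near. Qed.

End Uniqueness.
End Flow.

(** * Coefficients of an arbitrary solution in the class *)

Section SolutionFlow.
Context {R : realType} (mu alpha a b T : R) (B0 : R -> R) (B : R -> R -> R).
Hypotheses (mu0 : 0 < mu) (al2 : 2 < alpha) (al5 : alpha <= 5 / 2).
Hypotheses (T0 : 0 < T) (sol : is_solution a b mu alpha T B0 B) (cls : solution_class alpha T B).
Implicit Types (k : int) (s t p : R).
Local Notation leb := (@lebesgue_measure R).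
Local Notation rate := (rate mu alpha).
Local Notation kap := (kap alpha).
Local Notation reg0 := (reg0 alpha).
Let h t := har (B t).

Let reg0_ge0 : 0 <= reg0. Proof. by have := al5; rewrite reg0E; lra. Qed.

Lemma class_L2 t : 0 <= t < T -> L2 (B t).
Proof. by move=> tT; have [[cS _] _ _ _] := cls; have [] := cS t tT. Qed.

(** Since t^(be/alpha) > 0, finiteness of the supremum forces every norm at a positive time to be
    finite; the extended-real bound becomes summability together with a real bound. *)
Lemma class_smooth be : 0 <= be -> exists2 C, 0 <= C & forall t, 0 < t < T ->
  summ (fun k => sobw (reg0 + be) k * h t k ^+ 2) /\
  t `^ (be / alpha) * Num.sqrt (sob (reg0 + be) (h t)) <= C.
Proof.
move=> be0; have [_ _ H _] := cls; have := H be be0; rewrite -/reg0.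
set S := ereal_sup _ => Sfin.
have SP t : 0 < t < T -> ((t `^ (be / alpha))%:E * sobolev_norm (reg0 + be) (B t) <= S)%E.
  by move=> tT; apply: ereal_sup_ubound; exists t => //=; rewrite in_itv.
exists (Num.max 0 (fine S)); first by rewrite le_max lexx.
move=> t tT; have [t0 tT'] := andP tT; have p0 : 0 < t `^ (be / alpha) by exact: powR_gt0.
have iB : cintg (B t) by apply: L2_cintg; apply: class_L2; rewrite ltW.
have := SP t tT => Ht; have fin : (sobolev_norm (reg0 + be) (B t) < +oo)%E.
  rewrite ltey; apply/eqP => E; move: Ht; rewrite E gt0_muley ?lte_fin// leye_eq => /eqP E'.
  by move: Sfin; rewrite E' ltxx.
have sm := (sobolev_norm_lty (reg0 + be) iB).1 fin; split; first exact: sm.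
move: Ht; rewrite (sobolev_norm_fin iB sm) powR12_sqrt ?sob_ge0// -EFinM => Ht.
rewrite le_max; apply/orP; right; rewrite -lee_fin fineK//.
by apply/fin_numP; split; [apply: contraTneq Ht => ->; rewrite leNgt ltNyr|apply: contraTneq Sfin => ->; rewrite ltxx].
Qed.

Lemma sob_term_le_sob s (f : int -> R) k : 0 <= s -> summ (fun k => sobw s k * f k ^+ 2) ->
  (wt s k * `|f k|) ^+ 2 <= sob s f.
Proof.
move=> s0 sf; have := le_zsum_term k sf (fun j => sob_term_ge0 s f j); apply: le_trans.
by rewrite exprMn real_normK ?num_real// ler_wpM2r ?sqr_ge0// sobw_ge.
Qed.

Lemma hnorm2_sob s (f : int -> R) : 0 <= s -> summ (fun k => sobw s k * f k ^+ 2) -> hnorm2 s f <= sob s f.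
Proof.
move=> s0 sf; have le k : (wt s k * f k) ^+ 2 <= sobw s k * f k ^+ 2.
  by rewrite exprMn ler_wpM2r ?sqr_ge0// sobw_ge.
apply: le_zsum => //; apply: le_summ_ge0 sf => k; rewrite ger0_norm ?sqr_ge0//.
Qed.

Lemma class_weight_bound p t1 : 0 < t1 -> exists2 C, 0 <= C & forall t k, t1 <= t < T ->
  wt p k * `|h t k| <= C.
Proof.
move=> t10; have [C C0 HC] := class_smooth (normr_ge0 p).
have a0 := alpha_gt0 al2; have q0 : 0 <= `|p| / alpha by rewrite divr_ge0// ltW.
exists (C / t1 `^ (`|p| / alpha)); first by rewrite divr_ge0// powR_ge0.
move=> t k /andP[t1t tT]; have t0 := lt_le_trans t10 t1t.
have [|sm le] := HC t; first by rewrite t0.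
have s0 : 0 <= reg0 + `|p| by rewrite addr_ge0.
have tp : t1 `^ (`|p| / alpha) <= t `^ (`|p| / alpha).
  by apply: ge0_ler_powR; rewrite ?nnegrE ?(ltW t0) ?(ltW t10).
have pp : 0 < t1 `^ (`|p| / alpha) by exact: powR_gt0.
rewrite ler_pdivlMr// mulrC; apply: le_trans le; apply: ler_pM; rewrite ?mulr_ge0 ?wt_ge0 ?(ltW pp)//.
have -> : wt p k * `|h t k| = Num.sqrt ((wt p k * `|h t k|) ^+ 2).
  by rewrite sqrtr_sqr (ger0_norm (mulr_ge0 (wt_ge0 p k) (normr_ge0 (h t k)))).
apply: ler_wsqrtr; apply: le_trans (sob_term_le_sob k s0 sm).
rewrite lerXn2r ?nnegrE ?mulr_ge0 ?wt_ge0// ler_wpM2r// wt_mono//.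
by apply: (le_trans (ler_norm p)); rewrite lerDr.
Qed.

Lemma class_zero t : 0 <= t < T -> h t 0 = 0.
Proof. by move=> tT; have [_ zm _] := sol; apply/zero_mean_har; exact: zm. Qed.

(** The supremum over t is taken for each mode. It decays rapidly because the weighted bounds are
    uniform in time away from 0; the case T <= t1 is vacuous. *)
Lemma class_envelope t1 : 0 < t1 -> exists U, [/\ forall k, 0 <= U k, even_seq U, rapid U &
  forall t k, t1 <= t < T -> `|h t k| <= U k].
Proof.
move=> t10; have [Tt1|t1T] := leP T t1.
  exists (fun=> 0); split=> //.
    by move=> p; exists 0 => k; rewrite normr0 mulr0.
  by move=> t k /andP[h1 h2]; have := le_lt_trans (le_trans Tt1 h1) h2; rewrite ltxx.
pose E k := [set `|h t k| | t in [set t | t1 <= t < T]].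
have E0 k : E k !=set0 by exists `|h t1 k|; exists t1 => //=; rewrite lexx.
have Ele k (C : R) : (forall t, t1 <= t < T -> `|h t k| <= C) -> sup (E k) <= C.
  by move=> H; apply: ge_sup => // _ [t /= tt <-]; exact: H.
have bd k : has_ubound (E k).
  have [C C0 HC] := class_weight_bound 0 t10; exists C => _ [t /= tt <-].
  have [->|k0] := eqVneq k 0; last by have := HC t k tt; rewrite wt00// mul1r.
  have /andP[h1 h2] := tt; rewrite class_zero ?normr0// h2 andbT ltW//; exact: lt_le_trans h1.
have Eub k t : t1 <= t < T -> `|h t k| <= sup (E k).
  by move=> tt; apply: ub_le_sup => //; exists t.
have S0 k : 0 <= sup (E k) by apply: le_trans (Eub k t1 _); rewrite ?lexx.
have rS : rapid (fun k => sup (E k)).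
  move=> p; have [C C0 HC] := class_weight_bound p t10; exists C => k.
  have [->|k0] := eqVneq k 0; first by rewrite wt0 mul0r.
  have w0 : 0 < wt p k :> R by rewrite wtE// powR_gt0// zabs_gt0.
  rewrite ger0_norm// -ler_pdivlMl//; apply: Ele => t tt.
  by rewrite ler_pdivlMl//; exact: HC.
exists (fun k => sup (E k) + sup (E (- k))); split.
- by move=> k; rewrite addr_ge0.
- by move=> k; rewrite opprK addrC.
- exact: (rapidD rS (rapidN rS)).
- by move=> t k tt; apply: (le_trans (Eub k t tt)); rewrite lerDl.
Qed.

(** The Sobolev weights are at least 1, so continuity in H^reg0 controls the l^2 distance of the
    coefficients. *)
Lemma class_n2_cvg t0 : 0 <= t0 < T ->
  n2 (fun k => h t k - h t0 k) @[t --> within `[0, T[ (nbhs t0)] --> 0.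
Proof.
move=> t0T; have [[cS1 cS2] _ _ _] := cls; have := cS2 t0 t0T; rewrite -/reg0 => /fine_cvg c.
have c2 : (fine (sobolev_norm reg0 (fun x => B t x - B t0 x))) ^+ 2 @[t --> within `[0, T[ (nbhs t0)] --> 0.
  rewrite -[X in _ --> X](mulr0 0); under eq_fun do rewrite expr2; apply: cvgM; exact: c.
apply: (@squeeze_cvgr _ _ _ _ (fun=> 0) (fun t => (fine (sobolev_norm reg0 (fun x => B t x - B t0 x))) ^+ 2)) => //; last exact: cvg_cst.
near=> t; have tT : 0 <= t < T.
  by have : `[0, T[%classic t by [near: t; exact: withinT]; rewrite /= in_itv.
rewrite n2_ge0/=; have [l1 l2] := (class_L2 tT, class_L2 t0T).
have iD : cintg (fun x => B t x - B t0 x) by apply: L2_cintg; exact: L2_sub.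
have hD k : har (fun x => B t x - B t0 x) k = h t k - h t0 k by rewrite harB//; exact: L2_cintg.
have [_ f1] := cS1 t tT; have [_ f2] := cS1 t0 t0T.
have s1 := (sobolev_norm_lty reg0 (L2_cintg l1)).1 f1; have s2 := (sobolev_norm_lty reg0 (L2_cintg l2)).1 f2.
have sD : summ (fun k => sobw reg0 k * har (fun x => B t x - B t0 x) k ^+ 2).
  apply: (le_summ_ge0 _ (summZ 2 (summD s1 s2))) => k; rewrite ger0_norm ?sob_term_ge0// hD.
  rewrite -/(h t) -/(h t0); have := sobw_ge0 reg0 k; move: (sobw _ _) (h t k) (h t0 k) => w x y w0.
  have -> : 2 * (w * x ^+ 2 + w * y ^+ 2) = w * (x - y) ^+ 2 + w * (x + y) ^+ 2 by ring.
  by rewrite lerDl mulr_ge0// sqr_ge0.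
rewrite (sobolev_norm_fin iD sD) /= powR12_sqrt ?sob_ge0// sqr_sqrtr ?sob_ge0//.
have sD' : summ (fun k => sobw reg0 k * (h t k - h t0 k) ^+ 2).
  by apply: eq_summ sD => k; rewrite hD.
have -> : sob reg0 (har (fun x => B t x - B t0 x)) = sob reg0 (fun k => h t k - h t0 k).
  by apply: eq_zsum => k; rewrite hD.
have le k : (h t k - h t0 k) ^+ 2 <= sobw reg0 k * (h t k - h t0 k) ^+ 2.
  rewrite ler_peMl ?sqr_ge0// -[leLHS](powRr0 (1 + k%:~R ^+ 2)) ler_powR// lerDl sqr_ge0//.
by apply: le_zsum => //; apply: le_summ_ge0 sD' => k; rewrite ger0_norm ?sqr_ge0.
Unshelve. all: by end_near. Qed.

Lemma class_l2 t : 0 <= t < T -> l2 (h t).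
Proof.
move=> tT; have [[cS1 _] _ _ _] := cls; have [L fin] := cS1 t tT.
have := (sobolev_norm_lty reg0 (L2_cintg L)).1 fin.
apply: le_summ_ge0 => k; rewrite ger0_norm ?sqr_ge0// ler_peMl ?sqr_ge0//.
by rewrite -[leLHS](powRr0 (1 + k%:~R ^+ 2)) ler_powR// lerDl sqr_ge0.
Qed.

Lemma class_continuous t k : 0 < t < T -> {for t, continuous (h ^~ k)}.
Proof.
move=> tT; have [t0 tT'] := andP tT; have t0T : 0 <= t < T by rewrite ltW.
apply/(@cvgrPdist_lt _ R^o) => e e0; have e20 : 0 < e ^+ 2 by exact: exprn_gt0.
have /cvgrPdist_lt/(_ _ e20) := class_n2_cvg t0T; rewrite near_withinE => H.
near=> s; have sT : 0 <= s < T.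
  have : s \in `]0, T[ by near: s; exact: near_in_itvoo.
  by rewrite in_itv/= => /andP[/ltW -> ->].
have : `|0 - n2 (fun k => h s k - h t k)| < e ^+ 2.
  have := sT; near: s; apply: filterS H => s Hs sT; apply: Hs; rewrite /= in_itv/=; exact: sT.
rewrite sub0r normrN ger0_norm ?n2_ge0// => nlt.
have l : l2 (fun k => h s k - h t k).
  apply: (@eq_summ _ (fun k => (h s k + (-1) * h t k) ^+ 2)); first by move=> j; rewrite mulN1r.
  exact: l2D (class_l2 sT) (l2Z (-1) (class_l2 t0T)).
rewrite distrC -ltr_sqr ?nnegrE ?(ltW e0)// real_normK ?num_real//.
by apply: le_lt_trans nlt; exact: (le_zsum_term k l (fun k => sqr_ge0 _)).
Unshelve. all: by end_near. Qed.

Let g k t := - rate k * h t k + nl a b (h t) (h t) k.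

Lemma class_rhs_continuous k t : 0 < t < T -> {for t, continuous (g k)}.
Proof.
apply: (@rhs_continuous R mu alpha a b T h k); last exact: class_envelope.
by move=> s j; exact: class_continuous.
Qed.

(** The weak equation is tested with [cas k]; [har_rhs] then expresses the tested right-hand side
    through the coefficients of [B] alone. *)
Lemma solution_increment k t1 t2 : 0 < t1 -> t1 <= t2 -> t2 < T ->
  h t2 k - h t1 k = \int[leb]_(t in `[t1, t2]) g k t.
Proof.
move=> t10 t12 t2T; have [_ _ [J [Jx [Bx [LB [op ev]]]]]] := sol.
have tT t : t1 <= t <= t2 -> 0 < t < T by move=> /andP[h1 h2]; apply/andP; split; lra.
have [_ E] := ev _ (cas_test k) t1 t2 t10 t12 t2T.
have HE F : cint (fun x => F x * cas k x) = 2 * pi * har F k.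
  by rewrite /har mulrA divff ?mul1r// gt_eqF ?pi2_gt0.
have FE t : t1 <= t <= t2 -> cint (fun x => (a * B t x * Jx t x + b * J t x * Bx t x + mu * LB t x) * cas k x) =
    - (2 * pi) * g k t.
  move=> /tT tt; have [LJ wB wJ _ LL] := op t tt; have [t0 t'T] := andP tt.
  have iB : cintg (B t) by apply: L2_cintg; apply: class_L2; rewrite ltW.
  have hJN := Lambda_har iB LJ.
  have iJ : cintg (J t).
    have [/L2_cintg i _] := LJ; apply: eq_integrable (cintgZ (-1) i) => //.
      exact: measurable_circle.
    by move=> x _; rewrite /= mulN1r opprK.
  have hJ j : har (J t) j = - (zabs j * har (B t) j).
    have := hJN j; have -> : har (fun x => - J t x) j = - har (J t) j.
      by rewrite -mulN1r -(harZ _ _ iJ); apply: eq_har => x _; rewrite mulN1r.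
    by rewrite (powRr1 (zabs_ge0 j)) => <-; rewrite opprK.
  have iJx : cintg (Jx t) by apply: L2_cintg; exact: wJ.1.
  have iBx : cintg (Bx t) by apply: L2_cintg; exact: wB.1.
  have iLB : cintg (LB t) by apply: L2_cintg; exact: LL.1.
  have rB : rapid (har (B t)).
    have [U [U0 _ rU hU]] := class_envelope t0.
    by apply: rapid_le rU => j; rewrite (ger0_norm (U0 j)); apply: hU; rewrite lexx.
  have [_ hW] := @har_rhs R a b mu alpha (B t) (J t) (Jx t) (Bx t) (LB t) al2 iB iJ iJx iBx iLB rB hJ
    (fun j => weak_derivative_har j iJ wJ) (fun j => weak_derivative_har j iB wB) (Lambda_har iB LL).
  by rewrite HE hW /g -/(h t); move: (2 * pi) => q; ring.
have : 2 * pi * (h t2 k - h t1 k) = 2 * pi * \int[leb]_(t in `[t1, t2]) g k t.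
  rewrite mulrBr -!HE; move: E; rewrite -!/(cint _) => ->.
  have -> : \int[leb]_(t in `[t1, t2]) cint (fun x => (a * B t x * Jx t x + b * J t x * Bx t x + mu * LB t x) * cas k x) =
      \int[leb]_(t in `[t1, t2]) (- (2 * pi) * g k t).
    by apply: eq_Rintegral => t; rewrite inE /= in_itv => tt; exact: FE.
  rewrite RintegralZl; first by rewrite mulNr opprK.
    exact: measurable_itv.
  by apply: continuous_at_integrable => t /tT; exact: class_rhs_continuous.
by move/(mulfI (lt0r_neq0 pi2_gt0)).
Qed.

Lemma solution_ode t k : 0 < t < T -> is_derive t 1 (h ^~ k) (g k t).
Proof.
move=> /andP[t0 tT]; pose t1 := t / 2; pose q := (t + T) / 2.
have t10 : 0 < t1 by rewrite divr_gt0.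
have t1t : t1 < t by rewrite /t1; lra.
have tq : t < q by rewrite /q; lra.
have ig : leb.-integrable `[t1, q] (EFin \o g k).
  by apply: continuous_at_integrable => s /andP[s1 s2]; apply: class_rhs_continuous; apply/andP; rewrite /q in s2; split; lra.
have cg : {for t, continuous (g k)} by apply: class_rhs_continuous; rewrite t0.
have [dG GE] := @continuous_FTC1 R (g k) (BLeft t1) t q tq ig t1t cg.
have dI : is_derive t 1 (fun x => \int[leb]_(s in `[t1, x]) g k s) (g k t).
  by apply: DeriveDef; [exact: dG|rewrite -derive1E; exact: GE].
have dI' : is_derive t 1 (fun x => h t1 k + \int[leb]_(s in `[t1, x]) g k s) (g k t).
  by rewrite -[g k t]add0r; exact: is_deriveD.
apply: near_eq_is_derive dI'; near=> s.
have : s \in `]t1, T[ by near: s; apply: near_in_itvoo; rewrite in_itv/= t1t.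
rewrite in_itv/= => /andP[s1 s2].
by rewrite -(solution_increment k t10 (ltW s1) s2) addrC subrK.
Unshelve. all: by end_near. Qed.

Lemma solution_energy : leb.-integrable `]0, T[ (fun t => (hnorm2 (1 + kap) (h t))%:E).
Proof.
have [_ [_ _ fin] _ _] := cls.
have sE : 5 / 2 - alpha / 2 = 1 + kap by rewrite kapE; field.
have sE' : 1 + kap = reg0 + alpha / 2 by rewrite !kapE !reg0E; field.
have k0 : 0 <= 1 + kap by have := al5; rewrite kapE; lra.
have a0 : 0 <= alpha / 2 by have := al2; lra.
have [C _ HC] := class_smooth a0.
have sm t : 0 < t < T -> summ (fun k => sobw (1 + kap) k * h t k ^+ 2).
  by move=> tT; rewrite sE'; have [] := HC t tT.
have mI : measurable (`]0, T[%classic : set (measurableTypeR R)) by exact: measurable_itv.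
have mh k : measurable_fun `]0, T[ (h ^~ k).
  by apply: (@continuous_at_measurable _ _ 0 T) => // t tT; exact: class_continuous.
have inI t : `]0, T[%classic t -> 0 < t < T by rewrite /= in_itv.
have mS : measurable_fun `]0, T[ (fun t => sob (1 + kap) (h t)).
  apply: (measurable_zsum (G := fun k t => sobw (1 + kap) k * h t k ^+ 2)) => [k|t /inI]; last exact: sm.
  by apply: measurable_funM => //; exact: measurable_funX.
have mN : measurable_fun `]0, T[ (fun t => hnorm2 (1 + kap) (h t)).
  apply: (measurable_zsum (G := fun k t => (wt (1 + kap) k * h t k) ^+ 2)) => [k|t /inI tT].
    by apply: measurable_funX; exact: measurable_funM.
  apply: le_summ_ge0 (sm t tT) => k.
  by rewrite ger0_norm ?sqr_ge0// exprMn ler_wpM2r ?sqr_ge0// sobw_ge.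
have nE t : `]0, T[%classic t -> (sobolev_norm (5 / 2 - alpha / 2) (B t) ^+ 2 = (sob (1 + kap) (h t))%:E)%E.
  move=> /inI tT; have [t0 tT'] := andP tT.
  have iB : cintg (B t) by apply: L2_cintg; apply: class_L2; rewrite ltW.
  by rewrite sE (sobolev_norm_fin iB (sm t tT)) powR12_sqrt ?sob_ge0// expe2 -EFinM -expr2 sqr_sqrtr ?sob_ge0.
apply/integrableP; split; first exact/measurable_EFinP.
apply: le_lt_trans fin; rewrite -integral_itv_obnd_cbnd; last first.
  apply: (eq_measurable_fun (fun t => (sob (1 + kap) (h t))%:E)); last exact/measurable_EFinP.
  by move=> t; rewrite inE => /nE.
have -> : (\int[leb]_(t in `]0%R, T[) (sobolev_norm (5 / 2 - alpha / 2) (B t) ^+ 2) =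
    \int[leb]_(t in `]0%R, T[) (sob (1 + kap) (h t))%:E)%E.
  by apply: eq_integral => t; rewrite inE => /nE.
apply: ge0_le_integral => //.
- by apply: measurableT_comp => //; exact/measurable_EFinP.
- exact/measurable_EFinP.
- move=> t /inI tT; rewrite /= lee_fin ger0_norm ?hnorm2_ge0//; exact: hnorm2_sob (sm t tT).
Qed.

(** Every larger bound is allowed, so that two solutions can be given a common one. *)
Lemma solution_flow : exists2 M, 0 <= M & forall M', M <= M' -> flow mu alpha a b T M' h.
Proof.
have [C C0 HC] := class_smooth (lexx 0).
exists (C ^+ 2) => [|M' CM]; first exact: sqr_ge0.
split.
- by move=> t /andP[t0 tT]; apply: class_zero; rewrite ltW.
- exact: class_envelope.
- exact: solution_ode.
- move=> t tT; have [sm le] := HC t tT; apply: le_trans CM.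
  rewrite addr0 mul0r powRr0 mul1r in sm le; apply: (le_trans (hnorm2_sob reg0_ge0 sm)).
  by rewrite -[leLHS]sqr_sqrtr ?sob_ge0// lerXn2r ?nnegrE ?sqrtr_ge0.
- exact: solution_energy.
Qed.

End SolutionFlow.

(** * Uniqueness in the class and the theorem *)

Section Uniqueness.
Context {R : realType} (mu alpha a b T : R) (B0 : R -> R) (B B' : R -> R -> R).
Hypotheses (mu0 : 0 < mu) (al2 : 2 < alpha) (al5 : alpha <= 5 / 2) (T0 : 0 < T).
Hypotheses (sB : is_solution a b mu alpha T B0 B) (cB : solution_class alpha T B).
Hypotheses (sB' : is_solution a b mu alpha T B0 B') (cB' : solution_class alpha T B').
Local Notation leb := (@lebesgue_measure R).

Lemma solution_initial : circle_eq (B 0) (B' 0).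
Proof.
have [e _ _] := sB; have [e' _ _] := sB'.
have ff : Filter (almost_everywhere leb) by exact: ae_filter_ringOfSetsType.
by apply: (@filterS2 _ _ ff _ _ _ _ e e') => x E E' cx; rewrite E// E'.
Qed.

(** Each solution is compared with its own value at 0; the two initial values agree almost
    everywhere and have the same coefficients. *)
Lemma solution_n2_diff :
  n2 (fun k => har (B t) k - har (B' t) k) @[t --> 0^'+] --> 0.
Proof.
have I0 : 0 <= (0 : R) < T by rewrite lexx.
have L0 := class_L2 cB I0; have L0' := class_L2 cB' I0.
have E k : har (B 0) k = har (B' 0) k by apply: circle_eq_har solution_initial; [exact: L0.1|exact: L0'.1].
have c : 2 * (n2 (fun k => har (B t) k - har (B 0) k) + n2 (fun k => har (B' t) k - har (B' 0) k))
    @[t --> within `[0, T[ (nbhs 0)] --> 0.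
  rewrite -[X in _ --> X](mulr0 2) -[X in 2 * X](addr0 0); apply: cvgMr.
  by apply: cvgD; [exact: (class_n2_cvg al5 cB I0)|exact: (class_n2_cvg al5 cB' I0)].
have sub P : (\forall t \near within `[0, T[ (nbhs (0 : R)), P t) -> \forall t \near 0^'+, P t.
  rewrite near_withinE => H; near=> t.
  have tT : `[0, T[%classic t.
    rewrite /= in_itv/=; apply/andP; split; [by rewrite ltW//; near: t; exact: nbhs_right_gt|].
    by near: t; exact: nbhs_right_lt.
  by move: tT; near: t; exact: cvg_within H.
apply: (@squeeze_cvgr _ _ _ _ (fun=> 0) (fun t => 2 * (n2 (fun k => har (B t) k - har (B 0) k) + n2 (fun k => har (B' t) k - har (B' 0) k)))).
- near=> t; rewrite n2_ge0/=.
  have tT : 0 <= t < T.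
    apply/andP; split; [by rewrite ltW//; near: t; exact: nbhs_right_gt|].
    by near: t; exact: nbhs_right_lt.
  have sb (C : R -> R -> R) : solution_class alpha T C -> l2 (fun k => har (C t) k - har (C 0) k).
    move=> cC; apply: (@eq_summ _ (fun k => (har (C t) k + (-1) * har (C 0) k) ^+ 2)).
      by move=> k; rewrite mulN1r.
    exact: l2D (class_l2 al5 cC tT) (l2Z (-1) (class_l2 al5 cC I0)).
  have -> : n2 (fun k => har (B t) k - har (B' t) k) =
      n2 (fun k => (har (B t) k - har (B 0) k) + (-1) * (har (B' t) k - har (B' 0) k)).
    by apply: eq_zsum => k; rewrite E; congr (_ ^+ 2); ring.
  apply: (le_trans (n2D_le (sb _ cB) (l2Z (-1) (sb _ cB')))).
  by rewrite (n2Z (-1) (sb _ cB')) expr2 mulrNN mul1r mul1r.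
- exact: cvg_cst.
- by move=> P /c; exact: sub.
Unshelve. all: by end_near. Qed.

Lemma solution_unique t : 0 <= t < T -> circle_eq (B' t) (B t).
Proof.
have sym : circle_eq (B t) (B' t) -> circle_eq (B' t) (B t).
  move=> e; have ff : Filter (almost_everywhere leb) by exact: ae_filter_ringOfSetsType.
  by apply: filterS e => x E cx; rewrite E.
move=> tT; apply: sym; have := tT => /andP[]; rewrite le_eqVlt => /predU1P[<- _|t0 tT'].
  exact: solution_initial.
have [M M0 F] := solution_flow al2 al5 sB cB; have [M' M'0 F'] := solution_flow al2 al5 sB' cB'.
apply: har_inj; [exact: L2_cintg (class_L2 cB tT)|exact: L2_cintg (class_L2 cB' tT)|] => k.
have h1 : M <= M + M' by rewrite lerDl.
have h2 : M' <= M + M' by rewrite lerDr.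
by apply: (flow_unique mu0 al2 al5 (F _ h1) (F' _ h2) (addr_ge0 M0 M'0) solution_n2_diff); rewrite t0.
Qed.

End Uniqueness.

Theorem theorem1p1 (R : realType) (mu a b alpha : R) (B0 : R -> R) :
  0 < mu -> 2 < alpha <= 5 / 2 ->
  Sobolev (5 / 2 - alpha) B0 -> zero_mean B0 ->
  exists T : R, 0 < T /\
    exists B : R -> R -> R,
      (is_solution a b mu alpha T B0 B /\ solution_class alpha T B) /\
      (forall B' : R -> R -> R,
         is_solution a b mu alpha T B0 B' -> solution_class alpha T B' ->
         forall t : R, 0 <= t < T -> circle_eq (B' t) (B t)).
Proof.
move=> mu0 /andP[al2 al5] SB0 zB0; have [LB0 fin] := SB0; have iB0 := L2_cintg LB0.
have h0 : har B0 0 = 0 by apply/zero_mean_har.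
have r0 : 0 <= reg0 alpha by rewrite /reg0; lra.
have lh : l2 (fun k => wt (reg0 alpha) k * har B0 k).
  apply: le_summ_ge0 ((sobolev_norm_lty (reg0 alpha) iB0).1 fin) => k.
  by rewrite ger0_norm ?sqr_ge0// exprMn ler_wpM2r ?sqr_ge0// sobw_ge.
have [T [u [D [T0 eD D0 lD [uD [Bm Gu] ode u0]]]]] := @local_flow R mu alpha a b mu0 al2 al5 (har B0) h0 lh.
exists T; split=> //; exists (sol u B0).
have S := sol_is_solution mu0 al2 al5 eD D0 lD uD Gu ode LB0 (fun k => erefl (har B0 k)) h0.
have C := sol_class mu0 al2 al5 T0 D0 lD uD Gu u0 SB0 (fun k => erefl (har B0 k)) h0.
by split=> // B' S' C' t tT; exact: (solution_unique mu0 al2 al5 T0 S C S' C').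
Qed.
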